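(* Let $s\in\mathbb{N}$ with $s>d/2$. There exist an open set $\mathscr{U}_s$ with $$(\mathbb{R}^+)^3\times\{0\}^{\ell+1}\times\{0\}^{\ell+1}\subset\mathscr{U}_s\subset(\mathbb{R}^+)^3\times (H^s(\mathbb{R}^d;\mathbb{R}^{d\times d}))^{\ell+1}\times(H^s(\mathbb{R}^d;\mathbb{R}^d))^{\ell+1},$$ open sets $\mathscr{V}_s(\mathbf{p})$ with $0\in\mathscr{V}_s(\mathbf{p})\subset H^{2+s}(\mathbb{R}^d;\mathbb{R}^d)\times\mathcal{H}^{3+s}(\mathbb{R}^d)$ for each $\mathbf{p}\in(\mathbb{R}^+)^3$, and a smooth mapping $$\mathscr{U}_s\ni(\gamma,\mu,\sigma,\{\tau_i\}_{i=0}^\ell,\{\varphi_i\}_{i=0}^\ell)\mapsto(v,\eta)\in\bigcup_{\mathbf{p}\in(\mathbb{R}^+)^3}\mathscr{V}_s(\mathbf{p})$$ with the following property. For all $(\gamma,\mu,\sigma,\{\tau_i\}_{i=0}^\ell,\{\varphi_i\}_{i=0}^\ell)\in\mathscr{U}_s$ the pair $(v,\eta)$ associated to it by this mapping is the unique $(v,\eta)\in\mathscr{V}_s(\gamma,\mu,\sigma)$ such that the system $$\begin{cases}\nabla\cdot((1+\eta)(v-\gamma e_1))=0,\\ (1+\eta)(v-\gamma e_1)\cdot\nabla v+v-\mu^2\nabla\cdot((1+\eta)\mathbb{S}v)+(1+\eta)(I-\sigma^2\Delta)\nabla\eta+\mathcal{F}=0\end{cases}$$ is classically satisfied on $\mathbb{R}^d$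 with forcing $$\mathcal{F}=\sum_{i=0}^\ell\eta^i(\tau_i\nabla\eta+\varphi_i).$$
   Context: $d\in\mathbb{N}^+$ (the dimension) and $\ell\in\mathbb{N}=\{0,1,2,\dots\}$ are fixed; $\mathbb{R}^+=(0,\infty)$; $e_1$ is the first standard basis vector of $\mathbb{R}^d$. For $v:\mathbb{R}^d\to\mathbb{R}^d$, $\mathbb{S}v=\nabla v+\nabla v^{\mathrm{t}}+2(\nabla\cdot v)I_{d\times d}$. $H^s$ denotes the usual $L^2$-based Sobolev space. $\mathscr{F}$ is the Fourier transform normalized to be unitary on $L^2$ (kernel $e^{-2\pi i x\cdot\xi}$), and $\langle\xi\rangle=\sqrt{1+|\xi|^2}$. For real $s\ge0$ the anisotropic Sobolev space $\mathcal{H}^s(\mathbb{R}^d)$ is the Hilbert space of real-valued tempered distributions $f$ with $\mathscr{F}[f]\in L^1_{\mathrm{loc}}(\mathbb{R}^d;\mathbb{C})$ and finite norm $$\|f\|_{\mathcal{H}^s}=\Big(\int_{\mathbb{R}^d}\big(|\xi|^{-2}(\xi_1^2+|\xi|^4)\mathbf 1_{B(0,1)}(\xi)+\langle\xi\rangle^{2s}\mathbf 1_{\mathbb{R}^d\setminus B(0,1)}(\xi)\big)|\mathscr{F}[f](\xi)|^2\,d\xi\Big)^{1/2}.$$ The convention $\eta^0=1$ is used. *)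

(* Defs.v *)
From HB Require Import structures.
From mathcomp Require Import all_boot all_order all_algebra.
From mathcomp Require Import complex.
From mathcomp Require Import all_classical all_reals all_analysis.

Set Implicit Arguments.
Unset Strict Implicit.
Unset Printing Implicit Defensive.

Import Order.TTheory GRing.Theory Num.Theory.
Import numFieldNormedType.Exports.

Local Open Scope classical_set_scope.
Local Open Scope ring_scope.

Section measurable_rV.
Context {R : realType} (n : nat).

Let coord (i : 'I_n) (x : 'rV[R]_n) : R := x ord0 i.

Let rV_set0 : g_sigma_preimage coord set0.
Proof. exact: sigma_algebra0. Qed.

Let rV_setC A : g_sigma_preimage coord A -> g_sigma_preimage coord (~` A).
Proof. exact: sigma_algebraC. Qed.

Let rV_bigcup (F : _^nat) : (forall i, g_sigma_preimage coord (F i)) ->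
  g_sigma_preimage coord (\bigcup_i (F i)).
Proof. exact: sigma_algebra_bigcup. Qed.

(* The product sigma-algebra, built as the library does for [n.-tuple T]; it
   is the Borel sigma-algebra of R^n. *)
HB.instance Definition _ := @isMeasurable.Build
  (measure_tuple_display default_measure_display) 'rV[R]_n
  (g_sigma_preimage coord) rV_set0 rV_setC rV_bigcup.

Lemma measurable_coord (i : 'I_n) :
  measurable_fun [set: 'rV[R]_n] (fun x : 'rV[R]_n => x ord0 i).
Proof.
move=> _ Y mY; rewrite setTI; apply: sub_sigma_algebra => /=.
rewrite -bigcup_seq/=; exists i => /=; first by rewrite mem_index_enum.
by exists Y => //; rewrite setTI.
Qed.

Lemma measurable_fun_coordP d (T : measurableType d) (f : T -> 'rV[R]_n) :
  (forall i, measurable_fun [set: T] (fun t => f t ord0 i)) ->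
  measurable_fun [set: T] f.
Proof.
move=> mf _ A mA; rewrite setTI.
suff : g_sigma_preimage (fun i => coord i \o f) `<=` measurable.
  by apply; rewrite g_sigma_preimage_comp; exists A => //; rewrite setTI.
apply: smallest_sub; first exact: sigma_algebra_measurable.
rewrite -bigcup_seq; apply: bigcup_sub => i _ B [C mC <-].
exact: mf.
Qed.

End measurable_rV.

Section lebesgue_rV.
Context {R : realType}.

Section step.
Context (n : nat) (m : {sigma_finite_measure set 'rV[R]_n -> \bar R}).

Definition rV_cons (p : measurableTypeR R * 'rV[R]_n) : 'rV[R]_n.+1 :=
  row_mx (const_mx p.1 : 'rV_1) p.2.

Let rV_uncons (x : 'rV[R]_n.+1) : measurableTypeR R * 'rV[R]_n :=
  (x ord0 ord0, \row_i x ord0 (lift ord0 i)).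

Let rV_consK : cancel rV_cons rV_uncons.
Proof.
move=> [a x]; congr pair.
  transitivity (row_mx (const_mx a : 'rV_1) x ord0 (lshift n ord0)).
    by congr (row_mx _ _ _ _); exact/val_inj.
  by rewrite row_mxEl mxE.
apply/rowP => i; rewrite mxE.
transitivity (row_mx (const_mx a : 'rV_1) x ord0 (rshift 1 i)).
  by congr (row_mx _ _ _ _); exact/val_inj.
by rewrite row_mxEr.
Qed.

Let measurable_rV_cons : measurable_fun setT rV_cons.
Proof.
apply: measurable_fun_coordP => i; have [j ->|->] := unliftP ord0 i.
  rewrite (_ : (fun _ => _) = (fun x : 'rV_n => x ord0 j) \o snd).
    by apply: measurableT_comp; [exact: measurable_coord|exact: measurable_snd].
  apply/funext => p /=; have /rowP/(_ j) := congr1 snd (rV_consK p).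
  by rewrite mxE.
rewrite (_ : (fun _ => _) = fst); first exact: measurable_fst.
by apply/funext => p; have := congr1 fst (rV_consK p).
Qed.

Let measurable_rV_uncons : measurable_fun setT rV_uncons.
Proof.
apply/measurable_fun_pairP; split; first exact: measurable_coord.
apply: measurable_fun_coordP => i.
rewrite (_ : (fun _ => _) = fun x : 'rV_n.+1 => x ord0 (lift ord0 i)).
  exact: measurable_coord.
by apply/funext => x; rewrite /= mxE.
Qed.

Definition lebesgue_rV_step : set 'rV[R]_n.+1 -> \bar R :=
  pushforward (@lebesgue_measure R \x m)%E rV_cons.

Let lebesgue_rV_step0 : lebesgue_rV_step set0 = 0%E.
Proof. by rewrite /lebesgue_rV_step /pushforward preimage_set0 measure0. Qed.

Let lebesgue_rV_step_ge0 A : (0 <= lebesgue_rV_step A)%E.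
Proof. exact: measure_ge0. Qed.

Let lebesgue_rV_step_sigma_additive : semi_sigma_additive lebesgue_rV_step.
Proof.
exact: (@measure_semi_sigma_additive _ _ _
  (@pushforward _ _ _ _ _ _ rV_cons)).
Qed.

HB.instance Definition _ := isMeasure.Build _ _ _ lebesgue_rV_step
  lebesgue_rV_step0 lebesgue_rV_step_ge0 lebesgue_rV_step_sigma_additive.

Let lebesgue_rV_step_sigma_finite : sigma_finite setT lebesgue_rV_step.
Proof.
have /sigma_finiteP[F [TF ndF Foo]] := sigma_finiteT (@lebesgue_measure R).
have /sigma_finiteP[G [TG ndG Goo]] := sigma_finiteT m.
exists (fun k => rV_uncons @^-1` (F k `*` G k)).
  rewrite -preimage_bigcup (_ : \bigcup_k _ = setT) ?preimage_setT//.
  apply/seteqP; split=> // -[x y] _.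
  have [k _ Fkx] : (\bigcup_k F k) x by rewrite -TF.
  have [l _ Gly] : (\bigcup_k G k) y by rewrite -TG.
  exists (maxn k l) => //; split.
    by move: x Fkx; exact/subsetPset/ndF/leq_maxl.
  by move: y Gly; exact/subsetPset/ndG/leq_maxr.
move=> k; have [mF Fk] := Foo k; have [mG Gk] := Goo k; split.
  rewrite -[X in measurable X]setTI; apply: measurable_rV_uncons => //.
  exact: measurableX.
rewrite /lebesgue_rV_step /pushforward -comp_preimage.
rewrite (_ : _ \o _ = id); last by apply/funext => p /=; rewrite rV_consK.
by rewrite preimage_id product_measure1E// lte_mul_pinfty// ge0_fin_numE.
Qed.

HB.instance Definition _ := Measure_isSigmaFinite.Build _ _ _ lebesgue_rV_step
  lebesgue_rV_step_sigma_finite.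

End step.

Fixpoint lebesgue_rV n : {sigma_finite_measure set 'rV[R]_n -> \bar R} :=
  if n is k.+1 then lebesgue_rV_step (lebesgue_rV k) else \d_(0 : 'rV[R]_0).

End lebesgue_rV.

Section euclidean.
Context {R : realType} {d : nat}.
Implicit Types x y : 'rV[R]_d.

Definition dotp x y : R := \sum_i x ord0 i * y ord0 i.

(* The library norm on ['rV[R]_d] is the sup norm. *)
Definition eucl x : R := Num.sqrt (dotp x x).

Definition japanese x : R := Num.sqrt (1 + eucl x ^+ 2).

Definition e1 : 'rV[R]_d := \row_j ((j : nat) == 0%N)%:R.

(* The order of differentiation in [pderivs] is immaterial on [Ck] functions. *)
Definition pderiv (j : 'I_d) (f : 'rV[R]_d -> R) : 'rV[R]_d -> R :=
  'D_(delta_mx ord0 j) f.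

Definition pderivs (l : seq 'I_d) (f : 'rV[R]_d -> R) : 'rV[R]_d -> R :=
  foldr pderiv f l.

Definition Ck (k : nat) (f : 'rV[R]_d -> R) : Prop :=
  (forall l, (size l <= k)%N -> continuous (pderivs l f)) /\
  (forall l, (size l < k)%N ->
     forall j x, derivable (pderivs l f) x (delta_mx ord0 j)).

End euclidean.

Section distributions.
Context {R : realType} {d : nat}.

Record schwartz := Schwartz {
  schwartz_fun :> 'rV[R]_d -> R ;
  schwartz_smooth : forall k, Ck k schwartz_fun ;
  schwartz_decay : forall (k : nat) (l : seq 'I_d), exists C : R,
    forall x, (1 + eucl x) ^+ k * `|pderivs l schwartz_fun x| <= C }.

Definition compactly_supported (f : 'rV[R]_d -> R) : Prop :=
  exists r : R, forall x, r < eucl x -> f x = 0.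

(* A real-valued tempered distribution is determined by its (real) values on
   real test functions. *)
Definition tempered (f : schwartz -> R) : Prop :=
  (forall (a : R) (p q r : schwartz),
     (forall x, r x = a * p x + q x) -> f r = a * f p + f q) /\
  exists (k : nat) (C : R), forall (p : schwartz) (M : R),
    (forall l x, (size l <= k)%N ->
       (1 + eucl x) ^+ k * `|pderivs l p x| <= M) ->
    `|f p| <= C * M.

(* [g] is a locally integrable function representing F[f].  For a real test
   function [p], F[p] = c + i s with [c], [s] as below, and the duality
   definition <F[f], p> = <f, F[p]> reads f(c) + i f(s) = \int g p.  Test
   functions with compact support determine F[f] and make the right-hand side
   converge for every locally integrable [g]. *)
Definition fourier_density (f : schwartz -> R) (g : 'rV[R]_d -> R[i]) : Prop :=
  (forall r : R,
     (lebesgue_rV d).-integrable [set x | eucl x <= r]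
       (fun x => (complex.Re (g x))%:E) /\
     (lebesgue_rV d).-integrable [set x | eucl x <= r]
       (fun x => (complex.Im (g x))%:E)) /\
  forall p c s : schwartz, compactly_supported p ->
    (forall x, c x =
       \int[lebesgue_rV d]_xi (p xi * cos (2 * pi * dotp x xi))) ->
    (forall x, s x =
       - \int[lebesgue_rV d]_xi (p xi * sin (2 * pi * dotp x xi))) ->
    f c = \int[lebesgue_rV d]_xi (complex.Re (g xi) * p xi) /\
    f s = \int[lebesgue_rV d]_xi (complex.Im (g xi) * p xi).

(* (\int w |F[f]|^2)^(1/2), and +oo when [f] is not a tempered distribution with
   locally integrable Fourier transform (infimum of the empty set); otherwise
   all densities agree a.e. and give the same value.  The space with this
   norm is [set f | weighted_norm w f < +oo]. *)
Definition weighted_norm (w : 'rV[R]_d -> R) (f : schwartz -> R) : \bar R :=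
  ereal_inf
    [set ((\int[lebesgue_rV d]_xi
             (w xi * (complex.Re (g xi) ^+ 2 + complex.Im (g xi) ^+ 2))%:E)
          `^ 2^-1)%E
    | g in [set g | tempered f /\ fourier_density f g]].

Definition sobolev_norm (s : R) : (schwartz -> R) -> \bar R :=
  weighted_norm (fun xi => japanese xi `^ (2 * s)).

Definition aniso_norm (s : R) : (schwartz -> R) -> \bar R :=
  weighted_norm (fun xi =>
    if eucl xi < 1 then eucl xi ^- 2 * (dotp xi e1 ^+ 2 + eucl xi ^+ 4)
    else japanese xi `^ (2 * s)).

Definition represented_by (f : schwartz -> R) (u : 'rV[R]_d -> R) : Prop :=
  continuous u /\
  forall p : schwartz, compactly_supported p ->
    f p = \int[lebesgue_rV d]_x (u x * p x).

End distributions.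
Arguments schwartz : clear implicits.

(* Open sets and smooth maps in the normed space [set x | NV x < +oo], for an
   extended norm [NV] on an ambient vector space. *)
Section normed_calculus.
Context {R : realType} {V W : lmodType R}.
Variables (NV : V -> \bar R) (NW : W -> \bar R).

Definition open_in (U : set V) : Prop :=
  forall x, U x -> (NV x < +oo)%E /\
    exists2 e : R, 0 < e & forall y, (NV (y - x)%R < e%:E)%E -> U y.

(* [D x [:: u_1; ...; u_k]] is the k-th Frechet derivative of [f] at [x], a
   bounded k-linear map applied to u_1, ..., u_k.  The last clause says that
   x |-> D x (of order k) is Frechet differentiable for the operator norm on
   bounded k-linear maps, with derivative h |-> D x (h :: _). *)
Definition smooth_on (U : set V) (f : V -> W) : Prop :=
  let fin := all (fun v => (NV v < +oo)%E) in
  exists D : V -> seq V -> W, forall x, U x ->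
  [/\ D x [::] = f x,
      forall u u' (a : R) y z, fin (u ++ [:: y, z & u']) ->
        D x (u ++ (a *: y + z) :: u') =
        a *: D x (u ++ y :: u') + D x (u ++ z :: u'),
      forall k, exists C : R, forall u, size u = k -> fin u ->
        (NW (D x u) <= C%:E * \big[mule/1]_(v <- u) NV v)%E
    & forall k (e : R), 0 < e -> exists2 r : R, 0 < r &
        forall h, (NV h < r%:E)%E -> U (x + h) ->
        forall u, size u = k -> fin u ->
        (NW (D (x + h) u - D x u - D x (h :: u))%R <=
         e%:E * NV h * \big[mule/1]_(v <- u) NV v)%E].

End normed_calculus.

Section travelling_wave.
Context {R : realType} {d : nat}.
Implicit Types (v : 'I_d -> 'rV[R]_d -> R) (eta : 'rV[R]_d -> R).

Definition divergence v (x : 'rV[R]_d) : R := \sum_j pderiv j (v j) x.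

Definition stress v (i j : 'I_d) (x : 'rV[R]_d) : R :=
  pderiv j (v i) x + pderiv i (v j) x + 2 * divergence v x * (i == j)%:R.

Definition laplacian (f : 'rV[R]_d -> R) (x : 'rV[R]_d) : R :=
  \sum_j pderiv j (pderiv j f) x.

Definition forcing (l : nat) (tau : 'I_l.+1 -> 'I_d -> 'I_d -> 'rV[R]_d -> R)
    (phi : 'I_l.+1 -> 'I_d -> 'rV[R]_d -> R) eta (i : 'I_d) (x : 'rV[R]_d) : R :=
  \sum_(k < l.+1) eta x ^+ k *
    (\sum_j tau k i j x * pderiv j eta x + phi k i x).

Definition wave_system (gamma mu sigma : R) v eta
    (F : 'I_d -> 'rV[R]_d -> R) : Prop :=
  forall x : 'rV[R]_d,
  divergence (fun j y => (1 + eta y) * (v j y - gamma * e1 ord0 j)) x = 0 /\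
  forall i : 'I_d,
    (1 + eta x) * \sum_j (v j x - gamma * e1 ord0 j) * pderiv j (v i) x
    + v i x
    - mu ^+ 2 * divergence (fun j y => (1 + eta y) * stress v i j y) x
    + (1 + eta x) *
        (pderiv i eta x - sigma ^+ 2 * laplacian (pderiv i eta) x)
    + F i x = 0.

End travelling_wave.

Section spaces.
Variables (R : realType) (d l : nat).

(* The ambient vector spaces consist of arbitrary functionals on test functions;
   the Sobolev spaces are cut out by finiteness of the norms below.  Products
   carry the sum of the norms of the factors. *)
Definition data : lmodType R :=
  ((R * R * R) * ('I_l.+1 -> 'I_d -> 'I_d -> schwartz R d -> R)
   * ('I_l.+1 -> 'I_d -> schwartz R d -> R))%type.

Definition solution : lmodType R :=
  (('I_d -> schwartz R d -> R) * (schwartz R d -> R))%type.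

(* R^3 x H^s(R^d; R^(d x d))^(l+1) x H^s(R^d; R^d)^(l+1) *)
Definition data_norm (s : R) (q : data) : \bar R :=
  let: ((gamma, mu, sigma), tau, phi) := q in
  ((`|gamma| + `|mu| + `|sigma|)%:E
   + \sum_k \sum_i \sum_j sobolev_norm s (tau k i j)
   + \sum_k \sum_i sobolev_norm s (phi k i))%E.

(* H^(2+s)(R^d; R^d) x calH^(3+s)(R^d) *)
Definition solution_norm (s : R) (w : solution) : \bar R :=
  (\sum_i sobolev_norm (2 + s) (w.1 i) + aniso_norm (3 + s) w.2)%E.

(* Classical satisfaction is that of the (unique) continuous representatives. *)
Definition classical_solution (q : data) (w : solution) : Prop :=
  let: ((gamma, mu, sigma), tau, phi) := q in
  exists (v : 'I_d -> 'rV[R]_d -> R) (eta : 'rV[R]_d -> R)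
         (t : 'I_l.+1 -> 'I_d -> 'I_d -> 'rV[R]_d -> R)
         (f : 'I_l.+1 -> 'I_d -> 'rV[R]_d -> R),
  [/\ forall i, represented_by (w.1 i) (v i) /\ Ck 2 (v i),
      represented_by w.2 eta /\ Ck 3 eta,
      forall k i j, represented_by (tau k i j) (t k i j),
      forall k i, represented_by (phi k i) (f k i)
    & wave_system gamma mu sigma v eta (forcing t f eta)].

End spaces.

Definition positive_triple (R : realType) (p : R * R * R) : Prop :=
  [/\ 0 < p.1.1, 0 < p.1.2 & 0 < p.2].

(* Main.v *)
Require Import Defs.
From HB Require Import structures.
From mathcomp Require Import all_boot all_order all_algebra.
From mathcomp Require Import complex ring lra zify.
From mathcomp Require Import all_classical all_reals all_analysis.
From mathcomp Require Import measurable_realfun.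
Import Order.TTheory GRing.Theory Num.Theory.
Import numFieldNormedType.Exports.
Set Implicit Arguments.
Unset Strict Implicit.
Unset Printing Implicit Defensive.
Local Open Scope classical_set_scope.
Local Open Scope ring_scope.

(* With the constants mu^2 and sigma^2, the Horner partial sums
   b_k = sum_(i >= k) eta^(i-k) (tau_i grad eta + phi_i) and the products
   g = (S v) grad eta and c (the terms of the momentum balance with a factor
   1 + eta) as extra unknowns, the system becomes quadratic in (data, unknowns), hence a bounded
   quadratic map between Banach spaces. These are spaces of Hartley transforms
   of weighted L^2 functions: the Hartley transform is the real form of the
   Fourier transform, and the weights are subadditive up to constants, which
   gives the products. The linearisation at v = 0, eta = 0 is a Fourier multiplier
   system, inverted through symP and symD, whose moduli are bounded below by the
   weight of the anisotropic space. A contraction argument solves the quadratic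
   equation near each trivial solution; the inverses of its linearisations give
   derivatives of all orders, and local uniqueness glues the solutions. *)

(** A quadratic map equals its second-order Taylor polynomial, so differentiability of the solution
    map reduces to polarisation and to inverses of linearisations; this repays the extra unknowns.
    The main obstacle is the zero frequency. The divergence of the linearised momentum balance, with
    div v eliminated, is a scalar equation for eta whose symbol vanishes at 0: its squared modulus
    is comparable to (xi_1^2 + |xi|^4)(1 + |xi|^2)^2. The mass equation must therefore take values
    in a space of divergences, whose weight carries an extra |xi|^-2, and eta lands in the
    anisotropic space. All weights have integrable reciprocals, for the anisotropic one thanks to a
    Poisson kernel in xi_1, so transforms converge absolutely. A second obstacle is that uniqueness
    concerns (v, eta) alone: near a trivial solution the auxiliary unknowns are forced to be close
    to their base values once the data and (v, eta) are. A third is that V(p) may depend on p only,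
    whereas the radii depend on the base point used; V(p) is a union of balls over all base points
    whose data ball contains p. *)

Lemma le_of_eq disp (T : porderType disp) (x y : T) : x = y -> (x <= y)%O.
Proof. by move->. Qed.

(** * Lebesgue integration on R^n, one coordinate at a time *)

Section step_integral.
Context {R : realType}.
Local Notation mu := (@lebesgue_rV R).

Lemma rV_cons0 n (p : R * 'rV[R]_n) : rV_cons p ord0 ord0 = p.1.
Proof.
rewrite /rV_cons.
transitivity (row_mx (const_mx p.1 : 'rV_1) p.2 ord0 (lshift n ord0)).
  by congr (row_mx _ _ _ _); exact/val_inj.
by rewrite row_mxEl ?mxE.
Qed.

Lemma rV_consS n (p : R * 'rV[R]_n) j : rV_cons p ord0 (lift ord0 j) = p.2 ord0 j.
Proof.
rewrite /rV_cons.
transitivity (row_mx (const_mx p.1 : 'rV_1) p.2 ord0 (rshift 1 j)).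
  by congr (row_mx _ _ _ _); exact/val_inj.
by rewrite row_mxEr.
Qed.

Lemma measurable_rV_cons n :
  measurable_fun setT (@rV_cons R n).
Proof.
apply: measurable_fun_coordP => i; have [j ->|->] := unliftP ord0 i.
  rewrite (_ : (fun _ => _) = (fun x : 'rV_n => x ord0 j) \o snd).
    by apply: measurableT_comp; [exact: measurable_coord|exact: measurable_snd].
  by apply/funext => p /=; rewrite rV_consS.
rewrite (_ : (fun _ => _) = fst); first exact: measurable_fst.
by apply/funext => p; rewrite rV_cons0.
Qed.

Lemma ge0_integral_step n (f : 'rV[R]_n.+1 -> \bar R) :
  measurable_fun [set: _] f -> (forall x, 0 <= f x)%E ->
  (\int[mu n.+1]_x f x = \int[lebesgue_measure]_t \int[mu n]_y f (rV_cons (t, y)))%E.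
Proof.
move=> mf f0.
transitivity (\int[pushforward (@lebesgue_measure R \x mu n)%E (@rV_cons R n)]_x f x)%E => //.
rewrite ge0_integral_pushforward//; last exact: measurable_rV_cons.
rewrite preimage_setT fubini_tonelli1//; last by move=> x; exact: f0.
by apply: measurableT_comp => //; exact: measurable_rV_cons.
Qed.

Lemma measurable_section_rV n (f : 'rV[R]_n.+1 -> \bar R) t :
  measurable_fun setT f -> measurable_fun setT (fun y => f (rV_cons (t, y))).
Proof.
move=> mf; apply: (measurableT_comp mf).
by apply: (measurableT_comp (@measurable_rV_cons n)); exact: measurable_pair1.
Qed.

Lemma integral_mu0 (f : 'rV[R]_0 -> \bar R) :
  measurable_fun [set: _] f -> (forall x, 0 <= f x)%E -> (\int[mu 0]_x f x = f 0%R)%E.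
Proof.
move=> mf f0; rewrite (_ : lebesgue_rV 0 = \d_(0 : 'rV[R]_0))//.
by rewrite integral_dirac ?diracT ?mul1e.
Qed.

Lemma measurable_inner n (f : 'rV[R]_n.+1 -> \bar R) :
  measurable_fun [set: _] f -> (forall x, 0 <= f x)%E ->
  measurable_fun setT (fun t : R => \int[mu n]_y f (rV_cons (t, y)))%E.
Proof.
move=> mf f0.
have mg : measurable_fun setT (fun p : measurableTypeR R * 'rV[R]_n => f (rV_cons p)).
  by apply: measurableT_comp => //; exact: measurable_rV_cons.
have := @measurable_fun_fubini_tonelli_F _ _ _ _ _ (mu n) _ mg.
by apply=> x; exact: f0.
Qed.

Definition map_coord n (T : 'I_n -> R -> R) (x : 'rV[R]_n) : 'rV[R]_n :=
  \row_i T i (x ord0 i).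

Lemma measurable_map_coord n (T : 'I_n -> R -> R) :
  (forall i, measurable_fun setT (T i)) -> measurable_fun setT (map_coord T).
Proof.
move=> mT; apply: measurable_fun_coordP => i.
rewrite (_ : (fun _ => _) = T i \o (fun x : 'rV[R]_n => x ord0 i)).
  by apply: measurableT_comp; [exact: mT|exact: measurable_coord].
by apply/funext => x; rewrite /map_coord/= mxE.
Qed.

(** Integrating out one coordinate after the other, each contributes one factor [c]. Translations,
    dilations and the reflection of R^n are all maps of this kind. *)
Lemma integral_map_coord (c : R) n (T : 'I_n -> R -> R) (f : 'rV[R]_n -> \bar R) :
  0 <= c ->
  (forall i, measurable_fun setT (T i)) ->
  (forall i (g : R -> \bar R), measurable_fun setT g -> (forall x, 0 <= g x)%E ->
     \int[lebesgue_measure]_t g (T i t) = c%:E * \int[lebesgue_measure]_t g t)%E ->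
  measurable_fun [set: _] f -> (forall x, 0 <= f x)%E ->
  (\int[mu n]_x f (map_coord T x) = (c ^+ n)%:E * \int[mu n]_x f x)%E.
Proof.
move=> c0; elim: n T f => [|n IH] T f mT HT mf f0.
  rewrite expr0 mul1e; apply: eq_integral => x _; congr f.
  by apply/rowP => -[].
have mTf : measurable_fun setT (f \o map_coord T).
  by apply: measurableT_comp => //; exact: measurable_map_coord.
rewrite (@ge0_integral_step n (fun x => f (map_coord T x)))// ge0_integral_step//.
transitivity (\int[lebesgue_measure]_t ((c ^+ n)%:E * \int[mu n]_y f (rV_cons (T ord0 t, y))))%E.
  apply: eq_integral => t _.
  rewrite -(IH (fun i => T (lift ord0 i)) (fun y => f (rV_cons (T ord0 t, y)))
    (fun i => mT _) (fun i => HT _) (measurable_section_rV _ mf))//.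
  apply: eq_integral => y _; congr f; apply/rowP => i.
  have [j ->|->] := unliftP ord0 i; first by rewrite /map_coord mxE !rV_consS mxE.
  by rewrite mxE !rV_cons0.
have mi := measurable_inner mf f0.
have i0 t : (0 <= \int[mu n]_y f (rV_cons (t, y)))%E by apply: integral_ge0.
have mTi := measurableT_comp mi (mT ord0).
apply: (eq_trans (@ge0_integralZl_EFin _ (measurableTypeR R) _ lebesgue_measure _ measurableT
  _ (fun t _ => i0 (T ord0 t)) mTi _ (exprn_ge0 n c0))).
rewrite (HT ord0 (fun t => \int[mu n]_y f (rV_cons (t, y)))%E)// muleA.
by rewrite -EFinM exprSr.
Qed.

(** Tonelli for tensor products, from which the volume of a box is read off. *)
Lemma integral_prod_coord n (f : 'I_n -> R -> \bar R) :
  (forall i, measurable_fun setT (f i)) -> (forall i t, 0 <= f i t)%E ->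
  (\int[mu n]_x \prod_i f i (x ord0 i) = \prod_i \int[lebesgue_measure]_t f i t)%E.
Proof.
elim: n f => [|n IH] f mf f0.
  rewrite big_ord0 integral_mu0; first by rewrite big_ord0.
    rewrite (_ : (fun _ => _) = cst 1%E) //.
    by apply/funext => x; rewrite big_ord0.
  by move=> x; rewrite big_ord0.
have mprod m (g : 'I_m -> R -> \bar R) : (forall i, measurable_fun setT (g i)) ->
    measurable_fun setT (fun x : 'rV[R]_m => \prod_i g i (x ord0 i))%E.
  move=> mg.
  have : forall s : seq 'I_m, measurable_fun setT (fun x : 'rV[R]_m => \prod_(i <- s) g i (x ord0 i))%E.
    elim=> [|i s IHs].
      rewrite (_ : (fun _ => _) = cst 1%E) //.
      by apply/funext => x; rewrite big_nil.
    rewrite (_ : (fun _ => _) = (fun x : 'rV[R]_m => g i (x ord0 i) * \prod_(j <- s) g j (x ord0 j))%E); last first.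
      by apply/funext => x; rewrite big_cons.
    apply: emeasurable_funM => //.
    by apply: measurableT_comp => //; exact: measurable_coord.
  exact.
rewrite ge0_integral_step; last 2 first.
- exact: mprod.
- by move=> x; apply: prode_ge0.
rewrite big_ord_recl.
rewrite -(IH (fun i => f (lift ord0 i)))//.
set c := (\int[mu n]_x _)%E.
have c0 : (0 <= c)%E by apply: integral_ge0 => x _; exact: prode_ge0.
transitivity (\int[lebesgue_measure]_t (c * f ord0 t))%E; last first.
  by rewrite [RHS]muleC ge0_integralZl//; exact: mf.
apply: eq_integral => t _.
rewrite [RHS]muleC /c -ge0_integralZl//; last 2 first.
- exact: (mprod _ (fun i => f (lift ord0 i))).
- by move=> x _; apply: prode_ge0.
apply: eq_integral => y _; rewrite big_ord_recl rV_cons0; congr (_ * _)%E.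
by apply: eq_bigr => i _; rewrite rV_consS.
Qed.

End step_integral.

(** * Fubini's theorem for real-valued integrals *)

Section Fubini_Rintegral.
Context d1 d2 (T1 : measurableType d1) (T2 : measurableType d2) (R : realType).
Variables (m1 : {sigma_finite_measure set T1 -> \bar R})
  (m2 : {sigma_finite_measure set T2 -> \bar R}).
Variable f : T1 -> T2 -> R.
Hypothesis mf : measurable_fun [set: T1 * T2] (fun z => f z.1 z.2).
Hypothesis fi : (\int[m1]_x \int[m2]_y `|f x y|%:E < +oo)%E.

Let mfE : measurable_fun [set: T1 * T2] (fun z => (f z.1 z.2)%:E).
Proof. exact/measurable_EFinP. Qed.
Let pi12 : (m1 \x m2)%E.-integrable setT (fun z => (f z.1 z.2)%:E).
Proof. by apply/integrable12ltyP. Qed.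

Lemma integrable_Rintegral_l :
  m1.-integrable setT (fun x => (\int[m2]_y f x y)%:E).
Proof.
have iF := integrable_fubini_F pi12.
apply/integrableP; split.
  apply/measurable_EFinP; apply: measurableT_comp => //.
  by have /integrableP[] := iF.
have /integrableP[_] := iF; apply: le_lt_trans.
apply: ge0_le_integral => //.
- apply: measurableT_comp => //; apply/measurable_EFinP.
  apply: measurableT_comp => //; by have /integrableP[] := iF.
- by apply: measurableT_comp => //; have /integrableP[] := iF.
(* Where the inner integral is infinite [fine] returns 0, which only lowers the absolute value. *)
move=> x _; rewrite /Rintegral /fubini_F /=.
by case: (\int[m2]_y (f x y)%:E)%E => [r||] //=; rewrite ?leey.
Qed.

(** The real-valued and the extended inner integrals differ only where the latter is infinite, hence
    on a null set. *)
Lemma Fubini_Rintegral_lhs :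
  \int[m1]_x (\int[m2]_y f x y) = fine (\int[m1 \x m2]_z (f z.1 z.2)%:E)%E.
Proof.
have iF := integrable_fubini_F pi12.
rewrite -(integral12_prod_meas1 pi12) /Rintegral; congr fine.
apply: ae_eq_integral => //.
- by have /integrableP[] := integrable_Rintegral_l.
- by have /integrableP[] := iF.
have := integrable_ae measurableT iF.
apply: filterS => x /= /(_ Logic.I) H _.
by rewrite fineK.
Qed.

End Fubini_Rintegral.

Lemma Fubini_Rintegral d1 d2 (T1 : measurableType d1) (T2 : measurableType d2)
    (R : realType) (m1 : {sigma_finite_measure set T1 -> \bar R})
    (m2 : {sigma_finite_measure set T2 -> \bar R}) (f : T1 -> T2 -> R) :
  measurable_fun [set: T1 * T2] (fun z => f z.1 z.2) ->
  (\int[m1]_x \int[m2]_y `|f x y|%:E < +oo)%E ->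
  \int[m1]_x (\int[m2]_y f x y) = \int[m2]_y (\int[m1]_x f x y).
Proof.
move=> mf fi.
have pi12 : (m1 \x m2)%E.-integrable setT (fun z => (f z.1 z.2)%:E).
  by apply/integrable12ltyP => //; exact/measurable_EFinP.
have mf' : measurable_fun [set: T2 * T1] (fun z => f z.2 z.1).
  suff : measurable_fun [set: T2 * T1]
    ((fun z : T1 * T2 => f z.1 z.2) \o (fun z : T2 * T1 => (z.2, z.1))) by [].
  apply: (measurableT_comp (f := fun z : T1 * T2 => f z.1 z.2) mf).
  by apply: measurable_fun_pair.
have fi' : (\int[m2]_y \int[m1]_x `|f x y|%:E < +oo)%E.
  by move/integrable21ltyP : (pi12) => /(_ ((measurable_EFinP _ _).2 mf)).
have pi21 : (m2 \x m1)%E.-integrable setT (fun z => (f z.2 z.1)%:E).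
  by apply/integrable12ltyP => //; exact/measurable_EFinP.
rewrite (Fubini_Rintegral_lhs mf)// (Fubini_Rintegral_lhs (f := fun y x => f x y))//.
congr fine.
by rewrite -(integral12_prod_meas1 pi12) -(integral12_prod_meas1 pi21) (Fubini pi12).
Qed.

(** * Affine changes of variables *)

Section change_of_variable.
Context d (T : measurableType d) (R : realType).
Variables (mu : {measure set T -> \bar R}) (phi : T -> T) (c : R).
Hypotheses (mphi : measurable_fun setT phi) (c0 : 0 <= c).
Hypothesis phiE : forall f : T -> \bar R, measurable_fun setT f ->
  (forall x, 0 <= f x)%E -> (\int[mu]_x f (phi x) = c%:E * \int[mu]_x f x)%E.

Lemma integrable_change (f : T -> R) : mu.-integrable setT (EFin \o f) ->
  mu.-integrable setT (EFin \o (f \o phi)).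
Proof.
move=> /integrableP[mf fi]; apply/integrableP; split.
  by apply: (measurableT_comp mf).
have mabs : measurable_fun setT (fun x => `|(EFin \o f) x|%E).
  exact: measurableT_comp.
rewrite (phiE (f := fun x => `|(EFin \o f) x|%E))//.
by rewrite lte_mul_pinfty// ge0_fin_numE//; apply: integral_ge0.
Qed.

Lemma Rintegral_change (f : T -> R) : mu.-integrable setT (EFin \o f) ->
  \int[mu]_x f (phi x) = c * \int[mu]_x f x.
Proof.
move=> fi; have mf := measurable_int _ fi.
rewrite /Rintegral (integralE _ _ (fun x => (f (phi x))%:E)) [in RHS]integralE.
have fp := integrable_pos_fin_num measurableT fi.
have fn := integrable_neg_fin_num measurableT fi.
have -> : (\int[mu]_x ((fun x => (f (phi x))%:E)^\+ x) =
    c%:E * \int[mu]_x ((EFin \o f)^\+ x))%E.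
  have h := phiE (measurable_funepos mf) (funepos_ge0 (EFin \o f)).
  by rewrite -h; apply: eq_integral => x _; rewrite !funeposE.
have -> : (\int[mu]_x ((fun x => (f (phi x))%:E)^\- x) =
    c%:E * \int[mu]_x ((EFin \o f)^\- x))%E.
  have h := phiE (measurable_funeneg mf) (funeneg_ge0 (EFin \o f)).
  by rewrite -h; apply: eq_integral => x _; rewrite !funenegE.
have fd : (\int[mu]_x ((EFin \o f)^\+ x) - \int[mu]_x ((EFin \o f)^\- x))%E \is a fin_num.
  by rewrite fin_numB fp fn.
by rewrite -muleBr ?fin_num_adde_defl ?fin_numN// fineM.
Qed.

End change_of_variable.

Section affine_line.
Context {R : realType}.
Local Notation leb := (@lebesgue_measure R).

Lemma measurable_affine (a b : R) :
  measurable_fun [set: measurableTypeR R] (fun t : measurableTypeR R => (a * t + b : measurableTypeR R)).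
Proof.
have : measurable_fun [set: R] (fun t : R => a * t + b).
  by apply: measurable_funD => //; apply: measurable_funM.
exact.
Qed.

(** By uniqueness of Lebesgue measure: the rescaled pushforward has the right value on half-open
    intervals. *)
Lemma lebesgue_measure_affine (a b : R) (A : set (measurableTypeR R)) : 0 < a -> measurable A ->
  (a%:E * pushforward leb (fun t : R => (a * t + b)%R : measurableTypeR R) A)%E = leb A.
Proof.
move=> a0 mA.
pose pm : {measure set (measurableTypeR R) -> \bar R} :=
  measure_function_pushforward__canonical__measure_function_Measure leb (measurable_affine a b).
pose m : {measure set (measurableTypeR R) -> \bar R} := mscale (NngNum (ltW a0)) pm.
apply/esym; rewrite -[RHS]/(m A).
apply: (lebesgue_measure_unique (mu := m)) => //= _ [[x y]] _ <-.
rewrite /m /mscale /= /pm /pushforward /=.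
rewrite (_ : _ @^-1` _ = `](x - b) / a, (y - b) / a]%classic); last first.
  apply/seteqP; split => t /=; rewrite !in_itv/= ltr_pdivrMr// ler_pdivlMr//.
    by move=> /andP[? ?]; rewrite ltrBlDr lerBrDr mulrC; apply/andP; split.
  by rewrite ltrBlDr lerBrDr mulrC.
rewrite !lebesgue_measure_itv/= !lte_fin ltr_pM2r ?invr_gt0// ltrD2r.
case: ifPn => xy; last by rewrite mule0.
rewrite -!EFinB -EFinM; congr EFin; field; exact: lt0r_neq0.
Qed.

Lemma ge0_integral_affine (a b : R) (f : R -> \bar R) : 0 < a ->
  measurable_fun setT f -> (forall x, 0 <= f x)%E ->
  (\int[leb]_t f (a * t + b)%R = a^-1%:E * \int[leb]_t f t)%E.
Proof.
move=> a0 mf f0.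
have mT := measurable_affine a b.
pose pm : {measure set (measurableTypeR R) -> \bar R} :=
  measure_function_pushforward__canonical__measure_function_Measure leb mT.
transitivity (\int[pm]_t f t)%E; first by rewrite [RHS]ge0_integral_pushforward.
have -> : (\int[leb]_t f t = \int[mscale (NngNum (ltW a0)) pm]_t f t)%E.
  apply: eq_measure_integral => A mA _.
  exact/esym/(lebesgue_measure_affine b a0 mA).
rewrite ge0_integral_mscale//= muleA -EFinM mulVf ?mul1e//.
exact: lt0r_neq0.
Qed.

Lemma ge0_integral_opp (f : R -> \bar R) :
  measurable_fun setT f -> (forall x, 0 <= f x)%E ->
  (\int[leb]_t f (- t)%R = \int[leb]_t f t)%E.
Proof.
move=> mf f0.
have mT : measurable_fun [set: measurableTypeR R] (-%R : _ -> measurableTypeR R).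
  have : measurable_fun [set: R] (fun t : R => - t) by exact: measurableT_comp.
  exact.
transitivity (\int[pushforward leb (-%R : _ -> measurableTypeR R)]_t f t)%E.
  rewrite ge0_integral_pushforward//.
apply: eq_measure_integral => A mA _; exact: lebesgue_measureN.
Qed.

End affine_line.

Section affine_rV.
Context {R : realType} {d : nat}.
Local Notation mu := (@lebesgue_rV R d).
Implicit Types f : 'rV[R]_d -> \bar R.

Lemma measurable_addr_rV (a : 'rV[R]_d) : measurable_fun setT (fun x : 'rV[R]_d => x + a).
Proof.
apply: measurable_fun_coordP => i.
rewrite (_ : (fun _ => _) = (fun x : 'rV[R]_d => x ord0 i + a ord0 i)).
  by apply: measurable_funD => //; exact: measurable_coord.
by apply/funext => x; rewrite mxE.
Qed.

Lemma measurable_scale_rV (a : R) : measurable_fun setT (fun x : 'rV[R]_d => a *: x).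
Proof.
apply: measurable_fun_coordP => i.
rewrite (_ : (fun _ => _) = (fun x : 'rV[R]_d => a * x ord0 i)).
  by apply: measurable_funM => //; exact: measurable_coord.
by apply/funext => x; rewrite mxE.
Qed.

Lemma ge0_integral_addr f (a : 'rV[R]_d) :
  measurable_fun setT f -> (forall x, 0 <= f x)%E ->
  (\int[mu]_x f (x + a)%R = \int[mu]_x f x)%E.
Proof.
move=> mf f0.
transitivity ((1 ^+ d)%:E * \int[mu]_x f x)%E; last by rewrite expr1n mul1e.
rewrite -(@integral_map_coord R 1 d (fun i t => 1 * t + a ord0 i))//; last 2 first.
- by move=> i; apply: measurable_funD => //; apply: measurable_funM.
- by move=> i g mg g0; rewrite ge0_integral_affine// invr1.
apply: eq_integral => x _; congr f; apply/rowP => i.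
by rewrite !mxE mul1r.
Qed.

Lemma ge0_integral_scaler f (a : R) : 0 < a ->
  measurable_fun setT f -> (forall x, 0 <= f x)%E ->
  (\int[mu]_x f (a *: x)%R = (a^-1 ^+ d)%:E * \int[mu]_x f x)%E.
Proof.
move=> a0 mf f0.
rewrite -(@integral_map_coord R _ d (fun i t => a * t + 0))//; last 3 first.
- by rewrite invr_ge0 ltW.
- by move=> i; apply: measurable_funD => //; apply: measurable_funM.
- by move=> i g mg g0; rewrite ge0_integral_affine.
apply: eq_integral => x _; congr f; apply/rowP => i.
by rewrite !mxE addr0.
Qed.

Lemma ge0_integral_oppr f :
  measurable_fun setT f -> (forall x, 0 <= f x)%E ->
  (\int[mu]_x f (- x)%R = \int[mu]_x f x)%E.
Proof.
move=> mf f0.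
transitivity ((1 ^+ d)%:E * \int[mu]_x f x)%E; last by rewrite expr1n mul1e.
rewrite -(@integral_map_coord R 1 d (fun i t => - t))//; last 2 first.
- by move=> i; exact: measurableT_comp.
- by move=> i g mg g0; rewrite ge0_integral_opp// mul1e.
by apply: eq_integral => x _; congr f; apply/rowP => i; rewrite !mxE.
Qed.

End affine_rV.

(** * Derivatives along lines and under the integral sign *)

Section line.
Context {R : realType} {V : normedModType R}.
Implicit Types (f : V -> R) (x v : V).

Let line_quotient f x v (t : R) :
  (fun h : R => h^-1 *: (f ((h *: (1 : R) + t) *: v + x) - f (t *: v + x))) =
  (fun h : R => h^-1 *: (f (h *: v + (t *: v + x)) - f (t *: v + x))).
Proof.
by apply/funext => h; rewrite [h *: _]mulr1 scalerDl addrA.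
Qed.

(** The difference quotients coincide literally. This makes the one-dimensional theorems (mean
    value, chain rule, dominated differentiation) available for directional derivatives. *)
Lemma derivable_line f x v (t : R) :
  derivable f (t *: v + x) v <-> derivable (fun s : R => f (s *: v + x)) t 1.
Proof. by rewrite /derivable /= -(line_quotient f x v t). Qed.

Lemma derive_line f x v (t : R) :
  'D_1 (fun s : R => f (s *: v + x)) t = 'D_v f (t *: v + x).
Proof. by rewrite /derive /= -(line_quotient f x v t). Qed.

End line.

Section under_integral.
Context {R : realType} {V : normedModType R} d (Y : measurableType d)
  (mu : {measure set Y -> \bar R}).
Variables (F : V -> Y -> R) (G : Y -> R).
Hypothesis intF : forall x, mu.-integrable setT (EFin \o F x).
Hypothesis intG : mu.-integrable setT (EFin \o G).

(** By contradiction: a failure of continuity at [x] yields a sequence tending to [x] along which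
    dominated convergence is violated. *)
Lemma continuous_Rintegral :
  (forall y, continuous (F ^~ y)) -> (forall x y, `|F x y| <= G y) ->
  continuous (fun x => \int[mu]_y F x y).
Proof.
move=> cF FG x; apply/cvgrPdist_lt => e e0.
apply: contrapT => H.
have {H} : forall n : nat, exists z, `|x - z| < n.+1%:R^-1 /\
    e <= `|\int[mu]_y F x y - \int[mu]_y F z y|.
  move=> n; apply: contrapT => /forallNP N; apply: H.
  have : \forall z \near x, `|x - z| < n.+1%:R^-1.
    by apply/nbhs_ballP; exists n.+1%:R^-1 => /=; [rewrite invr_gt0|move=> z; rewrite -ball_normE].
  apply: filterS => z zn; rewrite ltNge; apply/negP => ez.
  by apply: (N z).
move=> /choice[u Hu].
have ux : u @ \oo --> x.
  apply/cvgrPdist_lt => r r0; near=> n.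
  apply: (lt_trans (Hu n).1); near: n; exact: near_infty_natSinv_lt (PosNum r0).
have DC : (fun n => \int[mu]_y F (u n) y) @ \oo --> \int[mu]_y F x y.
  apply: fine_cvg; rewrite fineK; last first.
    by rewrite (integrable_fin_num _ (intF x)).
  apply: (@dominated_cvg _ _ _ mu setT measurableT (fun n y => (F (u n) y)%:E) _ (EFin \o G)) => //.
  - by move=> n; exact: (measurable_int _ (intF (u n))).
  - move=> y _; apply/fine_cvgP; split; first exact: nearW.
    rewrite (_ : fine \o _ = (F ^~ y) \o u)//.
    by apply: cvg_comp; [exact: ux|exact: cF].
  - by move=> n y _; rewrite lee_fin.
move/cvgrPdist_lt : DC => /(_ e e0)[N _ /(_ N (leqnn N))] /=.
by rewrite ltNge (Hu N).2.
Unshelve. all: by end_near. Qed.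

Lemma derive_Rintegral v :
  (forall x y, derivable (F ^~ y) x v) ->
  (forall x y, `|'D_v (F ^~ y) x| <= G y) ->
  (forall x, derivable (fun x => \int[mu]_y F x y) x v) /\
  'D_v (fun x => \int[mu]_y F x y) = (fun x => \int[mu]_y 'D_v (F ^~ y) x).
Proof.
move=> dF FG.
have H x : derivable (fun t : R => \int[mu]_y F (t *: v + x) y) 0 1 /\
   'D_1 (fun t : R => \int[mu]_y F (t *: v + x) y) 0 = \int[mu]_y 'D_v (F ^~ y) x.
  (* The differentiation theorem asks for an open interval of parameters; any one around 0, where
     the derivative is read off, will do. *)
  have I0 : (`](-1), 1[%classic : set R) 0 by rewrite /= in_itv/=; lra.
  have i1 (t : R) : (`](-1), 1[%classic : set R) t -> mu.-integrable setT (EFin \o (fun y => F (t *: v + x) y)).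
    by move=> _; exact: intF.
  have d1 (t : R) y : (`](-1), 1[%classic : set R) t -> setT y ->
      derivable ((fun s y => F (s *: v + x) y) ^~ y) t 1.
    by move=> _ _; exact: ((derivable_line (F ^~ y) x v t).1 (dF _ _)).
  have G0 y : 0 <= G y by exact: le_trans (FG x y).
  have b1 (t : R) y : (`](-1), 1[%classic : set R) t -> setT y ->
      `|partial1of2 (fun s y => F (s *: v + x) y) t y| <= G y.
    by move=> _ _; rewrite partial1of2E (derive_line (F ^~ y)).
  split; first exact: (derivable_under_integral measurableT I0 i1 d1 G0 intG b1).
  rewrite -derive1E (differentiation_under_integral measurableT I0 i1 d1 G0 intG b1).
  apply: eq_Rintegral => y _; rewrite partial1of2E (derive_line (F ^~ y)).
  by rewrite scale0r add0r.
split=> [x|].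
  have [h _] := H x.
  by have := (derivable_line (fun x => \int[mu]_y F x y) x v 0).2 h; rewrite scale0r add0r.
apply/funext => x; have [_ <-] := H x.
by rewrite (derive_line (fun x => \int[mu]_y F x y)) scale0r add0r.
Qed.

End under_integral.

(** * Smooth functions on R^d *)

Section smooth.
Context {R : realType} {d : nat}.
Local Notation E := 'rV[R]_d.
Implicit Types f g : E -> R.

Record smooth f : Prop := Smooth { smooth_Ck : forall k, Ck k f }.

(** A coinduction principle: to prove smoothness one exhibits a class of differentiable functions
    that is stable under partial differentiation. *)
Lemma smooth_coind (S : set (E -> R)) :
  (forall f, S f -> [/\ continuous f, forall j x, derivable f x (delta_mx ord0 j)
     & forall j, S (pderiv j f)]) ->
  S `<=` smooth.
Proof.
move=> HS f Sf; split=> k.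
have Sl l : S (pderivs l f) by elim: l => //= j l /HS[].
by split=> l _; have [] := HS _ (Sl l).
Qed.

Lemma smoothP f : smooth f ->
  [/\ continuous f, forall j x, derivable f x (delta_mx ord0 j)
    & forall j, smooth (pderiv j f)].
Proof.
move=> sf; split.
- by have [/(_ [::] isT)] := smooth_Ck sf 0%N.
- by move=> j x; have [_ /(_ [::] isT)] := smooth_Ck sf 1%N.
move=> j; split=> k; have pE l : pderivs l (pderiv j f) = pderivs (rcons l j) f.
  by rewrite /pderivs -cats1 foldr_cat.
have [h1 h2] := smooth_Ck sf k.+1.
split=> l lk.
  by rewrite pE; apply: h1; rewrite size_rcons.
by move=> i x; rewrite pE; apply: h2; rewrite size_rcons.
Qed.

Lemma smooth_continuous f : smooth f -> continuous f.
Proof. by case/smoothP. Qed.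

Lemma pderivD j f g x : derivable f x (delta_mx ord0 j) -> derivable g x (delta_mx ord0 j) ->
  pderiv j (fun y => f y + g y) x = pderiv j f x + pderiv j g x.
Proof. by move=> df dg; rewrite /pderiv (deriveD df dg). Qed.

Lemma pderivM j f g x : derivable f x (delta_mx ord0 j) -> derivable g x (delta_mx ord0 j) ->
  pderiv j (fun y => f y * g y) x = f x * pderiv j g x + g x * pderiv j f x.
Proof. by move=> df dg; rewrite /pderiv (deriveM df dg). Qed.

Lemma pderivZ (c : R) j f x : derivable f x (delta_mx ord0 j) -> pderiv j (fun y => c * f y) x = c * pderiv j f x.
Proof.
move=> df; rewrite pderivM; [|exact: derivable_cst|exact: df].
by rewrite [X in _ + _ * X]derive_cst mulr0 addr0.
Qed.

(** Leibniz's rule turns one product into a sum of two, so the stable class handed to [smooth_coind]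
    has to contain sums of products. *)
Inductive prod_sum : (E -> R) -> Prop :=
| ProdSum f g : smooth f -> smooth g -> prod_sum (fun x => f x * g x)
| ProdSumD f g : prod_sum f -> prod_sum g -> prod_sum (fun x => f x + g x).

Lemma smooth_prod_sum : prod_sum `<=` smooth.
Proof.
apply: smooth_coind => f; elim=> {f} f g.
- move=> sf sg; have [cf df sf'] := smoothP sf; have [cg dg sg'] := smoothP sg; split.
  + by move=> x; exact: (cvgM (cf x) (cg x)).
  + by move=> j x; exact: derivableM.
  + move=> j; rewrite (_ : pderiv j _ = fun x => f x * pderiv j g x + g x * pderiv j f x).
      by apply: ProdSumD; apply: ProdSum.
    by apply/funext => x; exact: pderivM.
move=> _ [cf df sf'] _ [cg dg sg']; split.
- by move=> x; exact: (cvgD (cf x) (cg x)).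
- by move=> j x; exact: derivableD.
move=> j; rewrite (_ : pderiv j _ = fun x => pderiv j f x + pderiv j g x).
  exact: ProdSumD.
by apply/funext => x; exact: pderivD.
Qed.

Lemma smoothM f g : smooth f -> smooth g -> smooth (fun x => f x * g x).
Proof. by move=> sf sg; apply: smooth_prod_sum; exact: ProdSum. Qed.

Lemma smooth_cst (c : R) : smooth (cst c).
Proof.
apply: (@smooth_coind [set f | exists c, f = cst c]); last by exists c.
move=> _ [b ->]; split.
- exact: cst_continuous.
- by move=> j x; exact: derivable_cst.
- by move=> j; exists 0; apply/funext => x; rewrite /pderiv derive_cst.
Qed.

Lemma smoothZ (c : R) f : smooth f -> smooth (fun x => c * f x).
Proof. by move=> sf; apply: smoothM => //; exact: smooth_cst. Qed.

Lemma smooth_prod (I : Type) (s : seq I) (F : I -> E -> R) :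
  (forall i, smooth (F i)) -> smooth (fun x => \prod_(i <- s) F i x).
Proof.
move=> sF; elim: s => [|i s IH].
  rewrite (_ : (fun x => _) = cst 1); first exact: smooth_cst.
  by apply/funext => x; rewrite big_nil.
rewrite (_ : (fun x => _) = fun x => F i x * \prod_(j <- s) F j x); first exact: smoothM.
by apply/funext => x; rewrite big_cons.
Qed.

Definition smooth1 (p : R -> R) := forall n x, derivable (derive1n n p) x 1.

Lemma derivable_coord_comp (p : R -> R) (i j : 'I_d) (a b : R) (x : E) :
  (forall t, derivable p t 1) ->
  derivable (fun y : E => p (a * y ord0 i + b)) x (delta_mx ord0 j) /\
  pderiv j (fun y : E => p (a * y ord0 i + b)) x = (i == j)%:R * a * derive1 p (a * x ord0 i + b).
Proof.
move=> dp; set f := fun y : E => _.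
have fl : (fun s : R => f (s *: delta_mx ord0 j + x)) =
    (fun s : R => p (s * (a * (i == j)%:R) + (a * x ord0 i + b))).
  apply/funext => s; rewrite /f !mxE eqxx /=; congr p; case: eqVneq => _ /=; ring.
pose g (s : R) : R := s * (a * (i == j)%:R) + (a * x ord0 i + b).
have dl : is_derive (0 : R) (1 : R) (p \o g) (derive1 p (a * x ord0 i + b) * (a * (i == j)%:R)).
  apply: is_derive1_comp.
    by rewrite /g mul0r add0r derive1E; apply: DeriveDef => //; exact: dp.
  rewrite (_ : g = (a * (i == j)%:R) \*: id + cst (a * x ord0 i + b)).
    by apply: is_derive_eq; rewrite addr0 [_ *: _]mulr1.
  by apply/funext => s; rewrite /g /= mulrC.
split.
  have : derivable f (0 *: delta_mx ord0 j + x) (delta_mx ord0 j).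
    by apply/derivable_line; rewrite fl; exact: ex_derive.
  by rewrite scale0r add0r.
rewrite /pderiv; have := derive_line f x (delta_mx ord0 j) 0.
rewrite scale0r add0r => <-; rewrite fl (@derive_val _ _ _ _ _ _ _ dl); ring.
Qed.

Lemma smooth_coord (p : R -> R) (i : 'I_d) (a b : R) : smooth1 p ->
  smooth (fun x : E => p (a * x ord0 i + b)).
Proof.
move=> sp.
(* A partial derivative multiplies by a constant and raises the order of the derivative of [p], so
   scalar multiples of all [derive1n n p] form a stable class. *)
apply: (@smooth_coind [set f | exists c n, f = fun x : E => c * derive1n n p (a * x ord0 i + b)]); last first.
  by exists 1, 0%N; apply/funext => x; rewrite mul1r.
move=> _ [c [n ->]].
have D j x := derivable_coord_comp i j a b x (sp n).
have dc j x : derivable (fun y : E => c * derive1n n p (a * y ord0 i + b)) x (delta_mx ord0 j).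
  by apply: derivableM => //; exact: (D j x).1.
split.
- have ca : continuous (fun x : E => a * x ord0 i + b).
    by move=> x; exact: (cvgD (cvgM (cvg_cst a) (@coord_continuous _ _ _ ord0 i x)) (cvg_cst b)).
  have cp : continuous (fun x : E => derive1n n p (a * x ord0 i + b)).
    move=> x; apply: (@continuous_comp _ _ _ (fun x : E => a * x ord0 i + b) (derive1n n p)).
      exact: ca.
    by apply: differentiable_continuous; apply/derivable1_diffP; exact: sp.
  by move=> x; exact: (cvgM (cvg_cst c) (cp x)).
- exact: dc.
move=> j; exists (c * ((i == j)%:R * a)), n.+1; apply/funext => x.
rewrite pderivM; [|exact: derivable_cst|exact: (D j x).1].
rewrite (D j x).2 /pderiv derive_cst mulr0 addr0 -derive1nS; ring.
Qed.

End smooth.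

(** * Borel measurability on R^d *)

Section borel.
Context {R : realType} {d : nat}.
Local Notation E := 'rV[R]_d.

Lemma measurable_ball_rV (x : E) (r : R) : 0 < r -> measurable (ball x r : set E).
Proof.
move=> r0.
rewrite (_ : ball x r = \bigcap_(i in [set: 'I_d]) ((fun y : E => y ord0 i) @^-1` ball (x ord0 i) r)).
  apply: fin_bigcap_measurable => // i _; rewrite -[X in measurable X]setTI.
  by apply: measurable_coord => //; exact: measurable_ball.
apply/seteqP; split => y /=; first by move=> xy i _; exact: (xy.2 ord0 i).
by move=> H; split=> // i j; rewrite (ord1 i); exact: H.
Qed.

(** The sigma-algebra is generated by the coordinates, and balls of the sup norm are finite
    intersections of coordinate slabs; an open set is the countable union of the balls of rational
    centre and radius 1/(n+1) that it contains. *)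
Lemma open_measurable_rV (U : set E) : open U -> measurable U.
Proof.
move=> oU.
pose rv (q : 'rV[rat]_d) : E := map_mx (@ratr R) q.
pose B (p : 'rV[rat]_d * nat) : set E :=
  if `[< ball (rv p.1) p.2.+1%:R^-1 `<=` U >] then ball (rv p.1) p.2.+1%:R^-1 else set0.
have mB p : measurable (B p).
  by rewrite /B; case: ifPn => // _; apply: measurable_ball_rV; rewrite invr_gt0.
rewrite (_ : U = \bigcup_k (if unpickle k is Some p then B p else set0)).
  by apply: bigcup_measurable => k _; case: (unpickle k) => [p|].
apply/seteqP; split; last first.
  move=> y [k _]; case: (unpickle k) => [p|//]; rewrite /B.
  by case: ifPn => // /asboolP; apply.
move=> y Uy.
have /nbhs_ballP[e /= e0 eU] : nbhs y U by exact: open_nbhs_nbhs.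
(* Half of [e], because the rational centre is off by one radius and the ball around it adds
   another. *)
have [n ne] : exists n : nat, n.+1%:R^-1 < e / 2.
  near \oo => n; exists n; near: n.
  have e20 : 0 < e / 2 by rewrite divr_gt0.
  exact: near_infty_natSinv_lt (PosNum e20).
have /choice[q Hq] : forall i : 'I_d, exists q : rat, `|y ord0 i - ratr q| < n.+1%:R^-1.
  move=> i; have [|q] := @rat_in_itvoo R (y ord0 i - n.+1%:R^-1) (y ord0 i + n.+1%:R^-1).
    by rewrite ltrD2l gtrN// invr_gt0.
  rewrite in_itv/= => /andP[h1 h2]; exists q.
  by rewrite ltr_distlC h1 h2.
pose qv : 'rV[rat]_d := \row_i q i.
have yq : ball (rv qv) n.+1%:R^-1 y.
  split; first by rewrite invr_gt0.
  by move=> i j; rewrite (ord1 i) !mxE /ball/= distrC; exact: Hq.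
exists (pickle (qv, n)) => //; rewrite pickleK /B /=.
rewrite ifT//; apply/asboolP => z qz; apply: eU.
have : ball y (n.+1%:R^-1 + n.+1%:R^-1) z by apply: ball_triangle qz; exact: ball_sym.
by apply: le_ball; rewrite (splitr e); apply: lerD; exact: ltW.
Unshelve. all: by end_near. Qed.

Lemma continuous_measurable_rV (f : E -> R) : continuous f -> measurable_fun setT f.
Proof.
move=> cf; apply: (measurability _ (RGenOpens.measurableE R)).
move=> _ [_ [a [b ->]] <-]; rewrite setTI.
apply: open_measurable_rV; apply: open_comp => //; exact: interval_open.
Qed.

End borel.

(** * The flat function behind bump functions *)

Section bump.
Context {R : realType}.

(* t |-> P(1/t) exp(-1/t) on t > 0, extended by 0. *)
Definition flat (P : {poly R}) (t : R) : R :=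
  if 0 < t then P.[t^-1] * expR (- t^-1) else 0.

(** From 1 + y/n <= exp(y/n) one gets y exp(-y/n) <= n; take n-th powers. *)
Lemma exprn_expRN_bounded (n : nat) (y : R) : 0 <= y -> y ^+ n * expR (- y) <= n%:R ^+ n.
Proof.
move=> y0; case: n => [|n].
  by rewrite !expr0 mul1r -expR0 ler_expR oppr_le0.
have -> : expR (- y) = (expR (y / n.+1%:R))^-1 ^+ n.+1.
  by rewrite -expRN -expRM_natl mulrN mulrCA divff ?mulr1// pnatr_eq0.
rewrite -exprMn; apply: lerXn2r; rewrite ?nnegrE ?ler0n//.
  by rewrite mulr_ge0// invr_ge0 expR_ge0.
rewrite ler_pdivrMr ?expR_gt0//.
have := expR_ge1Dx (y / n.+1%:R) => h.
have n0 : (0 : R) < n.+1%:R by rewrite ltr0n.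
have e : n.+1%:R * (1 + y / n.+1%:R) = n.+1%:R + y :> R.
  by rewrite mulrDr mulr1 mulrCA divff ?mulr1// gt_eqF.
have : n.+1%:R * (1 + y / n.+1%:R) <= n.+1%:R * expR (y / n.+1%:R) by rewrite ler_pM2l.
by rewrite e; lra.
Qed.

Lemma poly_expRN_bounded (P : {poly R}) : exists2 C, 0 <= C & forall y, 0 <= y ->
  `|P.[y]| * expR (- y) <= C.
Proof.
exists (\sum_(i < size P) `|P`_i| * (i%:R ^+ i)).
  by apply: sumr_ge0 => i _; rewrite mulr_ge0// exprn_ge0.
move=> y y0; rewrite horner_coef.
apply: (@le_trans _ _ ((\sum_(i < size P) `|P`_i * y ^+ i|) * expR (- y))).
  by rewrite ler_wpM2r ?expR_ge0// ler_norm_sum.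
rewrite mulr_suml; apply: ler_sum => i _.
rewrite normrM [ `|y ^+ i| ]ger0_norm ?exprn_ge0// -mulrA.
by rewrite ler_wpM2l//; exact: exprn_expRN_bounded.
Qed.

(** The family is stable under differentiation, which gives all derivatives at once. The delicate
    point is t = 0, where the quotient P(1/h) exp(-1/h) / h is h times a quantity bounded by
    [poly_expRN_bounded] for X^2 P. *)
Lemma flat_derive (P : {poly R}) (t : R) :
  is_derive t (1 : R) (flat P) (flat ('X^2 * (P - P^`())) t).
Proof.
have [t0|t0|<-] := ltgtP 0 t.
- have dV : is_derive t (1 : R) (fun s : R => s^-1) (- t ^- 2).
    apply: is_derive_eq; first by apply: is_deriveV; rewrite gt_eqF.
    by rewrite [_ *: _]mulr1.
  have dP : is_derive t (1 : R) (fun s : R => P.[s^-1]) (P^`().[t^-1] * - t ^- 2).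
    have dh : is_derive t^-1 (1 : R) (horner P) P^`().[t^-1].
      have -> : P^`().[t^-1] = derive1 (horner P) t^-1 by rewrite -derivE.
      by rewrite derive1E; apply: DeriveDef => //; exact: derivable_horner.
    exact: (@is_derive1_comp _ (horner P) (fun s : R => s^-1)).
  have dE : is_derive t (1 : R) (fun s : R => expR (- s^-1)) (expR (- t^-1) * t ^- 2).
    apply: (@is_derive1_comp _ (@expR R) (fun s : R => - s^-1)).
    by apply: is_derive_eq; rewrite opprK.
  have dM : is_derive t (1 : R) (fun s : R => P.[s^-1] * expR (- s^-1))
      (flat ('X^2 * (P - P^`())) t).
    apply: is_derive_eq.
    rewrite /flat t0 !hornerE /= -!exprVn /GRing.scale /=; ring.
  apply: (near_eq_is_derive _ dM).
  near=> s; rewrite /flat ifT//; near: s; exact: lt_nbhsr.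
- have -> : flat ('X^2 * (P - P^`())) t = 0 by rewrite /flat ltNge ltW.
  apply: (near_eq_is_derive _ (is_derive_cst (0 : R) t 1)).
  near=> s; rewrite /flat ltNge ltW//; near: s; exact: lt_nbhsl.
have [C C0 HC] := poly_expRN_bounded ('X^2 * P).
have H : (fun h : R => h^-1 *: (flat P (h *: (1 : R) + 0) - flat P 0)) @ 0^' --> (0 : R).
  apply/cvgrPdist_le => e e0; near=> h.
  rewrite sub0r normrN addr0 [h *: _]mulr1 {2}/flat ltxx subr0 [_ *: _]/GRing.scale /=.
  have hC : `|h| * C <= e.
    have hC1 : `|h| <= e / (C + 1).
      by near: h; apply: dnbhs0_le; rewrite divr_gt0//; lra.
    have : `|h| * (C + 1) <= e by rewrite -ler_pdivlMr//; lra.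
    by have := normr_ge0 h; lra.
  rewrite /flat; case: ifPn => [h0|_]; last by rewrite mulr0 normr0 ltW.
  apply: le_trans hC; have := HC h^-1; rewrite invr_ge0 (ltW h0) => /(_ isT).
  rewrite !hornerE !normrM (gtr0_norm h0) [ `|h^-1|]gtr0_norm ?invr_gt0//.
  rewrite [ `|expR _|]ger0_norm ?expR_ge0// => hb.
  have : h * (h^-1 * h^-1 * `|P.[h^-1]| * expR (- h^-1)) <= h * C by rewrite ler_pM2l.
  by rewrite !mulrA divff ?mul1r// gt_eqF.
rewrite {2}/flat ltxx.
apply: DeriveDef; first by apply/cvg_ex; exists 0.
exact/cvg_lim.
Unshelve. all: by end_near. Qed.

Lemma derive1_flat (P : {poly R}) : derive1 (flat P) = flat ('X^2 * (P - P^`())).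
Proof.
by apply/funext => t; rewrite derive1E; exact: (@derive_val _ _ _ _ _ _ _ (flat_derive P t)).
Qed.

End bump.

Section smooth_flat.
Context {R : realType}.

Lemma smooth1_flat (P : {poly R}) : forall n x, derivable (derive1n n (flat P)) x 1.
Proof.
suff H n : exists Q, derive1n n (flat P) = flat Q.
  by move=> n x; have [Q ->] := H n; have [] := flat_derive Q x.
elim: n => [|n [Q IH]]; first by exists P.
by exists ('X^2 * (Q - Q^`())); rewrite derive1nS IH derive1_flat.
Qed.

End smooth_flat.

(** The inverse, with 0^-1 = 0, is the pointwise limit of the continuous functions x / (x^2 +
    1/(n+1)). *)
Lemma measurable_invr (R : realType) : measurable_fun setT (@GRing.inv R).
Proof.
apply: (@measurable_fun_cvg _ R R setT (fun n (x : R) => x / (x ^+ 2 + n.+1%:R^-1)) (fun x => x^-1)) => //.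
  move=> n; apply: continuous_measurable_fun => x.
  apply: cvgM; first exact: cvg_id.
  apply: cvgV; first by rewrite gt_eqF// ltr_wpDl// ?sqr_ge0// invr_gt0.
  by apply: cvgD; [exact: exprn_continuous|exact: cvg_cst].
move=> x _ /=; have [->|x0] := eqVneq x 0.
  by rewrite invr0; under eq_fun do rewrite mul0r; exact: cvg_cst.
rewrite (_ : x^-1 = x / (x ^+ 2 + 0)); last by rewrite addr0 expr2 invfM mulrA divff// mul1r.
apply: cvgM; first exact: cvg_cst.
apply: cvgV; first by rewrite addr0 expf_neq0.
apply: cvgD; first exact: cvg_cst.
exact: cvg_harmonic.
Qed.

(** * Integrability of the reciprocal weights *)

Section line_weight.
Context {R : realType}.
Local Notation leb := (@lebesgue_measure R).

Lemma continuous_oneDsqrV : continuous (fun t : R => (1 + t ^+ 2)^-1).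
Proof.
move=> t; apply: cvgV; first by rewrite gt_eqF// ltr_pwDl// sqr_ge0.
by apply: cvgD; [exact: cvg_cst|exact: exprn_continuous].
Qed.

Lemma measurable_scaled_oneDsqrV (a : R) :
  measurable_fun setT (fun t : R => ((1 + (a * t) ^+ 2)^-1)%:E).
Proof.
apply/measurable_EFinP; apply: continuous_measurable_fun => t.
apply: (@continuous_comp _ _ _ (fun t : R => a * t) (fun t : R => (1 + t ^+ 2)^-1)).
  exact: mulrl_continuous.
exact: continuous_oneDsqrV.
Qed.

Lemma integral_oneDsqrV_lty : (\int[leb]_t ((1 + t ^+ 2)^-1)%:E < +oo)%E.
Proof.
have p t : 0 <= (1 + t ^+ 2)^-1 :> R by rewrite invr_ge0 addr_ge0// sqr_ge0.
rewrite ge0_symfun_integralT//; last 2 first.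
- exact: continuous_oneDsqrV.
- by move=> t /=; rewrite sqrrN.
rewrite -set_itvcy (@ge0_continuous_FTC2y _ _ (@atan R) 0 (pi / 2)) => //.
- by rewrite -EFinB -EFinM ltry.
- by apply: continuous_subspaceT => x; exact: continuous_oneDsqrV.
- exact: cvgy_atan.
- by apply: cvg_at_right_filter; exact: continuous_atan.
- by move=> x _; rewrite derive1E; have h := is_derive1_atan x; rewrite (@derive_val _ _ _ _ _ _ _ h).
Qed.

Lemma integral_scaled_oneDsqrV (a : R) : 0 < a ->
  (\int[leb]_t ((1 + (a * t) ^+ 2)^-1)%:E = (a^-1)%:E * \int[leb]_t ((1 + t ^+ 2)^-1)%:E)%E.
Proof.
move=> a0; rewrite -(ge0_integral_affine 0 (f := fun t => ((1 + t ^+ 2)^-1)%:E))//.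
- by apply: eq_integral => t _; rewrite addr0.
- by apply/measurable_EFinP; apply: continuous_measurable_fun; exact: continuous_oneDsqrV.
- by move=> t; rewrite lee_fin invr_ge0 addr_ge0// sqr_ge0.
Qed.

End line_weight.

Section weights.
Context {R : realType}.
Local Notation mu := (@lebesgue_rV R).
Local Notation leb := (@lebesgue_measure R).

Lemma dotp_ge0 n (x : 'rV[R]_n) : 0 <= dotp x x.
Proof. by apply: sumr_ge0 => i _; rewrite -expr2 sqr_ge0. Qed.
Lemma eucl_sqr n (x : 'rV[R]_n) : eucl x ^+ 2 = dotp x x.
Proof. by rewrite sqr_sqrtr// dotp_ge0. Qed.
Lemma eucl_ge0 n (x : 'rV[R]_n) : 0 <= eucl x.
Proof. exact: sqrtr_ge0. Qed.
Lemma japanese_ge1 n (x : 'rV[R]_n) : 1 <= japanese x.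
Proof. by rewrite -[X in X <= _]sqrtr1 ler_wsqrtr// lerDl sqr_ge0. Qed.
Lemma japanese_sqr n (x : 'rV[R]_n) : japanese x ^+ 2 = 1 + dotp x x.
Proof. by rewrite sqr_sqrtr ?eucl_sqr// addr_ge0// dotp_ge0. Qed.

Lemma dotp_cons n (p : R * 'rV[R]_n) : dotp (rV_cons p) (rV_cons p) = p.1 ^+ 2 + dotp p.2 p.2.
Proof.
rewrite /dotp big_ord_recl !rV_cons0 -expr2; congr (_ + _).
by apply: eq_bigr => i _; rewrite !rV_consS.
Qed.

Lemma dotpC n (x y : 'rV[R]_n) : dotp x y = dotp y x.
Proof. by apply: eq_bigr => i _; rewrite mulrC. Qed.
Lemma dotpDl n (x y z : 'rV[R]_n) : dotp (x + y) z = dotp x z + dotp y z.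
Proof. by rewrite /dotp -big_split; apply: eq_bigr => i _; rewrite mxE mulrDl. Qed.
Lemma dotpDr n (x y z : 'rV[R]_n) : dotp z (x + y) = dotp z x + dotp z y.
Proof. by rewrite dotpC dotpDl !(dotpC z). Qed.
Lemma dotpNl n (x z : 'rV[R]_n) : dotp (- x) z = - dotp x z.
Proof. by rewrite /dotp -sumrN; apply: eq_bigr => i _; rewrite mxE mulNr. Qed.
Lemma dotpNr n (x z : 'rV[R]_n) : dotp z (- x) = - dotp z x.
Proof. by rewrite dotpC dotpNl dotpC. Qed.
Lemma dotpNN n (x z : 'rV[R]_n) : dotp (- x) (- z) = dotp x z.
Proof. by rewrite dotpNl dotpNr opprK. Qed.
Lemma dotpZl n (a : R) (x z : 'rV[R]_n) : dotp (a *: x) z = a * dotp x z.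
Proof. by rewrite /dotp mulr_sumr; apply: eq_bigr => i _; rewrite mxE mulrA. Qed.
Lemma dotp_delta n (j : 'I_n) (z : 'rV[R]_n) : dotp (delta_mx ord0 j) z = z ord0 j.
Proof.
rewrite /dotp (bigD1 j)//= mxE !eqxx mul1r big1 ?addr0// => i /negPf ij.
by rewrite mxE ij andbF mul0r.
Qed.
Lemma euclN n (x : 'rV[R]_n) : eucl (- x) = eucl x.
Proof. by rewrite /eucl dotpNN. Qed.
Lemma coord_le_eucl n (x : 'rV[R]_n) i : `|x ord0 i| <= eucl x.
Proof.
rewrite -sqrtr_sqr ler_sqrt ?dotp_ge0//.
by rewrite /dotp (bigD1 i)//= -expr2 lerDl; apply: sumr_ge0 => j _; rewrite -expr2 sqr_ge0.
Qed.

Lemma measurable_dotp n : measurable_fun setT (fun z : 'rV[R]_n * 'rV[R]_n => dotp z.1 z.2).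
Proof.
apply: measurable_sum => i; apply: measurable_funM.
  exact: (measurableT_comp (measurable_coord i) measurable_fst).
exact: (measurableT_comp (measurable_coord i) measurable_snd).
Qed.

Lemma measurable_dotpl n (x : 'rV[R]_n) : measurable_fun setT (dotp x).
Proof.
apply: measurable_sum => i; apply: measurable_funM => //; exact: measurable_coord.
Qed.

Lemma measurable_dotp_diag n : measurable_fun setT (fun x : 'rV[R]_n => dotp x x).
Proof.
apply: measurable_sum => i; apply: measurable_funM; exact: measurable_coord.
Qed.

Lemma measurable_eucl n : measurable_fun setT (@eucl R n).
Proof.
apply: (@measurableT_comp _ _ _ _ _ _ (@Num.sqrt R)); last exact: measurable_dotp_diag.
by apply: continuous_measurable_fun; exact: sqrt_continuous.
Qed.

Lemma measurable_ball_lt n (r : R) : measurable [set x : 'rV[R]_n | eucl x < r].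
Proof.
rewrite (_ : [set x | _] = setT `&` (@eucl R n) @^-1` `]-oo, r[%classic).
  by apply: measurable_eucl => //; exact: measurable_itv.
by rewrite setTI; apply/seteqP; split=> x /=; rewrite in_itv.
Qed.

Lemma measurable_ball_le n (r : R) : measurable [set x : 'rV[R]_n | eucl x <= r].
Proof.
rewrite (_ : [set x | _] = setT `&` (@eucl R n) @^-1` `]-oo, r]%classic).
  by apply: measurable_eucl => //; exact: measurable_itv.
by rewrite setTI; apply/seteqP; split=> x /=; rewrite in_itv.
Qed.

Lemma dotp_e1 n (n0 : (0 < n)%N) (x : 'rV[R]_n) : dotp x e1 = x ord0 (Ordinal n0).
Proof.
rewrite /dotp (bigD1 (Ordinal n0))//= big1 ?addr0 ?mxE ?mulr1// => i /negPf i0.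
by rewrite mxE (_ : (i == 0%N :> nat) = false) ?mulr0//; exact: i0.
Qed.

Lemma measurable_aniso n : measurable_fun setT (fun x : 'rV[R]_n => dotp x e1 ^+ 2 + eucl x ^+ 4).
Proof.
apply: measurable_funD; apply: measurable_funX; last exact: measurable_eucl.
rewrite (_ : dotp^~ e1 = dotp e1); first exact: measurable_dotpl.
by apply/funext => x; rewrite dotpC.
Qed.

Lemma measurable_japanese n : measurable_fun setT (@japanese R n).
Proof.
apply: (@measurableT_comp _ _ _ _ _ _ (@Num.sqrt R)).
  by apply: continuous_measurable_fun; exact: sqrt_continuous.
apply: measurable_funD => //; apply: measurable_funX; exact: measurable_eucl.
Qed.

(** Induction on the dimension. Since <(t,y)>^2 = <y>^2 (1 + (t/<y>)^2) and <(t,y)> >= <y>,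
    integrating <(t,y)>^-(m+2) over t leaves at most a constant times <y>^-(m+1): one dimension
    costs one power. *)
Lemma integral_japanese_lty n m : (n < m)%N ->
  (\int[mu n]_x (japanese x ^- m)%:E < +oo)%E.
Proof.
have mj k l : measurable_fun setT (fun x : 'rV[R]_k => (japanese x ^- l)%:E).
  apply/measurable_EFinP; apply: measurableT_comp; first exact: measurable_invr.
  by apply: measurable_funX; exact: measurable_japanese.
have j0 k l (x : 'rV[R]_k) : (0 <= (japanese x ^- l)%:E)%E.
  by rewrite lee_fin invr_ge0 exprn_ge0// (le_trans ler01)// japanese_ge1.
elim: n m => [|n IH] m nm; first by rewrite integral_mu0// ltry.
case: m nm => [//|[//|m]] nm.
rewrite ge0_integral_step//.
set C := (\int[leb]_t ((1 + t ^+ 2)^-1)%:E)%E.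
have C0 : (0 <= C)%E.
  by apply: integral_ge0 => t _; rewrite lee_fin invr_ge0 addr_ge0// sqr_ge0.
have Clt : (C < +oo)%E by exact: integral_oneDsqrV_lty.
have mp : measurable_fun setT (fun z : measurableTypeR R * 'rV[R]_n => (japanese (rV_cons z) ^- m.+2)%:E).
  by apply: (measurableT_comp (mj n.+1 m.+2)); exact: measurable_rV_cons.
have -> : (\int[leb]_t \int[mu n]_y (japanese (rV_cons (t, y)) ^- m.+2)%:E =
    \int[mu n]_y \int[leb]_t (japanese (rV_cons (t, y)) ^- m.+2)%:E)%E.
  by apply: (@fubini_tonelli _ _ _ _ _ leb (mu n) _ mp) => z; exact: j0.
apply: (@le_lt_trans _ _ (\int[mu n]_y (C * (japanese y ^- m.+1)%:E))%E).
  apply: ge0_le_integral => //.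
  - by move=> y _; apply: integral_ge0 => t _; exact: j0.
  - by apply: (@measurable_fun_fubini_tonelli_G _ _ _ _ _ leb _ mp) => z; exact: j0.
  - by apply: emeasurable_funM => //; exact: mj.
  move=> y _; have y1 := japanese_ge1 y.
  have y0 : 0 < japanese y by rewrite (lt_le_trans ltr01).
  rewrite /C muleC.
  have -> : (japanese y ^- m.+1)%:E = ((japanese y ^- m.+2)%:E * (((japanese y)^-1)^-1)%:E)%E.
    by rewrite -EFinM invrK (exprSr _ m.+1) invfM -mulrA mulVf ?mulr1// gt_eqF.
  rewrite -muleA -integral_scaled_oneDsqrV ?invr_gt0//.
  rewrite -ge0_integralZl//; last 2 first.
  - exact: measurable_scaled_oneDsqrV.
  - by move=> t _; rewrite lee_fin invr_ge0 addr_ge0// sqr_ge0.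
  apply: ge0_le_integral => //.
  - exact: (measurableT_comp mp (measurable_pair2 y)).
  - by apply: emeasurable_funM => //; exact: measurable_scaled_oneDsqrV.
  move=> t _; rewrite -EFinM lee_fin.
  have jE : japanese (rV_cons (t, y)) ^+ 2 = japanese y ^+ 2 * (1 + ((japanese y)^-1 * t) ^+ 2).
    rewrite mulrDr mulr1 exprMn exprVn mulrA divff ?mul1r ?expf_neq0 ?gt_eqF//.
    by rewrite !japanese_sqr dotp_cons /=; ring.
  have jy : japanese y <= japanese (rV_cons (t, y)).
    by rewrite ler_wsqrtr// lerD2l !eucl_sqr dotp_cons/= lerDr sqr_ge0.
  rewrite -invfM lef_pV2 ?posrE; last 2 first.
  - by rewrite exprn_gt0// (lt_le_trans y0).
  - by rewrite mulr_gt0 ?exprn_gt0// ltr_pwDl// sqr_ge0.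
  rewrite -[m.+2]/(2 + m)%N !exprD jE mulrAC ler_wpM2l//.
    by rewrite mulr_ge0 ?sqr_ge0// addr_ge0// sqr_ge0.
  by apply: lerXn2r; rewrite ?nnegrE// ltW// (lt_le_trans y0).
rewrite ge0_integralZl//; last exact: mj.
rewrite lte_mul_pinfty//; last exact: IH.
by rewrite fin_numE gt_eqF ?(lt_le_trans _ C0)// lt_eqF.
Qed.

(** The integrand is a Poisson kernel: rescaling t by q removes the parameter, so the bound is
    uniform in q, the degenerate value q = 0 included. *)
Lemma integral_poisson_le (q : R) : 0 <= q ->
  (\int[leb]_t (q * (t ^+ 2 + q ^+ 2)^-1)%:E <= \int[leb]_t ((1 + t ^+ 2)^-1)%:E)%E.
Proof.
rewrite le_eqVlt => /predU1P[<-|q0].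
  rewrite integral0_eq; last by move=> t _; rewrite mul0r.
  by apply: integral_ge0 => t _; rewrite lee_fin invr_ge0 addr_ge0// sqr_ge0.
have -> : (\int[leb]_t (q * (t ^+ 2 + q ^+ 2)^-1)%:E =
    \int[leb]_t (q^-1%:E * ((1 + (q^-1 * t) ^+ 2)^-1)%:E))%E.
  apply: eq_integral => t _; rewrite -EFinM; congr EFin.
  have e : t ^+ 2 + q ^+ 2 = q ^+ 2 * (1 + (q^-1 * t) ^+ 2).
    by rewrite mulrDr mulr1 exprMn mulrA -exprMn divff ?gt_eqF// expr1n mul1r addrC.
  by rewrite e expr2 !invfM !mulrA divff ?mul1r// gt_eqF.
rewrite (@ge0_integralZl_EFin _ (measurableTypeR R) _ leb _ measurableT); last 3 first.
- by move=> t _; rewrite lee_fin invr_ge0 addr_ge0// sqr_ge0.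
- exact: measurable_scaled_oneDsqrV.
- by rewrite invr_ge0 ltW.
by rewrite integral_scaled_oneDsqrV ?invr_gt0// muleA -EFinM invrK mulVf ?mul1e// gt_eqF.
Qed.

(** With x = (t, y) and q = |y|^2 the integrand is at most 1 + q / (t^2 + q^2) ([main]), whose
    second term is a Poisson kernel in t with integral bounded in y. Negative powers of the bracket
    replace the unit ball by an integrable majorant on the whole space. *)
Lemma integral_aniso_lty n :
  (\int[mu n.+1]_(x in [set x | (eucl x < 1)%R])
     (eucl x ^+ 2 * (dotp x e1 ^+ 2 + eucl x ^+ 4)^-1)%R%:E < +oo)%E.
Proof.
(* On the unit ball <z>^2 <= 2, so 2^(n+2) <z>^-N >= 1; and N exceeds both dimensions n+1 and n. *)
pose N := (n.+2).*2.
pose J m (x : 'rV[R]_m) : \bar R := (japanese x ^- N)%:E.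
have mJ m : measurable_fun setT (J m).
  apply/measurable_EFinP; apply: measurableT_comp; first exact: measurable_invr.
  by apply: measurable_funX; exact: measurable_japanese.
have J0 m (x : 'rV[R]_m) : (0 <= J m x)%E.
  by rewrite lee_fin invr_ge0 exprn_ge0// (le_trans ler01)// japanese_ge1.
pose P (z : measurableTypeR R * 'rV[R]_n) : \bar R :=
  ((dotp z.2 z.2 * (z.1 ^+ 2 + dotp z.2 z.2 ^+ 2)^-1)%:E * J n z.2)%E.
have mq : measurable_fun setT (fun z : measurableTypeR R * 'rV[R]_n => dotp z.2 z.2).
  exact: (measurableT_comp (@measurable_dotp_diag n) measurable_snd).
have mP : measurable_fun setT P.
  apply: emeasurable_funM; last exact: (measurableT_comp (mJ n) measurable_snd).
  apply/measurable_EFinP; apply: measurable_funM; first exact: mq.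
  apply: measurableT_comp; first exact: measurable_invr.
  apply: measurable_funD; last exact: measurable_funX.
  by apply: measurable_funX; exact: measurable_fst.
have P0 z : (0 <= P z)%E.
  by rewrite /P mule_ge0// lee_fin mulr_ge0 ?dotp_ge0// invr_ge0 addr_ge0// sqr_ge0.
pose uncons (x : 'rV[R]_n.+1) : measurableTypeR R * 'rV[R]_n := (x ord0 ord0, \row_i x ord0 (lift ord0 i)).
have unconsK x : rV_cons (uncons x) = x.
  apply/rowP => i; have [j ->|->] := unliftP ord0 i; first by rewrite rV_consS mxE.
  by rewrite rV_cons0.
have consK z : uncons (rV_cons z) = z.
  case: z => t y; rewrite /uncons rV_cons0; congr pair.
  by apply/rowP => i; rewrite mxE rV_consS.
have mu_uncons : measurable_fun setT uncons.
  apply/measurable_fun_pairP; split; first exact: measurable_coord.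
  apply: measurable_fun_coordP => i.
  rewrite (_ : (fun _ => _) = fun x : 'rV_n.+1 => x ord0 (lift ord0 i)).
    exact: measurable_coord.
  by apply/funext => x; rewrite /= mxE.
have mPu : measurable_fun setT (fun x => P (uncons x)) by exact: measurableT_comp.
have mset := @measurable_ball_lt n.+1 1.
have mJP : measurable_fun setT (fun x => (J n.+1 x + P (uncons x))%E).
  by apply: emeasurable_funD; [exact: mJ|exact: mPu].
apply: (@le_lt_trans _ _ (\int[mu n.+1]_x ((2 ^+ n.+2)%:E * (J n.+1 x + P (uncons x))))%E).
  rewrite integral_mkcond; apply: ge0_le_integral => //.
  - move=> x _; rewrite /patch; case: ifP => // _.
    by rewrite lee_fin mulr_ge0 ?sqr_ge0// invr_ge0 addr_ge0 ?sqr_ge0// exprn_ge0// eucl_ge0.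
  - apply: (measurable_restrictT _ mset).1; apply: measurable_funTS.
    apply/measurable_EFinP; apply: measurable_funM.
      by apply: measurable_funX; exact: measurable_eucl.
    apply: measurableT_comp; first exact: measurable_invr.
    exact: measurable_aniso.
  - by apply: emeasurable_funM.
  move=> x _; rewrite /patch; case: ifPn => [|_]; last first.
    by rewrite mule_ge0// ?adde_ge0// lee_fin exprn_ge0.
  rewrite inE /= => x1.
  set t := x ord0 ord0; set y := (uncons x).2; set q := dotp y y.
  have q0 : 0 <= q by exact: dotp_ge0.
  have xE : eucl x ^+ 2 = t ^+ 2 + q by rewrite eucl_sqr -{1 2}(unconsK x) dotp_cons.
  have eE : dotp x e1 = t.
    by rewrite (dotp_e1 (ltn0Sn n)); congr (x _ _); exact: val_inj.
  have sq1 : t ^+ 2 + q < 1 by rewrite -xE expr_lt1// eucl_ge0.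
  have jx : japanese x ^+ 2 <= 2 by rewrite japanese_sqr -eucl_sqr xE; lra.
  have jy : japanese y ^+ 2 <= 2 by rewrite japanese_sqr -/q; have := sqr_ge0 t; lra.
  have jb m (z : 'rV[R]_m) : japanese z ^+ 2 <= 2 -> 1 <= 2 ^+ n.+2 * (japanese z ^- N).
    move=> j2; have jp : 0 < japanese z by rewrite (lt_le_trans ltr01)// japanese_ge1.
    rewrite -ler_pdivrMr ?invr_gt0 ?exprn_gt0// div1r invrK /N -muln2 mulnC exprM.
    by apply: lerXn2r => //; rewrite nnegrE ?exprn_ge0// ltW.
  rewrite (_ : ((2 ^+ n.+2)%:E * (J n.+1 x + P (uncons x)))%E =
    (2 ^+ n.+2 * (japanese x ^- N + q * (t ^+ 2 + q ^+ 2)^-1 * japanese y ^- N))%:E); last first.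
    by rewrite /P /J -/y -/t /= -/q -EFinM.
  rewrite lee_fin.
  rewrite -/y -/t -/q -[eucl x ^+ 4]/(eucl x ^+ (2 * 2)) exprM xE eE mulrDr.
  have b1 := jb _ x jx; have b2 := jb _ y jy.
  have main : (t ^+ 2 + q) * (t ^+ 2 + (t ^+ 2 + q) ^+ 2)^-1 <= 1 + q * (t ^+ 2 + q ^+ 2)^-1.
    have [t0|t0] := eqVneq t 0.
      rewrite t0 expr0n /= !add0r; by rewrite lerDr.
    have t2 : 0 < t ^+ 2 by rewrite exprn_even_gt0.
    have d1 : 0 < t ^+ 2 + (t ^+ 2 + q) ^+ 2 by rewrite ltr_wpDr ?sqr_ge0.
    have d2 : 0 < t ^+ 2 + q ^+ 2 by rewrite ltr_wpDr ?sqr_ge0.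
    rewrite mulrDl; apply: lerD.
      by rewrite ler_pdivrMr// mul1r lerDl sqr_ge0.
    rewrite ler_wpM2l// lef_pV2 ?posrE// lerD2l; apply: lerXn2r; rewrite ?nnegrE//.
      by rewrite addr_ge0// sqr_ge0.
    by rewrite lerDr sqr_ge0.
  apply: (le_trans main); apply: lerD => //.
  rewrite mulrCA [X in _ <= X](_ : _ = q * (t ^+ 2 + q ^+ 2)^-1 * (2 ^+ n.+2 * japanese y ^- N)); last by ring.
  by rewrite ler_peMr// mulr_ge0// invr_ge0 addr_ge0// sqr_ge0.
rewrite ge0_integralZl//; last by move=> x _; rewrite adde_ge0.
apply: lte_mul_pinfty; rewrite ?lee_fin ?exprn_ge0//.
have eD : (\int[mu n.+1]_x (J n.+1 x + P (uncons x)) =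
    \int[mu n.+1]_x (J n.+1 x) + \int[mu n.+1]_x (P (uncons x)))%E.
  by apply: ge0_integralD => //; exact: mJ.
rewrite eD; apply: lte_add_pinfty; first by apply: integral_japanese_lty; rewrite /N -addnn !addSn !addnS; lia.
rewrite ge0_integral_step//.
under eq_integral do under eq_integral do rewrite consK.
have -> : (\int[leb]_t \int[mu n]_y P (t, y) = \int[mu n]_y \int[leb]_t P (t, y))%E.
  exact: (@fubini_tonelli _ _ _ _ _ leb (mu n) _ mP).
set C := (\int[leb]_t ((1 + t ^+ 2)^-1)%:E)%E.
have C0 : (0 <= C)%E.
  by apply: integral_ge0 => t _; rewrite lee_fin invr_ge0 addr_ge0// sqr_ge0.
apply: (@le_lt_trans _ _ (\int[mu n]_y (C * J n y))%E).
  apply: ge0_le_integral => //.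
  - by move=> y _; apply: integral_ge0 => t _; exact: P0.
  - by apply: (@measurable_fun_fubini_tonelli_G _ _ _ _ _ leb _ mP) => z; exact: P0.
  - by apply: emeasurable_funM => //; exact: mJ.
  move=> y _; rewrite /P /=.
  under eq_integral do rewrite muleC.
  rewrite (@ge0_integralZl_EFin _ (measurableTypeR R) _ leb _ measurableT); last 3 first.
  - by move=> t _; rewrite lee_fin mulr_ge0 ?dotp_ge0// invr_ge0 addr_ge0// sqr_ge0.
  - apply/measurable_EFinP; apply: measurable_funM => //.
    apply: measurableT_comp; first exact: measurable_invr.
    by apply: measurable_funD => //; exact: measurable_funX.
  - by rewrite invr_ge0 exprn_ge0// (le_trans ler01)// japanese_ge1.
  rewrite muleC; apply: lee_wpmul2r; first exact: J0.
  by apply: integral_poisson_le; exact: dotp_ge0.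
rewrite ge0_integralZl//; last exact: mJ.
apply: lte_mul_pinfty => //; last by apply: integral_japanese_lty; rewrite /N -addnn !addSn !addnS; lia.
by rewrite ge0_fin_numE//; exact: integral_oneDsqrV_lty.
Qed.

End weights.

(** * Integrable functions on R^d *)

Section L1.
Context {R : realType} {d : nat}.
Local Notation E := 'rV[R]_d.
Local Notation mu := (@lebesgue_rV R d).
Implicit Types h k f : E -> R.

Record L1 h : Prop := MkL1 { L1_int : mu.-integrable setT (EFin \o h) }.

Lemma L1P h : measurable_fun setT h -> (\int[mu]_x `|h x|%:E < +oo)%E -> L1 h.
Proof. by move=> mh hi; split; apply/integrableP; split => //; exact/measurable_EFinP. Qed.
Lemma L1_measurable h : L1 h -> measurable_fun setT h.
Proof. by case=> /measurable_int /measurable_EFinP. Qed.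
Lemma L1_lty h : L1 h -> (\int[mu]_x `|h x|%:E < +oo)%E.
Proof. by case=> /integrableP[]. Qed.

Lemma L1_le h k : measurable_fun setT h -> (forall x, `|h x| <= k x) -> L1 k -> L1 h.
Proof.
move=> mh hk [ik]; split; apply: (le_integrable measurableT _ _ ik).
  exact/measurable_EFinP.
by move=> x _ /=; rewrite lee_fin (le_trans (hk x))// ler_norm.
Qed.

Lemma L1D h k : L1 h -> L1 k -> L1 (fun x => h x + k x).
Proof. by move=> [ih] [ik]; split; exact: (integrableD measurableT ih ik). Qed.
Lemma L1Z (c : R) h : L1 h -> L1 (fun x => c * h x).
Proof. by move=> [ih]; split; exact: (integrableZl measurableT c ih). Qed.
Lemma L1N h : L1 h -> L1 (fun x => - h x).
Proof. by move=> /(L1Z (-1)); rewrite (_ : (fun x => _) = fun x => - h x)//; apply/funext => x; rewrite mulN1r. Qed.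
Lemma L1B h k : L1 h -> L1 k -> L1 (fun x => h x - k x).
Proof. by move=> ih /L1N; exact: L1D. Qed.
Lemma L1_norm h : L1 h -> L1 (fun x => `|h x|).
Proof. by move=> [/integrable_norm ih]; split. Qed.

Lemma L1_Mb (c : R) h k : L1 h -> measurable_fun setT k -> (forall x, `|k x| <= c) ->
  L1 (fun x => h x * k x).
Proof.
move=> ih mk kc; apply: (L1_le (k := fun x => c * `|h x|)).
- by apply: measurable_funM => //; exact: L1_measurable.
- by move=> x; rewrite normrM mulrC ler_wpM2r.
- exact/L1Z/L1_norm.
Qed.

Lemma measurable_opp_rV : measurable_fun setT (fun x : E => - x).
Proof.
rewrite (_ : (fun x : E => - x) = (fun x : E => -1 *: x)); first exact: measurable_scale_rV.
by apply/funext => x; rewrite scaleN1r.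
Qed.

Lemma L1_opp h : L1 h -> L1 (fun x => h (- x)).
Proof.
move=> [ih]; split; apply: (@integrable_change _ _ _ mu -%R 1); rewrite ?ler01//.
- exact: measurable_opp_rV.
- by move=> f mf f0; rewrite ge0_integral_oppr// mul1e.
Qed.

Lemma Rintegral_opp h : L1 h -> \int[mu]_x h (- x) = \int[mu]_x h x.
Proof.
move=> [ih]; rewrite (@Rintegral_change _ _ _ mu -%R 1) ?mul1r//.
- by move=> f mf f0; rewrite ge0_integral_oppr// mul1e.
Qed.

Lemma L1_addr h (a : E) : L1 h -> L1 (fun x => h (x + a)).
Proof.
move=> [ih]; split; apply: (@integrable_change _ _ _ mu (+%R^~ a) 1) => //.
- exact: measurable_addr_rV.
- by move=> f mf f0; rewrite ge0_integral_addr// mul1e.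
Qed.

Lemma Rintegral_addr h (a : E) : L1 h -> \int[mu]_x h (x + a) = \int[mu]_x h x.
Proof.
move=> [ih]; rewrite (@Rintegral_change _ _ _ mu (+%R^~ a) 1) ?mul1r//.
- by move=> f mf f0; rewrite ge0_integral_addr// mul1e.
Qed.

Lemma Rintegral_scale h (a : R) : 0 < a -> L1 h ->
  \int[mu]_x h (a *: x) = a^-1 ^+ d * \int[mu]_x h x.
Proof.
move=> a0 [ih]; rewrite (@Rintegral_change _ _ _ mu (fun x => a *: x) (a^-1 ^+ d))//.
- by move=> f mf f0; rewrite ge0_integral_scaler.
Qed.

Lemma RintD h k : L1 h -> L1 k ->
  \int[mu]_x (h x + k x) = \int[mu]_x h x + \int[mu]_x k x.
Proof. by move=> [ih] [ik]; rewrite RintegralD. Qed.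
Lemma RintZ (c : R) h : L1 h -> \int[mu]_x (c * h x) = c * \int[mu]_x h x.
Proof. by move=> [ih]; rewrite RintegralZl. Qed.

Lemma RintN h : L1 h -> \int[mu]_x (- h x) = - \int[mu]_x h x.
Proof.
by move=> ih; rewrite -mulN1r -RintZ//; apply: eq_Rintegral => x _; rewrite mulN1r.
Qed.

Lemma RintB h k : L1 h -> L1 k ->
  \int[mu]_x (h x - k x) = \int[mu]_x h x - \int[mu]_x k x.
Proof. by move=> ih ik; rewrite RintD ?RintN//; exact: L1N. Qed.
Lemma le_Rint h k : L1 h -> L1 k -> (forall x, h x <= k x) -> \int[mu]_x h x <= \int[mu]_x k x.
Proof. by move=> [ih] [ik] hk; apply: le_Rintegral. Qed.
Lemma Rint_ge0 h : (forall x, 0 <= h x) -> 0 <= \int[mu]_x h x.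
Proof. by move=> h0; apply: Rintegral_ge0. Qed.

Lemma Rint_norm_le h k : L1 h -> L1 k -> (forall x, `|h x| <= k x) ->
  `|\int[mu]_x h x| <= \int[mu]_x k x.
Proof.
move=> ih ik hk; apply: (le_trans (le_normr_Rintegral measurableT (L1_int ih))).
by apply: le_Rint => //; exact: L1_norm.
Qed.

Lemma EFin_Rint h : L1 h -> (\int[mu]_x h x)%:E = (\int[mu]_x (h x)%:E)%E.
Proof. by move=> [ih]; rewrite /Rintegral fineK//; exact: integrable_fin_num. Qed.
Lemma L1_0 : L1 (fun=> 0).
Proof. by split; exact: integrable0. Qed.

(** The common shape of the exchanges made for transforms: two integrable factors and one bounded
    kernel. *)
Lemma Fubini_L1 h k (b : E -> E -> R) (c : R) : L1 h -> L1 k ->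
  measurable_fun setT (fun z : E * E => b z.1 z.2) -> (forall x y, `|b x y| <= c) ->
  \int[mu]_x (h x * \int[mu]_y (k y * b x y)) = \int[mu]_y (k y * \int[mu]_x (h x * b x y)).
Proof.
move=> ih ik mb bc.
have mh := L1_measurable ih; have mk := L1_measurable ik.
have kb x : L1 (fun y => k y * b x y).
  by apply: (L1_Mb ik (c := c)) => //; exact: (measurableT_comp mb (measurable_pair1 x)).
have hb y : L1 (fun x => h x * b x y).
  by apply: (L1_Mb ih (c := c)) => //; exact: (measurableT_comp mb (measurable_pair2 y)).
transitivity (\int[mu]_x \int[mu]_y (h x * k y * b x y)).
  by apply: eq_Rintegral => x _; rewrite -RintZ//; apply: eq_Rintegral => y _; rewrite mulrA.
rewrite (Fubini_Rintegral (f := fun x y => h x * k y * b x y)); last 2 first.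
- apply: measurable_funM => //; apply: measurable_funM.
    exact: (measurableT_comp mh measurable_fst).
  exact: (measurableT_comp mk measurable_snd).
- apply: (@le_lt_trans _ _ (\int[mu]_x ((c * \int[mu]_y `|k y|) * `|h x|)%:E)%E).
    apply: ge0_le_integral => //.
    + by move=> x _; exact: integral_ge0.
    + apply: (@measurable_fun_fubini_tonelli_F _ _ _ _ _ mu (fun z => `|h z.1 * k z.2 * b z.1 z.2|%:E)) => //.
      apply/measurable_EFinP/measurableT_comp => //.
      apply: measurable_funM => //; apply: measurable_funM.
        exact: (measurableT_comp mh measurable_fst).
      exact: (measurableT_comp mk measurable_snd).
    + by apply/measurable_EFinP; apply: measurable_funM => //; apply: measurableT_comp.
    move=> x _.
    have i2 : L1 (fun y => (c * `|h x|) * `|k y|) by exact/L1Z/L1_norm.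
    have i1 : L1 (fun y => `|h x * k y * b x y|).
      apply: L1_norm; rewrite (_ : (fun y => _) = fun y => h x * (k y * b x y)); first exact: L1Z.
      by apply/funext => y; rewrite mulrA.
    rewrite -EFin_Rint// lee_fin mulrAC -RintZ; last exact: L1_norm.
    apply: le_Rint => // y; rewrite !normrM mulrC mulrA ler_wpM2r//.
    by rewrite ler_wpM2r.
  by rewrite -EFin_Rint ?ltry//; exact/L1Z/L1_norm.
apply: eq_Rintegral => y _; rewrite -RintZ//.
by apply: eq_Rintegral => x _; rewrite mulrCA mulrA.
Qed.

End L1.

Lemma continuous_affine (R : realType) (V : normedModType R) (a : R) (b : V) :
  continuous (fun x : V => a *: x + b).
Proof. by move=> x; apply: cvgD; [exact: scaler_continuous|exact: cvg_cst]. Qed.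

(** * Schwartz functions and test functions *)

Section schwartz_class.
Context {R : realType} {d : nat}.
Local Notation E := 'rV[R]_d.
Local Notation mu := (@lebesgue_rV R d).
Implicit Types f q : E -> R.

Lemma derivable_affine (a : R) (b : E) g j x : (forall y, derivable g y (delta_mx ord0 j)) ->
    derivable (fun x => g (a *: x + b)) x (delta_mx ord0 j) /\
    pderiv j (fun x => g (a *: x + b)) x = a * pderiv j g (a *: x + b).
Proof.
move=> dg; set v : E := delta_mx ord0 j; set f1 := fun x => _.
  pose p (s : R) := g (s *: v + (a *: x + b)).
  have fl : (fun s : R => f1 (s *: v + x)) = p \o ( *:%R a).
    apply/funext => s; rewrite /f1 /p /=; congr g.
    by rewrite scalerDr scalerA addrA.
  have dp : is_derive (a *: (0 : R)) (1 : R) p (pderiv j g (a *: x + b)).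
    rewrite scaler0; have -> : pderiv j g (a *: x + b) = 'D_1 p 0.
      by rewrite (derive_line g) scale0r add0r.
    by apply: DeriveDef => //; apply/derivable_line; exact: dg.
  have dl : is_derive (0 : R) (1 : R) (p \o ( *:%R a)) (pderiv j g (a *: x + b) * a).
    apply: is_derive1_comp; rewrite (_ : *:%R a = a \*: id)//.
    by apply: is_derive_eq; rewrite [_ *: _]mulr1.
  split.
    have : derivable f1 (0 *: v + x) v by apply/derivable_line; rewrite fl; exact: ex_derive.
    by rewrite scale0r add0r.
  rewrite /pderiv; have := derive_line f1 x v 0.
  by rewrite scale0r add0r => <-; rewrite fl (@derive_val _ _ _ _ _ _ _ dl) mulrC.
Qed.

Lemma smooth_affine_coord f (a : R) (b : E) : smooth f ->
  smooth (fun x => f (a *: x + b)) /\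
  forall j, pderiv j (fun x => f (a *: x + b)) = fun x => a * pderiv j f (a *: x + b).
Proof.
have H g j x := @derivable_affine a b g j x.
move=> sf; split; last first.
  by move=> j; apply/funext => x; apply: (H _ _ _ _).2; case: (smoothP sf).
apply: (@smooth_coind _ _ [set g | exists c f, smooth f /\ g = fun x => c * f (a *: x + b)]); last first.
  by exists 1, f; split => //; apply/funext => x; rewrite mul1r.
move=> _ [c [g [sg ->]]]; have [cg dg sg'] := smoothP sg.
have dga j x := (H g j x (dg j)).1.
split.
- have ca : continuous (fun x : E => a *: x + b).
    exact: (@continuous_affine R 'rV[R]_d).
  have cga : continuous (fun x : E => g (a *: x + b)).
    move=> x; apply: (@continuous_comp _ _ _ (fun x : E => a *: x + b) g); last exact: cg.
    exact: ca.
  by move=> x; exact: (cvgM (cvg_cst c) (cga x)).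
- by move=> j x; apply: derivableM => //; exact: derivable_cst.
move=> j; exists (c * a), (pderiv j g); split; first exact: sg'.
apply/funext => x; rewrite pderivM; [|exact: derivable_cst|exact: dga].
by rewrite (H g j x (dg j)).2 [X in _ + _ * X]derive_cst mulr0 addr0 mulrA.
Qed.

Lemma smooth_coordX (j : 'I_d) : smooth (fun x : E => x ord0 j) /\
  forall i x, pderiv i (fun x : E => x ord0 j) x = (j == i)%:R.
Proof.
have d1 (t : R) : derivable (@id R) t 1 by exact: derivable_id.
have H i x := derivable_coord_comp (p := id) j i 1 0 x d1.
have e : (fun x : E => id (1 * x ord0 j + 0)) = fun x => x ord0 j.
  by apply/funext => x; rewrite addr0 mul1r.
rewrite -e; split; last first.
  by move=> i x; rewrite (H i x).2 mulr1 derive1E derive_id mulr1.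
apply: (smooth_coord (p := id)) => -[//|n] x.
have -> : derive1n n.+1 (@id R) = derive1n n (derive1 id) by rewrite /derive1n iterSr.
rewrite (_ : derive1 (@id R) = cst 1); last first.
  by apply/funext => t; rewrite derive1E derive_id.
have [m ->] : exists c : R, derive1n n (cst 1 : R -> R) = cst c.
  elim: n => [|n [c IH]]; first by exists 1.
  exists 0; rewrite /derive1n iterS -/(derive1n n _) IH.
  by apply/funext => t; rewrite derive1_cst.
exact: derivable_cst.
Qed.

Definition rapid q := smooth q /\
  forall (k : nat) l, exists C : R, forall x, (1 + eucl x) ^+ k * `|pderivs l q x| <= C.

Lemma eucl_le_sum (x : E) : eucl x <= \sum_j `|x ord0 j|.
Proof.
rewrite -[leRHS]ger0_norm ?sumr_ge0// -sqrtr_sqr; apply: ler_wsqrtr.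
have S0 : 0 <= \sum_j `|x ord0 j| by apply: sumr_ge0.
rewrite /dotp expr2 {1}mulr_suml; apply: ler_sum => j _.
rewrite -expr2 -real_normK ?num_real// expr2 ler_wpM2l//.
by rewrite (bigD1 j)//= lerDl sumr_ge0.
Qed.

(** Only boundedness is asked of each member: stability under multiplication by coordinates upgrades
    it to decay of every order, through |x| <= sum_j |x_j|. *)
Lemma rapid_coind (S : set (E -> R)) :
  (forall q, S q -> [/\ continuous q, forall j x, derivable q x (delta_mx ord0 j),
     forall j, S (pderiv j q), forall j, S (fun x => x ord0 j * q x)
     & exists C, forall x, `|q x| <= C]) ->
  S `<=` rapid.
Proof.
move=> HS q Sq; split.
  by move: q Sq; apply: smooth_coind => q /HS[].
move=> k l; have {Sq} : S (pderivs l q) by elim: l => //= j l /HS[].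
move: (pderivs l q); elim: k => [|k IH] {}q Sq.
  by have [_ _ _ _ [C HC]] := HS _ Sq; exists C => x; rewrite mul1r.
have [_ _ _ Sx _] := HS _ Sq.
have [C HC] := IH _ Sq.
have /choice[c Hc] : forall j, exists C, forall x, (1 + eucl x) ^+ k * `|x ord0 j * q x| <= C.
  by move=> j; exact: IH.
exists (C + \sum_j c j) => x.
have e0 : 0 <= (1 + eucl x) ^+ k by rewrite exprn_ge0// addr_ge0// eucl_ge0.
rewrite exprSr -mulrA mulrDl mul1r mulrDr; apply: lerD => //.
apply: (@le_trans _ _ (\sum_j (1 + eucl x) ^+ k * `|x ord0 j * q x|)); last exact: ler_sum.
rewrite -mulr_sumr ler_wpM2l//; under eq_bigr do rewrite normrM.
by rewrite -mulr_suml ler_wpM2r// eucl_le_sum.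
Qed.

Lemma rapid_smooth q : rapid q -> smooth q.
Proof. by case. Qed.

Lemma rapid_pderiv q j : rapid q -> rapid (pderiv j q).
Proof.
move=> [sq dq]; split; first by case: (smoothP sq).
by move=> k l; have [C HC] := dq k (rcons l j); exists C => x; have := HC x; rewrite /pderivs -cats1 foldr_cat.
Qed.

Lemma rapid_bound q (k : nat) : rapid q -> exists C : R, forall x, (1 + eucl x) ^+ k * `|q x| <= C.
Proof. by move=> [_ /(_ k [::])]. Qed.
Lemma onep_eucl_ge1 (x : E) : 1 <= 1 + eucl x.
Proof. by rewrite lerDl eucl_ge0. Qed.

Lemma L1_japanese : L1 (fun x : E => (japanese x)^-1 ^+ d.+1).
Proof.
apply: L1P.
  by apply: measurable_funX; exact: (measurableT_comp (@measurable_invr R) (@measurable_japanese R d)).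
apply: le_lt_trans (@integral_japanese_lty R d d.+1 (leqnn _)).
apply/le_of_eq/eq_integral => x _.
by rewrite exprVn ger0_norm// invr_ge0 exprn_ge0// (le_trans ler01)// japanese_ge1.
Qed.

Lemma japanese_le (x : E) : japanese x <= 1 + eucl x.
Proof.
have e0 := eucl_ge0 x.
have -> : 1 + eucl x = Num.sqrt ((1 + eucl x) ^+ 2) by rewrite sqrtr_sqr ger0_norm// addr_ge0.
apply: ler_wsqrtr; rewrite sqrrD expr1n mul1r lerD2r lerDl; by rewrite mulrn_wge0.
Qed.

Lemma L1_decay f (C : R) : measurable_fun setT f ->
  (forall x, (1 + eucl x) ^+ d.+1 * `|f x| <= C) -> L1 f.
Proof.
move=> mf fC; apply: (L1_le (k := fun x => C * (japanese x)^-1 ^+ d.+1)) => //; last first.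
  exact: L1Z L1_japanese.
move=> x; have j1 := japanese_ge1 x.
have jp : 0 < japanese x ^+ d.+1 by rewrite exprn_gt0// (lt_le_trans ltr01).
rewrite exprVn ler_pdivlMr// mulrC; apply: le_trans (fC x).
rewrite ler_wpM2r//; apply: lerXn2r; rewrite ?nnegrE ?japanese_le//.
  by rewrite (le_trans ler01).
by rewrite (le_trans ler01)// onep_eucl_ge1.
Qed.

Lemma rapid_measurable q : rapid q -> measurable_fun setT q.
Proof. by move=> /rapid_smooth/smooth_continuous/continuous_measurable_rV. Qed.

Lemma rapid_L1 q : rapid q -> L1 q.
Proof.
move=> rq; have [C HC] := rapid_bound d.+1 rq.
exact: (L1_decay (rapid_measurable rq) HC).
Qed.

Lemma rapid_moment q (k : nat) : rapid q -> L1 (fun x => (1 + eucl x) ^+ k * `|q x|).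
Proof.
move=> rq; have [C HC] := rapid_bound (d.+1 + k) rq; apply: (L1_decay (C := C)).
  apply: measurable_funM; last by apply: measurableT_comp => //; exact: rapid_measurable.
  by apply: measurable_funX; apply: measurable_funD => //; exact: measurable_eucl.
move=> x; apply: le_trans (HC x); rewrite exprD -mulrA ger0_norm//.
by rewrite mulr_ge0// exprn_ge0// addr_ge0// eucl_ge0.
Qed.

Definition testf q := smooth q /\ compactly_supported q.

Lemma bounded_coord_compact (r : R) : compact [set x : E | forall i, `|x ord0 i| <= r].
Proof.
have := @rV_compact R d (fun=> `[(- r), r]%classic) (fun=> @segment_compact R _ _).
congr compact; apply/seteqP; split => x /= H i; have := H i.
  by rewrite in_itv /= ler_norml.
by rewrite ler_norml in_itv.
Qed.

Lemma testf_bounded q : continuous q -> compactly_supported q -> exists C, forall x, `|q x| <= C.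
Proof.
move=> cq [r qr].
have := @continuous_compact _ _ q _ (continuous_subspaceT cq) (@bounded_coord_compact r).
move=> /compact_bounded[M [_ /(_ (M + 1))]]; rewrite ltrDl ltr01 => /(_ isT) H.
exists (Num.max 0 (M + 1)) => x; have [rx|xr] := ltP r (eucl x).
  by rewrite qr// normr0 le_max lexx.
rewrite le_max; apply/orP; right; apply: (H (q x)); exists x => //= i.
by apply: le_trans xr; exact: coord_le_eucl.
Qed.

Lemma continuous_dotp_diag : continuous (fun x : E => dotp x x).
Proof.
rewrite /dotp; elim: (index_enum _) => [|i s IH].
  rewrite (_ : (fun x : E => _) = cst (0 : R)); last by apply/funext => y; rewrite big_nil.
  exact: cst_continuous.
rewrite (_ : (fun x : E => _) = fun x => x ord0 i * x ord0 i + \sum_(j <- s) x ord0 j * x ord0 j); last first.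
  by apply/funext => x; rewrite big_cons.
move=> x; have ci := @coord_continuous R 1 d ord0 i x.
exact: (cvgD (cvgM ci ci) (IH x)).
Qed.

Lemma compact_pderiv q j : compactly_supported q -> compactly_supported (pderiv j q).
Proof.
(* [r] may be negative; the maximum makes it legitimate to compare squares, for which continuity of
   [dotp x x] gives an open complement. *)
move=> [r qr]; exists (Num.max 0 r) => x rx; rewrite /pderiv.
rewrite (@near_eq_derive _ _ _ q (cst 0)) ?derive_cst//.
have r0 : 0 <= Num.max 0 r by rewrite le_max lexx.
have sq y : (Num.max 0 r < eucl y) = (Num.max 0 r ^+ 2 < dotp y y).
  by rewrite -eucl_sqr ltr_pXn2r// nnegrE eucl_ge0.
rewrite sq in rx; near=> y; apply: qr.
have : Num.max 0 r < eucl y.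
  rewrite sq; near: y.
  have /cvgrPdist_lt/(_ (dotp x x - Num.max 0 r ^+ 2)) := @continuous_dotp_diag x.
  rewrite subr_gt0 => /(_ rx); apply: filterS => y.
  by move=> /ltr_normlW; lra.
by rewrite gt_max => /andP[].
Unshelve. all: by end_near. Qed.

Lemma testf_pderiv q j : testf q -> testf (pderiv j q).
Proof. by move=> [sq cq]; split; [case: (smoothP sq)|exact: compact_pderiv]. Qed.

Lemma testfM p q : smooth p -> testf q -> testf (fun x => p x * q x).
Proof.
move=> sp [sq [r qr]]; split; first exact: smoothM.
by exists r => x /qr ->; rewrite mulr0.
Qed.

Lemma testf_rapid : testf `<=` rapid.
Proof.
apply: rapid_coind => q tq; have [sq kq] := tq; have [cq dq _] := smoothP sq; split.
- exact: cq.
- exact: dq.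
- by move=> j; exact: testf_pderiv tq.
- by move=> j; have [sx _] := smooth_coordX j; exact: testfM sx tq.
exact: testf_bounded cq kq.
Qed.

Definition mk_schwartz q (rq : rapid q) : schwartz R d :=
  Schwartz (smooth_Ck rq.1) rq.2.

Lemma schwartz_rapid (p : schwartz R d) : rapid p.
Proof. by split; [split; exact: schwartz_smooth|exact: schwartz_decay]. Qed.

(** One class closed under all operations of interest, so that a single coinduction proves every
    closure property of Schwartz functions. *)
Inductive rapid_gen : (E -> R) -> Prop :=
| RGen q : rapid q -> rapid_gen q
| RGenX j q : rapid_gen q -> rapid_gen (fun x => x ord0 j * q x)
| RGenZ c q : rapid_gen q -> rapid_gen (fun x => c * q x)
| RGenD p q : rapid_gen p -> rapid_gen q -> rapid_gen (fun x => p x + q x)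
| RGenN q : rapid_gen q -> rapid_gen (fun x => q (- x)).

Lemma rapid_gen_rapid : rapid_gen `<=` rapid.
Proof.
suff H q : rapid_gen q -> [/\ continuous q, forall j x, derivable q x (delta_mx ord0 j),
     forall j, rapid_gen (pderiv j q)
     & forall k : nat, exists C, forall x, (1 + eucl x) ^+ k * `|q x| <= C].
  apply: rapid_coind => q gq; have [cq dq gq' bq] := H q gq; split.
  - exact: cq.
  - exact: dq.
  - exact: gq'.
  - by move=> j; exact: RGenX.
  by have [C HC] := bq 0%N; exists C => x; have := HC x; rewrite mul1r.
elim=> {q}.
- move=> q rq; have [cq dq _] := smoothP (rapid_smooth rq); split.
  + exact: cq.
  + exact: dq.
  + by move=> j; apply: RGen; exact: rapid_pderiv.
  by move=> k; exact: rapid_bound.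
- move=> j q gq [cq dq gq' bq].
  have [sx dx] := smooth_coordX j; have [cx ddx _] := smoothP sx; split.
  + by move=> x; exact: (cvgM (cx x) (cq x)).
  + by move=> i x; apply: derivableM; [exact: ddx|exact: dq].
  + move=> i; rewrite (_ : pderiv i _ = fun x => x ord0 j * pderiv i q x + (j == i)%:R * q x).
      by apply: RGenD; [exact/RGenX/gq'|exact/RGenZ].
    by apply/funext => x; rewrite pderivM ?dx; [rewrite [q x * _]mulrC|exact: ddx|exact: dq].
  + move=> k; have [C HC] := bq k.+1; exists C => x; apply: le_trans (HC x).
    rewrite normrM exprSr -mulrA ler_wpM2l//.
      by rewrite exprn_ge0// addr_ge0// eucl_ge0.
    by rewrite ler_wpM2r// (le_trans (coord_le_eucl x j))// lerDr.
- move=> c q gq [cq dq gq' bq]; split.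
  + by move=> x; exact: (cvgM (cvg_cst c) (cq x)).
  + by move=> i x; apply: derivableM; [exact: derivable_cst|exact: dq].
  + move=> i; rewrite (_ : pderiv i _ = fun x => c * pderiv i q x).
      exact/RGenZ/gq'.
    apply/funext => x; rewrite pderivM; [|exact: derivable_cst|exact: dq].
    by rewrite [X in _ + _ * X]derive_cst mulr0 addr0.
  + move=> k; have [C HC] := bq k; exists (`|c| * C) => x.
    by rewrite normrM mulrCA ler_wpM2l.
- move=> p q gp [cp dp gp' bp] gq [cq dq gq' bq]; split.
  + by move=> x; exact: (cvgD (cp x) (cq x)).
  + by move=> i x; apply: derivableD; [exact: dp|exact: dq].
  + move=> i; rewrite (_ : pderiv i _ = fun x => pderiv i p x + pderiv i q x).
      by apply: RGenD; [exact: gp'|exact: gq'].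
    by apply/funext => x; rewrite pderivD.
  + move=> k; have [C HC] := bp k; have [D HD] := bq k; exists (C + D) => x.
    apply: le_trans (lerD (HC x) (HD x)); rewrite -mulrDr ler_wpM2l ?ler_normD//.
    by rewrite exprn_ge0// addr_ge0// eucl_ge0.
move=> q gq [cq dq gq' bq].
have dN j x : derivable (fun x => q (- x)) x (delta_mx ord0 j) /\
  pderiv j (fun x => q (- x)) x = - pderiv j q (- x).
  have := derivable_affine (-1) 0 x (fun y => dq j y).
  rewrite (_ : (fun x : E => q (-1 *: x + 0)) = fun x => q (- x)).
    by rewrite addr0 scaleN1r mulN1r.
  by apply/funext => y; rewrite addr0 scaleN1r.
split.
- rewrite (_ : (fun x => _) = (fun x : E => q (-1 *: x + 0))); last first.
    by apply/funext => x; rewrite addr0 scaleN1r.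
  move=> x; apply: (@continuous_comp _ _ _ (fun x : E => -1 *: x + 0) q); last exact: cq.
  exact: (@continuous_affine R 'rV[R]_d).
- by move=> j x; exact: (dN j x).1.
- move=> j; rewrite (_ : pderiv j _ = fun x => -1 * pderiv j q (- x)).
    exact/RGenZ/(RGenN (gq' j)).
  by apply/funext => x; rewrite (dN j x).2 mulN1r.
by move=> k; have [C HC] := bq k; exists C => x; have := HC (- x); rewrite euclN.
Qed.

Lemma rapidX j q : rapid q -> rapid (fun x => x ord0 j * q x).
Proof. by move=> rq; exact/rapid_gen_rapid/RGenX/RGen. Qed.
Lemma rapidZ c q : rapid q -> rapid (fun x => c * q x).
Proof. by move=> rq; exact/rapid_gen_rapid/RGenZ/RGen. Qed.
Lemma rapidD p q : rapid p -> rapid q -> rapid (fun x => p x + q x).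
Proof. by move=> rp rq; apply/rapid_gen_rapid/RGenD; exact: RGen. Qed.
Lemma rapid_opp q : rapid q -> rapid (fun x => q (- x)).
Proof. by move=> rq; apply/rapid_gen_rapid/RGenN/RGen. Qed.

Lemma rapidB p q : rapid p -> rapid q -> rapid (fun x => p x - q x).
Proof.
move=> rp /(rapidZ (-1)) rq; rewrite (_ : (fun x => _) = fun x => p x + -1 * q x).
  exact: rapidD.
by apply/funext => x; rewrite mulN1r.
Qed.

(** A Peetre-type inequality derived from the parallelogram identity; it moves polynomial weights
    across translations. *)
Lemma onep_euclD (x z : E) : 1 + eucl (x + z) <= 2 * ((1 + eucl x) * (1 + eucl z)).
Proof.
have H (y : E) : 0 <= eucl y by exact: eucl_ge0.
have hx := H x; have hz := H z; have hxz := H (x + z).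
have e : eucl (x + z) ^+ 2 + dotp (x - z) (x - z) = 2 * eucl x ^+ 2 + 2 * eucl z ^+ 2.
  rewrite !eucl_sqr !dotpDl !dotpDr !(dotpNl, dotpNr) (dotpC z x); ring.
have := dotp_ge0 (x - z) => h.
rewrite -(@ler_pXn2r _ 2) ?nnegrE ?mulr_ge0 ?addr_ge0//.
have a : (1 + eucl (x + z)) ^+ 2 <= 2 * (1 + eucl (x + z) ^+ 2).
  by have := sqr_ge0 (1 - eucl (x + z)); lra.
apply: (le_trans a); rewrite !exprMn.
have : 0 <= eucl x ^+ 2 * eucl z ^+ 2 by rewrite mulr_ge0// sqr_ge0.
have b : 1 + eucl x ^+ 2 <= (1 + eucl x) ^+ 2 by rewrite sqrrD; lra.
have c : 1 + eucl z ^+ 2 <= (1 + eucl z) ^+ 2 by rewrite sqrrD; lra.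
have := sqr_ge0 (eucl x); have := sqr_ge0 (eucl z) => h1 h2 h3.
have : (1 + eucl x ^+ 2) * (1 + eucl z ^+ 2) <= (1 + eucl x) ^+ 2 * (1 + eucl z) ^+ 2.
  by apply: ler_pM => //; rewrite addr_ge0.
lra.
Qed.

(** By translation invariance the integral of y -> f (y + sin t e_j) does not depend on t;
    differentiate it at t = 0. The sine keeps all translates within distance 1, so one integrable
    function dominates the derivatives for every t. *)
Lemma Rintegral_pderiv f j (C : R) : L1 f ->
  (forall x, derivable f x (delta_mx ord0 j)) ->
  (forall x, (1 + eucl x) ^+ d.+1 * `|pderiv j f x| <= C) ->
  \int[mu]_x pderiv j f x = 0.
Proof.
move=> fi df HC; pose v : E := delta_mx ord0 j.
pose F (t : R) (y : E) := f (y + sin t *: v).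
have ev (t : R) : eucl (sin t *: v) <= 1.
  rewrite -(@ler_pXn2r _ 2) ?nnegrE ?eucl_ge0// eucl_sqr dotpZl dotpC dotpZl dotp_delta.
  by rewrite mxE !eqxx mulr1 -expr2 expr1n -(cos2Dsin2 t) lerDr sqr_ge0.
(* 4 = 2 (1 + 1): the factor of [onep_euclD] times the largest value of 1 + |sin t e_j|. *)
pose G (y : E) := C * 4 ^+ d.+1 * (japanese y)^-1 ^+ d.+1.
have dline (y : E) (t : R) : is_derive (t : R) (1 : R) (F ^~ y) (pderiv j f (y + sin t *: v) * cos t).
  rewrite (_ : F ^~ y = (fun s => f (s *: v + y)) \o sin); last first.
    by apply/funext => s; rewrite /F /= addrC.
  apply: is_derive1_comp.
  have -> : pderiv j f (y + sin t *: v) = 'D_1 (fun s : R => f (s *: v + y)) (sin t).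
    by rewrite (derive_line f) addrC.
  by apply: DeriveDef => //; apply/derivable_line; exact: df.
have iF t : mu.-integrable setT (EFin \o F t) := L1_int (L1_addr (sin t *: v) fi).
have iG : mu.-integrable setT (EFin \o G) := L1_int (L1Z _ L1_japanese).
have H := @derive_Rintegral R R _ _ mu F G iF iG 1
  (fun t y => @ex_derive _ _ _ _ _ _ _ (dline y t)).
have {}H : 'D_1 (fun x : R => \int[mu]_y F x y) = fun x : R => \int[mu]_y 'D_1 (F^~ y) x.
  apply: (H _).2 => t y; rewrite (@derive_val _ _ _ _ _ _ _ (dline y t)).
  rewrite normrM; apply: (@le_trans _ _ `|pderiv j f (y + sin t *: v)|).
    by rewrite ler_piMr// ler_norml cos_geN1 cos_le1.
  have j1 := japanese_ge1 y.
  have jp : 0 < japanese y ^+ d.+1 by rewrite exprn_gt0// (lt_le_trans ltr01).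
  rewrite /G exprVn ler_pdivlMr//.
  apply: (@le_trans _ _ ((1 + eucl (y + sin t *: v)) ^+ d.+1 * `|pderiv j f (y + sin t *: v)| * 4 ^+ d.+1)); last first.
    by rewrite ler_wpM2r// exprn_ge0.
  rewrite mulrC [X in _ <= X]mulrAC ler_wpM2r// -exprMn; apply: lerXn2r; rewrite ?nnegrE.
  - by rewrite (le_trans ler01).
  - by rewrite mulr_ge0// addr_ge0// eucl_ge0.
  apply: (le_trans (japanese_le y)).
  have := onep_euclD (y + sin t *: v) (- (sin t *: v)); rewrite addrK euclN => /le_trans; apply.
  rewrite mulrC -mulrA ler_wpM2l ?addr_ge0 ?eucl_ge0//.
  have := ev t; lra.
have /(congr1 (fun g => g 0)) := H.
rewrite (_ : (fun x : R => _) = cst (\int[mu]_x f x)); last first.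
  by apply/funext => t; rewrite /F Rintegral_addr.
rewrite derive_cst => ->; apply: eq_Rintegral => y _.
by rewrite (@derive_val _ _ _ _ _ _ _ (dline y 0)) sin0 cos0 scale0r addr0 mulr1.
Qed.

End schwartz_class.

(** * The Hartley transform *)

Section cas.
Context {R : realType}.

Definition cas (t : R) : R := cos t + sin t.

Lemma cas_le2 t : `|cas t| <= 2.
Proof.
apply: (le_trans (ler_normD _ _)).
have : `|cos t| <= 1 by rewrite ler_norml cos_geN1 cos_le1.
have : `|sin t| <= 1 by rewrite ler_norml sin_geN1 sin_le1.
lra.
Qed.

Lemma casM a b : cas a * cas b = cos (a - b) + sin (a + b).
Proof. rewrite /cas cosB sinD; ring. Qed.
Lemma casNE a : cas (- a) = cos a - sin a.
Proof. by rewrite /cas cosN sinN. Qed.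
Lemma continuous_cas : continuous cas.
Proof. by move=> t; exact: (cvgD (@continuous_cos R t) (@continuous_sin R t)). Qed.
Lemma is_derive_cas (t : R) : is_derive t (1 : R) cas (cas (- t)).
Proof. by apply: is_derive_eq; rewrite casNE addrC. Qed.

End cas.

Section hartley.
Context {R : realType} {d : nat}.
Local Notation E := 'rV[R]_d.
Local Notation mu := (@lebesgue_rV R d).
Implicit Types h k p q : E -> R.

Definition kern (x y : E) : R := cas (2 * pi * dotp x y).

(** In terms of the Fourier transform this is Re F[h] - Im F[h] for real h. The kernel is symmetric,
    so the transform is its own adjoint ([hart_dual]). *)
Definition hart h (x : E) : R := \int[mu]_y (h y * kern x y).

Lemma kernC x y : kern x y = kern y x.
Proof. by rewrite /kern dotpC. Qed.
Lemma kernN x y : kern (- x) y = kern x (- y).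
Proof. by rewrite /kern dotpNl dotpNr. Qed.
Lemma kern_le2 x y : `|kern x y| <= 2.
Proof. exact: cas_le2. Qed.

Lemma measurable_kern2 : measurable_fun setT (fun z : E * E => kern z.1 z.2).
Proof.
apply: measurableT_comp; first exact: continuous_measurable_fun continuous_cas.
by apply: measurable_funM => //; exact: measurable_dotp.
Qed.

Lemma measurable_kern x : measurable_fun setT (kern x).
Proof. exact: (measurableT_comp measurable_kern2 (measurable_pair1 x)). Qed.
Lemma L1_kern h x : L1 h -> L1 (fun y => h y * kern x y).
Proof. by move=> ih; apply: (L1_Mb ih (measurable_kern x) (kern_le2 x)). Qed.

Lemma hart_bound h x : L1 h -> `|hart h x| <= 2 * \int[mu]_y `|h y|.
Proof.
move=> ih; rewrite -RintZ; last exact: L1_norm.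
apply: Rint_norm_le; [exact: L1_kern|exact/L1Z/L1_norm|].
by move=> y; rewrite normrM mulrC ler_wpM2r// kern_le2.
Qed.

Lemma is_derive_kern j x y : is_derive x (delta_mx ord0 j : E) (fun x => kern x y)
  (2 * pi * y ord0 j * kern (- x) y).
Proof.
set v : E := delta_mx ord0 j; set f := fun x => _.
have fl : (fun s : R => f (s *: v + x)) = cas \o (fun s => s * (2 * pi * y ord0 j) + 2 * pi * dotp x y).
  apply/funext => s; rewrite /f /kern /= dotpDl dotpZl dotp_delta; congr cas; ring.
have dl : is_derive (0 : R) (1 : R) (fun s : R => f (s *: v + x))
    (cas (- (2 * pi * dotp x y)) * (2 * pi * y ord0 j)).
  rewrite fl; set c := 2 * pi * y ord0 j; set b := 2 * pi * dotp x y.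
  apply: is_derive1_comp.
    by rewrite mul0r add0r; exact: is_derive_cas.
  rewrite (_ : (fun s => _) = c \*: id + cst b); last by apply/funext => s /=; rewrite mulrC.
  by apply: is_derive_eq; rewrite addr0 [_ *: _]mulr1.
apply: DeriveDef.
  have : derivable f (0 *: v + x) v by apply/derivable_line; exact: ex_derive.
  by rewrite scale0r add0r.
have := derive_line f x v 0; rewrite scale0r add0r => <-.
by rewrite (@derive_val _ _ _ _ _ _ _ dl) mulrC /kern dotpNl mulrN.
Qed.

Lemma continuous_kern y : continuous (fun x : E => kern x y).
Proof.
move=> x; apply: (@continuous_comp _ _ _ (fun x : E => 2 * pi * dotp x y) cas); last first.
  exact: continuous_cas.
have c : continuous (fun x : E => dotp x y).
  rewrite /dotp; elim: (index_enum _) => [|i s IH].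
    rewrite (_ : (fun x : E => _) = cst (0 : R)); last by apply/funext => z; rewrite big_nil.
    exact: cst_continuous.
  rewrite (_ : (fun x : E => _) = fun x => x ord0 i * y ord0 i + \sum_(j <- s) x ord0 j * y ord0 j); last first.
    by apply/funext => z; rewrite big_cons.
  move=> z; exact: (cvgD (cvgM (@coord_continuous R 1 d ord0 i z) (cvg_cst _)) (IH z)).
exact: (cvgM (cvg_cst _) (c x)).
Qed.

Lemma hart_continuous h : L1 h -> continuous (hart h).
Proof.
move=> ih; apply: (@continuous_Rintegral R E _ _ mu (fun x y => h y * kern x y) (fun y => 2 * `|h y|)).
- by move=> x; exact/L1_int/L1_kern.
- exact/L1_int/L1Z/L1_norm.
- by move=> y x; exact: (cvgM (cvg_cst _) (@continuous_kern y x)).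
- by move=> x y; rewrite normrM mulrC ler_wpM2r// kern_le2.
Qed.

Lemma hart_measurable h : L1 h -> measurable_fun setT (hart h).
Proof. by move=> ih; apply: continuous_measurable_rV; exact: hart_continuous. Qed.

Lemma hartD h k x : L1 h -> L1 k -> hart (fun y => h y + k y) x = hart h x + hart k x.
Proof.
move=> ih ik; rewrite /hart -RintD; [|exact: L1_kern|exact: L1_kern].
by apply: eq_Rintegral => y _; rewrite mulrDl.
Qed.

Lemma hartZ c h x : L1 h -> hart (fun y => c * h y) x = c * hart h x.
Proof.
move=> ih; rewrite /hart -RintZ; last exact: L1_kern.
by apply: eq_Rintegral => y _; rewrite mulrA.
Qed.

Lemma hart_opp h x : L1 h -> hart (fun y => h (- y)) x = hart h (- x).
Proof.
move=> ih; rewrite /hart -[RHS]Rintegral_opp; last exact: L1_kern.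
by apply: eq_Rintegral => y _; rewrite kernN opprK.
Qed.

Lemma hart_dual h k : L1 h -> L1 k ->
  \int[mu]_x (hart h x * k x) = \int[mu]_x (h x * hart k x).
Proof.
move=> ih ik; have := Fubini_L1 ik ih measurable_kern2 kern_le2.
rewrite (_ : \int[mu]_x (hart h x * k x) = \int[mu]_x (k x * \int[mu]_y (h y * kern x y))).
  move=> ->; apply: eq_Rintegral => x _; congr (_ * _).
  by apply: eq_Rintegral => y _; rewrite kernC.
by apply: eq_Rintegral => x _; rewrite mulrC.
Qed.

(** The derivative of cas at a is cas (-a): differentiation multiplies the density by a coordinate
    and also reflects it. *)
Lemma hart_pderiv h j : L1 h -> L1 (fun y => y ord0 j * h y) ->
  (forall x, derivable (hart h) x (delta_mx ord0 j)) /\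
  pderiv j (hart h) = hart (fun y => - (2 * pi) * (y ord0 j * h (- y))).
Proof.
move=> ih ijh; pose v : E := delta_mx ord0 j.
pose F x y := h y * kern x y.
have dF x y : is_derive x v (F ^~ y) (2 * pi * (y ord0 j * h y) * kern (- x) y).
  have dk := is_derive_kern j x y.
  rewrite (_ : F ^~ y = (h y) \*: (fun x => kern x y)); last by apply/funext.
  by apply: is_derive_eq; rewrite [_ *: _]mulrA; congr (_ * _); ring.
pose G (y : E) := 2 * (2 * pi * `|y ord0 j * h y|).
have iF x : mu.-integrable setT (EFin \o F x) by exact/L1_int/L1_kern.
have iG : mu.-integrable setT (EFin \o G) by exact/L1_int/L1Z/L1Z/L1_norm.
have pi0 : 0 <= 2 * pi :> R by rewrite mulr_ge0// pi_ge0.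
have [D1 D2] : (forall x, derivable (hart h) x v) /\ 'D_v (hart h) = fun x => \int[mu]_y 'D_v (F^~ y) x.
  apply: (derive_Rintegral iF iG).
    by move=> x y; have := dF x y => ?; exact: ex_derive.
  move=> x y; rewrite (@derive_val _ _ _ _ _ _ _ (dF x y)) normrM normrM (ger0_norm pi0).
  by rewrite /G mulrC ler_wpM2r// ?kern_le2// mulr_ge0.
split; first exact: D1.
rewrite [LHS]D2; apply/funext => x; rewrite /hart.
have ih2 : L1 (fun y : E => - (2 * pi) * (y ord0 j * h (- y)) * kern x y).
  apply: (L1_kern (h := fun y : E => - (2 * pi) * (y ord0 j * h (- y)))); apply: L1Z.
  have := L1N (L1_opp ijh); congr L1; apply/funext => y.
  by rewrite mxE mulNr opprK.
rewrite -[RHS]Rintegral_opp//; apply: eq_Rintegral => y _.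
rewrite (@derive_val _ _ _ _ _ _ _ (dF x y)) kernN opprK mxE; ring.
Qed.

(** Integration by parts, in the form that the derivative of p times the kernel has integral 0. *)
Lemma hart_of_pderiv p j w : rapid p ->
  hart (pderiv j p) w = - (2 * pi * w ord0 j * hart p (- w)).
Proof.
move=> rp; have ip := rapid_L1 rp; have rp' := rapid_pderiv j rp; have ip' := rapid_L1 rp'.
have [_ dp _] := smoothP (rapid_smooth rp).
pose v : E := delta_mx ord0 j.
have dk y : is_derive (y : E) v (kern w) (2 * pi * w ord0 j * kern (- w) y).
  have := is_derive_kern j y w; rewrite kernN -kernC.
  by rewrite (_ : kern^~ w = kern w)//; apply/funext => z; rewrite kernC.
have E1 (y : E) : pderiv j (fun y => p y * kern w y) y =
    pderiv j p y * kern w y + 2 * pi * w ord0 j * (p y * kern (- w) y).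
  have d2 := dk y.
  rewrite pderivM; [|exact: dp|exact: ex_derive].
  rewrite [in X in _ * X]/pderiv (@derive_val _ _ _ _ _ _ _ d2); ring.
have [C HC] := rapid_bound d.+1 rp; have [D HD] := rapid_bound d.+1 rp'.
set c := 2 * pi * w ord0 j in E1 *.
have := @Rintegral_pderiv R d (fun y => p y * kern w y) j (D * 2 + C * (`|c| * 2)) (L1_kern w ip).
have -> : \int[mu]_x pderiv j (fun y => p y * kern w y) x = hart (pderiv j p) w + c * hart p (- w).
  rewrite /hart -RintZ -?RintD; [by apply: eq_Rintegral => y _|exact: L1_kern|exact/L1Z/L1_kern|exact: L1_kern].
move=> H; apply/eqP; rewrite -addr_eq0; apply/eqP/H.
  by move=> y; have d2 := dk y; apply: derivableM; [exact: dp|exact: ex_derive].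
move=> y; rewrite E1.
have e0 : 0 <= (1 + eucl y) ^+ d.+1 by rewrite exprn_ge0// addr_ge0// eucl_ge0.
apply: (le_trans (ler_wpM2l e0 (ler_normD _ _))); rewrite mulrDr; apply: lerD.
  by rewrite normrM mulrA ler_pM// ?mulr_ge0// kern_le2.
rewrite normrM [`|p y * _|]normrM [`|c| * (_ * _)]mulrCA [_ ^+ _ * _]mulrA.
apply: ler_pM; [exact: mulr_ge0 e0 (normr_ge0 _)|exact: mulr_ge0 (normr_ge0 _) (normr_ge0 _)|exact: HC|].
by rewrite ler_wpM2l// kern_le2.
Qed.

(** The transform exchanges derivatives and multiplication by coordinates, up to reflections and
    constants, so the transforms of Schwartz functions form a class as in [rapid_coind]. *)
Lemma rapid_hart : [set hart p | p in rapid] `<=` rapid.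
Proof.
apply: rapid_coind => _ [p rp <-].
have ip := rapid_L1 rp; have ixp j : L1 (fun y => y ord0 j * p y) by exact/rapid_L1/rapidX.
split.
- exact: hart_continuous.
- by move=> j; exact: (hart_pderiv ip (ixp j)).1.
- move=> j; rewrite (hart_pderiv ip (ixp j)).2.
  by exists (fun y : E => - (2 * pi) * (y ord0 j * p (- y))) => //; exact/rapidZ/rapidX/rapid_opp.
- move=> j; exists (fun y : E => (2 * pi)^-1 * pderiv j p (- y)).
    exact/rapidZ/rapid_opp/rapid_pderiv.
  have ip' := rapid_L1 (rapid_pderiv j rp).
  apply/funext => x; rewrite hartZ ?hart_opp//; last exact: L1_opp.
  have pi0 : 2 * pi != 0 :> R by rewrite mulf_neq0// gt_eqF// pi_gt0.
  apply: (mulfI pi0); rewrite mulrA divff// mul1r.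
  by rewrite hart_of_pderiv// mxE opprK; ring.
by move: ip => ip; exists (2 * \int[mu]_y `|p y|) => x; exact: hart_bound.
Qed.

End hartley.

(** * Bump functions on boxes and increments of functions *)

Section bumps.
Context {R : realType} {d : nat}.
Local Notation E := 'rV[R]_d.
Implicit Types a b x : E.

Let flat1 : R -> R := flat 1.

(** [m] sharpens the bump: since exp(-1/(m u)) tends to 1 for u > 0, the bumps tend to the indicator
    of the open box as m grows. *)
Definition box_bump a b (m : R) x : R :=
  \prod_i (flat1 (m * x ord0 i + m * - a ord0 i) * flat1 (- m * x ord0 i + m * b ord0 i)).

Let flat1_itv t : 0 <= flat1 t <= 1.
Proof.
rewrite /flat1 /flat; case: ifP => t0; last by rewrite lexx ler01.
rewrite hornerC mul1r expR_ge0 /= -[leRHS]expR0 ler_expR.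
by rewrite oppr_le0 invr_ge0 ltW.
Qed.

Let flat1_gt0 t : 0 < t -> 0 < flat1 t.
Proof. by move=> t0; rewrite /flat1 /flat t0 hornerC mul1r expR_gt0. Qed.

Lemma box_bump_ge0 a b m x : 0 <= box_bump a b m x.
Proof.
by apply: prodr_ge0 => i _; apply: mulr_ge0; [case/andP: (flat1_itv (m * x ord0 i + m * - a ord0 i))|
  case/andP: (flat1_itv (- m * x ord0 i + m * b ord0 i))].
Qed.

Lemma box_bump_le1 a b m x : box_bump a b m x <= 1.
Proof.
apply: prodr_ile1 => i _.
have /andP[u0 u1] := flat1_itv (m * x ord0 i + m * - a ord0 i).
have /andP[v0 v1] := flat1_itv (- m * x ord0 i + m * b ord0 i).
by rewrite mulr_ge0//= mulr_ile1.
Qed.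

Lemma box_bump_gt0 a b m x : 0 < m -> (forall i, a ord0 i < x ord0 i < b ord0 i) ->
  0 < box_bump a b m x.
Proof.
move=> m0 ab; apply: prodr_gt0 => i _; have /andP[ax xb] := ab i.
by apply: mulr_gt0; apply: flat1_gt0;
  [rewrite -mulrDr|rewrite mulNr addrC -mulrBr]; rewrite mulr_gt0// subr_gt0.
Qed.

Lemma box_bump_eq0 a b m x i : 0 < m -> ~~ (a ord0 i < x ord0 i < b ord0 i) ->
  box_bump a b m x = 0.
Proof.
move=> m0 H; rewrite /box_bump (bigD1 i)//=.
rewrite (_ : flat1 _ * flat1 _ = 0) ?mul0r//.
move: H; rewrite negb_and -!leNgt => /orP[H|H]; apply/eqP; rewrite mulf_eq0; apply/orP; [left|right].
  by rewrite /flat1 /flat ifF// -mulrDr; apply/negbTE; rewrite -leNgt pmulr_rle0// subr_le0.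
by rewrite /flat1 /flat ifF// mulNr addrC -mulrBr; apply/negbTE; rewrite -leNgt pmulr_rle0// subr_le0.
Qed.

Lemma testf_box_bump a b m : 0 < m -> testf (box_bump a b m).
Proof.
move=> m0; split.
  apply: (@smooth_prod R d _ _ (fun i x => flat1 (m * x ord0 i + m * - a ord0 i) *
      flat1 (- m * x ord0 i + m * b ord0 i))) => i.
  by apply: smoothM; apply: smooth_coord; exact: smooth1_flat.
exists (\sum_i (`|a ord0 i| + `|b ord0 i|)) => x rx.
have [i Hi] : exists i, `|a ord0 i| + `|b ord0 i| < `|x ord0 i|.
  apply: contrapT => /forallNP N; move: rx; rewrite ltNge => /negP; apply.
  apply: (le_trans (eucl_le_sum x)); apply: ler_sum => i _.
  by rewrite leNgt; exact/negP.
apply: (@box_bump_eq0 _ _ _ _ i) => //; apply/negP => /andP[h1 h2].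
move: Hi; apply/negP; rewrite -leNgt ler_norml.
have := ler_norm (b ord0 i); have := ler_norm (- a ord0 i); rewrite normrN.
have := normr_ge0 (b ord0 i); have := normr_ge0 (a ord0 i); lra.
Qed.

Lemma box_bump_cvg a b x : (fun n : nat => box_bump a b n.+1%:R x) @ \oo -->
  (if `[< forall i, a ord0 i < x ord0 i < b ord0 i >] then 1 else 0 : R).
Proof.
case: asboolP => [ab|]; last first.
  move=> /existsNP[i /negP Hi].
  rewrite (_ : (fun n => _) = cst 0); first exact: cvg_cst.
  by apply/funext => n; exact: box_bump_eq0 Hi.
have c1 (t : R) : 0 < t -> (fun n : nat => flat1 (n.+1%:R * t)) @ \oo --> (1 : R).
  move=> t0.
  rewrite (_ : (fun n => _) = expR \o (fun n : nat => - t^-1 * n.+1%:R^-1)); last first.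
    apply/funext => n; rewrite /flat1 /flat mulr_gt0// hornerC mul1r /=.
    by congr expR; rewrite invfM mulrC mulNr.
  rewrite -[X in _ --> X]expR0; apply: continuous_cvg; first exact: continuous_expR.
  rewrite -[X in _ --> X](mulr0 (- t^-1)); apply: cvgM; first exact: cvg_cst.
  exact: cvg_harmonic.
rewrite /box_bump; elim: (index_enum _) => [|i s IH].
  rewrite (_ : (fun n => _) = cst 1); first exact: cvg_cst.
  by apply/funext => n; rewrite big_nil.
have /andP[ax xb] := ab i.
have a1 : 0 < x ord0 i - a ord0 i by rewrite subr_gt0.
have b1 : 0 < b ord0 i - x ord0 i by rewrite subr_gt0.
rewrite (_ : (fun n => _) = fun n : nat => flat1 (n.+1%:R * (x ord0 i - a ord0 i)) *
    flat1 (n.+1%:R * (b ord0 i - x ord0 i)) * \prod_(j <- s)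
      (flat1 (n.+1%:R * x ord0 j + n.+1%:R * - a ord0 j) *
       flat1 (- n.+1%:R * x ord0 j + n.+1%:R * b ord0 j))).
  suff h : (fun n : nat => flat1 (n.+1%:R * (x ord0 i - a ord0 i)) *
    flat1 (n.+1%:R * (b ord0 i - x ord0 i)) * \prod_(j <- s)
      (flat1 (n.+1%:R * x ord0 j + n.+1%:R * - a ord0 j) *
       flat1 (- n.+1%:R * x ord0 j + n.+1%:R * b ord0 j))) @ \oo --> (1 * 1 * 1 : R).
    by move: h; rewrite !mulr1.
  by apply: cvgM => //; apply: cvgM; exact: c1.
apply/funext => n; rewrite big_cons; congr (flat1 _ * flat1 _ * _); [ring|].
by rewrite mulrBr mulNr addrC.
Qed.

Lemma box_bump_opp a m x : box_bump (- a) a m (- x) = box_bump (- a) a m x.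
Proof.
apply: eq_bigr => i _; rewrite mulrC !mxE; congr (flat1 _ * flat1 _); ring.
Qed.


Lemma line_increment (f : E -> R) j (y : E) (c M : R) :
  (forall y, derivable f y (delta_mx ord0 j)) ->
  (forall t, 0 <= t <= 1 -> `|pderiv j f (y + (t * c) *: delta_mx ord0 j)| <= M) ->
  `|f (y + c *: delta_mx ord0 j) - f y| <= `|c| * M.
Proof.
move=> df Hf; pose v : E := delta_mx ord0 j; pose g (t : R) := f (y + (t * c) *: v).
have dg (t : R) : is_derive t (1 : R) g (pderiv j f (y + (t * c) *: v) * c).
  rewrite (_ : g = (fun s => f (s *: v + y)) \o (fun t => t * c)); last first.
    by apply/funext => s; rewrite /g /= addrC.
  apply: is_derive1_comp.
    have -> : pderiv j f (y + (t * c) *: v) = 'D_1 (fun s : R => f (s *: v + y)) (t * c).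
      by rewrite (derive_line f) addrC.
    by apply: DeriveDef => //; apply/derivable_line; exact: df.
  rewrite (_ : (fun t => _) = c \*: id); last by apply/funext => s /=; rewrite mulrC.
  by apply: is_derive_eq; rewrite [_ *: _]mulr1.
have cg : {within `[0, 1], continuous g}.
  apply: continuous_subspaceT => t; apply: differentiable_continuous.
  by apply/derivable1_diffP; have := dg t => ?; exact: ex_derive.
have [t t01] := MVT ltr01 (fun t _ => dg t) cg.
rewrite subr0 mulr1 /g mul1r mul0r scale0r addr0 => ->.
rewrite normrM mulrC ler_wpM2l//; apply: Hf.
by move: t01; rewrite in_itv /= => /andP[/ltW-> /ltW->].
Qed.

Lemma eucl_le_coord (x z : E) : (forall i, `|x ord0 i| <= `|z ord0 i|) -> eucl x <= eucl z.
Proof.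
move=> xz; apply: ler_wsqrtr; apply: ler_sum => i _.
by rewrite -!expr2 -(real_normK (num_real (x ord0 i))) -(real_normK (num_real (z ord0 i))) lerXn2r ?nnegrE.
Qed.

(** Go from x to x + z one coordinate at a time. The truncations [tr m] of z, and the segments
    between them, stay in the ball of radius |z| where the derivative is controlled. *)
Lemma increment_le (f : E -> R) (x z : E) (M : R) : 0 <= M ->
  (forall j y, derivable f y (delta_mx ord0 j)) ->
  (forall w j, eucl w <= eucl z -> `|pderiv j f (x + w)| <= M) ->
  `|f (x + z) - f x| <= d%:R * (eucl z * M).
Proof.
move=> M0 df Hf; pose tr (m : nat) : E := \row_i (if (i < m)%N then z ord0 i else 0).
have trS m (md : (m < d)%N) : tr m.+1 = tr m + z ord0 (Ordinal md) *: delta_mx ord0 (Ordinal md).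
  apply/rowP => i; rewrite !mxE eqxx /= ltnS leq_eqVlt -val_eqE /=.
  by case: (ltngtP i m) => [h|h|h]; rewrite ?mulr0 ?mulr1 ?addr0 ?add0r//; congr (z _ _); exact: val_inj.
have H m : (m <= d)%N -> `|f (x + tr m) - f x| <= m%:R * (eucl z * M).
  elim: m => [_|m IH md].
    rewrite (_ : tr 0%N = 0) ?addr0 ?subrr ?normr0 ?mul0r//.
    by apply/rowP => i; rewrite !mxE.
  rewrite trS (addrA x); set w := x + tr m; set w' := w + _.
  have -> : f w' - f x = (f w' - f w) + (f w - f x) by rewrite addrA subrK.
  apply: (le_trans (ler_normD _ _)); rewrite -natr1 mulrDl mul1r addrC.
  apply: lerD; first exact/IH/ltnW.
  apply: (@le_trans _ _ (`|z ord0 (Ordinal md)| * M)); last by rewrite ler_wpM2r// coord_le_eucl.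
  apply: line_increment => // t /andP[t0 t1].
  rewrite /w -addrA; apply: Hf; apply: eucl_le_coord => i; rewrite !mxE eqxx /= -val_eqE /=.
  case: (ltngtP i m) => [h|h|h]; rewrite ?mulr0 ?mulr1 ?addr0 ?add0r ?normr0//.
  rewrite normrM (_ : Ordinal md = i); last exact: val_inj.
  by rewrite ger0_norm// ler_piMl.
have := H d (leqnn d); rewrite (_ : tr d = z)//.
by apply/rowP => i; rewrite mxE ltn_ord.
Qed.

End bumps.

Lemma harmonic_scale (R : realType) (V : normedModType R) (x : V) :
  (fun n : nat => (n.+1%:R^-1 : R) *: x) @ \oo --> 0 *: x.
Proof. by apply: cvgZr_tmp; exact: cvg_harmonic. Qed.

(** * Inversion of the Hartley transform and injectivity *)

Section inversion.
Context {R : realType} {d : nat}.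
Local Notation E := 'rV[R]_d.
Local Notation mu := (@lebesgue_rV R d).
Implicit Types h k p q : E -> R.

Lemma Rint_odd h : L1 h -> (forall x, h (- x) = - h x) -> \int[mu]_x h x = 0.
Proof.
move=> ih ho; have := Rintegral_opp ih.
rewrite (_ : (fun x : E => h (- x)) = fun x => - h x); last exact/funext.
rewrite RintN//; lra.
Qed.

(** Normalised to 1 at the origin and even; the parity removes sine terms from products of
    kernels. *)
Definition cutoff (x : E) : R :=
  (box_bump (- const_mx 1) (const_mx 1) 1 (0 : E))^-1 * box_bump (- const_mx 1) (const_mx 1) 1 x.

Lemma cutoff_testf (a : R) : 0 < a -> testf (fun x => cutoff (a *: x)).
Proof.
move=> a0; have [sb [r br]] := testf_box_bump (- const_mx 1) (const_mx 1 : E) ltr01.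
rewrite /cutoff; set c := _^-1; split.
  have [H _] := smooth_affine_coord a 0 sb; apply: smoothZ; move: H.
  by congr smooth; apply/funext => x; rewrite addr0.
exists (r / a) => x rx; rewrite br ?mulr0//.
have -> : eucl (a *: x) = a * eucl x.
  rewrite -[RHS]ger0_norm ?mulr_ge0 ?(ltW a0) ?eucl_ge0// -sqrtr_sqr; congr Num.sqrt.
  by rewrite exprMn eucl_sqr dotpZl dotpC dotpZl mulrA.
by rewrite mulrC -ltr_pdivrMr.
Qed.

Lemma cutoff0 : cutoff 0 = 1.
Proof.
rewrite /cutoff mulVf// gt_eqF// box_bump_gt0// => i; rewrite !mxE; lra.
Qed.

Lemma cutoffN x : cutoff (- x) = cutoff x.
Proof. by rewrite /cutoff (box_bump_opp (const_mx 1) 1 x). Qed.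

Lemma cutoff_bounded : exists C, forall x, `|cutoff x| <= C.
Proof.
exists (box_bump (- const_mx 1) (const_mx 1 : E) 1 0)^-1 => x.
rewrite ger0_norm /cutoff ?mulr_ge0 ?invr_ge0 ?box_bump_ge0//.
by rewrite ler_piMr ?invr_ge0 ?box_bump_ge0 ?box_bump_le1.
Qed.

Lemma cutoff_cvg (x : E) : (fun n : nat => cutoff (n.+1%:R^-1 *: x)) @ \oo --> (1 : R).
Proof.
have [sc _] := cutoff_testf ltr01.
have cc : continuous (fun x : E => cutoff (1 *: x)) by exact: smooth_continuous.
rewrite (_ : (fun n => _) = (fun x : E => cutoff (1 *: x)) \o (fun n : nat => n.+1%:R^-1 *: x)); last first.
  by apply/funext => n /=; rewrite scale1r.
rewrite -[X in _ --> X]cutoff0 -(scale1r (0 : E)).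
apply: continuous_cvg; first exact: cc.
rewrite -[X in _ --> X](scale0r x).
exact: (@harmonic_scale R 'rV[R]_d).
Qed.

(** The mollifier is the transform of the cutoff, neither claimed positive nor normalised:
    [hart_cst] is its integral. *)
Definition mol : E -> R := hart cutoff.
Definition hart_cst : R := \int[mu]_x mol x.
Definition mollify (a : R) p (x : E) : R := \int[mu]_z (p (x - a *: z) * mol z).

Lemma testf_cutoff : testf cutoff.
Proof.
by have := cutoff_testf ltr01; congr testf; apply/funext => x; rewrite scale1r.
Qed.

Lemma rapid_mol : rapid mol.
Proof. by apply: rapid_hart; exists cutoff => //; exact/testf_rapid/testf_cutoff. Qed.

(** Expand cas a cas b = cos (a - b) + sin (a + b): against an even function the sine integrates to
    0. *)
Lemma hart_even_kern c x y : L1 c -> (forall z, c (- z) = c z) ->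
  \int[mu]_z (c z * kern x z * kern z y) = hart c (x - y).
Proof.
move=> ic ce.
have msc (f : R -> R) (w : E) : continuous f -> measurable_fun setT (fun z : E => f (2 * pi * dotp w z)).
  move=> cf; apply: measurableT_comp; first exact: continuous_measurable_fun.
  by apply: measurable_funM => //; exact: measurable_dotpl.
have isin w : L1 (fun z => c z * sin (2 * pi * dotp w z)).
  apply: (L1_Mb (c := 1)) => //; first exact: msc (@continuous_sin R).
  by move=> z; rewrite ler_norml sin_geN1 sin_le1.
have icos w : L1 (fun z => c z * cos (2 * pi * dotp w z)).
  apply: (L1_Mb (c := 1)) => //; first exact: msc (@continuous_cos R).
  by move=> z; rewrite ler_norml cos_geN1 cos_le1.
have osin w : \int[mu]_z (c z * sin (2 * pi * dotp w z)) = 0.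
  apply: Rint_odd => // z; rewrite ce dotpNr mulrN sinN; ring.
rewrite /hart.
transitivity (\int[mu]_z (c z * cos (2 * pi * dotp (x - y) z) + c z * sin (2 * pi * dotp (x + y) z))).
  apply: eq_Rintegral => z _; rewrite -mulrA -mulrDr; congr (_ * _).
  by rewrite (kernC z) /kern casM -mulrBr -mulrDr -dotpNl -!dotpDl.
rewrite RintD// osin addr0 -[LHS]addr0 -(osin (x - y)) -RintD//.
by apply: eq_Rintegral => z _; rewrite -mulrDr.
Qed.

(** Cutting off the transform at frequency 1/a and transforming again amounts to convolution with
    the mollifier at scale a, by Fubini and [hart_even_kern]. In this way mollifications become
    transforms of compactly supported functions. *)
Lemma hart_cutoff a x p : 0 < a -> rapid p ->
  hart (fun y => cutoff (a *: y) * hart p y) x = mollify a p x.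
Proof.
move=> a0 rp; have ip := rapid_L1 rp; have im := rapid_L1 rapid_mol.
pose c (y : E) := cutoff (a *: y).
have ic : L1 c by apply: rapid_L1; apply: testf_rapid; exact: cutoff_testf.
have ce z : c (- z) = c z by rewrite /c scalerN cutoffN.
rewrite /hart; transitivity (\int[mu]_y (c y * kern x y * \int[mu]_z (p z * kern y z))).
  by apply: eq_Rintegral => y _; rewrite mulrAC.
rewrite (Fubini_L1 (L1_kern x ic) ip measurable_kern2 kern_le2).
transitivity (\int[mu]_z (p z * (a^-1 ^+ d * mol (a^-1 *: (x - z))))).
  apply: eq_Rintegral => z _; congr (_ * _); rewrite (hart_even_kern x z ic ce).
  rewrite /mol /hart -(Rintegral_scale a0); last exact/L1_kern/rapid_L1/testf_rapid/testf_cutoff.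
  apply: eq_Rintegral => y _; congr (_ * _); rewrite /kern dotpZl [dotp _ (a *: y)]dotpC dotpZl [dotp y _]dotpC.
  by rewrite [a^-1 * _]mulrA mulVf ?mul1r// gt_eqF.
have [C HC] := rapid_bound 0 rapid_mol.
pose F (z : E) := p z * mol (a^-1 *: (x - z)).
have iF : L1 F.
  apply: (L1_Mb (c := C)) => //; last by move=> z; have := HC (a^-1 *: (x - z)); rewrite mul1r.
  apply: (@measurableT_comp _ _ _ _ _ _ mol); first exact: rapid_measurable rapid_mol.
  apply: (@measurableT_comp _ _ _ _ _ _ (fun z : E => a^-1 *: z)); first exact: measurable_scale_rV.
  rewrite (_ : (fun z => x - z) = (fun z : E => z + x) \o (fun z : E => - z)).
    by apply: measurableT_comp; [exact: measurable_addr_rV|exact: measurable_opp_rV].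
  by apply/funext => z /=; rewrite addrC.
transitivity (a^-1 ^+ d * \int[mu]_z F z).
  by rewrite -RintZ//; apply: eq_Rintegral => z _; rewrite /F mulrCA.
rewrite -(Rintegral_addr x iF) -(Rintegral_opp (L1_addr x iF)) -(Rintegral_scale a0 (L1_opp (L1_addr x iF))).
apply: eq_Rintegral => z _; rewrite /F addrC; congr (p _ * mol _).
by rewrite opprB addrCA subrr addr0 scalerA mulVf ?scale1r// gt_eqF.
Qed.

Lemma cutoff_hart_testf a p : 0 < a -> rapid p -> testf (fun y => cutoff (a *: y) * hart p y).
Proof.
move=> a0 rp; have rhp : rapid (hart p) by apply: rapid_hart; exists p.
have := testfM (rapid_smooth rhp) (cutoff_testf a0).
by congr testf; apply/funext => y; rewrite mulrC.
Qed.

Lemma rapid_mollify a p : 0 < a -> rapid p -> rapid (mollify a p).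
Proof.
move=> a0 rp; rewrite (_ : mollify a p = hart (fun y => cutoff (a *: y) * hart p y)); last first.
  by apply/funext => x; rewrite hart_cutoff.
apply: rapid_hart; exists (fun y => cutoff (a *: y) * hart p y) => //; apply: testf_rapid.
exact: cutoff_hart_testf.
Qed.

Let L1_mollify a p x : rapid p -> L1 (fun z => p (x - a *: z) * mol z).
Proof.
move=> rp; have [C HC] := rapid_bound 0 rp.
have := L1_Mb (rapid_L1 rapid_mol) (k := fun z => p (x - a *: z)) (c := C).
have mm : measurable_fun setT (fun z : E => p (x - a *: z)).
  apply: (@measurableT_comp _ _ _ _ _ _ p); first exact: rapid_measurable.
  rewrite (_ : (fun z => x - a *: z) = (fun z : E => z + x) \o (fun z : E => (- a) *: z)).
    by apply: measurableT_comp; [exact: measurable_addr_rV|exact: measurable_scale_rV].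
  by apply/funext => z /=; rewrite addrC scaleNr.
move=> /(_ mm) H; have : L1 (fun x0 => mol x0 * p (x - a *: x0)).
  by apply: H => z; have := HC (x - a *: z); rewrite mul1r.
by congr L1; apply/funext => z; rewrite mulrC.
Qed.

Lemma pderiv_mollify a p j : rapid p -> pderiv j (mollify a p) = mollify a (pderiv j p).
Proof.
move=> rp; have [_ dp _] := smoothP (rapid_smooth rp).
have rp' := rapid_pderiv j rp; have [C HC] := rapid_bound 0 rp'.
pose F (x z : E) := p (x - a *: z) * mol z.
have H x z : derivable (F ^~ z) x (delta_mx ord0 j) /\
    'D_(delta_mx ord0 j) (F ^~ z) x = pderiv j p (x - a *: z) * mol z.
  have [d1 d2] := derivable_affine 1 (- (a *: z)) x (fun y => dp j y).
  have e : (fun x : E => p (1 *: x + - (a *: z))) = (fun x => p (x - a *: z)).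
    by apply/funext => w; rewrite scale1r.
  rewrite e in d1 d2; split; first exact: (derivableM d1 (@derivable_cst _ _ _ _ _ _)).
  have := @pderivM R d j (fun x => p (x - a *: z)) (cst (mol z)) x d1 (@derivable_cst _ _ _ _ _ _).
  rewrite [X in _ * X + _]derive_cst mulr0 add0r d2 scale1r mul1r mulrC => <-//.
have [_ D2] := @derive_Rintegral R E _ _ mu F (fun z => C * `|mol z|)
  (fun x => L1_int (L1_mollify a x rp)) (L1_int (L1Z C (L1_norm (rapid_L1 rapid_mol))))
  (delta_mx ord0 j) (fun x z => (H x z).1)
  (ltac:(move=> x z; rewrite (H x z).2 normrM ler_wpM2r//; have := HC (x - a *: z); by rewrite mul1r)).
rewrite [LHS]D2.
by apply/funext => x; apply: eq_Rintegral => z _; rewrite (H x z).2.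
Qed.

Lemma pderivs_mollify a p l : rapid p ->
  pderivs l (mollify a p) = mollify a (pderivs l p) /\ rapid (pderivs l p).
Proof.
move=> rp; elim: l => [//|j l [IH1 IH2]]; split => /=; last exact: rapid_pderiv.
by rewrite IH1 pderiv_mollify.
Qed.

(** A rate of order a in every polynomially weighted sup norm: the mean value inequality gives the
    factor a |z|, and the moments of the Schwartz mollifier absorb the powers of 1 + |z| coming from
    [onep_euclD]. *)
Lemma mollify_cvg p (k : nat) : rapid p -> exists C, forall a x, 0 < a <= 1 ->
  (1 + eucl x) ^+ k * `|mollify a p x - hart_cst * p x| <= C * a.
Proof.
move=> rp; have im := rapid_L1 rapid_mol.
have [_ dp _] := smoothP (rapid_smooth rp).
have /choice[c Hc] : forall j, exists C, forall x, (1 + eucl x) ^+ k * `|pderiv j p x| <= C.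
  by move=> j; apply: rapid_bound; exact: rapid_pderiv.
pose C := \sum_j `|c j|.
have HC j x : (1 + eucl x) ^+ k * `|pderiv j p x| <= C.
  apply: (le_trans (Hc j x)); apply: (le_trans (ler_norm _)).
  by rewrite /C (bigD1 j)//= lerDl sumr_ge0.
have C0 : 0 <= C by apply: sumr_ge0.
pose G (z : E) := (1 + eucl z) ^+ k.+1 * `|mol z|.
have iG : L1 G by exact: rapid_moment rapid_mol.
have eZ a (z : E) : 0 < a <= 1 -> eucl (a *: z) = a * eucl z.
  move=> /andP[a0 _].
  rewrite -[RHS]ger0_norm ?mulr_ge0 ?(ltW a0) ?eucl_ge0// -sqrtr_sqr; congr Num.sqrt.
  by rewrite exprMn eucl_sqr dotpZl dotpC dotpZl mulrA.
exists (d%:R * 2 ^+ k * C * \int[mu]_z G z) => a x a01; have /andP[a0 a1] := a01.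
have e0 (y : E) : 0 < 1 + eucl y by rewrite ltr_pwDl// eucl_ge0.
have key z : `|(p (x - a *: z) - p x) * mol z| <=
   ((1 + eucl x) ^- k * (d%:R * 2 ^+ k * C * a)) * G z.
  set M := (1 + eucl x) ^- k * (2 ^+ k * (1 + eucl z) ^+ k * C).
  have M0 : 0 <= M.
    by rewrite mulr_ge0 ?invr_ge0 ?mulr_ge0// ?exprn_ge0// ltW.
  have := @increment_le R d p x (- (a *: z)) M M0 dp.
  rewrite euclN eZ// => H.
  rewrite normrM; apply: (@le_trans _ _ (d%:R * (a * eucl z * M) * `|mol z|)).
    rewrite ler_wpM2r//; apply: H => w j wz.
    rewrite /M mulrC ler_pdivlMr ?exprn_gt0// mulrC.
    apply: (@le_trans _ _ (2 ^+ k * (1 + eucl z) ^+ k * ((1 + eucl (x + w)) ^+ k * `|pderiv j p (x + w)|))); last first.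
      by rewrite ler_wpM2l ?HC// mulr_ge0// exprn_ge0// ltW.
    rewrite mulrA ler_wpM2r// -!exprMn; apply: lerXn2r; rewrite ?nnegrE.
    - exact: ltW.
    - by rewrite !mulr_ge0// ltW.
    have := onep_euclD (x + w) (- w); rewrite addrK euclN => /le_trans; apply.
    rewrite [2 * _]mulrA [X in _ <= X]mulrAC ler_wpM2l//.
      by rewrite mulr_ge0// ltW.
    by rewrite lerD2l (le_trans wz)// ler_piMl// eucl_ge0.
  rewrite /M /G exprS.
  rewrite [X in _ <= X](_ : _ = d%:R * (a * (1 + eucl z) * ((1 + eucl x) ^- k * (2 ^+ k * (1 + eucl z) ^+ k * C))) * `|mol z|); last by ring.
  rewrite ler_wpM2r// ler_wpM2l// ler_wpM2r// ler_wpM2l ?(ltW a0)//.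
  by rewrite lerDr.
have iA := L1_mollify a x rp.
have iK : L1 (fun z => p x * mol z) by exact: L1Z.
have E1 : mollify a p x - hart_cst * p x = \int[mu]_z ((p (x - a *: z) - p x) * mol z).
  rewrite /mollify /hart_cst [_ * p x]mulrC -RintZ// -RintB//.
  by apply: eq_Rintegral => z _; rewrite mulrBl.
rewrite E1 mulrC -ler_pdivlMr ?exprn_gt0//.
have iD : L1 (fun z => (p (x - a *: z) - p x) * mol z).
  by have := L1B iA iK; congr L1; apply/funext => z; rewrite mulrBl.
apply: (le_trans (Rint_norm_le iD (L1Z _ iG) key)).
rewrite RintZ//; apply: le_of_eq; ring.
Qed.

Lemma Rint_dominated (F : nat -> E -> R) (f G : E -> R) : (forall n, measurable_fun setT (F n)) ->
  L1 f -> (forall x, (fun n => F n x) @ \oo --> f x) -> (forall n x, `|F n x| <= G x) -> L1 G ->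
  (fun n => \int[mu]_x F n x) @ \oo --> \int[mu]_x f x.
Proof.
move=> mF [if_] Ff FG [iG]; apply: fine_cvg; rewrite fineK; last first.
  by rewrite (integrable_fin_num _ if_).
apply: (@dominated_cvg _ _ _ mu setT measurableT (fun n y => (F n y)%:E) _ (EFin \o G)) => //.
- by move=> n; exact/measurable_EFinP.
- by move=> y _; apply/fine_cvgP; split; [exact: nearW|exact: Ff].
- by move=> n y _; rewrite lee_fin.
Qed.

Lemma continuousM_rV (f g : E -> R) : continuous f -> continuous g -> continuous (fun x : E => f x * g x).
Proof. by move=> cf cg x; exact: (cvgM (cf x) (cg x)). Qed.

Lemma measurable_open_box (a b : E) : measurable [set x : E | forall i, a ord0 i < x ord0 i < b ord0 i].
Proof.
rewrite (_ : [set x | _] = \big[setI/setT]_i ((fun x : E => x ord0 i) @^-1` `]a ord0 i, b ord0 i[)); last first.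
  apply/seteqP; split=> x.
    by move=> H; rewrite -bigcap_seq => i _ /=; rewrite in_itv /=; exact: H.
  rewrite -bigcap_seq => H i; have := H i (mem_index_enum i).
  by rewrite /= in_itv.
apply: bigsetI_measurable => i _; rewrite -[X in measurable X]setTI.
by apply: measurable_coord => //; exact: measurable_itv.
Qed.

Lemma measure_open_box (a b : E) : (forall i, a ord0 i < b ord0 i) ->
  (\int[mu]_x (\1_[set x : E | forall i, (a ord0 i < x ord0 i < b ord0 i)%R] x)%:E =
   (\prod_i (b ord0 i - a ord0 i))%:E)%E.
Proof.
move=> ab.
rewrite (_ : (fun x : E => _) = fun x : E => (\prod_i (\1_(`]a ord0 i, b ord0 i[ : set R) (x ord0 i))%:E)%E); last first.
  apply/funext => x; rewrite indicE.
  case: (boolP (_ \in _)) => [|]; rewrite ?inE ?notin_setE /= => H.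
    rewrite big1// => i _; rewrite indicE mem_set//=; by rewrite in_itv /=; exact: H.
  move/existsNP: H => [i Hi]; rewrite (bigD1 i)//= indicE memNset ?mul0e//.
rewrite (@integral_prod_coord R d (fun i t => (\1_(`]a ord0 i, b ord0 i[ : set R) t)%:E)); last 2 first.
- by move=> i; apply/measurable_EFinP; exact: measurable_indic.
- by move=> i t; rewrite lee_fin.
rewrite (_ : (\prod_i _)%:E = \prod_i (b ord0 i - a ord0 i)%:E)%E; last first.
  by elim: (index_enum _) => [|i s IH]; rewrite ?big_nil// !big_cons EFinM IH.
apply: eq_bigr => i _; rewrite integral_indic// setIT.
apply: (etrans (@lebesgue_measure_itv R `]a ord0 i, b ord0 i[)).
by rewrite /= lte_fin ab EFinB.
Qed.

(** By continuity h stays above half of its value at [x0] on a box, whose volume is known. *)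
Lemma Rint_gt0 h (x0 : E) : L1 h -> continuous h -> (forall x, 0 <= h x) -> 0 < h x0 ->
  0 < \int[mu]_x h x.
Proof.
move=> ih ch h0 hx0.
have /cvgrPdist_lt/(_ (h x0 / 2)) := ch x0; rewrite divr_gt0// => /(_ isT).
move=> /nbhs_ballP[r /= r0 Hr].
pose a : E := \row_i (x0 ord0 i - r); pose b : E := \row_i (x0 ord0 i + r).
pose B := [set x : E | forall i, a ord0 i < x ord0 i < b ord0 i].
have ab i : a ord0 i < b ord0 i by rewrite !mxE; lra.
have mB : measurable B by exact: measurable_open_box.
have BH x : B x -> h x0 / 2 <= h x.
  move=> Bx; have : ball x0 r x.
    split=> // i j; rewrite (ord1 i) /ball /= ltr_norml.
    have := Bx j; rewrite !mxE; lra.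
  by move=> /Hr /= /ltr_normlW; lra.
have iB : (\int[mu]_x (\1_B x)%:E = (\prod_i (b ord0 i - a ord0 i))%:E)%E by exact: measure_open_box.
have LB : L1 (fun x => \1_B x).
  apply: L1P; first exact: measurable_indic.
  rewrite (_ : (fun x => _) = fun x => (\1_B x)%:E) ?iB ?ltry//.
  by apply/funext => x; rewrite ger0_norm// indicE.
apply: (@lt_le_trans _ _ (\int[mu]_x (h x0 / 2 * \1_B x))); last first.
  apply: le_Rint => //; first exact: L1Z.
  move=> x; rewrite indicE; case: (boolP (x \in B)) => [|_]; last by rewrite mulr0.
  by rewrite inE => /BH; rewrite mulr1.
rewrite RintZ// mulr_gt0 ?divr_gt0// /Rintegral iB /= prodr_gt0// => i _.
by rewrite subr_gt0.
Qed.

Lemma L1_compact q : continuous q -> compactly_supported q -> L1 q.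
Proof.
move=> cq kq; have [C HC] := testf_bounded cq kq; have [r Hr] := kq.
apply: (@L1_decay _ _ _ ((1 + Num.max 0 r) ^+ d.+1 * C)).
  exact: continuous_measurable_rV.
move=> x; have [rx|xr] := ltP r (eucl x).
  by rewrite Hr// normr0 mulr0 mulr_ge0 ?exprn_ge0 ?addr_ge0 ?le_max ?lexx// (le_trans _ (HC x)).
apply: ler_pM => //; first by rewrite exprn_ge0// addr_ge0// eucl_ge0.
apply: lerXn2r; rewrite ?nnegrE ?addr_ge0 ?eucl_ge0 ?le_max ?lexx//.
by rewrite lerD2l le_max xr orbT.
Qed.

(** Where the function is positive it remains so on a box, and a bump supported there has a positive
    pairing with it; the opposite sign is treated through -h. *)
Lemma continuous_test_inj h : continuous h ->
  (forall p, testf p -> \int[mu]_x (h x * p x) = 0) -> forall x, h x = 0.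
Proof.
suff H k x0 : continuous k -> (forall p, testf p -> \int[mu]_x (k x * p x) = 0) -> ~ 0 < k x0.
  move=> ch Hp x0; have h1 := H h x0 ch Hp.
  have h2 : ~ 0 < - h x0.
    apply: (H (fun x => - h x) x0); first by move=> x; exact: (continuousN (@ch x)).
    move=> p tp; rewrite -[RHS]oppr0 -(Hp p tp) -RintN.
      by apply: eq_Rintegral => x _; rewrite mulNr.
    have [sp [r Hr]] := tp; apply: L1_compact.
      exact: continuousM_rV ch (smooth_continuous sp).
    by exists r => x /Hr ->; rewrite mulr0.
  by case: (ltgtP (h x0) 0) => // h0; case: h2; rewrite oppr_gt0.
move=> ck Hp k0.
have /cvgrPdist_lt/(_ (k x0)) := ck x0; rewrite k0 => /(_ isT).
move=> /nbhs_ballP[r /= r0 Hr].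
pose a : E := \row_i (x0 ord0 i - r); pose b : E := \row_i (x0 ord0 i + r).
have tb : testf (box_bump a b 1) by exact: testf_box_bump.
have := Hp _ tb; apply/eqP; rewrite gt_eqF//; have [sb [s Hs]] := tb.
have ckb : continuous (fun x => k x * box_bump a b 1 x).
  exact: continuousM_rV ck (smooth_continuous sb).
apply: (@Rint_gt0 _ x0) => //.
- by apply: L1_compact => //; exists s => x /Hs ->; rewrite mulr0.
- move=> x; case: (pselect (forall i, a ord0 i < x ord0 i < b ord0 i)) => [ab|].
    apply: mulr_ge0; last exact: box_bump_ge0.
    have : ball x0 r x.
      split=> // i j; rewrite (ord1 i) /ball /= ltr_norml.
      have := ab j; rewrite !mxE; lra.
    by move=> /Hr /= /ltr_normlW; lra.
  by move=> /existsNP[i /negP Hi]; rewrite (box_bump_eq0 _ Hi)// mulr0.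
by rewrite mulr_gt0// box_bump_gt0// => i; rewrite !mxE; lra.
Qed.

(** Its value is 1 for this kernel, but it is carried as a symbol; only [hcst_neq0] is
    established. *)
Definition hcst : R := hart_cst.

(** The transforms of the cut-off transforms tend to the double transform by dominated convergence;
    they are also mollifications, which tend to [hcst] times p. *)
Lemma hart_hart p x : rapid p -> hart (hart p) x = hcst * p x.
Proof.
move=> rp; have rh : rapid (hart p) by apply: rapid_hart; exists p.
have ih := rapid_L1 rh; have [C HC] := cutoff_bounded.
pose a (n : nat) : R := n.+1%:R^-1.
have a0 n : 0 < a n by rewrite invr_gt0.
have a1 n : 0 < a n <= 1 by rewrite a0 invf_le1// ler1n.
have mc n : measurable_fun setT (fun y : E => cutoff (a n *: y)).
  by apply: rapid_measurable; apply: testf_rapid; exact: cutoff_testf.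
have L1 : (fun n => mollify (a n) p x) @ \oo --> hart (hart p) x.
  rewrite (_ : (fun n => _) = fun n => \int[mu]_y (cutoff (a n *: y) * hart p y * kern x y)); last first.
    by apply/funext => n; rewrite -hart_cutoff.
  apply: (@Rint_dominated _ _ (fun y => C * (2 * `|hart p y|))).
  - move=> n; apply: measurable_funM; last exact: measurable_kern.
    by apply: measurable_funM => //; exact: rapid_measurable.
  - exact: L1_kern.
  - move=> y; suff : (fun n => cutoff (a n *: y) * hart p y * kern x y) @ \oo -->
        (1 * hart p y * kern x y : R) by rewrite mul1r.
    exact: (cvgM (cvgM (cutoff_cvg y) (cvg_cst _)) (cvg_cst _)).
  - move=> n y; rewrite normrM [`|cutoff _ * _|]normrM -mulrA; apply: ler_pM => //.
    by rewrite mulrC ler_wpM2r// kern_le2.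
  - exact/L1Z/L1Z/L1_norm.
have L2 : (fun n => mollify (a n) p x) @ \oo --> hcst * p x.
  have [D HD] := mollify_cvg 0 rp.
  apply/cvgrPdist_le => e e0; near=> n.
  rewrite distrC; have := HD (a n) x (a1 n); rewrite mul1r => /le_trans; apply.
  apply: (@le_trans _ _ ((`|D| + 1) * a n)).
    by rewrite ler_wpM2r ?(ltW (a0 n))// (le_trans (ler_norm D))// lerDl.
  rewrite -ler_pdivlMl; last by rewrite ltr_wpDl.
  rewrite ltW//; near: n; apply: (@near_infty_natSinv_lt R (PosNum _)).
  by rewrite mulr_gt0// invr_gt0 ltr_wpDl.
exact: (cvg_unique _ L1 L2).
Unshelve. all: by end_near. Qed.

(** Otherwise self-adjointness would give int (hart p)^2 = int p (hart (hart p)) = 0 for the cutoff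
    p, although [hart p 0] is the integral of p and is positive. *)
Lemma hcst_neq0 : hcst != 0.
Proof.
apply/eqP => K0; pose p : E -> R := cutoff.
have tp : testf p := testf_cutoff; have rp := testf_rapid tp.
have rh : rapid (hart p) by apply: rapid_hart; exists p.
have ip := rapid_L1 rp; have ih := rapid_L1 rh.
have p0 x : 0 <= p x by rewrite /p /cutoff mulr_ge0// ?invr_ge0 box_bump_ge0.
have h0 : 0 < hart p 0.
  rewrite (_ : hart p 0 = \int[mu]_x p x); last first.
    apply: eq_Rintegral => y _.
    by rewrite /kern -(scale0r (0 : E)) dotpZl mul0r mulr0 /cas cos0 sin0 addr0 mulr1.
  apply: (@Rint_gt0 _ 0) => //; first exact/smooth_continuous/rapid_smooth.
  by rewrite /p cutoff0.
have ch := smooth_continuous (rapid_smooth rh).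
have : 0 < \int[mu]_x (hart p x * hart p x).
  apply: (@Rint_gt0 _ 0).
  - have [C HC] := rapid_bound 0 rh; apply: (L1_Mb (c := C)) => //.
      exact: rapid_measurable.
    by move=> x; have := HC x; rewrite mul1r.
  - exact: continuousM_rV.
  - by move=> x; rewrite -expr2 sqr_ge0.
  - by rewrite mulr_gt0.
have -> : \int[mu]_x (hart p x * hart p x) = \int[mu]_x (0 * p x).
  by rewrite hart_dual//; apply: eq_Rintegral => x _; rewrite hart_hart// K0 !mul0r mulr0.
by rewrite RintZ// mul0r ltxx.
Qed.

(** A pi-lambda argument: the sets over which h integrates to 0 form a lambda-system; it contains
    the open boxes, as limits of bumps, and these are stable under intersection and generate the
    sigma-algebra. *)
Lemma L1_test_inj h : L1 h -> (forall p, testf p -> \int[mu]_x (h x * p x) = 0) ->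
  {ae mu, forall x, h x = 0}.
Proof.
move=> ih Hp.
pose box (a b : E) := [set x : E | forall i, a ord0 i < x ord0 i < b ord0 i].
pose G := [set A | exists a b, A = box a b].
pose H := [set A : set E | measurable A /\ \int[mu]_x (h x * \1_A x) = 0].
have mG A : G A -> measurable A by move=> [a [b ->]]; exact: measurable_open_box.
have ihA A : measurable A -> L1 (fun x => h x * \1_A x).
  move=> mA; apply: (L1_Mb (c := 1)) => //.
  by move=> x; rewrite indicE ger0_norm// lern1 leq_b1.
have lim (A : nat -> set E) B : (forall n, measurable (A n)) -> measurable B ->
    (forall x, (fun n => \1_(A n) x : R) @ \oo --> (\1_B x : R)) ->
    (fun n => \int[mu]_x (h x * \1_(A n) x)) @ \oo --> \int[mu]_x (h x * \1_B x).
  move=> mA mB AB; apply: (@Rint_dominated _ _ (fun x => `|h x|)).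
  - by move=> n; apply: L1_measurable; exact: ihA.
  - exact: ihA.
  - by move=> x; exact: (cvgM (cvg_cst _) (AB x)).
  - by move=> n x; rewrite normrM ler_piMr// indicE ger0_norm// lern1 leq_b1.
  - exact: L1_norm.
have GH : G `<=` H.
  move=> _ [a [b ->]]; split; first exact: measurable_open_box.
  have L : (fun n : nat => \int[mu]_x (h x * box_bump a b n.+1%:R x)) @ \oo -->
      \int[mu]_x (h x * \1_(box a b) x).
    apply: (@Rint_dominated _ _ (fun x => `|h x|)).
    - move=> n; apply: measurable_funM; first exact: L1_measurable.
      by apply: rapid_measurable; apply: testf_rapid; exact: testf_box_bump.
    - by apply: ihA; exact: measurable_open_box.
    - move=> x; have := @box_bump_cvg R d a b x => c; apply: (cvgM (cvg_cst _)).
      move: c; rewrite indicE.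
      by case: asboolP => ab; [rewrite mem_set|rewrite memNset].
    - by move=> n x; rewrite normrM ler_piMr// ger0_norm ?box_bump_ge0 ?box_bump_le1.
    - exact: L1_norm.
  apply/esym/(cvg_unique _ _ L) => //.
  rewrite (_ : (fun n => _) = cst 0); first exact: cvg_cst.
  by apply/funext => n; apply: Hp; exact: testf_box_bump.
have setIG : setI_closed G.
  move=> _ _ [a [b ->]] [a' [b' ->]].
  exists (\row_i Num.max (a ord0 i) (a' ord0 i)), (\row_i Num.min (b ord0 i) (b' ord0 i)).
  apply/seteqP; split=> x /=.
    by move=> [h1 h2] i; rewrite !mxE gt_max lt_min; have /andP[-> ->] := h1 i; have /andP[-> ->] := h2 i.
  move=> h1; split=> i; have := h1 i; rewrite !mxE gt_max lt_min => /andP[/andP[h2 h3] /andP[h4 h5]].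
    by rewrite h2 h4.
  by rewrite h3 h5.
have ndlim (F : nat -> set E) : nondecreasing_seq F -> (forall n, H (F n)) -> H (\bigcup_n F n).
  move=> ndF HF; have mF n : measurable (F n) := (HF n).1.
  have mB : measurable (\bigcup_n F n) by exact: bigcup_measurable.
  split => //; have := lim F _ mF mB.
  have AB x : (fun n => \1_(F n) x : R) @ \oo --> (\1_(\bigcup_n F n) x : R).
    case: (pselect ((\bigcup_n F n) x)) => [Bx|nB].
      have [n _ Fn] := Bx; apply: cvg_near_cst; exists n => // m /= nm.
      rewrite !indicE mem_set ?mem_set//.
      by move: x Fn {Bx}; apply/subsetPset/ndF.
    rewrite (_ : (fun n => _) = cst (\1_(\bigcup_n F n) x)); first exact: cvg_cst.
    apply/funext => n /=; rewrite !indicE !memNset// => Fn; apply: nB; by exists n.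
  move=> /(_ AB); rewrite (_ : (fun n => _) = cst 0); last first.
    by apply/funext => n; exact: (HF n).2.
  by move=> L; apply/esym/(cvg_unique _ _ L) => //; exact: cvg_cst.
have lH : lambda_system setT H.
  split.
  - by [].
  - pose F n := box (const_mx (- n%:R)) (const_mx (n%:R)).
    have -> : setT = \bigcup_n F n.
      apply/seteqP; split=> // x _.
      pose n := (Num.truncn (eucl x)).+1.
      exists n => // i; rewrite !mxE -ltr_norml (le_lt_trans (coord_le_eucl x i))//.
      exact: truncnS_gt.
    apply: ndlim; last by move=> n; apply: GH; exists (const_mx (- n%:R)), (const_mx n%:R).
    move=> n m nm; apply/subsetPset => x Fx i; have := Fx i; rewrite !mxE => /andP[x1 x2].
    have : (n%:R : R) <= m%:R by rewrite ler_nat.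
    by move=> nm'; rewrite (le_lt_trans _ x1) ?lerN2// (lt_le_trans x2).
  - move=> A B BA [mA HA] [mB HB]; have mAB := measurableD mA mB; split=> //.
    rewrite -[RHS](subrr 0) -{1}HA -HB -RintB; [|exact: ihA|exact: ihA].
    apply: eq_Rintegral => x _; rewrite -mulrBr; congr (_ * _).
    rewrite !indicE in_setD; case: (boolP (x \in B)) => [xB|_]; last by rewrite andbT subr0.
    by rewrite andbF mem_set ?subrr//; apply: BA; exact: set_mem.
  - by move=> F ndF HF; exact: ndlim.
have HM (A : set E) : measurable A -> H A.
  have sub : <<s G >> `<=` H by apply: (lambda_system_subset setIG lH GH).
  move=> mA; apply: sub.
  suff : measurable_fun [set: g_sigma_algebraType G] (fun x : g_sigma_algebraType G => (x : E)).
    by move=> /(_ measurableT _ mA); rewrite setTI preimage_id.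
  apply: measurable_fun_coordP => i.
  apply: (measurability _ (RGenInftyO.measurableE R)) => // _ [_ [r ->] <-].
  rewrite setTI.
  (* A coordinate half-space is exhausted by open boxes. *)
  pose F n := box (const_mx (- n%:R)) (\row_j if j == i then Num.min r n%:R else n%:R).
  rewrite (_ : _ @^-1` _ = \bigcup_n F n).
    apply: bigcup_measurable => n _; apply: sub_sigma_algebra.
    by exists (const_mx (- n%:R)), (\row_j if j == i then Num.min r n%:R else n%:R).
  apply/seteqP; split=> x /=.
    rewrite in_itv /= => xr; pose n := (Num.truncn (eucl x)).+1.
    have xn j : - n%:R < x ord0 j < n%:R.
      rewrite -ltr_norml (le_lt_trans (coord_le_eucl x j))//; exact: truncnS_gt.
    exists n => // j; rewrite !mxE; have /andP[-> h2] := xn j.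
    by case: eqP => [ji|//]; rewrite lt_min h2 ji xr.
  move=> [n _ /(_ i)]; rewrite !mxE eqxx lt_min in_itv /= => /andP[_ /andP[]//].
have /integral_ae_eq : mu.-integrable setT (EFin \o h) := L1_int ih.
move=> /(_ measurableT (cst 0%E)); case.
- exact: measurable_cst.
- move=> A _ mA; have [_ HA] := HM A mA.
  have := EFin_Rint (ihA A mA); rewrite HA => e.
  rewrite integral0 integral_mkcond [RHS]e; apply: eq_integral => x _.
  rewrite /patch indicE; case: ifP => xA; by rewrite ?mulr1 ?mulr0.
move=> N [mN N0 HN]; exists N; split => // x /= hx; apply: HN => /= /(_ Logic.I) [].
exact: hx.
Qed.

End inversion.

(** * From Fourier densities of distributions to Hartley transforms *)

Section transform.
Context {R : realType} {d : nat}.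
Local Notation E := 'rV[R]_d.
Local Notation mu := (@lebesgue_rV R d).
Local Notation hcst := (@hcst R d).
Implicit Types (h k p q u : E -> R) (f : schwartz R d -> R).

Definition ihart h (x : E) : R := hcst^-1 * hart h x.

Definition functional u : schwartz R d -> R := fun p : schwartz R d => \int[mu]_x (u x * p x).

Definition evenp h (x : E) : R := 2^-1 * (h x + h (- x)).
Definition oddp h (x : E) : R := 2^-1 * (h x - h (- x)).

Lemma evenpN h x : evenp h (- x) = evenp h x.
Proof. by rewrite /evenp opprK addrC. Qed.
Lemma oddpN h x : oddp h (- x) = - oddp h x.
Proof. by rewrite /oddp opprK -mulrN opprB. Qed.
Lemma evenpDoddp h x : evenp h x + oddp h x = h x.
Proof. rewrite /evenp /oddp; by field. Qed.
Lemma L1_evenp h : L1 h -> L1 (evenp h).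
Proof. by move=> ih; apply/L1Z/L1D => //; exact: L1_opp. Qed.
Lemma L1_oddp h : L1 h -> L1 (oddp h).
Proof. by move=> ih; apply/L1Z/L1B => //; exact: L1_opp. Qed.
Lemma rapid_evenp p : rapid p -> rapid (evenp p).
Proof. by move=> rp; apply/rapidZ/rapidD => //; exact: rapid_opp. Qed.
Lemma rapid_oddp p : rapid p -> rapid (oddp p).
Proof. by move=> rp; apply/rapidZ/rapidB => //; exact: rapid_opp. Qed.

Lemma hart_evenp h x : L1 h -> hart (evenp h) x = evenp (hart h) x.
Proof.
move=> ih; have io := L1_opp ih; rewrite /evenp hartZ; last exact: L1D.
by rewrite hartD// hart_opp.
Qed.

Lemma hart_oddp h x : L1 h -> hart (oddp h) x = oddp (hart h) x.
Proof.
move=> ih; have io := L1_opp ih; rewrite /oddp hartZ; last exact: L1B.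
rewrite hartD//; last exact: L1N.
have := hartZ (-1) x io; rewrite (_ : (fun y => -1 * h (- y)) = fun y => - h (- y)).
  by move=> ->; rewrite hart_opp// mulN1r.
by apply/funext => y; rewrite mulN1r.
Qed.

(** The reflection x -> -x moves the parity projection from one factor to the other; e = 1 gives the
    even part and e = -1 the odd one. *)
Lemma Rint_parity (e : R) h k : L1 h -> measurable_fun setT k -> (exists C, forall x, `|k x| <= C) ->
  \int[mu]_x (h x * (2^-1 * (k x + e * k (- x)))) = \int[mu]_x (2^-1 * (h x + e * h (- x)) * k x).
Proof.
move=> ih mk [C HC].
have mko : measurable_fun setT (fun x : E => k (- x)).
  by apply: measurableT_comp => //; exact: measurable_opp_rV.
have i1 : L1 (fun x => h x * k x) by exact: (L1_Mb ih mk HC).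
have i2 : L1 (fun x => h x * k (- x)) by apply: (L1_Mb ih mko (c := C)) => x; exact: HC.
have i3 : L1 (fun x => h (- x) * k x) by exact: (L1_Mb (L1_opp ih) mk HC).
have j2 : L1 (fun x => e * (h x * k (- x))) by exact: L1Z.
have j3 : L1 (fun x => e * (h (- x) * k x)) by exact: L1Z.
transitivity (2^-1 * (\int[mu]_x (h x * k x) + e * \int[mu]_x (h x * k (- x)))).
  rewrite -RintZ// -RintD// -RintZ; last exact: L1D.
  by apply: eq_Rintegral => x _; ring.
rewrite -[X in _ + _ * X]Rintegral_opp//.
rewrite (_ : \int[mu]_x (h (- x) * k (- - x)) = \int[mu]_x (h (- x) * k x)); last first.
  by apply: eq_Rintegral => x _; rewrite opprK.
rewrite -RintZ// -RintD// -RintZ; last exact: L1D.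
by apply: eq_Rintegral => x _; ring.
Qed.

Lemma Rint_evenp h k : L1 h -> measurable_fun setT k -> (exists C, forall x, `|k x| <= C) ->
  \int[mu]_x (h x * evenp k x) = \int[mu]_x (evenp h x * k x).
Proof.
move=> ih mk bk; have := Rint_parity 1 ih mk bk.
by congr (_ = _); apply: eq_Rintegral => x _; rewrite mul1r.
Qed.

Lemma Rint_oddp h k : L1 h -> measurable_fun setT k -> (exists C, forall x, `|k x| <= C) ->
  \int[mu]_x (h x * oddp k x) = \int[mu]_x (oddp h x * k x).
Proof.
move=> ih mk bk; have := Rint_parity (-1) ih mk bk.
by congr (_ = _); apply: eq_Rintegral => x _; rewrite mulN1r.
Qed.

Lemma continuous_sc (s : R -> R) (w : E) : continuous s -> measurable_fun setT (fun z : E => s (2 * pi * dotp w z)).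
Proof.
move=> cf; apply: measurableT_comp; first exact: continuous_measurable_fun.
by apply: measurable_funM => //; exact: measurable_dotpl.
Qed.

Lemma hart_cos_sin h x : L1 h -> evenp (hart h) x = \int[mu]_y (h y * cos (2 * pi * dotp x y)) /\
  oddp (hart h) x = \int[mu]_y (h y * sin (2 * pi * dotp x y)).
Proof.
move=> ih.
have ic : L1 (fun y => h y * cos (2 * pi * dotp x y)).
  apply: (L1_Mb ih (c := 1)); first exact: continuous_sc (@continuous_cos R).
  by move=> z; rewrite ler_norml cos_geN1 cos_le1.
have is_ : L1 (fun y => h y * sin (2 * pi * dotp x y)).
  apply: (L1_Mb ih (c := 1)); first exact: continuous_sc (@continuous_sin R).
  by move=> z; rewrite ler_norml sin_geN1 sin_le1.
have e1 : hart h x = \int[mu]_y (h y * cos (2 * pi * dotp x y)) + \int[mu]_y (h y * sin (2 * pi * dotp x y)).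
  by rewrite -RintD//; apply: eq_Rintegral => y _; rewrite -mulrDr.
have e2 : hart h (- x) = \int[mu]_y (h y * cos (2 * pi * dotp x y)) - \int[mu]_y (h y * sin (2 * pi * dotp x y)).
  rewrite -RintB//; apply: eq_Rintegral => y _.
  by rewrite -mulrBr /kern dotpNl mulrN casNE.
rewrite /evenp /oddp e1 e2; split; by field.
Qed.

Let step (n : nat) : R := n.+1%:R^-1.

Let step_gt0 n : 0 < step n. Proof. by rewrite invr_gt0. Qed.
Let step_itv n : 0 < step n <= 1. Proof. by rewrite step_gt0 invf_le1// ler1n. Qed.

(** All seminorms of [mollify (step n) q - hcst q] are O(1/n) by [mollify_cvg], and a tempered
    functional is controlled by finitely many of them. *)
Lemma tempered_mollify f q (rq : rapid q) (c : nat -> schwartz R d) (e : R) :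
  tempered f -> (forall n x, c n x = e * mollify (step n) q x) ->
  (fun n => f (c n)) @ \oo --> e * (hcst * f (mk_schwartz rq)).
Proof.
move=> tf ce; have [lf [k [C HC]]] := tf.
have rd n : rapid (fun x => - (e * hcst) * q x + c n x).
  by apply: rapidD; [exact: rapidZ|exact: schwartz_rapid].
pose r n := mk_schwartz (rd n).
have fr n : f (r n) = - (e * hcst) * f (mk_schwartz rq) + f (c n) by exact: lf.
have /choice[D HD] : forall l, exists D, forall a x, 0 < a <= 1 ->
    (1 + eucl x) ^+ k * `|mollify a (pderivs l q) x - hcst * pderivs l q x| <= D * a.
  by move=> l; apply: mollify_cvg; have [] := pderivs_mollify 1 l rq.
(* Lists of length at most k are enumerated as tuples, so that one constant dominates all the [D l]
   concerned. *)
pose DD := \sum_(m < k.+1) \sum_(t : m.-tuple 'I_d) `|D t|.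
have DDP l : (size l <= k)%N -> D l <= DD.
  move=> lk; rewrite /DD (bigD1 (Ordinal (lk : (size l < k.+1)%N)))//=.
  rewrite (bigD1 (in_tuple l))//= -addrA.
  apply: (le_trans (ler_norm _)); rewrite lerDl addr_ge0//.
    by apply: sumr_ge0.
  by apply: sumr_ge0 => i _; apply: sumr_ge0.
have DD0 : 0 <= DD by apply: sumr_ge0 => i _; apply: sumr_ge0.
have pr n l x : pderivs l (r n) x = e * (mollify (step n) (pderivs l q) x - hcst * pderivs l q x).
  have -> : (r n : E -> R) = fun x => e * (mollify (step n) q x - hcst * q x).
    by apply/funext => y /=; rewrite ce; ring.
  elim: l x => [//|j l IH] x /=.
  rewrite (_ : pderivs l _ = fun x => e * (mollify (step n) (pderivs l q) x - hcst * pderivs l q x)); last exact/funext.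
  have [_ rl] := pderivs_mollify (step n) l rq.
  have [_ dq _] := smoothP (rapid_smooth rl).
  have [_ dm _] := smoothP (rapid_smooth (rapid_mollify (step_gt0 n) rl)).
  have dA y : derivable (fun x => - hcst * pderivs l q x) y (delta_mx ord0 j).
    by apply: derivableM; [exact: derivable_cst|exact: dq].
  have dB y : derivable (fun x => mollify (step n) (pderivs l q) x + - hcst * pderivs l q x) y (delta_mx ord0 j).
    by apply: derivableD; [exact: dm|exact: dA].
  rewrite (_ : (fun x => e * _) = fun x => e * (mollify (step n) (pderivs l q) x + - hcst * pderivs l q x)); last first.
    by apply/funext => y; rewrite mulNr.
  rewrite pderivZ; last exact: dB.
  by rewrite pderivD ?pderivZ ?pderiv_mollify ?mulNr//.
have bnd n : `|f (r n)| <= C * (`|e| * (DD * step n)).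
  apply: HC => l x lk; rewrite pr normrM mulrCA ler_wpM2l//.
  apply: le_trans (HD l _ x (step_itv n)) _.
  by rewrite ler_wpM2r ?DDP// ltW.
apply/cvgrPdist_le => eps eps0; near=> n.
rewrite distrC (_ : f (c n) - _ = f (r n)); last by rewrite fr; ring.
apply: (le_trans (bnd n)); rewrite !mulrA.
apply: (@le_trans _ _ ((`|C * `|e| * DD| + 1) * step n)).
  by rewrite ler_wpM2r ?(ltW (step_gt0 n))// (le_trans (ler_norm _))// lerDl.
rewrite -ler_pdivlMl; last by rewrite ltr_wpDl.
rewrite ltW//; near: n; apply: (@near_infty_natSinv_lt R (PosNum _)).
by rewrite mulr_gt0// invr_gt0 ltr_wpDl.
Unshelve. all: by end_near. Qed.


Implicit Types w : E -> R.
Lemma rapid_bounded (p : E -> R) : rapid p -> exists C, forall x, `|p x| <= C.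
Proof. by move=> /(rapid_bound 0)[C HC]; exists C => x; have := HC x; rewrite mul1r. Qed.

Lemma schwartz0 : rapid (fun _ : E => 0).
Proof.
have := rapidZ 0 (testf_rapid (@testf_cutoff R d)).
by congr rapid; apply/funext => x; rewrite mul0r.
Qed.

Let sn (n : nat) : R := n.+1%:R^-1.

Let sn_gt0 n : 0 < sn n. Proof. by rewrite invr_gt0. Qed.

(** A Fourier density is tested on compactly supported functions only; these approximate [hart q],
    and their transforms are mollifications of q. *)
Let rho n (q : E -> R) (y : E) := cutoff (sn n *: y) * hart q y.

Let rho_testf n (q : E -> R) : rapid q -> testf (rho n q).
Proof. exact: cutoff_hart_testf. Qed.
Let hart_parity (e : R) k x : L1 k -> (forall x, k (- x) = e * k x) -> hart k (- x) = e * hart k x.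
Proof. by move=> ik ke; rewrite -hart_opp// -hartZ//; congr (hart _ x); apply/funext => y. Qed.
Let hart_rho n (q : E -> R) x : rapid q -> hart (rho n q) x = mollify (sn n) q x.
Proof. by move=> rq; apply: hart_cutoff. Qed.

Let mollify_parity (e : R) n (q : E -> R) x : rapid q -> (forall x, q (- x) = e * q x) ->
  mollify (sn n) q (- x) = e * mollify (sn n) q x.
Proof.
move=> rq qe; rewrite -!hart_rho//; apply: hart_parity; first exact: rapid_L1 (testf_rapid (rho_testf n rq)).
by move=> y; rewrite /rho scalerN cutoffN (hart_parity (e := e) _ (rapid_L1 rq))// mulrCA.
Qed.

Let density_limit f (q : E -> R) (rq : rapid q) k (e : R) (c : nat -> schwartz R d) : tempered f -> L1 k ->
  (forall n x, c n x = e * mollify (sn n) q x) -> (forall n, f (c n) = \int[mu]_x (k x * rho n q x)) ->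
  e * (hcst * f (mk_schwartz rq)) = \int[mu]_x (k x * hart q x).
Proof.
move=> tf ik cE fE; have rh : rapid (hart q) by apply: rapid_hart; exists q.
have L1 := tempered_mollify (rq := rq) tf cE; apply: (cvg_unique _ L1) => //.
rewrite (_ : (fun n => _) = fun n => \int[mu]_x (k x * rho n q x)); last exact/funext.
have [C HC] := @cutoff_bounded R d; have [D HD] := rapid_bounded rh.
apply: (@Rint_dominated _ _ _ _ (fun x => (C * D) * `|k x|)).
- move=> n; apply: measurable_funM; first exact: L1_measurable.
  exact: rapid_measurable (testf_rapid (rho_testf n rq)).
- exact: L1_Mb ik (rapid_measurable rh) HD.
- move=> x; suff : (fun n => k x * rho n q x) @ \oo --> (k x * (1 * hart q x) : R) by rewrite mul1r.
  exact: (cvgM (cvg_cst _) (cvgM (cutoff_cvg x) (cvg_cst _))).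
- by move=> n x; rewrite normrM mulrC ler_wpM2r// normrM ler_pM.
- exact/L1Z/L1_norm.
Qed.

(** For even q the sine transforms of the approximations vanish, so the pairing sees the real part
    of the density alone; for odd q it sees the imaginary part. *)
Lemma density_even f (q : E -> R) (rq : rapid q) (g : E -> R[i]) :
  tempered f -> fourier_density f g -> L1 (fun x => complex.Re (g x)) ->
  (forall x, q (- x) = q x) ->
  hcst * f (mk_schwartz rq) = \int[mu]_x (complex.Re (g x) * hart q x).
Proof.
move=> tf [_ fg] ig qe; have rm n := rapid_mollify (sn_gt0 n) rq.
rewrite -[LHS]mul1r; apply: (@density_limit _ _ _ _ _ (fun n => mk_schwartz (rm n))) => // [n x|n]; first by rewrite mul1r.
have tr := rho_testf n rq; have ir := rapid_L1 (testf_rapid tr).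
have mN x : mollify (sn n) q (- x) = mollify (sn n) q x.
  by rewrite (mollify_parity (e := 1)) ?mul1r// => y; rewrite mul1r.
have cE x : mollify (sn n) q x = \int[mu]_y (rho n q y * cos (2 * pi * dotp x y)).
  have [<- _] := hart_cos_sin x ir; rewrite /evenp !hart_rho// mN; by field.
have sE x : 0 = - \int[mu]_y (rho n q y * sin (2 * pi * dotp x y)).
  by have [_ <-] := hart_cos_sin x ir; rewrite /oddp !hart_rho// mN subrr mulr0 oppr0.
by have [] := fg (mk_schwartz (testf_rapid tr)) (mk_schwartz (rm n)) (mk_schwartz schwartz0) tr.2 cE sE.
Qed.

Lemma density_odd f (q : E -> R) (rq : rapid q) (g : E -> R[i]) :
  tempered f -> fourier_density f g -> L1 (fun x => complex.Im (g x)) ->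
  (forall x, q (- x) = - q x) ->
  hcst * f (mk_schwartz rq) = - \int[mu]_x (complex.Im (g x) * hart q x).
Proof.
move=> tf [_ fg] ig qo; have rm n := rapidZ (-1) (rapid_mollify (sn_gt0 n) rq).
rewrite -[LHS]opprK -[X in - X = _]mulN1r; congr (- _).
apply: (@density_limit _ _ _ _ _ (fun n => mk_schwartz (rm n))) => // n.
have tr := rho_testf n rq; have ir := rapid_L1 (testf_rapid tr).
have mN x : mollify (sn n) q (- x) = - mollify (sn n) q x.
  by rewrite (mollify_parity (e := -1)) ?mulN1r// => y; rewrite mulN1r.
have cE x : 0 = \int[mu]_y (rho n q y * cos (2 * pi * dotp x y)).
  by have [<- _] := hart_cos_sin x ir; rewrite /evenp !hart_rho// mN subrr mulr0.
have sE x : -1 * mollify (sn n) q x = - \int[mu]_y (rho n q y * sin (2 * pi * dotp x y)).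
  have [_ <-] := hart_cos_sin x ir; rewrite /oddp !hart_rho// mN; by field.
by have [] := fg (mk_schwartz (testf_rapid tr)) (mk_schwartz schwartz0) (mk_schwartz (rm n)) tr.2 cE sE.
Qed.

Lemma functional_ihart h p : L1 h -> rapid p ->
  \int[mu]_x (ihart h x * p x) = hcst^-1 * \int[mu]_x (h x * hart p x).
Proof.
move=> ih rp; have ip := rapid_L1 rp.
have ihp : L1 (fun x => hart h x * p x).
  have := L1_Mb ip (hart_measurable ih) (fun x => hart_bound x ih).
  by congr L1; apply/funext => x; rewrite mulrC.
rewrite -hart_dual// -RintZ//.
by apply: eq_Rintegral => x _; rewrite mulrA.
Qed.

(** The Hartley transform of a real distribution is Re F - Im F; the parity projections enforce
    pointwise the Hermitian symmetry of F. *)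
Definition hartley_density (g : E -> R[i]) (x : E) : R :=
  evenp (fun x => complex.Re (g x)) x - oddp (fun x => complex.Im (g x)) x.

(** Split the test function into its even and odd parts, apply the two preceding lemmas, and let
    [functional_ihart] recognise the pairing with [hart p] as an integral against a function. *)
Lemma density_functional f (g : E -> R[i]) :
  tempered f -> fourier_density f g ->
  L1 (fun x => complex.Re (g x)) -> L1 (fun x => complex.Im (g x)) ->
  f = functional (ihart (hartley_density g)).
Proof.
move=> tf fg ir ii; apply/funext => p.
have rp := schwartz_rapid p; have re := rapid_evenp rp; have ro := rapid_oddp rp.
have rh : rapid (hart p) by apply: rapid_hart; exists (p : E -> R).
have ih : L1 (hartley_density g) by apply: L1B; [exact: L1_evenp|exact: L1_oddp].
have fp : f p = f (mk_schwartz re) + f (mk_schwartz ro).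
  have [lf _] := tf; rewrite (lf 1 (mk_schwartz re) (mk_schwartz ro) p) ?mul1r// => x.
  by rewrite mul1r /= evenpDoddp.
rewrite /functional functional_ihart//.
apply: (mulfI (@hcst_neq0 R d)); rewrite mulrA divff ?hcst_neq0// mul1r fp mulrDr.
rewrite (density_even re tf fg ir) ?(density_odd ro tf fg ii); [|by move=> x; exact: oddpN|by move=> x; exact: evenpN].
have ip := rapid_L1 rp.
rewrite (_ : \int[mu]_x (complex.Re (g x) * _) = \int[mu]_x (complex.Re (g x) * evenp (hart p) x)); last first.
  by apply: eq_Rintegral => x _; rewrite hart_evenp.
rewrite (_ : \int[mu]_x (complex.Im (g x) * _) = \int[mu]_x (complex.Im (g x) * oddp (hart p) x)); last first.
  by apply: eq_Rintegral => x _; rewrite hart_oddp.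
have mh := rapid_measurable rh; have bh := rapid_bounded rh.
rewrite Rint_evenp// Rint_oddp//; have [C HC] := bh.
rewrite -RintB; [|exact: (L1_Mb (L1_evenp ir) mh HC)|exact: (L1_Mb (L1_oddp ii) mh HC)].
by apply: eq_Rintegral => x _; rewrite -mulrBl.
Qed.

Lemma tempered_functional h : L1 h -> tempered (functional (ihart h)).
Proof.
move=> ih; have mh : measurable_fun setT (ihart h).
  by apply: measurable_funM => //; exact: hart_measurable.
set B := `|hcst^-1| * (2 * \int[mu]_y `|h y|).
have bh x : `|ihart h x| <= B by rewrite normrM ler_wpM2l// hart_bound.
have ip (p : schwartz R d) : L1 (fun x => ihart h x * p x).
  have := L1_Mb (rapid_L1 (schwartz_rapid p)) mh bh.
  by congr L1; apply/funext => x; rewrite mulrC.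
split.
  move=> a p q r rE; rewrite /functional -RintZ// -RintD//; last exact: L1Z.
  by apply: eq_Rintegral => x _; rewrite rE mulrDr mulrCA.
have B0 : 0 <= B by exact: le_trans (normr_ge0 _) (bh 0).
(* Decay of order d+1 makes test functions integrable, which suffices against a bounded function. *)
exists d.+1, (B * \int[mu]_x (japanese x)^-1 ^+ d.+1) => p M HM.
have iJ := @L1_japanese R d.
have -> : B * \int[mu]_x (japanese x)^-1 ^+ d.+1 * M = \int[mu]_x (B * (M * (japanese x)^-1 ^+ d.+1)).
  by rewrite RintZ ?RintZ//; [ring|exact: L1Z].
apply: Rint_norm_le => //; first exact/L1Z/L1Z.
move=> x; rewrite normrM; apply: ler_pM => //.
have j1 := japanese_ge1 x.
have jp : 0 < japanese x ^+ d.+1 by rewrite exprn_gt0// (lt_le_trans ltr01).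
rewrite exprVn ler_pdivlMr// mulrC; apply: le_trans (HM [::] x (leq0n _)).
rewrite ler_wpM2r//; apply: lerXn2r; rewrite ?nnegrE ?japanese_le//.
  by rewrite (le_trans ler01).
by rewrite (le_trans ler01)// onep_eucl_ge1.
Qed.

Definition fourier_of_hartley h (x : E) : R[i] := Complex (evenp h x) (- oddp h x).

Lemma density_ihart h : L1 h -> fourier_density (functional (ihart h)) (fourier_of_hartley h).
Proof.
move=> ih; split.
  move=> r; have mB := @measurable_ball_le R d r.
  split; apply: (@integrableS _ _ _ mu setT) => //.
    exact: L1_int (L1_evenp ih).
  exact: L1_int (L1N (L1_oddp ih)).
move=> p c s kp cE sE; have rp := schwartz_rapid p; have ip := rapid_L1 rp.
have re := rapid_evenp rp; have ro := rapid_oddp rp.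
have [C HC] := rapid_bounded rp; have mp := rapid_measurable rp.
split.
  transitivity (\int[mu]_x (ihart h x * hart (evenp p) x)).
    apply: eq_Rintegral => x _; congr (_ * _); rewrite cE hart_evenp//.
    by have [-> _] := hart_cos_sin x ip.
  have rhe : rapid (hart (evenp p)) by apply: rapid_hart; exists (evenp p).
  rewrite functional_ihart//.
  transitivity (\int[mu]_x (h x * evenp p x)).
    have [D HD] := rapid_bounded re.
    rewrite -RintZ; last first.
      rewrite (_ : (fun x => _) = fun x => h x * (hcst * evenp p x)).
        apply: (L1_Mb (c := `|hcst| * D) ih); first exact: rapid_measurable (rapidZ _ re).
        by move=> x; rewrite normrM ler_wpM2l.
      by apply/funext => x; rewrite hart_hart.
    apply: eq_Rintegral => x _; rewrite hart_hart//; field; exact: hcst_neq0.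
  rewrite Rint_evenp//; by exists C.
transitivity (\int[mu]_x (ihart h x * hart (fun x => -1 * oddp p x) x)).
  apply: eq_Rintegral => x _; congr (_ * _); rewrite sE hartZ; last exact: rapid_L1.
  by rewrite hart_oddp// mulN1r; have [_ ->] := hart_cos_sin x ip.
have rn := rapidZ (-1) ro.
have rhe : rapid (hart (fun x => -1 * oddp p x)) by apply: rapid_hart; exists (fun x => -1 * oddp p x).
rewrite functional_ihart//.
have [D HD] := rapid_bounded rn.
transitivity (\int[mu]_x (h x * (-1 * oddp p x))).
  rewrite -RintZ; last first.
    rewrite (_ : (fun x => h x * _) = fun x => h x * (hcst * (-1 * oddp p x))).
      apply: (L1_Mb (c := `|hcst| * D) ih); first exact: rapid_measurable (rapidZ _ rn).
      by move=> x; rewrite normrM ler_wpM2l.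
    by apply/funext => x; rewrite hart_hart.
  apply: eq_Rintegral => x _; rewrite hart_hart//; field; exact: hcst_neq0.
have bp : exists C, forall x, `|p x| <= C by exists C.
have io : L1 (fun x => h x * oddp p x).
  by have [D' HD'] := rapid_bounded ro; exact: L1_Mb ih (rapid_measurable ro) HD'.
have io' : L1 (fun x => oddp h x * p x) by exact: L1_Mb (L1_oddp ih) mp HC.
transitivity (- \int[mu]_x (h x * oddp p x)).
  by rewrite -RintN//; apply: eq_Rintegral => x _; rewrite mulN1r mulrN.
rewrite Rint_oddp// -RintN//.
by apply: eq_Rintegral => x _; rewrite mulNr.
Qed.

(** Every test function is, up to the nonzero constant, the transform of its own transform, so
    self-adjointness makes h orthogonal to all of them. *)
Lemma hart_inj h : L1 h -> (forall x, hart h x = 0) -> {ae mu, forall x, h x = 0}.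
Proof.
move=> ih h0; apply: L1_test_inj => // p tp; have rp := testf_rapid tp.
have rh : rapid (hart p) by apply: rapid_hart; exists p.
have ip := rapid_L1 rp; have ihp := rapid_L1 rh.
have [C HC] := rapid_bounded rp.
have : \int[mu]_x (h x * hart (hart p) x) = 0.
  rewrite -hart_dual//; transitivity (\int[mu]_x (0 * h x)); last by rewrite RintZ ?mul0r.
  by apply: eq_Rintegral => x _; rewrite h0 !mul0r.
rewrite (_ : \int[mu]_x _ = \int[mu]_x (hcst * (h x * p x))); last first.
  by apply: eq_Rintegral => x _; rewrite hart_hart// mulrCA.
rewrite RintZ; last exact: L1_Mb ih (rapid_measurable rp) HC.
by move/eqP; rewrite mulf_eq0 (negbTE (@hcst_neq0 R d)) => /eqP.
Qed.

Lemma ihart_continuous h : L1 h -> continuous (ihart h).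
Proof. by move=> ih; apply: (continuousM_rV (f := cst hcst^-1)); [exact: cst_continuous|exact: hart_continuous]. Qed.

Lemma functional_inj (u v : E -> R) : continuous u -> continuous v ->
  (forall p : schwartz R d, compactly_supported p ->
     \int[mu]_x (u x * p x) = \int[mu]_x (v x * p x)) -> u = v.
Proof.
move=> cu cv uv; apply/funext => x; apply/eqP; rewrite -subr_eq0; apply/eqP.
move: x; apply: continuous_test_inj.
  by move=> x; exact: (cvgB (cu x) (cv x)).
move=> p tp; have [sp kp] := tp.
have ii (g : E -> R) : continuous g -> L1 (fun x => g x * p x).
  move=> cg; apply: L1_compact; first exact: continuousM_rV cg (smooth_continuous sp).
  by have [r Hr] := kp; exists r => x /Hr ->; rewrite mulr0.
have := uv (mk_schwartz (testf_rapid tp)) kp => /= e.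
transitivity (\int[mu]_x (u x * p x) - \int[mu]_x (v x * p x)); last by rewrite e subrr.
rewrite -RintB; [|exact: ii|exact: ii].
by apply: eq_Rintegral => x _; rewrite mulrBl.
Qed.

End transform.

(** * Weighted L^2 spaces and the weighted norms of distributions *)

Section weighted.
Context {R : realType} {d : nat}.
Local Notation E := 'rV[R]_d.
Local Notation mu := (@lebesgue_rV R d).
Implicit Types (h k : E -> R) (f : schwartz R d -> R).

(** The last field is the decisive one: with 1/w integrable, weighted L^2 embeds in L^1, so
    transforms converge absolutely, and the convolution estimate for products closes. *)
Record weight := Weight {
  wt :> E -> R ;
  wt_gt0 : forall x, 0 < wt x ;
  wt_meas : measurable_fun setT wt ;
  wt_even : forall x, wt (- x) = wt x ;
  wt_inv : (\int[mu]_x ((wt x)^-1)%:E < +oo)%E }.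

Implicit Type w : weight.

Let sqr_le (x y : R) : 0 <= x -> x <= y -> x ^+ 2 <= y ^+ 2.
Proof. by move=> x0 xy; rewrite lerXn2r// nnegrE (le_trans x0). Qed.

Definition wsq w h : \bar R := (\int[mu]_x (w x * h x ^+ 2)%:E)%E.

Lemma measurable_wsq w h : measurable_fun setT h -> measurable_fun setT (fun x => (w x * h x ^+ 2)%:E).
Proof.
move=> mh; apply/measurable_EFinP; apply: measurable_funM; first exact: wt_meas.
exact: measurable_funX.
Qed.

Definition L2 w h := measurable_fun setT h /\ (wsq w h < +oo)%E.

Lemma L1_wt_inv w : L1 (fun x => (w x)^-1).
Proof.
apply: L1P; first exact: (measurableT_comp (@measurable_invr R) (wt_meas w)).
apply: le_lt_trans (wt_inv w); apply/le_of_eq/eq_integral => x _.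
by rewrite ger0_norm// invr_ge0 ltW// wt_gt0.
Qed.

Lemma L2_wsq w h : L2 w h -> L1 (fun x => w x * h x ^+ 2).
Proof.
move=> [mh hf]; apply: L1P; first by apply/measurable_EFinP; exact: measurable_wsq.
apply: le_lt_trans hf; apply/le_of_eq/eq_integral => x _.
by rewrite ger0_norm// mulr_ge0 ?sqr_ge0// ltW// wt_gt0.
Qed.

Lemma L2P w h : measurable_fun setT h -> L1 (fun x => w x * h x ^+ 2) -> L2 w h.
Proof.
move=> mh /L1_lty hf; split => //; apply: le_lt_trans hf; rewrite le_eqVlt; apply/orP; left.
apply/eqP/eq_integral => x _.
by rewrite ger0_norm// mulr_ge0 ?sqr_ge0// ltW// wt_gt0.
Qed.

(** Completing a square. Optimising over the free parameter t afterwards plays the part of the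
    Cauchy-Schwarz inequality. *)
Lemma abs_le_weighted w h x (t : R) : 0 < t ->
  `|h x| <= 2^-1 * (t * (w x * h x ^+ 2) + t^-1 * (w x)^-1).
Proof.
move=> t0; have w0 := wt_gt0 w x.
have p0 : 0 < t * w x by rewrite mulr_gt0.
have : 0 <= (t * w x)^-1 * (t * w x * `|h x| - 1) ^+ 2 by rewrite mulr_ge0 ?sqr_ge0// invr_ge0 ltW.
have -> : (t * w x)^-1 * (t * w x * `|h x| - 1) ^+ 2 =
   t * (w x * `|h x| ^+ 2) - 2 * `|h x| + t^-1 * (w x)^-1.
  by field; rewrite !gt_eqF.
rewrite real_normK ?num_real//; lra.
Qed.

Lemma L2_L1 w h : L2 w h -> L1 h.
Proof.
move=> hL; apply: (L1_le (k := fun x => 2^-1 * (1 * (w x * h x ^+ 2) + 1^-1 * (w x)^-1))).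
- exact: hL.1.
- by move=> x; exact: abs_le_weighted.
- by apply/L1Z/L1D; apply: L1Z; [exact: L2_wsq|exact: L1_wt_inv].
Qed.

Definition wnorm w h : R := Num.sqrt (\int[mu]_x (w x * h x ^+ 2)).

Lemma wint_ge0 w h : 0 <= \int[mu]_x (w x * h x ^+ 2).
Proof. by apply: Rint_ge0 => x; rewrite mulr_ge0 ?sqr_ge0// ltW// wt_gt0. Qed.
Lemma wnorm_ge0 w h : 0 <= wnorm w h. Proof. exact: sqrtr_ge0. Qed.
Lemma wnorm_sqr w h : wnorm w h ^+ 2 = \int[mu]_x (w x * h x ^+ 2).
Proof. by rewrite sqr_sqrtr// wint_ge0. Qed.
Lemma wsqE w h : L2 w h -> wsq w h = (wnorm w h ^+ 2)%:E.
Proof. by move=> hL; rewrite wnorm_sqr EFin_Rint//; exact: L2_wsq. Qed.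

Lemma L2Z w (c : R) h : L2 w h -> L2 w (fun x => c * h x).
Proof.
move=> hL; apply: L2P; first by apply: measurable_funM => //; exact: hL.1.
have := L1Z (c ^+ 2) (L2_wsq hL); congr L1; apply/funext => x; ring.
Qed.

Lemma wnormZ w (c : R) h : L2 w h -> wnorm w (fun x => c * h x) = `|c| * wnorm w h.
Proof.
move=> hL; rewrite /wnorm -sqrtr_sqr -sqrtrM ?sqr_ge0// -RintZ; last exact: L2_wsq.
by congr Num.sqrt; apply: eq_Rintegral => x _; ring.
Qed.

(** Integrate (h + k)^2 <= (1 + 1/s) h^2 + (1 + s) k^2 and take for s the ratio of the two norms. *)
Lemma L2D w h k : L2 w h -> L2 w k ->
  L2 w (fun x => h x + k x) /\ wnorm w (fun x => h x + k x) <= wnorm w h + wnorm w k.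
Proof.
move=> hL kL; have ih := L2_wsq hL; have ik := L2_wsq kL.
have mhk : measurable_fun setT (fun x => h x + k x).
  by apply: measurable_funD; [exact: hL.1|exact: kL.1].
have le (s : R) x : 0 < s -> w x * (h x + k x) ^+ 2 <=
    (1 + s^-1) * (w x * h x ^+ 2) + (1 + s) * (w x * k x ^+ 2).
  move=> s0; have : 0 <= w x * (s * (s^-1 * h x - k x) ^+ 2).
    by rewrite mulr_ge0 ?(ltW (wt_gt0 w x))// mulr_ge0 ?sqr_ge0 ?(ltW s0).
  have -> : w x * (s * (s^-1 * h x - k x) ^+ 2) =
    s^-1 * (w x * h x ^+ 2) + s * (w x * k x ^+ 2) - 2 * (w x * h x * k x).
    by field; rewrite gt_eqF.
  by rewrite sqrrD; lra.
have hkL : L2 w (fun x => h x + k x).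
  apply: L2P => //; apply: (L1_le (k := fun x => (1 + 1^-1) * (w x * h x ^+ 2) + (1 + 1) * (w x * k x ^+ 2))).
  - by apply/measurable_EFinP; exact: measurable_wsq.
  - by move=> x; rewrite ger0_norm ?le// mulr_ge0 ?sqr_ge0// ltW// wt_gt0.
  - by apply: L1D; exact: L1Z.
split=> //; have h0 := wnorm_ge0 w h; have k0 := wnorm_ge0 w k.
apply/ler_addgt0Pr => e e0.
(* Both norms are enlarged, so that the ratio a / b makes sense even if one of them vanishes. *)
set a := wnorm w h + e / 2; set b := wnorm w k + e / 2.
have a0 : 0 < a by rewrite ltr_wpDl// divr_gt0.
have b0 : 0 < b by rewrite ltr_wpDl// divr_gt0.
rewrite (_ : _ + e = a + b); last by rewrite /a /b; field.
rewrite -(@ler_pXn2r _ 2) ?nnegrE ?wnorm_ge0 ?addr_ge0 ?(ltW a0) ?(ltW b0) ?divr_ge0 ?(ltW e0)//.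
rewrite wnorm_sqr; apply: (@le_trans _ _ ((1 + (a / b)^-1) * wnorm w h ^+ 2 + (1 + a / b) * wnorm w k ^+ 2)).
  rewrite !wnorm_sqr -!RintZ// -RintD; [|exact: L1Z|exact: L1Z].
  apply: le_Rint; first exact: L2_wsq.
    by apply: L1D; exact: L1Z.
  by move=> x; apply: le; rewrite divr_gt0.
have ha : wnorm w h ^+ 2 <= a ^+ 2 by apply: sqr_le; rewrite ?wnorm_ge0// lerDl ltW// divr_gt0.
have hb : wnorm w k ^+ 2 <= b ^+ 2 by apply: sqr_le; rewrite ?wnorm_ge0// lerDl ltW// divr_gt0.
have c1 : 0 <= 1 + (a / b)^-1 by rewrite addr_ge0// invr_ge0 divr_ge0// ltW.
have c2 : 0 <= 1 + a / b by rewrite addr_ge0// divr_ge0// ltW.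
apply: (le_trans (lerD (ler_wpM2l c1 ha) (ler_wpM2l c2 hb))).
apply: le_of_eq; field.
by rewrite !gt_eqF.
Qed.

Lemma wnorm_eq0 w h : L2 w h -> wnorm w h = 0 -> {ae mu, forall x, h x = 0}.
Proof.
move=> hL /(congr1 (fun r => r ^+ 2)); rewrite wnorm_sqr expr0n /= => e.
have ih := L2_wsq hL.
have mh : measurable_fun setT (fun x => (w x * h x ^+ 2)%:E) by exact: measurable_wsq hL.1.
have : (\int[mu]_x `|(w x * h x ^+ 2)%:E| = 0)%E.
  transitivity (\int[mu]_x (w x * h x ^+ 2)%:E)%E; last by rewrite -EFin_Rint// e.
  by apply: eq_integral => x _; rewrite gee0_abs// lee_fin mulr_ge0 ?sqr_ge0// ltW// wt_gt0.
move=> /(ae_eq_integral_abs mu measurableT mh) [N [mN N0 HN]]; exists N; split=> // x /= hx.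
apply: HN => /= H; have e1 : w x * h x ^+ 2 = 0 := congr1 (@fine R) (H Logic.I).
by move/eqP : e1; rewrite mulf_eq0 gt_eqF ?wt_gt0//= sqrf_eq0 => /eqP.
Qed.

Lemma L1_norm_le w h : L2 w h ->
  \int[mu]_x `|h x| <= Num.sqrt (\int[mu]_x (w x)^-1) * wnorm w h.
Proof.
move=> hL; have ih := L2_wsq hL; have iw := L1_wt_inv w.
set I := \int[mu]_x (w x)^-1.
have I0 : 0 <= I by apply: Rint_ge0 => x; rewrite invr_ge0 ltW// wt_gt0.
have iL := L2_L1 hL.
have B t : 0 < t -> \int[mu]_x `|h x| <= 2^-1 * (t * wnorm w h ^+ 2 + t^-1 * I).
  move=> t0; rewrite wnorm_sqr -!RintZ// -RintD; [|exact: L1Z|exact: L1Z].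
  rewrite -RintZ; last by apply: L1D; exact: L1Z.
  apply: le_Rint; first exact: L1_norm.
    by apply/L1Z/L1D; exact: L1Z.
  by move=> x; exact: abs_le_weighted.
have s0 := sqrtr_ge0 I; have n0 := wnorm_ge0 w h.
apply/ler_addgt0Pr => e e0.
(* [r] enlarges both factors, to make the optimal parameter b / a legitimate; it is chosen so that
   the product grows by at most e. *)
have [r r0 Hr] : exists2 r : R, 0 < r & r * (Num.sqrt I + wnorm w h) + r ^+ 2 <= e.
  set S := Num.sqrt I + wnorm w h; have S0 : 0 <= S by rewrite addr_ge0.
  exists (Num.min 1 (e / (S + 1))).
    by rewrite lt_min ltr01 divr_gt0// ltr_wpDl.
  set r := Num.min _ _; have r1 : r <= 1 by rewrite ge_min lexx.
  have r2 : r * (S + 1) <= e by rewrite -ler_pdivlMr ?ltr_wpDl// ge_min lexx orbT.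
  have r0 : 0 <= r by rewrite le_min ler01 divr_ge0// ?ltW// ltr_wpDl.
  rewrite expr2; nra.
set a := wnorm w h + r; set b := Num.sqrt I + r.
have a0 : 0 < a by rewrite ltr_wpDl.
have b0 : 0 < b by rewrite ltr_wpDl.
have := B (b / a); rewrite divr_gt0// => /(_ isT) /le_trans; apply.
have ha : wnorm w h ^+ 2 <= a ^+ 2 by apply: sqr_le; rewrite ?wnorm_ge0// lerDl ltW.
have hb : I <= b ^+ 2.
  by rewrite -[I]sqr_sqrtr//; apply: sqr_le; rewrite ?sqrtr_ge0// lerDl ltW.
have c1 : 0 <= b / a by rewrite divr_ge0// ltW.
have c2 : 0 <= (b / a)^-1 by rewrite invr_ge0.
apply: (@le_trans _ _ (2^-1 * (b / a * a ^+ 2 + (b / a)^-1 * b ^+ 2))).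
  by rewrite ler_wpM2l ?invr_ge0//; apply: lerD; exact: ler_wpM2l.
have -> : 2^-1 * (b / a * a ^+ 2 + (b / a)^-1 * b ^+ 2) = b * a.
  by field; rewrite !gt_eqF.
by rewrite /a /b; move: Hr; rewrite expr2; lra.
Qed.

Lemma L2_opp w h : L2 w h -> L2 w (fun x => h (- x)) /\ wnorm w (fun x => h (- x)) = wnorm w h.
Proof.
move=> hL; have ih := L2_wsq hL.
have e : (fun x : E => w x * h (- x) ^+ 2) = (fun x => w (- x) * h (- x) ^+ 2).
  by apply/funext => x; rewrite wt_even.
split.
  apply: L2P; first by apply: measurableT_comp; [exact: hL.1|exact: measurable_opp_rV].
  by rewrite e; exact: L1_opp ih.
rewrite /wnorm; congr Num.sqrt.
by rewrite -[RHS](Rintegral_opp ih) /=; apply: eq_Rintegral => x _; rewrite wt_even.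
Qed.

End weighted.
Arguments weight : clear implicits.

Section weighted_norm_value.
Context {R : realType} {d : nat}.
Local Notation E := 'rV[R]_d.
Local Notation mu := (@lebesgue_rV R d).
Implicit Types (h k : E -> R) (f : schwartz R d -> R) (w : weight R d) (g : E -> R[i]).

Lemma density_measurable f g : fourier_density f g ->
  measurable_fun setT (fun x => complex.Re (g x)) /\ measurable_fun setT (fun x => complex.Im (g x)).
Proof.
move=> [H _].
have mB (n : nat) := @measurable_ball_le R d n%:R.
have BT : [set: E] = \bigcup_n [set x : E | eucl x <= n%:R].
  apply/seteqP; split=> // x _; exists (Num.truncn (eucl x)).+1 => //=.
  exact/ltW/truncnS_gt.
by split; rewrite BT; apply/measurable_fun_bigcup => // n; have [h1 h2] := H n%:R;
  apply/measurable_EFinP; [exact: measurable_int h1|exact: measurable_int h2].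
Qed.

Lemma ge0_L1 h : measurable_fun setT h -> (forall x, 0 <= h x) ->
  (\int[mu]_x (h x)%:E < +oo)%E -> L1 h.
Proof.
move=> mh h0 hi; apply: L1P => //; apply: le_lt_trans hi; rewrite le_eqVlt; apply/orP; left.
by apply/eqP/eq_integral => x _; rewrite ger0_norm.
Qed.

(** Add the integrals over x and -x: as the weight is even, the parity projections can only decrease
    the sum. *)
Lemma density_L2 w f g : tempered f -> fourier_density f g ->
  (\int[mu]_x (w x * (complex.Re (g x) ^+ 2 + complex.Im (g x) ^+ 2))%:E < +oo)%E ->
  [/\ L2 w (hartley_density g), f = functional (ihart (hartley_density g)) &
   ((wnorm w (hartley_density g)) ^+ 2)%:E <=
   \int[mu]_x (w x * (complex.Re (g x) ^+ 2 + complex.Im (g x) ^+ 2))%:E]%E.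
Proof.
move=> tf fg gi; have [mr mi] := density_measurable fg.
set a := fun x => complex.Re (g x) in mr *; set b := fun x => complex.Im (g x) in mi *.
have iN : L1 (fun x => w x * (a x ^+ 2 + b x ^+ 2)).
  apply: ge0_L1 => //.
    apply: measurable_funM; first exact: wt_meas.
    by apply: measurable_funD; exact: measurable_funX.
  by move=> x; rewrite mulr_ge0 ?addr_ge0 ?sqr_ge0// ltW// wt_gt0.
have La : L2 w a.
  apply: L2P => //; apply: (L1_le _ _ iN); first by apply/measurable_EFinP; exact: measurable_wsq.
  move=> x; rewrite ger0_norm; last by rewrite mulr_ge0 ?sqr_ge0// ltW// wt_gt0.
  by rewrite ler_wpM2l ?(ltW (wt_gt0 w x))// lerDl sqr_ge0.
have Lb : L2 w b.
  apply: L2P => //; apply: (L1_le _ _ iN); first by apply/measurable_EFinP; exact: measurable_wsq.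
  move=> x; rewrite ger0_norm; last by rewrite mulr_ge0 ?sqr_ge0// ltW// wt_gt0.
  by rewrite ler_wpM2l ?(ltW (wt_gt0 w x))// lerDr sqr_ge0.
have [Lao _] := L2_opp La; have [Lbo _] := L2_opp Lb.
have Lh : L2 w (hartley_density g).
  have e : hartley_density g = fun x => 2^-1 * (a x + a (- x)) + (- 2^-1) * (b x + -1 * b (- x)).
    by apply/funext => x; rewrite /hartley_density /evenp /oddp /a /b; ring.
  rewrite e; apply: (L2D _ _).1; apply: L2Z; apply: (L2D _ _).1 => //; exact: L2Z.
split => //.
  exact: density_functional tf fg (L2_L1 La) (L2_L1 Lb).
rewrite -(EFin_Rint iN) lee_fin wnorm_sqr.
have ih := L2_wsq Lh; set hd := hartley_density g in ih *.
have iho := L1_opp ih; have iNo := L1_opp iN.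
have k : 2 * \int[mu]_x (w x * hd x ^+ 2) <= 2 * \int[mu]_x (w x * (a x ^+ 2 + b x ^+ 2)).
  rewrite -[X in X <= _](_ : \int[mu]_x (w x * hd x ^+ 2) + \int[mu]_x (w (- x) * hd (- x) ^+ 2) = _); last first.
    by rewrite (Rintegral_opp ih); ring.
  rewrite -[X in _ <= X](_ : \int[mu]_x (w x * (a x ^+ 2 + b x ^+ 2)) +
      \int[mu]_x (w (- x) * (a (- x) ^+ 2 + b (- x) ^+ 2)) = _); last first.
    by rewrite (Rintegral_opp iN); ring.
  rewrite -!RintD//; apply: le_Rint; [exact: L1D|exact: L1D|].
  move=> x; rewrite wt_even -!mulrDr ler_wpM2l ?(ltW (wt_gt0 w x))//.
  rewrite /hd /hartley_density /evenp /oddp opprK /a /b.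
  have := sqr_ge0 (complex.Re (g x) - complex.Re (g (- x))).
  have := sqr_ge0 (complex.Im (g x) + complex.Im (g (- x))).
  nra.
lra.
Qed.

Lemma wsq_fourier w h : L2 w h ->
  (\int[mu]_x (w x * (complex.Re (fourier_of_hartley h x) ^+ 2 +
     complex.Im (fourier_of_hartley h x) ^+ 2))%:E = (wnorm w h ^+ 2)%:E)%E.
Proof.
move=> hL; have ih := L2_wsq hL; have iho := L1_opp ih.
have e : (fun x => w x * (complex.Re (fourier_of_hartley h x) ^+ 2 +
     complex.Im (fourier_of_hartley h x) ^+ 2)) =
   fun x => 2^-1 * (w x * h x ^+ 2 + w (- x) * h (- x) ^+ 2).
  by apply/funext => x; rewrite wt_even /= /evenp /oddp; field.
transitivity (\int[mu]_x (2^-1 * (w x * h x ^+ 2 + w (- x) * h (- x) ^+ 2))%:E)%E.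
  by apply: eq_integral => x _; have /(congr1 (fun F => F x)) := e => <-.
rewrite -EFin_Rint; last by apply/L1Z/L1D.
rewrite RintZ; last exact: L1D.
by rewrite RintD// (Rintegral_opp ih) wnorm_sqr; congr EFin; field.
Qed.

Lemma ihart_inj h k : L1 h -> L1 k -> ihart h = ihart k -> {ae mu, forall x, h x = k x}.
Proof.
move=> ih ik e; have : {ae mu, forall x, h x - k x = 0}.
  apply: hart_inj; first exact: L1B.
  move=> x; have := congr1 (fun F : E -> R => F x) e; rewrite /ihart.
  move=> /(mulfI (invr_neq0 (@hcst_neq0 R d))) ehk.
  have e1 : (fun y => h y - k y) = (fun y => h y + (-1) * k y).
    by apply/funext => y; rewrite mulN1r.
  by rewrite e1 hartD// ?hartZ// ?ehk ?mulN1r ?subrr//; exact: L1Z.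
by apply: filterS => x /eqP; rewrite subr_eq0 => /eqP.
Qed.

Lemma Rint_ae h k : measurable_fun setT h -> measurable_fun setT k ->
  {ae mu, forall x, h x = k x} -> \int[mu]_x h x = \int[mu]_x k x.
Proof.
move=> mh mk hk; rewrite /Rintegral; congr fine; apply: ae_eq_integral => //.
- exact/measurable_EFinP.
- exact/measurable_EFinP.
by apply: filterS hk => x /= -> _.
Qed.

Lemma hart_ae h k : measurable_fun setT h -> measurable_fun setT k ->
  {ae mu, forall x, h x = k x} -> ihart h = ihart k.
Proof.
move=> mh mk hk; apply/funext => x; congr (_ * _); apply: Rint_ae.
- by apply: measurable_funM => //; exact: measurable_kern.
- by apply: measurable_funM => //; exact: measurable_kern.
by apply: filterS hk => y /= ->.
Qed.

Lemma wnorm_ae w h k : measurable_fun setT h -> measurable_fun setT k ->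
  {ae mu, forall x, h x = k x} -> wnorm w h = wnorm w k.
Proof.
move=> mh mk hk; congr Num.sqrt; apply: Rint_ae.
- by apply/measurable_EFinP; exact: measurable_wsq.
- by apply/measurable_EFinP; exact: measurable_wsq.
by apply: filterS hk => y /= ->.
Qed.

(** Any competitor g in the infimum has a Hartley density equal to h almost everywhere, by
    injectivity, so it cannot do better than [fourier_of_hartley h]. *)
Lemma weighted_norm_ihart w h : L2 w h ->
  weighted_norm w (functional (ihart h)) = (wnorm w h)%:E.
Proof.
move=> hL; have ih := L2_L1 hL; have n0 := wnorm_ge0 w h.
have sq (r : R) : 0 <= r -> ((r ^+ 2)%:E `^ 2^-1)%E = r%:E.
  by move=> r0; rewrite poweR_EFin powR12_sqrt ?sqr_ge0// sqrtr_sqr ger0_norm.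
apply/eqP; rewrite eq_le; apply/andP; split.
  apply: ereal_inf_lbound; exists (fourier_of_hartley h).
    by split; [exact: tempered_functional|exact: density_ihart].
  by rewrite (wsq_fourier hL) sq.
apply: le_ereal_inf_tmp => _ [g [tf fg] <-].
set B := (\int[mu]_x _)%E.
have B0 : (0 <= B)%E.
  by apply: integral_ge0 => x _; rewrite lee_fin mulr_ge0 ?addr_ge0 ?sqr_ge0// ltW// wt_gt0.
have [Boo|] := ltP B +oo%E; last by rewrite leye_eq => /eqP ->; rewrite poweRyr ?leey// invr_neq0.
have [Lg eg nB] := density_L2 tf fg Boo.
have : ihart h = ihart (hartley_density g).
  apply: functional_inj; [exact: ihart_continuous|exact/ihart_continuous/(L2_L1 Lg)|].
  by move=> p _; have := congr1 (fun F => F p) eg.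
move=> /(ihart_inj ih (L2_L1 Lg)) /(wnorm_ae w hL.1 Lg.1) e.
rewrite -(sq _ n0); apply: gt0_ler_poweR; first by rewrite invr_ge0.
- by rewrite in_itv /= lee_fin sqr_ge0 leey.
- by rewrite in_itv /= B0 leey.
by rewrite e.
Qed.

Lemma weighted_norm_lty w f : (weighted_norm w f < +oo)%E ->
  exists2 h, L2 w h & f = functional (ihart h).
Proof.
move=> /ereal_inf_lt[_ [g [tf fg] <-] gi].
have [Lg eg _] : [/\ L2 w (hartley_density g), f = functional (ihart (hartley_density g)) &
   ((wnorm w (hartley_density g)) ^+ 2)%:E <=
   \int[mu]_x (w x * (complex.Re (g x) ^+ 2 + complex.Im (g x) ^+ 2))%:E]%E.
  apply: density_L2 => //; apply: lty_poweRy gi.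
  by rewrite invr_neq0.
by exists (hartley_density g).
Qed.

(** It permits altering the anisotropic weight at the origin, where its formula degenerates to 0. *)
Lemma eq_weighted_norm (v w : E -> R) f : measurable_fun setT v -> measurable_fun setT w ->
  {ae mu, forall x, v x = w x} -> weighted_norm v f = weighted_norm w f.
Proof.
move=> mv mw vw; rewrite /weighted_norm; congr ereal_inf; apply: eq_imagel => g [tf fg].
have [mr mi] := density_measurable fg.
congr (_ `^ _)%E; apply: ae_eq_integral => //.
- apply/measurable_EFinP; apply: measurable_funM => //.
  by apply: measurable_funD; exact: measurable_funX.
- apply/measurable_EFinP; apply: measurable_funM => //.
  by apply: measurable_funD; exact: measurable_funX.
by apply: filterS vw => x /= -> _.
Qed.

End weighted_norm_value.

(** * Deciding identities in abelian groups *)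

Inductive zexp := ZVar of nat | ZZero | ZAdd of zexp & zexp | ZOpp of zexp.

Fixpoint zeval (V : zmodType) (vs : seq V) (e : zexp) : V :=
  match e with
  | ZVar i => nth 0 vs i | ZZero => 0
  | ZAdd a b => zeval vs a + zeval vs b | ZOpp a => - zeval vs a
  end.

Fixpoint zcoef (e : zexp) (i : nat) : int :=
  match e with
  | ZVar j => (i == j)%:Z | ZZero => 0
  | ZAdd a b => zcoef a i + zcoef b i | ZOpp a => - zcoef a i
  end.

Lemma zeval_coef (V : zmodType) (vs : seq V) e :
  zeval vs e = \sum_(i < size vs) nth 0 vs i *~ zcoef e i.
Proof.
elim: e => /= [j||a -> b ->|a ->].
- have [jl|jl] := ltnP j (size vs).
    rewrite (bigD1 (Ordinal jl))//= eqxx mulr1z big1 ?addr0// => i /negPf ij.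
    by rewrite (_ : (i == j :> nat) = false) ?mulr0z//; exact: ij.
  rewrite nth_default// big1// => i _.
  by rewrite (_ : (i == j :> nat) = false) ?mulr0z//; apply/eqP => ij; move: (ltn_ord i); rewrite ij ltnNge jl.
- by rewrite big1.
- by rewrite -big_split; apply: eq_bigr => i _; rewrite mulrzDr.
- by rewrite -sumrN; apply: eq_bigr => i _; rewrite mulrNz.
Qed.

(** Equality of integer coefficients, checked by computation, transfers to every abelian group;
    [abel] only reifies the two sides. *)
Lemma zeval_eq (V : zmodType) (vs : seq V) e1 e2 :
  all (fun i => zcoef e1 i == zcoef e2 i) (iota 0 (size vs)) -> zeval vs e1 = zeval vs e2.
Proof.
move=> /allP H; rewrite !zeval_coef; apply: eq_bigr => i _.
by rewrite (eqP (H i _))// mem_iota /=.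
Qed.

Ltac zindex x vs :=
  match vs with
  | x :: _ => constr:(0%N)
  | _ :: ?t => let n := zindex x t in constr:(S n)
  end.
Ltac zatoms vs t :=
  lazymatch t with
  | (?a + ?b)%R => let vs := zatoms vs a in zatoms vs b
  | (- ?a)%R => zatoms vs a
  | 0%R => vs
  | _ => match vs with
         | _ => let _ := zindex t vs in vs
         | _ => constr:(t :: vs)
         end
  end.
Ltac zreify vs t :=
  lazymatch t with
  | (?a + ?b)%R => let a := zreify vs a in let b := zreify vs b in constr:(ZAdd a b)
  | (- ?a)%R => let a := zreify vs a in constr:(ZOpp a)
  | 0%R => constr:(ZZero)
  | _ => let n := zindex t vs in constr:(ZVar n)
  end.
Ltac abel :=
  lazymatch goal with
  | |- @eq ?V ?l ?r =>
    let vs := zatoms (@nil V) l in let vs := zatoms vs r in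
    let el := zreify vs l in let er := zreify vs r in
    exact (@zeval_eq _ vs el er isT)
  end.

(** * Norms, completeness and contractions *)

Record is_norm (R : realType) (V : lmodType R) (n : V -> R) : Prop := IsNorm {
  norm_ge0 : forall v, 0 <= n v ;
  norm_add : forall u v, n (u + v) <= n u + n v ;
  norm_scale : forall (a : R) v, n (a *: v) = `|a| * n v ;
  norm_eq0 : forall v, n v = 0 -> v = 0 }.

(** Completeness for geometrically convergent sequences with an explicit rate, the form in which
    iterates of a map of ratio 1/2 arrive. *)
Definition fast_complete (R : realType) (V : lmodType R) (n : V -> R) : Prop :=
  forall (u : nat -> V) (C : R), (forall k, n (u k.+1 - u k) <= C * 2^-1 ^+ k) ->
  exists v, forall k, n (v - u k) <= 2 * C * 2^-1 ^+ k.

Lemma addr_self0 (V : zmodType) (x : V) : x = x + x -> x = 0.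
Proof. by move=> h; apply: (addrI x); rewrite addr0. Qed.

Section norm_theory.
Context {R : realType} {V : lmodType R} (n : V -> R) (nP : is_norm n).

Lemma norm0 : n 0 = 0.
Proof. by rewrite -(scale0r (0 : V)) (norm_scale nP) normr0 mul0r. Qed.
Lemma normN v : n (- v) = n v.
Proof. by rewrite -scaleN1r (norm_scale nP) normrN normr1 mul1r. Qed.
Lemma norm_sub u v : n (u - v) <= n u + n v.
Proof. by rewrite -(normN v); exact: norm_add. Qed.
Lemma norm_subC u v : n (u - v) = n (v - u).
Proof. by rewrite -normN opprB. Qed.
Lemma norm_sub_trans w u v : n (u - v) <= n (u - w) + n (w - v).
Proof. by rewrite -[u - v](subrKA w); exact: norm_add. Qed.
Lemma norm_le_sub u v : n u <= n (u - v) + n v.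
Proof. by rewrite -{1}(subrK v u); exact: norm_add. Qed.

End norm_theory.

Section fixed_point.
Context {R : realType} {W : lmodType R} (n : W -> R) (nP : is_norm n) (cW : fast_complete n).

(** The first step is at most r / 4 and later ones halve, so the iterates and their limit stay
    within r / 2 of [w0], inside the ball where T contracts. *)
Lemma contraction_fixed_point (w0 : W) (r : R) (T : W -> W) : 0 <= r ->
  (forall u v, n (u - w0) <= r -> n (v - w0) <= r -> n (T u - T v) <= 2^-1 * n (u - v)) ->
  n (T w0 - w0) <= r / 4 ->
  exists w, n (w - w0) <= r /\ T w = w.
Proof.
move=> r0 HT HT0.
pose u k := iter k T w0.
have half0 k : (0 : R) <= 2^-1 ^+ k by apply: exprn_ge0; rewrite invr_ge0.
have S k : n (u k - w0) <= r / 2 * (1 - 2^-1 ^+ k) /\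
           n (u k.+1 - u k) <= r / 4 * 2^-1 ^+ k.
  elim: k => [|k [IH1 IH2]].
    by rewrite /= subrr (norm0 nP) expr0 subrr mulr0 mulr1.
  have A : n (u k.+1 - w0) <= r / 2 * (1 - 2^-1 ^+ k.+1).
    apply: (le_trans (norm_sub_trans nP (u k) _ _)); rewrite exprS.
    by move: IH1 IH2 (half0 k); nra.
  split=> //.
  apply: (le_trans (HT _ _ _ _)).
  - by apply: (le_trans A); move: (half0 k.+1); nra.
  - by apply: (le_trans IH1); move: (half0 k); nra.
  by rewrite -/(u k) -/(u k.+1) exprS; move: IH2; lra.
have [w Hw] := cW (fun k => (S k).2).
have Hw2 k : n (w - u k) <= r / 2 * 2^-1 ^+ k.
  by apply: (le_trans (Hw k)); apply: le_of_eq; field.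
have wr : n (w - w0) <= r.
  by move: (Hw2 0%N); rewrite expr0 mulr1 /u/=; move: r0; lra.
exists w; split=> //.
apply/eqP; rewrite -subr_eq0; apply/eqP/(norm_eq0 nP).
apply/eqP; rewrite eq_le (norm_ge0 nP) andbT.
apply/ler_addgt0Pr => e e0; rewrite add0r.
have bnd k : n (T w - w) <= r * 2^-1 ^+ k.
  have uk : n (u k - w0) <= r.
    by apply: (le_trans (S k).1); move: (half0 k); nra.
  apply: (le_trans (norm_sub_trans nP (u k.+1) _ _)).
  rewrite [X in _ + X](norm_subC nP).
  have := HT _ _ wr uk; rewrite -/(u k.+1) => h1.
  by move: h1 (Hw2 k) (Hw2 k.+1) (half0 k); rewrite exprS; nra.
have : (fun k => r * 2^-1 ^+ k) @ \oo --> (0 : R).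
  rewrite -(mulr0 r); apply: cvgM; first exact: cvg_cst.
  by apply: cvg_expr; rewrite gtr0_norm ?invr_gt0// invf_lt1// ltr1n.
move=> /cvgrPdist_le/(_ e e0)[N _ /(_ N (leqnn N))] /=.
rewrite sub0r normrN => h; apply: (le_trans (bnd N)).
exact: (le_trans (ler_norm _) h).
Qed.

Lemma contraction_unique (T : W -> W) u v :
  n (T u - T v) <= 2^-1 * n (u - v) -> T u = u -> T v = v -> u = v.
Proof.
move=> h Tu Tv; apply/eqP; rewrite -subr_eq0; apply/eqP/(norm_eq0 nP).
by move: h (norm_ge0 nP (u - v)); rewrite Tu Tv; lra.
Qed.

End fixed_point.

(** * Bounded quadratic maps *)

Section quadratic.
Context {R : realType} {X W Y : lmodType R}.
Variables (nX : X -> R) (nW : W -> R) (nY : Y -> R).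
Hypotheses (nXP : is_norm nX) (nWP : is_norm nW) (nYP : is_norm nY).
Local Notation Z := (X * W)%type.
Definition norm_pair (z : Z) : R := nX z.1 + nW z.2.
Local Notation nZ := norm_pair.

Lemma norm_pairP : is_norm nZ.
Proof.
split.
- by move=> v; rewrite addr_ge0// norm_ge0.
- by move=> u v; rewrite /nZ/= addrACA; apply: lerD; exact: norm_add.
- by move=> a v; rewrite /nZ/= (norm_scale nXP) (norm_scale nWP) mulrDr.
- move=> [x w]; rewrite /nZ/= => /eqP; rewrite paddr_eq0 ?norm_ge0//.
  by move=> /andP[/eqP/(norm_eq0 nXP)-> /eqP/(norm_eq0 nWP)->].
Qed.

Record bounded_quadratic (L : Z -> Y) (Q : Z -> Z -> Y) (C : R) : Prop := BQ {
  bq_C : 1 <= C ;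
  bq_lin : forall a u v, L (a *: u + v) = a *: L u + L v ;
  bq_l : forall a u v w, Q (a *: u + v) w = a *: Q u w + Q v w ;
  bq_r : forall a u v w, Q w (a *: u + v) = a *: Q w u + Q w v ;
  bq_Lb : forall z, nY (L z) <= C * nZ z ;
  bq_Qb : forall z w, nY (Q z w) <= C * (nZ z * nZ w) }.

Variables (y0 : Y) (L : Z -> Y) (Q : Z -> Z -> Y) (CF : R).
Hypothesis LQ : bounded_quadratic L Q CF.

Definition quad z := y0 + L z + Q z z.
Definition polar z z' := Q z z' + Q z' z.
(** The partial derivative of [quad] at z in the direction of the unknowns, the data being held
    fixed. *)
Definition dquad z w := L (0, w) + polar z (0, w).

Let C0 : 0 <= CF. Proof. exact: le_trans ler01 (bq_C LQ). Qed.
Lemma bq_LD u v : L (u + v) = L u + L v.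
Proof. by rewrite -[u]scale1r (bq_lin LQ) !scale1r. Qed.
Lemma bq_L0 : L 0 = 0.
Proof. by have := bq_LD 0 0; rewrite addr0 => /addr_self0. Qed.
Lemma bq_LZ a u : L (a *: u) = a *: L u.
Proof. by rewrite -[a *: u]addr0 (bq_lin LQ) bq_L0 addr0. Qed.
Lemma bq_LN u : L (- u) = - L u.
Proof. by apply/eqP; rewrite -addr_eq0 -bq_LD addNr bq_L0. Qed.
Lemma bq_QDl u v w : Q (u + v) w = Q u w + Q v w.
Proof. by rewrite -[u]scale1r (bq_l LQ) !scale1r. Qed.
Lemma bq_QDr u v w : Q w (u + v) = Q w u + Q w v.
Proof. by rewrite -[u]scale1r (bq_r LQ) !scale1r. Qed.
Lemma bq_Q0l w : Q 0 w = 0.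
Proof. by have := bq_QDl 0 0 w; rewrite addr0 => /addr_self0. Qed.
Lemma bq_Q0r w : Q w 0 = 0.
Proof. by have := bq_QDr 0 0 w; rewrite addr0 => /addr_self0. Qed.
Lemma bq_QZl a u w : Q (a *: u) w = a *: Q u w.
Proof. by rewrite -[a *: u]addr0 (bq_l LQ) bq_Q0l addr0. Qed.
Lemma bq_QZr a u w : Q w (a *: u) = a *: Q w u.
Proof. by rewrite -[a *: u]addr0 (bq_r LQ) bq_Q0r addr0. Qed.
Lemma polarC u v : polar u v = polar v u.
Proof. by rewrite /polar addrC. Qed.
Lemma polarDl u v w : polar (u + v) w = polar u w + polar v w.
Proof. by rewrite /polar bq_QDl bq_QDr addrACA. Qed.
Lemma polarDr u v w : polar w (u + v) = polar w u + polar w v.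
Proof. by rewrite polarC polarDl !(polarC w). Qed.
Lemma polarZl a u w : polar (a *: u) w = a *: polar u w.
Proof. by rewrite /polar bq_QZl bq_QZr scalerDr. Qed.
Lemma polarZr a u w : polar w (a *: u) = a *: polar w u.
Proof. by rewrite polarC polarZl polarC. Qed.
Lemma polar0r w : polar w 0 = 0.
Proof. by rewrite /polar bq_Q0r bq_Q0l addr0. Qed.
Lemma polarNl u w : polar (- u) w = - polar u w.
Proof. by apply/eqP; rewrite -addr_eq0 -polarDl addNr polarC polar0r. Qed.
Lemma polarNr u w : polar w (- u) = - polar w u.
Proof. by rewrite polarC polarNl polarC. Qed.
Lemma polar_bound u v : nY (polar u v) <= 2 * CF * (nZ u * nZ v).
Proof.
apply: (le_trans (norm_add nYP _ _)).
by move: (bq_Qb LQ u v) (bq_Qb LQ v u); rewrite [nZ v * _]mulrC; lra.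
Qed.

Lemma quadB z dz : quad (z + dz) - quad z = L dz + polar z dz + Q dz dz.
Proof.
rewrite /quad /polar bq_LD !bq_QDl !bq_QDr.
apply/eqP; rewrite subr_eq; apply/eqP.
by rewrite !addrA [RHS](ACl (5*6*1*7*2*3*4)).
Qed.

Lemma dquadD z u v : dquad z (u + v) = dquad z u + dquad z v.
Proof.
rewrite /dquad (_ : (0, u + v) = (0, u) + (0, v) :> Z); last first.
  by congr pair; rewrite addr0.
by rewrite bq_LD polarDr addrACA.
Qed.

Lemma dquadZ z a u : dquad z (a *: u) = a *: dquad z u.
Proof.
rewrite /dquad (_ : (0, a *: u) = a *: (0, u) :> Z); last first.
  by congr pair; rewrite scaler0.
by rewrite bq_LZ polarZr; exact/esym/scalerDr.
Qed.

Lemma nZ0 w : nZ (0, w) = nW w.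
Proof. by rewrite /nZ/= (norm0 nXP) add0r. Qed.

Lemma dquadB z z' w : nY (dquad z w - dquad z' w) <= 2 * CF * (nZ (z - z') * nW w).
Proof.
rewrite /dquad opprD addrACA subrr add0r -polarNl -polarDl.
by rewrite -nZ0; exact: polar_bound.
Qed.

End quadratic.

(** * Derivatives of all orders of an implicit function *)

Section implicit_smooth.
Context {R : realType} {X W Y : lmodType R}.
Variables (nX : X -> R) (nW : W -> R) (nY : Y -> R).
Hypotheses (nXP : is_norm nX) (nWP : is_norm nW) (nYP : is_norm nY).
Local Notation Z := (X * W)%type.
Local Notation nZ := (norm_pair nX nW).
Variables (y0 : Y) (L : Z -> Y) (Q : Z -> Z -> Y) (CF : R).
Hypothesis LQ : bounded_quadratic nX nW nY L Q CF.
Variables (U : set X) (Phi : X -> W) (Rinv : X -> Y -> W).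
Local Notation z x := (x, Phi x).
Local Notation polar := (polar Q).

(** The solution map is only assumed locally Lipschitz, and the inverses bounded at each point
    separately; differentiability and local uniformity are consequences. *)
Record implicit_data : Prop := ImplicitData {
  id_eq : forall x, U x -> quad y0 L Q (z x) = 0 ;
  id_lin : forall x a u v, U x -> Rinv x (a *: u + v) = a *: Rinv x u + Rinv x v ;
  id_bd : forall x, U x -> exists2 C, 1 <= C & forall y, nW (Rinv x y) <= C * nY y ;
  id_inv : forall x y, U x -> dquad L Q (z x) (Rinv x y) = y ;
  id_invK : forall x w, U x -> Rinv x (dquad L Q (z x) w) = w ;
  id_lip : forall x, U x -> exists2 C, 1 <= C & forall h, nX h < C^-1 -> U (x + h) ->
    nW (Phi (x + h) - Phi x) <= C * nX h }.

Hypothesis ID : implicit_data.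
Let nZP : is_norm nZ := norm_pairP nXP nWP.
Let CF1' : 1 <= CF. Proof. exact: bq_C LQ. Qed.
Let RD x u v : U x -> Rinv x (u + v) = Rinv x u + Rinv x v.
Proof. by move=> Ux; rewrite -[u]scale1r (id_lin ID)// !scale1r. Qed.
Let R0 x : U x -> Rinv x 0 = 0.
Proof.
by move=> Ux; have := RD 0 0 Ux; rewrite addr0 => /addr_self0.
Qed.
Let RN x u : U x -> Rinv x (- u) = - Rinv x u.
Proof. by move=> Ux; apply/eqP; rewrite -addr_eq0 -RD// addNr R0. Qed.

(** The derivative of x -> (x, Phi x) predicted by implicit differentiation. *)
Definition dz1 x h : Z := (h, - Rinv x (L (h, 0) + polar (z x) (h, 0))).

(** One constant K serves both as inverse radius and as bound, so that several estimates are
    combined by simply enlarging K. *)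
Definition near_at (x : X) (K : R) (h : X) := nX h < K^-1 /\ U (x + h).

Lemma near_at_le x K K' h : 1 <= K -> K <= K' -> near_at x K' h -> near_at x K h.
Proof.
move=> K1 KK' [tK Uh]; split=> //; apply: (lt_le_trans tK).
by rewrite lef_pV2// posrE; lra.
Qed.

Lemma near_at_mul x K h : 1 <= K -> near_at x K h -> K * nX h <= 1.
Proof.
move=> K1 [tK _]; rewrite mulrC -ler_pdivlMr ?div1r; last by lra.
exact: ltW.
Qed.

Lemma near_at_le1 x K h : 1 <= K -> near_at x K h -> nX h <= 1.
Proof.
by move=> K1 /(near_at_mul K1); have := norm_ge0 nXP h; nra.
Qed.

(** Expand [quad] exactly between its two zeros and apply the inverse of the linearisation: what
    separates the increment from [dz1] is the inverse applied to Q dz dz, of second order by the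
    Lipschitz bound. *)
Lemma zdiff x : U x -> exists2 K, 1 <= K & forall h, near_at x K h ->
  nZ (z (x + h) - z x) <= K * nX h /\
  nZ (z (x + h) - z x - dz1 x h) <= K * nX h ^+ 2.
Proof.
move=> Ux; have CF1 := CF1'; have [C C1 Clip] := id_lip ID Ux; have [c c1 cR] := id_bd ID Ux.
have K1 : 1 <= (1 + C) + c * (CF * (1 + C) ^+ 2).
  have : 0 <= c * (CF * (1 + C) ^+ 2).
    by rewrite !mulr_ge0 ?sqr_ge0//; lra.
  by lra.
exists ((1 + C) + c * (CF * (1 + C) ^+ 2)) => // h nh.
have t0 := norm_ge0 nXP h.
have Kpos : 0 <= c * (CF * (1 + C) ^+ 2).
  by rewrite !mulr_ge0 ?sqr_ge0//; lra.
have [tC Uh] : near_at x C h by apply: near_at_le nh => //; lra.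
have {}Clip := Clip h tC Uh.
set dPhi := Phi (x + h) - Phi x in Clip *.
have dzE : z (x + h) - z x = (h, dPhi).
  by congr pair; rewrite addrC addKr.
have ndz : nZ (h, dPhi) <= (1 + C) * nX h by rewrite /norm_pair/=; lra.
have ndz0 := norm_ge0 nZP (h, dPhi).
rewrite dzE; split.
  by apply: (le_trans ndz); rewrite ler_wpM2r//; lra.
have E : (h, dPhi) - dz1 x h = (0, - Rinv x (Q (h, dPhi) (h, dPhi))) :> Z.
  rewrite /dz1; congr pair; first exact: subrr.
  rewrite /= opprK -[X in X + _ = _](id_invK ID _ Ux) -RD// -RN//; congr (Rinv x _).
  have := quadB y0 LQ (z x) (h, dPhi).
  have zz : z x + (h, dPhi) = z (x + h) by rewrite -dzE addrC subrK.
  rewrite zz !(id_eq ID)// subrr => /esym/eqP; rewrite addr_eq0 => /eqP <-.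
  rewrite /dquad addrACA -(bq_LD LQ) -(polarDr LQ).
  by congr (L _ + polar _ _); congr pair; rewrite /= ?add0r ?addr0.
rewrite E (nZ0 _ nXP) (normN nWP); apply: (le_trans (cR _)).
apply: (@le_trans _ _ (c * (CF * ((1 + C) * nX h) ^+ 2))).
  rewrite ler_wpM2l//; first lra.
  apply: (le_trans (bq_Qb LQ _ _)); rewrite ler_wpM2l//; first lra.
  by rewrite -expr2 ler_sqr ?nnegrE//; apply: (le_trans ndz0).
rewrite exprMn; have t20 := sqr_ge0 (nX h).
by rewrite !mulrA ler_wpM2r// -!mulrA; lra.
Qed.

(** The resolvent identity R' = R - R polar(dz, R') ([RE]) bounds R' by absorption and then gives
    its first-order expansion. The arguments y and y' vary along with x, so that the lemma is
    directly a product rule for x -> Rinv x (y x). *)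
Lemma Rinv_near x : U x -> exists2 K, 1 <= K & forall h, near_at x K h ->
  forall (y y' y1 : Y) (p : R), 0 <= p -> nY y <= p -> nY (y' - y) <= p * nX h ->
    nY (y' - y - y1) <= p * nX h ^+ 2 ->
  [/\ nW (Rinv x y) <= K * p,
      nW (Rinv (x + h) y' - Rinv x y) <= K * p * nX h
    & nW (Rinv (x + h) y' - Rinv x y -
          (Rinv x y1 - Rinv x (polar (dz1 x h) (0, Rinv x y)))) <= K * p * nX h ^+ 2].
Proof.
move=> Ux; have CF1 := CF1'; have [K1 K11 zd] := zdiff Ux; have [c c1 cR] := id_bd ID Ux.
(* [a * nX h] bounds the operator R polar(dz, .). *)
pose a := c * (2 * CF * K1).
have a1 : 1 <= a.
  have h1 : 1 <= 2 * CF * K1 by nra.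
  by rewrite /a; nra.
(* The bound 4 a <= K forces a |h| <= 1/4, which allows the absorption; the square (1 + a)^2
   dominates the constants of all three estimates. *)
have Kge : K1 <= 2 * c * (1 + a) ^+ 2 /\ 4 * a <= 2 * c * (1 + a) ^+ 2.
  have aK1 : K1 <= a.
    have h1 : 1 <= c * (2 * CF) by nra.
    by rewrite /a mulrA -[X in X <= _]mul1r ler_wpM2r//; lra.
  have h2 : 4 * a <= (1 + a) ^+ 2 by have := sqr_ge0 (1 - a); nra.
  have h3 : (1 + a) ^+ 2 <= 2 * c * (1 + a) ^+ 2.
    by rewrite -[X in X <= _]mul1r ler_wpM2r ?sqr_ge0//; lra.
  by split; lra.
set K := 2 * c * (1 + a) ^+ 2 in Kge *.
have [KK1 Ka] := Kge.
have K1' : 1 <= K by lra.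
exists K => // h nh y y' y1 p p0 yp y'y y'1.
have t0 := norm_ge0 nXP h.
have t1 := near_at_le1 K1' nh.
have at2 : a * nX h <= 1 / 4.
  have := near_at_mul K1' nh; have : 4 * a * nX h <= K * nX h by rewrite ler_wpM2r.
  by lra.
have Uh : U (x + h) by case: nh.
have [dz_le dz1_le] := zd h (near_at_le K11 KK1 nh).
set dz := z (x + h) - z x in dz_le dz1_le *.
have RpolB v w : nW (Rinv x (polar v (0, w))) <= c * (2 * CF) * nZ v * nW w.
  apply: (le_trans (cR _)); rewrite -!mulrA ler_wpM2l//; first lra.
  by have := polar_bound nYP LQ v (0, w); rewrite (nZ0 _ nXP) -!mulrA.
have RpolB1 w : nW (Rinv x (polar dz (0, w))) <= a * nX h * nW w.
  apply: (le_trans (RpolB _ _)); rewrite ler_wpM2r ?norm_ge0//.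
  by rewrite /a -!mulrA 3?ler_wpM2l//; lra.
have RpolB2 w : nW (Rinv x (polar (dz - dz1 x h) (0, w))) <= a * nX h ^+ 2 * nW w.
  apply: (le_trans (RpolB _ _)); rewrite ler_wpM2r ?norm_ge0//.
  by rewrite /a -!mulrA 3?ler_wpM2l//; lra.
have RE v : Rinv (x + h) v = Rinv x v - Rinv x (polar dz (0, Rinv (x + h) v)).
  rewrite -RN// -RD// -{2}(id_inv ID v Uh) /dquad -addrA.
  rewrite -(polarNl LQ) -(polarDl LQ) (_ : z (x + h) - dz = z x); last by rewrite /dz subKr.
  by rewrite -/(dquad L Q (z x) _) (id_invK ID).
have Rb v : nW (Rinv (x + h) v) <= 2 * c * nY v.
  have : nW (Rinv (x + h) v) <= c * nY v + a * nX h * nW (Rinv (x + h) v).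
    rewrite {1}RE; apply: (le_trans (norm_sub nWP _ _)); exact: lerD.
  have : a * nX h * nW (Rinv (x + h) v) <= 1 / 4 * nW (Rinv (x + h) v).
    by rewrite ler_wpM2r ?norm_ge0.
  by have := norm_ge0 nWP (Rinv (x + h) v); have := norm_ge0 nYP v; nra.
have R'y : nW (Rinv (x + h) y) <= 2 * c * p.
  by apply: (le_trans (Rb y)); rewrite ler_wpM2l//; lra.
have Ry : nW (Rinv x y) <= c * p by apply: (le_trans (cR y)); rewrite ler_wpM2l//; lra.
have R'dy : nW (Rinv (x + h) (y' - y)) <= 2 * c * (p * nX h).
  by apply: (le_trans (Rb _)); rewrite ler_wpM2l//; lra.
have ty0 : 0 <= p * nX h by rewrite mulr_ge0.
have tty0 : 0 <= p * nX h ^+ 2 by rewrite mulr_ge0 ?sqr_ge0.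
have R'By v w : Rinv (x + h) (v - w) = Rinv (x + h) v - Rinv (x + h) w.
  by rewrite RD// RN.
have RBy v w : Rinv x (v - w) = Rinv x v - Rinv x w by rewrite RD// RN.
have dR : nW (Rinv (x + h) y - Rinv x y) <= a * nX h * (2 * c * p).
  rewrite {1}RE addrAC subrr add0r (normN nWP); apply: (le_trans (RpolB1 _)).
  by rewrite ler_wpM2l// mulr_ge0//; lra.
have Kc : c <= K /\ 2 * c + 2 * a * c <= K /\ c * (1 + 3 * a + 2 * a ^+ 2) <= K.
  have e : (1 + a) ^+ 2 = 1 + 2 * a + a ^+ 2 by ring.
  have a20 := sqr_ge0 a.
  rewrite /K e; split; [nra|split; nra].
case: Kc => Kc1 [Kc2 Kc3].
split.
- by apply: (le_trans Ry); rewrite ler_wpM2r.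
- have -> : Rinv (x + h) y' - Rinv x y = Rinv (x + h) (y' - y) + (Rinv (x + h) y - Rinv x y).
    by rewrite R'By subrKA.
  apply: (le_trans (norm_add nWP _ _)); apply: (le_trans (lerD R'dy dR)).
  have : (2 * c + 2 * a * c) * (p * nX h) <= K * (p * nX h) by rewrite ler_wpM2r.
  by lra.
(* Four errors of second order: the change of the inverse on y' - y, the error in the expansion of
   y, the second-order change of the inverse on y, and the error in the expansion of z. *)
have -> : Rinv (x + h) y' - Rinv x y -
    (Rinv x y1 - Rinv x (polar (dz1 x h) (0, Rinv x y))) =
  - Rinv x (polar dz (0, Rinv (x + h) (y' - y))) + Rinv x (y' - y - y1)
  + (- Rinv x (polar dz (0, Rinv (x + h) y - Rinv x y))
     - Rinv x (polar (dz - dz1 x h) (0, Rinv x y))).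
  have e1 : - Rinv x (polar dz (0, Rinv (x + h) (y' - y))) =
      Rinv (x + h) (y' - y) - Rinv x (y' - y).
    by rewrite {2}RE addrAC subrr add0r.
  have e2 : - Rinv x (polar dz (0, Rinv (x + h) y)) = Rinv (x + h) y - Rinv x y.
    by rewrite [Rinv (x + h) y in RHS]RE addrAC subrr add0r.
  have e3 : (0, Rinv (x + h) y - Rinv x y) = (0, Rinv (x + h) y) - (0, Rinv x y) :> Z.
    by congr pair; rewrite subr0.
  rewrite e1 e3 (polarDr LQ) (polarNr LQ) RBy (polarDl LQ) (polarNl LQ) !RBy opprB.
  rewrite R'By.
  set A := Rinv (x + h) y'; set B := Rinv (x + h) y; set A0 := Rinv x y'; set B0 := Rinv x y.
  set P := Rinv x (polar dz (0, B)) in e2 *; set P0 := Rinv x (polar dz (0, B0)).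
  set D1 := Rinv x y1; set P1 := Rinv x _.
  have -> : P = - (B - B0) by rewrite -e2 opprK.
  abel.
apply: (le_trans (norm_add nWP _ _)).
apply: (le_trans (lerD (norm_add nWP _ _) (norm_sub nWP _ _))).
rewrite !(normN nWP).
have b1 : nW (Rinv x (polar dz (0, Rinv (x + h) (y' - y)))) <= a * nX h * (2 * c * (p * nX h)).
  by apply: (le_trans (RpolB1 _)); rewrite ler_wpM2l// mulr_ge0//; lra.
have b2 : nW (Rinv x (y' - y - y1)) <= c * (p * nX h ^+ 2).
  by apply: (le_trans (cR _)); rewrite ler_wpM2l//; lra.
have b3 : nW (Rinv x (polar dz (0, Rinv (x + h) y - Rinv x y))) <=
    a * nX h * (a * nX h * (2 * c * p)).
  by apply: (le_trans (RpolB1 _)); rewrite ler_wpM2l// mulr_ge0//; lra.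
have b4 : nW (Rinv x (polar (dz - dz1 x h) (0, Rinv x y))) <= a * nX h ^+ 2 * (c * p).
  by apply: (le_trans (RpolB2 _)); rewrite ler_wpM2l// mulr_ge0 ?sqr_ge0//; lra.
apply: (le_trans (lerD (lerD b1 b2) (lerD b3 b4))).
have : c * (1 + 3 * a + 2 * a ^+ 2) * (p * nX h ^+ 2) <= K * (p * nX h ^+ 2).
  by rewrite ler_wpM2r.
by lra.
Qed.

Definition prodn (u : seq X) : R := \prod_(v <- u) nX v.

Lemma prodn_ge0 u : 0 <= prodn u.
Proof. by apply: prodr_ge0 => v _; exact: norm_ge0. Qed.
Lemma prodn_cons v u : prodn (v :: u) = nX v * prodn u.
Proof. by rewrite /prodn big_cons. Qed.

Lemma prodn_mask (m : bitseq) u : size m = size u ->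
  prodn u = prodn (mask m u) * prodn (mask (map negb m) u).
Proof.
elim: m u => [|b m IH] [|v u]//= => [_|[/IH E]].
  by rewrite /prodn !big_nil mulr1.
by case: b => /=; rewrite !prodn_cons E; ring.
Qed.

(* Families (x, u) |-> D x u of multilinear maps in k directions u that are
   obtained from z = (x, Phi x) by the operations occurring in its iterated
   derivatives; the masks say how the directions are distributed. *)
Inductive jet : nat -> (X -> seq X -> Z) -> Prop :=
| JetZ : jet 0 (fun x _ => z x)
| JetD : jet 1 (fun _ u => (head 0 u, 0))
| Jet0 k : jet k (fun _ _ => 0)
| JetA k D1 D2 : jet k D1 -> jet k D2 -> jet k (fun x u => D1 x u + D2 x u)
| JetN k D : jet k D -> jet k (fun x u => - D x u)
| JetL k D : jet k D -> jet k (fun x u => (0, Rinv x (L (D x u))))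
| JetQ k k1 k2 m D1 D2 : size m = k -> count id m = k1 -> count negb m = k2 ->
    jet k1 D1 -> jet k2 D2 ->
    jet k (fun x u => (0, Rinv x (polar (D1 x (mask m u)) (D2 x (mask (map negb m) u))))).

(** A complementary pair of masks sends the slot occupied by the varying direction to exactly one of
    the two factors; cutting the mask at that slot reduces to multilinearity of this factor. *)
Lemma jet_multilinear k D : jet k D -> forall x, U x -> forall a y y' u u',
  size (u ++ y :: u') = k ->
  D x (u ++ (a *: y + y') :: u') = a *: D x (u ++ y :: u') + D x (u ++ y' :: u').
Proof.
elim=> {k D} [||k|k D1 D2 _ I1 _ I2|k D _ I|k D _ I|k k1 k2 m D1 D2 sm c1 c2 _ I1 _ I2]
  x Ux a y y' u u' /=.
- by rewrite size_cat addnS.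
- case: u => [|v u] /=; last by rewrite size_cat addnS.
  by case: u' => //= _; congr pair; rewrite /= scaler0 addr0.
- by rewrite scaler0 addr0.
- move=> sk; rewrite I1// I2// addrACA; congr (_ + _); exact/esym/scalerDr.
- by move=> sk; rewrite I// opprD scalerN.
- move=> sk; rewrite I// (bq_lin LQ) (id_lin ID)//.
  by congr pair; rewrite /= scaler0 addr0.
move=> sk.
have [m1 [b [m2 [mE sm1 sm2]]]] : exists m1 b m2,
    [/\ m = m1 ++ b :: m2, size m1 = size u & size m2 = size u'].
  have su : (size u < size m)%N by rewrite sm -sk size_cat/= addnS leq_addr.
  exists (take (size u) m), (nth false m (size u)), (drop (size u).+1 m).
  rewrite -drop_nth// cat_take_drop size_takel 1?ltnW//; split=> //.
  by rewrite size_drop sm -sk size_cat/= -addSnnS addKn.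
have mk w b' : mask (m1 ++ b' :: m2) (u ++ w :: u') =
    mask m1 u ++ nseq b' w ++ mask m2 u'.
  by rewrite mask_cat//; case: b'.
have mk' w b' : mask (map negb m1 ++ b' :: map negb m2) (u ++ w :: u') =
    mask (map negb m1) u ++ nseq b' w ++ mask (map negb m2) u'.
  by rewrite mask_cat ?size_map//; case: b'.
move: c1 c2; rewrite mE map_cat /= !mk !mk' !count_cat /=.
have sz (n : bitseq) (s : seq X) : size n = size s -> size (mask n s) = count id n.
  by exact: size_mask.
have cn (n : bitseq) : count id (map negb n) = count negb n.
  by rewrite count_map; apply: eq_count => -[].
case: b mE => mE /= c1 c2.
  rewrite I1 ?(polarDl LQ) ?(polarZl LQ) ?(id_lin ID)//.
    by congr pair; rewrite /= scaler0 addr0.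
  by rewrite size_cat /= !sz// -c1.
rewrite I2 ?(polarDr LQ) ?(polarZr LQ) ?(id_lin ID)//.
  by congr pair; rewrite /= scaler0 addr0.
by rewrite size_cat /= !sz ?size_map// !cn -c2.
Qed.

Definition jet_diff k (D D' : X -> seq X -> Z) : Prop :=
  forall x, U x -> exists2 K, 1 <= K & forall h, near_at x K h ->
  forall u, size u = k ->
  [/\ nZ (D x u) <= K * prodn u,
      nZ (D (x + h) u - D x u) <= K * prodn u * nX h
    & nZ (D (x + h) u - D x u - D' x (h :: u)) <= K * prodn u * nX h ^+ 2].

(** Leibniz's rule constructor by constructor, with [Rinv_near] differentiating the inverse. The
    result is again a jet because [dz1] and polarisations are expressible by the constructors; the
    new direction is put at the head of the list. *)
Lemma jet_differentiable k D : jet k D -> exists2 D', jet k.+1 D' & jet_diff k D D'.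
Proof.
have CF1 := CF1'.
(* [dz1] rewritten as a jet of order one that reads only the head of the list. *)
pose dz x u : Z := (head 0 u, 0) - ((0, Rinv x (L (head 0 u, 0))) +
    (0, Rinv x (polar (z x) (head 0 (mask [:: true] u), 0)))).
have jdz : jet 1 dz.
  apply: JetA; first exact: JetD.
  apply: JetN; apply: JetA; first exact: (JetL JetD).
  by have := @JetQ 1 0 1 [:: false] _ _ erefl erefl erefl JetZ JetD.
have dzE x h u : U x -> dz x (h :: u) = dz1 x h.
  move=> Ux; rewrite /dz /dz1 RD//=; congr pair; rewrite /= ?mask0 ?addr0 ?subr0 ?sub0r //.
elim=> {k D} [||k|k D1 D2 _ [D1' j1 d1] _ [D2' j2 d2]|k D _ [D' j d]|k D jD [D' j d]
  |k k1 k2 m D1 D2 sm c1 c2 jD1 [D1' j1 d1] jD2 [D2' j2 d2]].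
- exists dz => // x Ux; have [K K1 zd] := zdiff Ux.
  have K' : 1 <= K + nZ (z x) by have := norm_ge0 nZP (z x); lra.
  exists (K + nZ (z x)) => // h nh [|//] _; rewrite /prodn big_nil mulr1.
  have t0 := norm_ge0 nXP h; have t20 := sqr_ge0 (nX h); have z0 := norm_ge0 nZP (z x).
  have [|h1 h2] := zd h; first by apply: near_at_le nh => //; lra.
  have e1 : K * nX h <= (K + nZ (z x)) * nX h by rewrite ler_wpM2r//; lra.
  have e2 : K * nX h ^+ 2 <= (K + nZ (z x)) * nX h ^+ 2 by rewrite ler_wpM2r//; lra.
  split; [lra|exact: le_trans e1|rewrite dzE//; exact: le_trans e2].
- exists (fun _ _ => 0); first exact: Jet0.
  move=> x Ux; exists 1 => // h nh [|v [|//]]//= _.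
  rewrite subrr subr0 (norm0 nZP) /prodn big_seq1 !mul1r /norm_pair/= (norm0 nWP) addr0.
  by have vv := norm_ge0 nXP v; split=> //; rewrite mulr_ge0 ?sqr_ge0 ?norm_ge0.
- exists (fun _ _ => 0); first exact: Jet0.
  move=> x Ux; exists 1 => // h nh u _.
  rewrite !subr0 (norm0 nZP) !mul1r.
  by have vv := prodn_ge0 u; split=> //; rewrite mulr_ge0 ?sqr_ge0 ?norm_ge0.
- exists (fun x u => D1' x u + D2' x u); first exact: JetA.
  move=> x Ux; have [K1 K11 H1] := d1 x Ux; have [K2 K21 H2] := d2 x Ux.
  exists (K1 + K2) => [|h nh u su]; first lra.
  have [|a1 a2 a3] := H1 h _ u su; first by apply: near_at_le nh => //; lra.
  have [|b1 b2 b3] := H2 h _ u su; first by apply: near_at_le nh => //; lra.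
  split.
  + by apply: (le_trans (norm_add nZP _ _)); lra.
  + have -> : D1 (x + h) u + D2 (x + h) u - (D1 x u + D2 x u) =
      (D1 (x + h) u - D1 x u) + (D2 (x + h) u - D2 x u) by abel.
    by apply: (le_trans (norm_add nZP _ _)); lra.
  have -> : D1 (x + h) u + D2 (x + h) u - (D1 x u + D2 x u) - (D1' x (h :: u) + D2' x (h :: u)) =
      (D1 (x + h) u - D1 x u - D1' x (h :: u)) + (D2 (x + h) u - D2 x u - D2' x (h :: u)) by abel.
  by apply: (le_trans (norm_add nZP _ _)); lra.
- exists (fun x u => - D' x u); first exact: JetN.
  move=> x Ux; have [K K1 H] := d x Ux; exists K => // h nh u su.
  have [a1 a2 a3] := H h nh u su.
  have e1 : - D (x + h) u - - D x u = - (D (x + h) u - D x u) by abel.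
  have e2 : - D (x + h) u - - D x u - - D' x (h :: u) =
      - (D (x + h) u - D x u - D' x (h :: u)) by abel.
  have nN (v : Z) : nZ (- v) = nZ v by exact: normN nZP v.
  split; [apply: (le_trans _ a1)|apply: (le_trans _ a2)|apply: (le_trans _ a3)];
    apply: le_of_eq.
  + exact: nN.
  + exact: (etrans (congr1 nZ e1) (nN _)).
  + exact: (etrans (congr1 nZ e2) (nN _)).
(* The mask [true :: nseq k false] hands the new direction to [dz] and the k old ones to [D]. *)
- exists (fun x u => (0, Rinv x (L (D' x u))) -
    (0, Rinv x (polar (dz x (mask (true :: nseq k false) u))
           (0, Rinv x (L (D x (mask (map negb (true :: nseq k false)) u))))))).
    apply: JetA; first exact: JetL.
    apply: JetN; apply: (@JetQ _ 1 k (true :: nseq k false) dz (fun x u => (0, Rinv x (L (D x u))))).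
    * by rewrite /= size_nseq.
    * by rewrite /= count_nseq.
    * by rewrite /= count_nseq mul1n.
    * exact: jdz.
    * exact: JetL.
  move=> x Ux; have [K1 K11 H1] := d x Ux; have [K2 K21 H2] := Rinv_near Ux.
  have KK : 1 <= CF * K1 by nra.
  have KK' : 1 <= K2 * (CF * K1) by nra.
  exists (K1 + K2 * (CF * K1)) => [|h nh u su]; first lra.
  have [|a1 a2 a3] := H1 h _ u su; first by apply: near_at_le nh => //; lra.
  have [|||||r1 r2 r3] := H2 h _ (L (D x u)) (L (D (x + h) u)) (L (D' x (h :: u))) (CF * K1 * prodn u).
  + by apply: near_at_le nh => //; nra.
  + by rewrite mulr_ge0 ?prodn_ge0//; lra.
  + by apply: (le_trans (bq_Lb LQ _)); rewrite -mulrA ler_wpM2l//; lra.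
  + rewrite -(bq_LN LQ) -(bq_LD LQ); apply: (le_trans (bq_Lb LQ _)).
    by rewrite -!mulrA ler_wpM2l ?mulrA//; lra.
  + rewrite -!(bq_LN LQ) -!(bq_LD LQ); apply: (le_trans (bq_Lb LQ _)).
    by rewrite -!mulrA ler_wpM2l ?mulrA//; lra.
  have p0 := prodn_ge0 u; have t0 := norm_ge0 nXP h; have t20 := sqr_ge0 (nX h).
  have PP : 0 <= K1 * prodn u by rewrite mulr_ge0//; lra.
  have mD : mask (nseq k true) u = u by rewrite -su mask_true.
  have e (w w' : W) : (0, w) - (0, w') = (0, w - w') :> Z by congr pair; rewrite subr0.
  split; rewrite ?e ?(nZ0 _ nXP).
  + by apply: (le_trans r1); lra.
  + by apply: (le_trans r2); have := mulr_ge0 PP t0; lra.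
  rewrite /= map_nseq /= mD mask_false /= dzE//.
  by apply: (le_trans r3); have := mulr_ge0 PP t20; lra.
(* The bit prepended to the mask records which factor the new direction differentiates; the last
   term comes from differentiating the inverse. *)
exists (fun x u =>
  ((0, Rinv x (polar (D1' x (mask (true :: m) u)) (D2 x (mask (map negb (true :: m)) u)))) +
   (0, Rinv x (polar (D1 x (mask (false :: m) u)) (D2' x (mask (map negb (false :: m)) u))))) -
  (0, Rinv x (polar (dz x (mask (true :: nseq k false) u))
     (0, Rinv x (polar (D1 x (mask m (mask (map negb (true :: nseq k false)) u)))
          (D2 x (mask (map negb m) (mask (map negb (true :: nseq k false)) u)))))))).
  apply: JetA; [apply: JetA|apply: JetN].
  + by apply: (@JetQ _ k1.+1 k2 (true :: m)) => //=; rewrite ?sm ?c1 ?c2.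
  + by apply: (@JetQ _ k1 k2.+1 (false :: m)) => //=; rewrite ?sm ?c1 ?c2.
  apply: (@JetQ _ 1 k (true :: nseq k false) dz
    (fun x u => (0, Rinv x (polar (D1 x (mask m u)) (D2 x (mask (map negb m) u)))))).
  + by rewrite /= size_nseq.
  + by rewrite /= count_nseq.
  + by rewrite /= count_nseq mul1n.
  + exact: jdz.
  + exact: (JetQ sm c1 c2).
move=> x Ux; have [K1 K11 H1] := d1 x Ux; have [K2 K21 H2] := d2 x Ux.
have [K3 K31 H3] := Rinv_near Ux.
have KK0 : 1 <= K1 * K2 by nra.
have KK : 1 <= CF * (K1 * K2) by nra.
have KK' : 1 <= K3 * (6 * (CF * (K1 * K2))) by nra.
exists (K1 + K2 + K3 * (6 * (CF * (K1 * K2)))) => [|h nh u su]; first lra.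
have mu : size m = size u by rewrite sm su.
have s1 : size (mask m u) = k1 by rewrite size_mask.
have s2 : size (mask (map negb m) u) = k2.
  by rewrite size_mask ?size_map// count_map -c2; apply: eq_count => -[].
have [|a1 a2 a3] := H1 h _ _ s1; first by apply: near_at_le nh => //; lra.
have [|b1 b2 b3] := H2 h _ _ s2; first by apply: near_at_le nh => //; lra.
have pE := prodn_mask mu.
set u1 := mask m u in s1 a1 a2 a3 pE *; set u2 := mask (map negb m) u in s2 b1 b2 b3 pE *.
have q1 := prodn_ge0 u1; have q2 := prodn_ge0 u2.
have t0 := norm_ge0 nXP h; have t20 := sqr_ge0 (nX h).
have t1 : nX h <= 1 by apply: (@near_at_le1 x K1) => //; apply: near_at_le nh => //; lra.
have pol (v w : Z) (a b : R) : nZ v <= a -> nZ w <= b -> nY (polar v w) <= 2 * CF * (a * b).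
  move=> va wb; apply: (le_trans (polar_bound nYP LQ _ _)).
  by rewrite ler_wpM2l//; [lra|apply: ler_pM => //; exact: (norm_ge0 nZP)].
have D2h : nZ (D2 (x + h) u2) <= 2 * (K2 * prodn u2).
  apply: (le_trans (norm_le_sub nZP _ (D2 x u2))).
  have : K2 * prodn u2 * nX h <= K2 * prodn u2.
    by rewrite ler_piMr// mulr_ge0//; lra.
  by lra.
pose y1 := polar (D1' x (h :: u1)) (D2 x u2) + polar (D1 x u1) (D2' x (h :: u2)).
have yE : polar (D1 (x + h) u1) (D2 (x + h) u2) - polar (D1 x u1) (D2 x u2) =
    polar (D1 (x + h) u1 - D1 x u1) (D2 (x + h) u2) + polar (D1 x u1) (D2 (x + h) u2 - D2 x u2).
  by rewrite (polarDl LQ) (polarDr LQ) (polarNl LQ) (polarNr LQ); abel.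
have yE1 : polar (D1 (x + h) u1) (D2 (x + h) u2) - polar (D1 x u1) (D2 x u2) - y1 =
    polar (D1 (x + h) u1 - D1 x u1 - D1' x (h :: u1)) (D2 x u2) +
    polar (D1 (x + h) u1 - D1 x u1) (D2 (x + h) u2 - D2 x u2) +
    polar (D1 x u1) (D2 (x + h) u2 - D2 x u2 - D2' x (h :: u2)).
  rewrite /y1 !(polarDl LQ) !(polarDr LQ) !(polarNl LQ) !(polarNr LQ); abel.
have P0 : 0 <= CF * (K1 * K2) * prodn u by rewrite mulr_ge0 ?prodn_ge0//; lra.
(* The factor 6 is 4 + 2 in the Lipschitz estimate, as [D2] at x + h is bounded by twice its bound
   at x, and 2 + 2 + 2 in the second-order one. *)
have [|||||r1 r2 r3] := H3 h _ (polar (D1 x u1) (D2 x u2)) (polar (D1 (x + h) u1) (D2 (x + h) u2))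
  y1 (6 * (CF * (K1 * K2)) * prodn u).
+ by apply: near_at_le nh => //; nra.
+ by lra.
+ by apply: (le_trans (pol _ _ _ _ a1 b1)); rewrite pE in P0 *; lra.
+ rewrite yE; apply: (le_trans (norm_add nYP _ _)).
  apply: (le_trans (lerD (pol _ _ _ _ a2 D2h) (pol _ _ _ _ a1 b2))).
  by rewrite pE; apply: le_of_eq; ring.
+ rewrite yE1; apply: (le_trans (norm_add nYP _ _)).
  apply: (le_trans (lerD (norm_add nYP _ _) (lexx _))).
  apply: (le_trans (lerD (lerD (pol _ _ _ _ a3 b1) (pol _ _ _ _ a2 b2)) (pol _ _ _ _ a1 b3))).
  by rewrite pE; apply: le_of_eq; ring.
have p0 := prodn_ge0 u.
have PP : 0 <= (K1 + K2) * prodn u by rewrite mulr_ge0//; lra.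
have mD : mask (nseq k true) u = u by rewrite -su mask_true.
have e (w w' : W) : (0, w) - (0, w') = (0, w - w') :> Z by congr pair; rewrite subr0.
split; rewrite ?e ?(nZ0 _ nXP).
+ by apply: (le_trans r1); lra.
+ by apply: (le_trans r2); have := mulr_ge0 PP t0; lra.
rewrite /= map_nseq /= mD mask_false /= dzE// -/u1 -/u2.
rewrite /y1 RD// in r3.
have nz (v : Z) : v.1 = 0 -> nZ v = nW v.2.
  by move=> v0; rewrite /norm_pair v0 (norm0 nXP) add0r.
rewrite nz; last by rewrite /= !(addr0, subr0).
by apply: (le_trans r3); have := mulr_ge0 PP t20; lra.
Qed.

Theorem implicit_smooth : exists D : X -> seq X -> W, forall x, U x ->
  [/\ D x [::] = Phi x,
      forall u u' a y y',
        D x (u ++ (a *: y + y') :: u') = a *: D x (u ++ y :: u') + D x (u ++ y' :: u'),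
      forall k, exists C, forall u, size u = k -> nW (D x u) <= C * prodn u
    & forall k e, 0 < e -> exists2 r, 0 < r & forall h, nX h < r -> U (x + h) ->
        forall u, size u = k ->
        nW (D (x + h) u - D x u - D x (h :: u)) <= e * nX h * prodn u].
Proof.
pose S k := {D : X -> seq X -> Z | jet k D}.
pose nxt k (s : S k) : S k.+1 :=
  let: exist2 D' j _ := cid2 (jet_differentiable (svalP s)) in exist _ D' j.
have nxtP k (s : S k) : jet_diff k (sval s) (sval (nxt k s)).
  by rewrite /nxt; case: cid2.
(* Derivatives are chosen successively from [JetZ] on; the second component of the jet of order k is
   the k-th derivative of [Phi]. *)
pose F := fix F k : S k := if k is k'.+1 then nxt k' (F k') else exist _ _ JetZ.
pose D x u := (sval (F (size u)) x u).2.
have le2 (v : Z) : nW v.2 <= nZ v by rewrite lerDr norm_ge0.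
exists D => x Ux; split => //.
- move=> u u' a y y'; rewrite /D !size_cat/=.
  by rewrite (jet_multilinear (svalP (F (size u + (size u').+1)%N)) Ux) ?size_cat.
- move=> k; have [K K1 HK] := nxtP k (F k) x Ux.
  exists K => u su; rewrite /D su.
  have n0 : near_at x K 0 by rewrite /near_at (norm0 nXP) addr0; split=> //; rewrite invr_gt0; lra.
  by have [h1 _ _] := HK 0 n0 u su; exact: le_trans (le2 _) h1.
move=> k e e0; have [K K1 HK] := nxtP k (F k) x Ux.
have K0 : 0 < K by lra.
(* A remainder K |h|^2 is at most e |h| as soon as K |h| < e. *)
exists (Order.min K^-1 (e / K)); first by rewrite lt_min invr_gt0 K0 divr_gt0.
move=> h; rewrite lt_min => /andP[hK he] Uh u su; rewrite /D /= su.
have [_ _ h3] := HK h (conj hK Uh) u su.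
apply: (le_trans (le2 (sval (F k) (x + h) u - sval (F k) x u - sval (nxt k (F k)) x (h :: u)))); apply: (le_trans h3).
rewrite ltr_pdivlMr// in he.
have t0 := norm_ge0 nXP h; have p0 := mulr_ge0 t0 (prodn_ge0 u).
have -> : K * prodn u * nX h ^+ 2 = (nX h * K) * (nX h * prodn u) by ring.
by rewrite -[X in _ <= X]mulrA; apply: ler_wpM2r => //; exact: ltW.
Qed.

End implicit_smooth.

(** * Local solution of a quadratic equation *)

Section local_solution.
Context {R : realType} {X W Y : lmodType R}.
Variables (nX : X -> R) (nW : W -> R) (nY : Y -> R).
Hypotheses (nXP : is_norm nX) (nWP : is_norm nW) (nYP : is_norm nY).
Hypothesis cW : fast_complete nW.
Local Notation Z := (X * W)%type.
Local Notation nZ := (norm_pair nX nW).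
Variables (y0 : Y) (L : Z -> Y) (Q : Z -> Z -> Y) (CF : R).
Hypothesis LQ : bounded_quadratic nX nW nY L Q CF.
Variables (x0 : X) (w0 : W) (R0 : Y -> W) (c : R).
Hypothesis z0E : quad y0 L Q (x0, w0) = 0.
Hypothesis R0l : forall a u v, R0 (a *: u + v) = a *: R0 u + R0 v.
Hypothesis c1 : 1 <= c.
Hypothesis R0b : forall y, nW (R0 y) <= c * nY y.
Hypothesis R0K : forall w, R0 (dquad L Q (x0, w0) w) = w.
Hypothesis KR0 : forall y, dquad L Q (x0, w0) (R0 y) = y.
Local Notation polar := (polar Q).
Local Notation quad := (quad y0 L Q).
Local Notation dquad := (dquad L Q).

Let nZP : is_norm nZ := norm_pairP nXP nWP.

Let R0D u v : R0 (u + v) = R0 u + R0 v.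
Proof. by rewrite -[u]scale1r R0l !scale1r. Qed.
Let R00 : R0 0 = 0.
Proof. by have := R0D 0 0; rewrite addr0 => /addr_self0. Qed.
Let R0N u : R0 (- u) = - R0 u.
Proof. by apply/eqP; rewrite -addr_eq0 -R0D addNr R00. Qed.
Let R0B u v : R0 (u - v) = R0 u - R0 v.
Proof. by rewrite R0D R0N. Qed.

(** Twelve, because the contraction ratio of the iteration comes out as 6 c CF delta = 1/2; for
    nearby linearisations it is 4 c CF delta = 1/3. *)
Definition ift_radius : R := (12 * (c * CF))^-1.
Local Notation delta := ift_radius.

Let cC1 : 1 <= c * CF.
Proof. by have CF1 := bq_C LQ; move: c1 => c1'; nra. Qed.
Lemma ift_radius_gt0 : 0 < delta.
Proof. by rewrite invr_gt0; have := cC1; lra. Qed.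
Let cCd : c * CF * delta = 1 / 12.
Proof. by rewrite /delta invfM mulrCA mulfV ?mulr1 ?div1r// lt0r_neq0//; have := cC1; lra. Qed.
Let pairB (x : X) (u v : W) : (x, u) - (x, v) = (0, u - v) :> Z.
Proof. by congr pair; exact: subrr. Qed.

(** Newton's iteration with the inverse frozen at the base point: in the difference of two steps the
    linearisation at the base cancels, and the rest is polarised against increments of size
    delta. *)
Lemma newton_contraction x u v : nX (x - x0) <= delta -> nW (u - w0) <= delta ->
  nW (v - w0) <= delta ->
  nW ((u - R0 (quad (x, u))) - (v - R0 (quad (x, v)))) <= 2^-1 * nW (u - v).
Proof.
have CF1 := bq_C LQ.
move=> xd ud vd; set dw := u - v.
have E : (u - R0 (quad (x, u))) - (v - R0 (quad (x, v))) =
    - R0 (polar ((x, v) - (x0, w0)) (0, dw) + Q (0, dw) (0, dw)).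
  have -> : (u - R0 (quad (x, u))) - (v - R0 (quad (x, v))) =
     dw - R0 (quad (x, u) - quad (x, v)) by rewrite R0B /dw; abel.
  rewrite -{1}(R0K dw) -R0B -R0N; congr (R0 _).
  have -> : quad (x, u) - quad (x, v) = L (0, dw) + polar (x, v) (0, dw) + Q (0, dw) (0, dw).
    rewrite -(quadB y0 LQ); congr (quad _ - _); congr pair; first by rewrite /= addr0.
    by rewrite /dw /= addrC subrK.
  have -> : dquad (x0, w0) dw = L (0, dw) + polar (x0, w0) (0, dw) by [].
  rewrite (polarDl LQ) (polarNl LQ); abel.
rewrite E (normN nWP); apply: (le_trans (R0b _)).
have n0 := norm_ge0 nWP dw.
have b1 : nY (polar ((x, v) - (x0, w0)) (0, dw)) <= 2 * CF * (2 * delta * nW dw).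
  apply: (le_trans (polar_bound nYP LQ _ _)); rewrite (nZ0 _ nXP).
  rewrite ler_wpM2l//; first lra.
  by rewrite ler_wpM2r// /norm_pair /=; lra.
have b2 : nY (Q (0, dw) (0, dw)) <= CF * (2 * delta * nW dw).
  apply: (le_trans (bq_Qb LQ _ _)); rewrite (nZ0 _ nXP) ler_wpM2l//; first lra.
  rewrite ler_wpM2r//.
  apply: (le_trans (norm_sub_trans nWP w0 _ _)); rewrite [X in _ + X](norm_subC nWP); lra.
have : c * nY (polar ((x, v) - (x0, w0)) (0, dw) + Q (0, dw) (0, dw)) <=
   c * (2 * CF * (2 * delta * nW dw) + CF * (2 * delta * nW dw)).
  rewrite ler_wpM2l//; first by move: c1; lra.
  by apply: (le_trans (norm_add nYP _ _)); exact: lerD.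
have -> : c * (2 * CF * (2 * delta * nW dw) + CF * (2 * delta * nW dw)) =
   6 * (c * CF * delta) * nW dw by ring.
by rewrite cCd; lra.
Qed.

Lemma dquad_near x w v : nX (x - x0) <= delta -> nW (w - w0) <= delta ->
  nW (v - R0 (dquad (x, w) v)) <= 2^-1 * nW v.
Proof.
have CF1 := bq_C LQ.
move=> xd wd; rewrite -{1}(R0K v) -R0B; apply: (le_trans (R0b _)).
have n0 := norm_ge0 nWP v.
have : nY (dquad (x0, w0) v - dquad (x, w) v) <= 2 * CF * (2 * delta * nW v).
  apply: (le_trans (dquadB nXP nYP LQ _ _ _)); rewrite ler_wpM2l//; first lra.
  rewrite ler_wpM2r// (norm_subC nZP) /norm_pair/=; lra.
move=> h; apply: (@le_trans _ _ (c * (2 * CF * (2 * delta * nW v)))).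
  by rewrite ler_wpM2l//; move: c1; lra.
have -> : c * (2 * CF * (2 * delta * nW v)) = 4 * (c * CF * delta) * nW v by ring.
by rewrite cCd; lra.
Qed.

Lemma ift_unique x w w' : nX (x - x0) <= delta -> nW (w - w0) <= delta ->
  nW (w' - w0) <= delta -> quad (x, w) = 0 -> quad (x, w') = 0 -> w = w'.
Proof.
move=> xd wd wd' e e'.
have := newton_contraction xd wd wd'; rewrite e e' R00 !subr0 => h.
by apply: (@contraction_unique _ _ _ nWP id).
Qed.

(** A Neumann series in the guise of the fixed point of v -> R0 y + (v - R0 (dquad v)), of ratio 1/2
    by [dquad_near]. From 0 the first step is [R0 y], hence the radius 4 |R0 y|. *)
Lemma dquad_inverse x w : nX (x - x0) <= delta -> nW (w - w0) <= delta ->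
  exists Ri : Y -> W, [/\ forall a u v, Ri (a *: u + v) = a *: Ri u + Ri v,
    forall y, nW (Ri y) <= 4 * c * nY y,
    forall y, dquad (x, w) (Ri y) = y & forall v, Ri (dquad (x, w) v) = v].
Proof.
move=> xd wd.
have inj u v : dquad (x, w) u = dquad (x, w) v -> u = v.
  move=> e; have := dquad_near (u - v) xd wd.
  have -> : dquad (x, w) (u - v) = 0.
    by rewrite (dquadD LQ) -scaleN1r (dquadZ LQ) scaleN1r e subrr.
  rewrite R00 subr0 => h; apply/eqP; rewrite -subr_eq0; apply/eqP/(norm_eq0 nWP).
  by move: h (norm_ge0 nWP (u - v)); lra.
have ex y : exists v, dquad (x, w) v = y /\ nW v <= 4 * c * nY y.
  have := @contraction_fixed_point _ _ _ nWP cW 0 (4 * nW (R0 y))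
    (fun v => R0 y + (v - R0 (dquad (x, w) v))).
  case.
  - by rewrite mulr_ge0 ?(norm_ge0 nWP).
  - move=> u v _ _.
    have -> : R0 y + (u - R0 (dquad (x, w) u)) - (R0 y + (v - R0 (dquad (x, w) v))) =
        (u - v) - R0 (dquad (x, w) (u - v)).
      rewrite (dquadD LQ) (_ : dquad (x, w) (- v) = - dquad (x, w) v) ?R0B; first abel.
      by rewrite -scaleN1r (dquadZ LQ) scaleN1r.
    exact: dquad_near.
  - have -> : dquad (x, w) 0 = 0 by rewrite -[0 in LHS](scale0r (0 : W)) (dquadZ LQ) scale0r.
    by rewrite R00 !subr0 addr0; lra.
  move=> v [nv e]; exists v; split; last first.
    by move: nv (R0b y); rewrite subr0; lra.
  apply/eqP; rewrite -subr_eq0; apply/eqP.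
  rewrite -[LHS]KR0 R0B.
  have : R0 y - R0 (dquad (x, w) v) = 0 by rewrite -[RHS](subrr v) -{2}e; abel.
  by move=> /eqP; rewrite subr_eq0 => /eqP ->; rewrite subrr -(KR0 0) R00.
have [Ri HRi] := choice ex.
exists Ri; split.
- move=> a u v; apply: inj.
  by rewrite (dquadD LQ) (dquadZ LQ) !(HRi _).1.
- by move=> y; have [] := HRi y.
- by move=> y; have [] := HRi y.
- by move=> v; apply: inj; have [] := HRi (dquad (x, w) v).
Qed.

Let quad_xB x x' w : nX (x - x') <= 1 ->
  nY (quad (x, w) - quad (x', w)) <= CF * (2 + 2 * nZ (x', w)) * nX (x - x').
Proof.
have CF1 := bq_C LQ.
move=> h1; have z0 := norm_ge0 nZP (x', w); have t0 := norm_ge0 nXP (x - x').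
have nE : nZ (x - x', 0) = nX (x - x') by rewrite /norm_pair/= (norm0 nWP) addr0.
have -> : quad (x, w) - quad (x', w) =
    L (x - x', 0) + polar (x', w) (x - x', 0) + Q (x - x', 0) (x - x', 0).
  rewrite -(quadB y0 LQ); congr (quad _ - _); congr pair; last by rewrite /= addr0.
  by rewrite /= addrC subrK.
apply: (le_trans (norm_add nYP _ _)); apply: (le_trans (lerD (norm_add nYP _ _) (lexx _))).
have := bq_Lb LQ (x - x', 0); have := polar_bound nYP LQ (x', w) (x - x', 0).
have := bq_Qb LQ (x - x', 0) (x - x', 0); rewrite !nE.
have : nX (x - x') * nX (x - x') <= nX (x - x') by rewrite ler_piMl.
move=> a1 a2 a3 a4.
have : CF * (nX (x - x') * nX (x - x')) <= CF * nX (x - x').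
  by rewrite ler_wpM2l//; lra.
by lra.
Qed.

(** It keeps the first Newton step within delta / 16, a quarter of the radius delta / 4 on which the
    iteration is run. *)
Definition ift_radius_x : R :=
  Order.min delta (delta / (16 * (c * (CF * (2 + 2 * nZ (x0, w0)))))).

Let den_gt0 : 0 < 16 * (c * (CF * (2 + 2 * nZ (x0, w0)))).
Proof.
have z0 := norm_ge0 nZP (x0, w0); have CF1 := bq_C LQ; have c1' := c1.
by rewrite !mulr_gt0//; lra.
Qed.

Lemma ift_radius_x_gt0 : 0 < ift_radius_x.
Proof. by rewrite lt_min ift_radius_gt0 divr_gt0 ?ift_radius_gt0. Qed.

Lemma ift_exists x : nX (x - x0) <= ift_radius_x ->
  exists w, nW (w - w0) <= delta / 4 /\ quad (x, w) = 0.
Proof.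
have d0 := ift_radius_gt0.
rewrite le_min => /andP[xd xr].
have [|||w [wd e]] := @contraction_fixed_point _ _ _ nWP cW w0 (delta / 4)
    (fun w => w - R0 (quad (x, w))).
- by lra.
- by move=> u v ud vd; apply: newton_contraction => //; lra.
- have -> : w0 - R0 (quad (x, w0)) - w0 = - R0 (quad (x, w0)) by abel.
  rewrite (normN nWP) -[quad (x, w0)]subr0 -z0E.
  apply: (le_trans (R0b _)).
  have d1 : delta <= 1 by rewrite invf_le1; have := cC1; lra.
  have := @quad_xB x x0 w0 (le_trans xd d1).
  move: xr; rewrite ler_pdivlMr// => xr h.
  have : c * nY (quad (x, w0) - quad (x0, w0)) <=
      c * (CF * (2 + 2 * nZ (x0, w0)) * nX (x - x0)).
    by rewrite ler_wpM2l//; move: c1; lra.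
  by lra.
exists w; split=> //.
have : R0 (quad (x, w)) = 0.
  by apply/eqP; rewrite -oppr_eq0; apply/eqP/(@addrI _ w); rewrite addr0.
by move=> e0; rewrite -[LHS]KR0 e0 -R00 KR0.
Qed.

(** [w] is fixed by the iteration at x, and [w'] fails to be so only by the variation of [quad]
    between x and x'; the ratio 1/2 turns this defect into twice itself. *)
Lemma ift_lipschitz : exists2 C, 1 <= C & forall x x' w w',
  nX (x - x0) <= delta -> nX (x' - x0) <= delta ->
  nW (w - w0) <= delta -> nW (w' - w0) <= delta ->
  quad (x, w) = 0 -> quad (x', w') = 0 -> nW (w - w') <= C * nX (x - x').
Proof.
have CF1 := bq_C LQ; have c1' := c1; have d0 := ift_radius_gt0.
have z0 := norm_ge0 nZP (x0, w0).
have d1 : delta <= 1 / 12.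
  by rewrite /delta -[1 / 12]/(1 * 12^-1) mul1r lef_pV2 ?posrE; have := cC1; lra.
pose C := 2 * (c * (CF * (2 + 2 * (nZ (x0, w0) + 1)))).
have C1 : 1 <= C.
  have s2 : 2 <= 2 + 2 * (nZ (x0, w0) + 1) by lra.
  have h : 2 <= CF * (2 + 2 * (nZ (x0, w0) + 1)).
    by apply: (le_trans s2); rewrite ler_peMl//; lra.
  have h' : 2 <= c * (CF * (2 + 2 * (nZ (x0, w0) + 1))).
    by apply: (le_trans h); rewrite ler_peMl//; lra.
  by rewrite /C; lra.
exists C => // x x' w w' xd xd' wd wd' e e'.
have x1 : nX (x - x') <= 1.
  apply: (le_trans (norm_sub_trans nXP x0 _ _)); rewrite [X in _ + X](norm_subC nXP); lra.
have := newton_contraction xd wd wd'; rewrite e R00 subr0 => h.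
have -> : w - w' = (w - (w' - R0 (quad (x, w')))) - R0 (quad (x, w')) by abel.
have h2 : nW (R0 (quad (x, w'))) <= c * (CF * (2 + 2 * (nZ (x0, w0) + 1)) * nX (x - x')).
  rewrite -[quad (x, w')]subr0 -e'; apply: (le_trans (R0b _)).
  rewrite ler_wpM2l//; first lra.
  apply: (le_trans (quad_xB _ x1)).
  rewrite ler_wpM2r ?norm_ge0// ler_wpM2l//; first lra.
  rewrite lerD2l ler_wpM2l//; apply: (le_trans (norm_le_sub nZP _ (x0, w0))).
  by rewrite addrC lerD2l /norm_pair/=; lra.
have := norm_sub nWP (w - (w' - R0 (quad (x, w')))) (R0 (quad (x, w'))).
have -> : (w - (w' - R0 (quad (x, w')))) - R0 (quad (x, w')) = w - w' by abel.
by rewrite /C; lra.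
Qed.

End local_solution.

(** * Banach spaces of Hartley transforms *)

Section space.
Context {R : realType} {d : nat}.
Local Notation E := 'rV[R]_d.
Local Notation mu := (@lebesgue_rV R d).
Implicit Types (h u v : E -> R) (w : weight R d).

Definition in_space w : {pred E -> R} := fun u => `[< exists2 h, L2 w h & u = ihart h >].

(** A density chosen without reference to a weight, so that one coefficient serves in every space
    containing u; it is unique up to null sets and 0 if there is none. *)
Definition coef u : E -> R := xget (fun=> 0) [set h | L1 h /\ u = ihart h].

Lemma L2_ae w h (k : E -> R) : measurable_fun setT k -> {ae mu, forall x, h x = k x} -> L2 w h -> L2 w k.
Proof.
move=> mk hk [mh hi]; split=> //; rewrite /wsq.
rewrite -(_ : wsq w h = \int[mu]_x (w x * k x ^+ 2)%:E)%E//.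
apply: ae_eq_integral => //; [exact: measurable_wsq|exact: measurable_wsq|].
by apply: filterS hk => x /= -> _.
Qed.

Lemma coefP w u : u \in in_space w -> L2 w (coef u) /\ u = ihart (coef u).
Proof.
move=> /asboolP[h hL uh]; rewrite /coef; case: xgetP => [k _ [ik uk]|/(_ h)]; last first.
  by move=> []; split => //; exact: L2_L1 hL.
split=> //; apply: (L2_ae (L1_measurable ik) _ hL).
by apply: ihart_inj => //; [exact: L2_L1 hL|rewrite -uh -uk].
Qed.

Lemma in_spaceI w h : L2 w h -> ihart h \in in_space w.
Proof. by move=> hL; apply/asboolP; exists h. Qed.

Lemma coef_ae w h : L2 w h -> {ae mu, forall x, coef (ihart h) x = h x}.
Proof.
move=> hL; have [cL ce] := coefP (in_spaceI hL).
by apply: ihart_inj; [exact: L2_L1 cL|exact: L2_L1 hL|].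
Qed.

Definition spnorm w u : R := wnorm w (coef u).

Lemma spnorm_ihart w h : L2 w h -> spnorm w (ihart h) = wnorm w h.
Proof.
move=> hL; have [cL _] := coefP (in_spaceI hL).
by apply: wnorm_ae; [exact: cL.1|exact: hL.1|exact: coef_ae hL].
Qed.

Lemma ihartD h (k : E -> R) : L1 h -> L1 k -> ihart (fun x => h x + k x) = fun x => ihart h x + ihart k x.
Proof. by move=> ih ik; apply/funext => x; rewrite /ihart hartD// mulrDr. Qed.
Lemma ihartZ (c : R) h : L1 h -> ihart (fun x => c * h x) = fun x => c * ihart h x.
Proof. by move=> ih; apply/funext => x; rewrite /ihart hartZ// mulrCA. Qed.

Lemma in_spaceD w u v : u \in in_space w -> v \in in_space w ->
  (fun x => u x + v x) \in in_space w /\ spnorm w (fun x => u x + v x) <= spnorm w u + spnorm w v.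
Proof.
move=> /coefP[hu eu] /coefP[hv ev]; have [hL hn] := L2D hu hv.
have e : (fun x => u x + v x) = ihart (fun x => coef u x + coef v x).
  rewrite ihartD; [|exact: L2_L1 hu|exact: L2_L1 hv].
  by apply/funext => x; rewrite -eu -ev.
by rewrite e; split; [exact: in_spaceI|rewrite spnorm_ihart].
Qed.

Lemma in_spaceZ w (c : R) u : u \in in_space w ->
  (fun x => c * u x) \in in_space w /\ spnorm w (fun x => c * u x) = `|c| * spnorm w u.
Proof.
move=> /coefP[hu eu]; have hL := L2Z c hu.
have e : (fun x => c * u x) = ihart (fun x => c * coef u x).
  rewrite ihartZ; last exact: L2_L1 hu.
  by apply/funext => x; rewrite -eu.
by rewrite e; split; [exact: in_spaceI|rewrite spnorm_ihart// wnormZ].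
Qed.

Lemma L2_0 w : L2 w (fun=> 0).
Proof.
apply: L2P => //; have := @L1_0 R d; congr L1.
by apply/funext => x; rewrite expr0n mulr0.
Qed.

Lemma ihart0 : ihart (fun _ : E => 0) = fun=> 0.
Proof.
have := ihartZ 0 (@L1_0 R d); rewrite (_ : (fun x => 0 * 0) = fun=> 0).
  by move=> ->; apply/funext => x; rewrite mul0r.
by apply/funext => x; rewrite mul0r.
Qed.

Lemma in_space_closed w : submod_closed (in_space w).
Proof.
split; first by rewrite -[X in X \in _]ihart0; exact: (in_spaceI (L2_0 w)).
move=> c u v uw vw; have [cu _] := in_spaceZ c uw.
exact: (in_spaceD cu vw).1.
Qed.

HB.instance Definition _ w := GRing.isSubmodClosed.Build R (E -> R) (in_space w) (in_space_closed w).

Record sp w := Sp { sp_fun :> E -> R ; sp_in : sp_fun \in in_space w }.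

HB.instance Definition _ w := [isSub for @sp_fun w].
HB.instance Definition _ w := [Choice of sp w by <:].
HB.instance Definition _ w := [SubChoice_isSubLmodule of sp w by <:].

Definition to_sp w u : sp w := insubd 0 u.

Lemma to_spE w u : u \in in_space w -> (to_sp w u : E -> R) = u.
Proof. by move=> uw; exact: (insubdK _ uw). Qed.
Lemma sp_inj w (u v : sp w) : (u : E -> R) = v -> u = v.
Proof. exact: val_inj. Qed.
Lemma spD w (u v : sp w) x : (u + v) x = u x + v x. Proof. by []. Qed.
Lemma spZ w (c : R) (u : sp w) x : (c *: u) x = c * u x. Proof. by []. Qed.
Lemma spN w (u : sp w) x : (- u) x = - u x. Proof. by []. Qed.
Definition spn w (u : sp w) : R := spnorm w u.

Lemma sp_coef w (u : sp w) : L2 w (coef u) /\ (u : E -> R) = ihart (coef u).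
Proof. exact: coefP (sp_in u). Qed.

Lemma spn_is_norm w : is_norm (@spn w).
Proof.
split.
- by move=> u; exact: wnorm_ge0.
- by move=> u v; exact: (in_spaceD (sp_in u) (sp_in v)).2.
- by move=> c u; exact: (in_spaceZ c (sp_in u)).2.
move=> u u0; have [uL uE] := sp_coef u; apply: sp_inj.
rewrite uE -[RHS]ihart0; apply: hart_ae; [exact: uL.1|exact: measurable_cst|].
exact: wnorm_eq0 uL u0.
Qed.

Lemma L2B w h (k : E -> R) : L2 w h -> L2 w k ->
  L2 w (fun x => h x - k x) /\ wnorm w (fun x => h x - k x) <= wnorm w h + wnorm w k.
Proof.
move=> hL kL; have nL := L2Z (-1) kL; have := L2D hL nL.
rewrite wnormZ// normrN normr1 mul1r.
by rewrite (_ : (fun x => h x + -1 * k x) = fun x => h x - k x)//; apply/funext => x; rewrite mulN1r.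
Qed.

Lemma wnorm0 w : wnorm w (fun=> 0) = 0.
Proof.
rewrite /wnorm (_ : (fun x => w x * 0 ^+ 2) = fun=> 0); last first.
  by apply/funext => x; rewrite expr0n mulr0.
have := RintZ 0 (@L1_0 R d); rewrite (_ : (fun x => 0 * 0) = fun=> 0).
  by move=> ->; rewrite mul0r sqrtr0.
by apply/funext => x; rewrite mul0r.
Qed.

(** Riesz-Fischer: the sum of the |h_(k+1) - h_k| has finite integral, by the embedding in L^1, so
    the sequence converges almost everywhere, and Fatou's lemma carries the weighted estimates to
    the limit. *)
Lemma L2_complete w (h : nat -> E -> R) (C : R) : (forall k, L2 w (h k)) ->
  (forall k, wnorm w (fun x => h k.+1 x - h k x) <= C * 2^-1 ^+ k) ->
  exists2 g, L2 w g & forall k, wnorm w (fun x => g x - h k x) <= 2 * C * 2^-1 ^+ k.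
Proof.
move=> hL hC; have mh k := (hL k).1.
pose D k x := h k.+1 x - h k x.
have DL k : L2 w (D k) := (L2B (hL k.+1) (hL k)).1.
have C0 : 0 <= C by have := hC 0%N; rewrite mulr1; exact: le_trans (wnorm_ge0 _ _).
pose F x : \bar R := (\sum_(0 <= k <oo) (`|D k x|)%:E)%E.
have mD k : measurable_fun setT (fun x => (`|D k x|)%:E).
  by apply/measurable_EFinP; apply: measurableT_comp => //; exact: (DL k).1.
have F0 x : (0 <= F x)%E by apply: nneseries_ge0 => k _ _; rewrite lee_fin.
have mF : measurable_fun setT F by apply: ge0_emeasurable_sum => // k x _; rewrite lee_fin.
have tele k m : wnorm w (fun x => h (k + m)%N x - h k x) <= 2 * C * 2^-1 ^+ k * (1 - 2^-1 ^+ m) /\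
    L2 w (fun x => h (k + m)%N x - h k x).
  split; last exact: (L2B _ _).1.
  elim: m => [|m IH].
    rewrite addn0 expr0 subrr mulr0 (_ : (fun x => _) = fun=> 0) ?wnorm0//.
    by apply/funext => x; rewrite subrr.
  rewrite (_ : (fun x => _) = fun x => D (k + m)%N x + (h (k + m)%N x - h k x)); last first.
    by apply/funext => x; rewrite /D addnS subrKA.
  apply: (le_trans (L2D (DL _) (L2B (hL _) (hL _)).1).2).
  apply: (le_trans (lerD (hC _) IH)); rewrite exprD exprS.
  apply: le_of_eq; by field.
have FI : (\int[mu]_x F x < +oo)%E.
  rewrite integral_nneseries//.
  set S := Num.sqrt (\int[mu]_x (w x)^-1).
  apply: (@le_lt_trans _ _ (S * C * 2)%:E); last exact: ltry.
  apply: lime_le; first by apply: is_cvg_nneseries => k _ _; apply: integral_ge0 => x _; rewrite lee_fin.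
  apply: nearW => n; rewrite (@le_trans _ _ (\sum_(0 <= k < n) (S * C * 2^-1 ^+ k)%:E)%E)//.
    apply: lee_sum => k _; rewrite -EFin_Rint; last exact/L1_norm/(L2_L1 (DL k)).
    rewrite lee_fin; apply: (le_trans (L1_norm_le (DL k))).
    by rewrite -[X in _ <= X]mulrA; apply: ler_wpM2l; [exact: sqrtr_ge0|exact: hC].
  rewrite sumEFin lee_fin -mulr_sumr ler_wpM2l ?mulr_ge0 ?sqrtr_ge0//.
  have : \sum_(0 <= k < n) 2^-1 ^+ k = 2 * (1 - 2^-1 ^+ n) :> R.
    elim: n => [|n IH]; first by rewrite big_nil expr0 subrr mulr0.
    rewrite big_nat_recr//= IH exprS; by field.
  by move=> ->; have : 0 <= 2^-1 ^+ n :> R by [rewrite exprn_ge0]; lra.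
have Fae : {ae mu, forall x, F x \is a fin_num}.
  have iF : mu.-integrable setT F.
    apply/integrableP; split => //; apply: le_lt_trans FI.
    by apply/le_of_eq/eq_integral => x _; rewrite gee0_abs.
  by have := integrable_ae measurableT iF; apply: filterS => x; apply.
pose A := [set x | (F x < +oo)%E].
have AE x : A x = (F x \is a fin_num) by rewrite ge0_fin_numE.
have mA : measurable A.
  rewrite -[A]setTI.
  by apply: emeasurable_fun_lt => //; exact: measurable_cst.
(* Replacing the sequence by 0 off the good set [A] makes it converge everywhere, hence to a
   measurable limit. *)
pose h' k x := h k x * \1_A x.
have mh' k : measurable_fun setT (h' k) by apply: measurable_funM.
have cv x : A x -> cvgn (fun k => h k x).
  move=> Ax.
  have nc : cvgn [normed series (fun k => D k x)].
    apply: nondecreasing_is_cvgn; first by apply: nondecreasing_series => k _ _; exact: normr_ge0.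
    exists (fine (F x)) => _ [n _ <-]; rewrite /= -lee_fin fineK -?AE// /series /= -sumEFin.
    by apply: nneseries_lim_ge => k _ _; rewrite lee_fin.
  have := normed_cvg nc => /cvg_ex[l Hl]; apply/cvg_ex; exists (l + h 0%N x).
  rewrite (_ : (fun k => h k x) = fun k => series (fun k => D k x) k + h 0%N x).
    exact: (cvgD Hl (cvg_cst _)).
  apply/funext => n; rewrite /series /=; elim: n => [|n IH]; first by rewrite big_nil add0r.
  by rewrite big_nat_recr//= addrAC -IH /D addrC subrK.
pose g x := lim ((fun k => h' k x) @ \oo).
have h'g x : (fun k => h' k x) @ \oo --> g x.
  suff : cvgn (fun k => h' k x) by [].
  rewrite /h' indicE; case: (boolP (x \in A)) => [|_].
    rewrite inE => Ax; under eq_fun do rewrite mulr1; exact: cv.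
  by under eq_fun do rewrite mulr0; exact: is_cvg_cst.
have mg : measurable_fun setT g by apply: (measurable_fun_cvg mh') => x _; exact: h'g.
have hh' k : {ae mu, forall x, h' k x = h k x}.
  by apply: filterS Fae => x Fx; rewrite /h' indicE mem_set ?mulr1// AE.
have key k : (\int[mu]_x (w x * (g x - h k x) ^+ 2)%:E <= ((2 * C * 2^-1 ^+ k) ^+ 2)%:E)%E.
  pose f m x := (w x * (h' (k + m)%N x - h' k x) ^+ 2)%:E.
  have mf m : measurable_fun setT (f m).
    by apply: measurable_wsq; exact: measurable_funB.
  have f0 m x : (0 <= f m x)%E by rewrite lee_fin mulr_ge0 ?sqr_ge0// ltW// wt_gt0.
  have fl x : limn_einf (f ^~ x) = (w x * (g x - h' k x) ^+ 2)%:E.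
    apply: (cvg_limn_einf_sup _).1; apply/fine_cvgP; split; first exact: nearW.
    rewrite (_ : fine \o _ = fun m => w x * ((h' (k + m)%N x - h' k x) * (h' (k + m)%N x - h' k x))).
      have c1 : (fun m => h' (k + m)%N x - h' k x) @ \oo --> g x - h' k x.
        apply: cvgB; last exact: cvg_cst.
        under eq_fun do rewrite addnC.
        have := h'g x; rewrite -(cvg_shiftn k (fun m => h' m x)) => c; exact: c.
      by rewrite expr2; apply: cvgM; [exact: cvg_cst|exact: cvgM].
    by apply/funext => m; rewrite /= expr2.
  have e1 : (\int[mu]_x (w x * (g x - h k x) ^+ 2)%:E = \int[mu]_x limn_einf (f ^~ x))%E.
    under [RHS]eq_integral do rewrite fl.
    apply: ae_eq_integral => //.
    - by apply: measurable_wsq; exact: measurable_funB.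
    - by apply: measurable_wsq; exact: measurable_funB.
    by apply: filterS (hh' k) => x /= -> _.
  rewrite e1; apply: (le_trans (fatou mu measurableT mf (fun m x _ => f0 m x))).
  rewrite limn_einf_lim; apply: lime_le; first exact: is_cvg_einfs.
  apply: nearW => n; apply: (@le_trans _ _ (\int[mu]_x f n x)%E).
    by apply: ereal_inf_lbound; exists n => /=.
  have [tn tL] := tele k n.
  have -> : (\int[mu]_x f n x = wsq w (fun x => (h (k + n)%N x - h k x)%R))%E.
    apply: ae_eq_integral => //; first exact: measurable_wsq tL.1.
    apply: filterS (filterI (hh' (k + n)%N) (hh' k)) => x /= [e2 e3] _.
    by rewrite /f e2 e3.
  rewrite wsqE// lee_fin lerXn2r ?nnegrE ?wnorm_ge0 ?mulr_ge0 ?exprn_ge0//.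
  apply: (le_trans tn); rewrite ler_piMr ?mulr_ge0 ?exprn_ge0//.
have gL k : L2 w (fun x => g x - h k x).
  split; first exact: measurable_funB.
  by apply: (le_lt_trans (key k)); exact: ltry.
exists g.
  have := (L2D (gL 0%N) (hL 0%N)).1; congr L2; apply/funext => x; exact: subrK.
move=> k; rewrite -(@ler_pXn2r _ 2) ?nnegrE ?wnorm_ge0 ?mulr_ge0 ?exprn_ge0//.
by rewrite -lee_fin -(wsqE (gL k)); exact: key.
Qed.

Lemma sp_complete w : fast_complete (@spn w).
Proof.
move=> u C uC; have uL k := (sp_coef (u k)).1; have uE k := (sp_coef (u k)).2.
have [|g gL gC] := @L2_complete w (fun k => coef (u k)) C uL.
  move=> k; apply: le_trans (uC k); rewrite /spn /spnorm.
  have bL := (L2B (uL k.+1) (uL k)).1.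
  have eB : (u k.+1 - u k : E -> R) = ihart (fun x => coef (u k.+1) x - coef (u k) x).
    have e2 : (fun x => coef (u k.+1) x - coef (u k) x) = fun x => coef (u k.+1) x + -1 * coef (u k) x.
      by apply/funext => x; rewrite mulN1r.
    rewrite e2 ihartD ?ihartZ; [|exact: L2_L1 (uL k)|exact: L2_L1 (uL k.+1)|exact/L1Z/(L2_L1 (uL k))].
    by apply/funext => x; rewrite -uE -uE mulN1r.
  by rewrite -[X in _ <= wnorm w (coef X)]/(u k.+1 - u k : E -> R) eB -[leRHS]/(spnorm w _) spnorm_ihart.
exists (Sp (in_spaceI gL)) => k; apply: le_trans (gC k).
have bL := (L2B gL (uL k)).1.
have eB : (Sp (in_spaceI gL) - u k : E -> R) = ihart (fun x => g x - coef (u k) x).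
  have e2 : (fun x => g x - coef (u k) x) = fun x => g x + -1 * coef (u k) x.
    by apply/funext => x; rewrite mulN1r.
  rewrite e2 ihartD ?ihartZ; [|exact: L2_L1 (uL k)|exact: L2_L1 gL|exact/L1Z/(L2_L1 (uL k))].
  by apply/funext => x; rewrite -uE mulN1r.
by rewrite /spn eB spnorm_ihart.
Qed.

Lemma sp_continuous w (u : sp w) : continuous (u : E -> R).
Proof. by have [uL ->] := sp_coef u; apply: ihart_continuous; exact: L2_L1 uL. Qed.


(** * Convolutions and pointwise products *)

Implicit Types k b : E -> R.
Definition conv h k (x : E) : R := \int[mu]_y (h y * k (x - y)).

Let measurable_sub : measurable_fun setT (fun z : E * E => z.1 - z.2).
Proof.
apply: measurable_fun_coordP => i.
rewrite (_ : (fun _ => _) = (fun z : E * E => z.1 ord0 i - z.2 ord0 i)).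
  by apply: measurable_funB; [exact: (measurableT_comp (measurable_coord i) measurable_fst)|
    exact: (measurableT_comp (measurable_coord i) measurable_snd)].
by apply/funext => z; rewrite !mxE.
Qed.

Let measurable_conv2 h k : measurable_fun setT h -> measurable_fun setT k ->
  measurable_fun setT (fun z : E * E => h z.2 * k (z.1 - z.2)).
Proof.
move=> mh mk; apply: measurable_funM; first exact: (measurableT_comp mh measurable_snd).
exact: (measurableT_comp mk measurable_sub).
Qed.

Lemma L1_subl k (x : E) : L1 k -> L1 (fun y => k (x - y)).
Proof.
move=> ik; have := L1_opp (L1_addr x ik); congr L1.
by apply/funext => y; rewrite addrC.
Qed.

Lemma Rint_subr k b (y : E) : L1 (fun x => k (x - y) * b x) ->
  \int[mu]_x (k (x - y) * b x) = \int[mu]_z (k z * b (y + z)).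
Proof.
move=> ik; rewrite -(Rintegral_addr y ik); apply: eq_Rintegral => z _.
by rewrite addrK addrC.
Qed.

Let lty h k b c : L1 h -> L1 k -> measurable_fun setT b -> (forall x, `|b x| <= c) ->
  (\int[mu]_x \int[mu]_y `|h y * k (x - y) * b x|%:E < +oo)%E.
Proof.
move=> ih ik mb bc.
have mh := L1_measurable ih; have mk := L1_measurable ik.
have mf : measurable_fun setT (fun z : E * E => `|h z.2 * k (z.1 - z.2) * b z.1|%:E).
  apply/measurable_EFinP; apply: measurableT_comp => //; apply: measurable_funM.
    exact: measurable_conv2.
  exact: (measurableT_comp mb measurable_fst).
rewrite (@fubini_tonelli _ _ _ _ _ mu mu _ mf); last by move=> z; rewrite lee_fin.
have c0 : 0 <= c by exact: le_trans (normr_ge0 _) (bc 0).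
apply: (@le_lt_trans _ _ (\int[mu]_y ((c * \int[mu]_z `|k z|) * `|h y|)%:E)%E); last first.
  by rewrite -EFin_Rint ?ltry//; exact/L1Z/L1_norm.
apply: ge0_le_integral => //.
- by move=> y _; apply: integral_ge0 => x _; rewrite lee_fin.
- by apply: (@measurable_fun_fubini_tonelli_G _ _ _ _ _ mu _ mf) => z; rewrite lee_fin.
- by apply/measurable_EFinP; apply: measurable_funM => //; apply: measurableT_comp.
move=> y _; have iy : L1 (fun x => k (x - y)) by exact: L1_addr.
have i1 : L1 (fun x => `|h y * k (x - y) * b x|).
  by apply: L1_norm; apply: (L1_Mb (c := c)) => //; exact: L1Z.
rewrite -EFin_Rint// lee_fin mulrAC -(@Rintegral_addr _ _ (fun z => `|k z|) (- y)); last exact: L1_norm.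
rewrite -RintZ; last exact: L1_norm.
apply: le_Rint => //; first exact/L1Z/L1_norm.
move=> x; rewrite !normrM -mulrA [c * _]mulrC -mulrA ler_wpM2l//.
by rewrite mulrC ler_wpM2r.
Qed.

Let mf3 h k b : measurable_fun setT h -> measurable_fun setT k -> measurable_fun setT b ->
  measurable_fun setT (fun z : E * E => h z.2 * k (z.1 - z.2) * b z.1).
Proof.
move=> mh mk mb; apply: measurable_funM; first exact: measurable_conv2.
exact: (measurableT_comp mb measurable_fst).
Qed.

Let mone : measurable_fun setT (fun _ : E => 1 : R). Proof. exact: measurable_cst. Qed.
Let one_le (x : E) : `|1 : R| <= 1. Proof. by rewrite normr1. Qed.

Lemma L1_conv h k : L1 h -> L1 k -> L1 (conv h k).
Proof.
move=> ih ik.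
have := integrable_Rintegral_l (mf3 (L1_measurable ih) (L1_measurable ik) mone) (lty ih ik mone one_le).
move=> H; split; move: H; congr (_.-integrable _ _); apply/funext => x /=; congr EFin.
by apply: eq_Rintegral => y _; rewrite mulr1.
Qed.

Lemma ae_L1_conv h k : L1 h -> L1 k -> {ae mu, forall x, L1 (fun y => h y * k (x - y))}.
Proof.
move=> ih ik; have mh := L1_measurable ih; have mk := L1_measurable ik.
have mf : measurable_fun setT (fun z : E * E => `|h z.2 * k (z.1 - z.2)|%:E).
  by apply/measurable_EFinP; apply: measurableT_comp => //; exact: measurable_conv2.
pose F (x : E) := (\int[mu]_y `|h y * k (x - y)|%:E)%E.
have F0 x : (0 <= F x)%E by apply: integral_ge0 => y _; rewrite lee_fin.
have iF : mu.-integrable setT F.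
  apply/integrableP; split.
    by apply: (@measurable_fun_fubini_tonelli_F _ _ _ _ _ mu _ mf) => z; rewrite lee_fin.
  apply: le_lt_trans (lty ih ik mone one_le); rewrite le_eqVlt; apply/orP; left.
  apply/eqP/eq_integral => x _; rewrite gee0_abs//; apply: eq_integral => y _.
  by rewrite mulr1.
have := integrable_ae measurableT iF; apply: filterS => x /(_ Logic.I) Fx.
apply: L1P; last by rewrite -ge0_fin_numE; [exact: Fx|exact: F0].
exact: (measurableT_comp (measurable_conv2 mh mk) (measurable_pair1 x)).
Qed.

(** Fubini against a bounded function: the constant 1 gives the integral of a convolution, the
    kernel its transform. *)
Lemma conv_dual h k b c : L1 h -> L1 k -> measurable_fun setT b -> (forall x, `|b x| <= c) ->
  \int[mu]_x (conv h k x * b x) = \int[mu]_y (h y * \int[mu]_z (k z * b (y + z))).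
Proof.
move=> ih ik mb bc.
have mfb := mf3 (L1_measurable ih) (L1_measurable ik) mb; have lb := lty ih ik mb bc.
have H := Fubini_Rintegral mfb lb.
have iky (y : E) : L1 (fun x => k (x - y) * b x).
  by apply: (L1_Mb (L1_addr (- y) ik) mb bc).
transitivity (\int[mu]_y \int[mu]_x (h y * k (x - y) * b x)); last first.
  apply: eq_Rintegral => y _; rewrite -(Rint_subr (iky y)) -(RintZ _ (iky y)).
  by apply: eq_Rintegral => x _; rewrite mulrA.
rewrite -H; apply: Rint_ae.
- by apply: measurable_funM; [exact: L1_measurable (L1_conv ih ik)|exact: mb].
- by have := integrable_Rintegral_l mfb lb => /measurable_int/measurable_EFinP.
apply: filterS (ae_L1_conv ih ik) => x ix.
by rewrite mulrC -(RintZ _ ix); apply: eq_Rintegral => y _; rewrite mulrC.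
Qed.

Lemma Rint_conv h k : L1 h -> L1 k -> \int[mu]_x conv h k x = (\int[mu]_x h x) * \int[mu]_x k x.
Proof.
move=> ih ik; have := conv_dual ih ik mone one_le.
rewrite (_ : \int[mu]_x (conv h k x * 1) = \int[mu]_x conv h k x).
  move=> ->; rewrite mulrC -RintZ//; apply: eq_Rintegral => y _; rewrite mulrC; congr (_ * _).
  by apply: eq_Rintegral => z _; rewrite mulr1.
by apply: eq_Rintegral => x _; rewrite mulr1.
Qed.

(** The optimal t = D / X turns a family of arithmetic-geometric bounds into a Cauchy-Schwarz
    inequality; for D = 0 and X > 0 the choice t = X / (J + 1) is contradictory. *)
Lemma amgm_sqr (X J D : R) : 0 <= X -> 0 <= J -> 0 <= D ->
  (forall t, 0 < t -> 2 * X <= t * J + t^-1 * D) -> X ^+ 2 <= J * D.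
Proof.
rewrite le_eqVlt => /predU1P[<-|X0] J0 D0 H; first by rewrite expr0n /= mulr_ge0.
move: D0; rewrite le_eqVlt => /predU1P[D0|D0].
  have J1 : 0 < J + 1 by rewrite ltr_wpDl.
  have := H (X / (J + 1)); rewrite divr_gt0// => /(_ isT); rewrite -D0 mulr0 addr0.
  have : X / (J + 1) * J <= X by rewrite mulrAC ler_pdivrMr// ler_wpM2l ?(ltW X0)// lerDl.
  lra.
have := H (D / X); rewrite divr_gt0// => /(_ isT).
have -> : (D / X)^-1 * D = X by field; rewrite !gt_eqF.
move=> h; have h1 : X <= D / X * J by lra.
rewrite expr2 -ler_pdivlMr//; apply: (le_trans h1).
by apply: le_of_eq; field; rewrite gt_eqF.
Qed.

(** By Cauchy-Schwarz, the square of the convolution is at most int 1/(wa(y) wb(x-y)) dy times the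
    convolution of wa h^2 with wb k^2. The hypothesis bounds the first integrand by (C / wc(x))
    (1/wa(y) + 1/wb(x-y)), so integrability of the reciprocals supplies the missing 1/wc(x). *)
Lemma conv_weighted (wa wb wc : weight R d) (C : R) h k :
  (forall x y, wc (x + y) <= C * (wa x + wb y)) -> 0 < C -> L2 wa h -> L2 wb k ->
  L2 wc (conv h k) /\ wnorm wc (conv h k) <=
    Num.sqrt (C * (\int[mu]_x (wa x)^-1 + \int[mu]_x (wb x)^-1)) * (wnorm wa h * wnorm wb k).
Proof.
move=> wabc C0 hL kL; have ih := L2_L1 hL; have ik := L2_L1 kL.
have iP := L2_wsq hL; have iQ := L2_wsq kL.
set P := fun x => wa x * h x ^+ 2 in iP; set Q := fun x => wb x * k x ^+ 2 in iQ.
have ia := L1_wt_inv wa; have ib := L1_wt_inv wb.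
set Ia := \int[mu]_x (wa x)^-1; set Ib := \int[mu]_x (wb x)^-1.
have Ia0 : 0 <= Ia by apply: Rint_ge0 => x; rewrite invr_ge0 ltW// wt_gt0.
have Ib0 : 0 <= Ib by apply: Rint_ge0 => x; rewrite invr_ge0 ltW// wt_gt0.
set D := C * (Ia + Ib); have D0 : 0 <= D by rewrite mulr_ge0 ?addr_ge0// ltW.
have J0 x : 0 <= conv P Q x.
  apply: Rint_ge0 => y; rewrite /P /Q mulr_ge0//.
    by rewrite mulr_ge0 ?sqr_ge0// ltW// wt_gt0.
  by rewrite mulr_ge0 ?sqr_ge0// ltW// wt_gt0.
have iJ := L1_conv iP iQ; have mc := L1_measurable (L1_conv ih ik).
have key : {ae mu, forall x, wc x * conv h k x ^+ 2 <= D * conv P Q x}.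
  apply: filterS (filterI (ae_L1_conv ih ik) (ae_L1_conv iP iQ)) => x [ix iPQ].
  have wx := wt_gt0 wc x.
  have iw : L1 (fun y => (wa y)^-1 + (wb (x - y))^-1) by exact: (L1D ia (L1_subl x ib)).
  have D1 : \int[mu]_y ((wa y)^-1 + (wb (x - y))^-1) = Ia + Ib.
    rewrite (RintD ia (L1_subl x ib)).
    congr (_ + _); rewrite /Ib -(Rintegral_opp ib) -(Rintegral_addr (- x) (L1_opp ib)).
    by apply: eq_Rintegral => y _; rewrite opprB.
  have B t : 0 < t -> 2 * `|conv h k x| <= t * conv P Q x + t^-1 * ((wc x)^-1 * D).
    move=> t0.
    have -> : (wc x)^-1 * D = \int[mu]_y ((wc x)^-1 * C * ((wa y)^-1 + (wb (x - y))^-1)).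
      by rewrite RintZ// D1 mulrA.
    rewrite /conv -RintZ// -RintZ; last exact: L1Z.
    rewrite -RintD; [|exact: L1Z|exact/L1Z/L1Z].
    apply: (@le_trans _ _ (2 * \int[mu]_y `|h y * k (x - y)|)).
      by rewrite ler_wpM2l//; apply: Rint_norm_le => //; exact: L1_norm.
    rewrite -RintZ; last exact: L1_norm.
    apply: le_Rint; [exact/L1Z/L1_norm|by apply: L1D; [exact: L1Z|exact/L1Z/L1Z]|].
    move=> y; have ay := wt_gt0 wa y; have by_ := wt_gt0 wb (x - y).
    set a := wa y in ay *; set b := wb (x - y) in by_ *; set c := wc x in wx *.
    have cab : c <= C * (a + b) by have := wabc y (x - y); rewrite addrC subrK.
    rewrite normrM; set p := `|h y|; set q := `|k (x - y)|.
    have -> : P y * Q (x - y) = a * b * (p * q) ^+ 2.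
      rewrite /P /Q -/a -/b exprMn !real_normK ?num_real//; ring.
    have : 0 <= (t * a * b)^-1 * (t * a * b * (p * q) - 1) ^+ 2.
      by rewrite mulr_ge0 ?sqr_ge0// invr_ge0 !mulr_ge0// ltW.
    have -> : (t * a * b)^-1 * (t * a * b * (p * q) - 1) ^+ 2 =
        t * (a * b * (p * q) ^+ 2) - 2 * (p * q) + t^-1 * (a * b)^-1.
      by field; rewrite !gt_eqF.
    have : t^-1 * (a * b)^-1 <= t^-1 * (c^-1 * C * (a^-1 + b^-1)).
      rewrite ler_wpM2l ?invr_ge0 ?(ltW t0)//.
      have -> : c^-1 * C * (a^-1 + b^-1) = (C * (a + b)) * (c^-1 * (a * b)^-1) by field; rewrite !gt_eqF.
      rewrite [X in X <= _](_ : _ = c * (c^-1 * (a * b)^-1)); last by rewrite mulrA divff ?mul1r// gt_eqF.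
      by rewrite ler_wpM2r// mulr_ge0// invr_ge0 ?mulr_ge0// ltW.
    lra.
  have := amgm_sqr (normr_ge0 (conv h k x)) (J0 x) (mulr_ge0 (ltW (_ : 0 < (wc x)^-1)) D0) B.
  rewrite invr_gt0 => /(_ wx); rewrite real_normK ?num_real// => h1.
  have := ler_wpM2l (ltW wx) h1.
  by rewrite [X in _ <= X](_ : _ = D * conv P Q x)//; field; rewrite gt_eqF.
have mcw : measurable_fun setT (fun x => wc x * conv h k x ^+ 2).
  by apply/measurable_EFinP; exact: measurable_wsq.
have iDJ : L1 (fun x => D * conv P Q x) by exact: L1Z.
have w0 x : 0 <= wc x * conv h k x ^+ 2 by rewrite mulr_ge0 ?sqr_ge0// ltW// wt_gt0.
have le : (\int[mu]_x (wc x * conv h k x ^+ 2)%:E <= \int[mu]_x (D * conv P Q x)%:E)%E.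
  apply: ae_ge0_le_integral => //.
  - by move=> x _; rewrite lee_fin.
  - exact/measurable_EFinP.
  - by move=> x _; rewrite lee_fin mulr_ge0.
  - by apply/measurable_EFinP; exact: L1_measurable iDJ.
  by apply: filterS key => x h1 _; rewrite lee_fin.
have hkL : L2 wc (conv h k).
  by split => //; apply: (le_lt_trans le); rewrite -EFin_Rint ?ltry.
split => //.
rewrite -(@ler_pXn2r _ 2) ?nnegrE ?wnorm_ge0 ?mulr_ge0 ?sqrtr_ge0 ?wnorm_ge0//.
rewrite !exprMn (sqr_sqrtr D0) !wnorm_sqr -/P -/Q -Rint_conv// -RintZ//.
by rewrite -lee_fin !EFin_Rint//; exact: L2_wsq.
Qed.

Lemma hart_conv h k x : L1 h -> L1 k -> hart (conv h k) x =
  evenp (hart h) x * evenp (hart k) x - oddp (hart h) x * oddp (hart k) x +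
  oddp (hart h) x * evenp (hart k) x + evenp (hart h) x * oddp (hart k) x.
Proof.
move=> ih ik; rewrite [LHS](conv_dual ih ik (measurable_kern x) (kern_le2 x)).
have [-> ->] := hart_cos_sin x ih; have [-> ->] := hart_cos_sin x ik.
have ic f : L1 f -> L1 (fun y => f y * cos (2 * pi * dotp x y)).
  move=> if_; apply: (L1_Mb if_ (c := 1)); first exact: continuous_sc (@continuous_cos R).
  by move=> z; rewrite ler_norml cos_geN1 cos_le1.
have is_ f : L1 f -> L1 (fun y => f y * sin (2 * pi * dotp x y)).
  move=> if_; apply: (L1_Mb if_ (c := 1)); first exact: continuous_sc (@continuous_sin R).
  by move=> z; rewrite ler_norml sin_geN1 sin_le1.
set Ck := \int[mu]_y (k y * cos _); set Sk := \int[mu]_y (k y * sin _).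
have inner y : \int[mu]_z (k z * kern x (y + z)) =
    cos (2 * pi * dotp x y) * (Ck + Sk) + sin (2 * pi * dotp x y) * (Ck - Sk).
  rewrite -RintD; [|exact: ic|exact: is_].
  rewrite -RintB; [|exact: ic|exact: is_].
  rewrite -RintZ; last by apply: L1D; [exact: ic|exact: is_].
  rewrite -RintZ; last by apply: L1B; [exact: ic|exact: is_].
  rewrite -RintD; last 2 first.
  - by apply/L1Z/L1D; [exact: ic|exact: is_].
  - by apply/L1Z/L1B; [exact: ic|exact: is_].
  apply: eq_Rintegral => z _; rewrite /kern /cas dotpDr [2 * pi * (_ + _)]mulrDr cosD sinD; ring.
transitivity ((Ck + Sk) * \int[mu]_y (h y * cos (2 * pi * dotp x y)) +
    (Ck - Sk) * \int[mu]_y (h y * sin (2 * pi * dotp x y))); last by ring.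
rewrite -RintZ; last exact: ic.
rewrite -RintZ; last exact: is_.
rewrite -RintD; [|by apply: L1Z; exact: ic|by apply: L1Z; exact: is_].
apply: eq_Rintegral => y _; rewrite inner; ring.
Qed.

(** With signs +, +, +, - the convolutions of h and k with zero, one or two reflections add up, in
    even and odd parts, to twice the product of the transforms. *)
Lemma ihartM h k x : L1 h -> L1 k -> ihart h x * ihart k x = (2 * @hcst R d)^-1 *
  (ihart (conv h k) x + ihart (conv h (fun y => k (- y))) x +
   ihart (conv (fun y => h (- y)) k) x - ihart (conv (fun y => h (- y)) (fun y => k (- y))) x).
Proof.
move=> ih ik; have iho := L1_opp ih; have iko := L1_opp ik.
rewrite /ihart !hart_conv// /evenp /oddp !hart_opp// !opprK; field.
exact: hcst_neq0.
Qed.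

Lemma in_spaceM (wa wb wc : weight R d) (C : R) :
  (forall x y, wc (x + y) <= C * (wa x + wb y)) -> 0 < C ->
  exists2 K, 1 <= K & forall u v, u \in in_space wa -> v \in in_space wb ->
    (fun x => u x * v x) \in in_space wc /\
    spnorm wc (fun x => u x * v x) <= K * (spnorm wa u * spnorm wb v).
Proof.
move=> wabc C0; set S := Num.sqrt (C * (\int[mu]_x (wa x)^-1 + \int[mu]_x (wb x)^-1)).
have S0 : 0 <= S by exact: sqrtr_ge0.
exists (Num.max 1 (`|(2 * @hcst R d)^-1| * (4 * S))); first by rewrite le_max lexx.
move=> u v /coefP[hL hu] /coefP[kL kv]; set h := coef u in hL hu *; set k := coef v in kL kv *.
have ih := L2_L1 hL; have ik := L2_L1 kL.
have [hoL hon] := L2_opp hL; have [koL kon] := L2_opp kL.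
have [L_1 n1] := conv_weighted wabc C0 hL kL.
have [L_2 n2] := conv_weighted wabc C0 hL koL.
have [L_3 n3] := conv_weighted wabc C0 hoL kL.
have [L_4 n4] := conv_weighted wabc C0 hoL koL.
rewrite kon in n2; rewrite hon in n3; rewrite hon kon in n4.
pose G x := (2 * @hcst R d)^-1 * (conv h k x + conv h (fun y => k (- y)) x +
   conv (fun y => h (- y)) k x - conv (fun y => h (- y)) (fun y => k (- y)) x).
have [L12 n12] := L2D L_1 L_2; have [L123 n123] := L2D L12 L_3; have [L1234 n1234] := L2B L123 L_4.
have GL : L2 wc G by exact: L2Z.
have e : (fun x => u x * v x) = ihart G.
  apply/funext => x; rewrite hu kv ihartM// ihartZ; last exact: L2_L1 L1234.
  congr (_ * _); set f4 := conv (fun y => h (- y)) (fun y => k (- y)).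
  have -> : (fun x => conv h k x + conv h (fun y => k (- y)) x + conv (fun y => h (- y)) k x - f4 x) =
    fun x => (conv h k x + conv h (fun y => k (- y)) x + conv (fun y => h (- y)) k x) + -1 * f4 x.
    by apply/funext => y; rewrite mulN1r.
  rewrite ihartD; [|exact: L2_L1 L123|exact/L1Z/(L2_L1 L_4)].
  rewrite ihartZ; last exact: L2_L1 L_4.
  rewrite ihartD; [|exact: L2_L1 L12|exact: L2_L1 L_3].
  rewrite ihartD; [|exact: L2_L1 L_1|exact: L2_L1 L_2].
  by rewrite mulN1r.
rewrite e; split; first exact: in_spaceI.
rewrite spnorm_ihart// wnormZ//; set N := _ * _ in n1 n2 n3 n4.
have -> : spnorm wa u * spnorm wb v = wnorm wa h * wnorm wb k by [].
apply: (@le_trans _ _ (`|(2 * @hcst R d)^-1| * (4 * (S * (wnorm wa h * wnorm wb k))))).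
  rewrite ler_wpM2l//; apply: (le_trans n1234).
  rewrite -/N (_ : 4 * N = N + N + N + N); last by ring.
  apply: lerD; last exact: n4.
  apply: (le_trans n123); apply: lerD; last exact: n3.
  exact: (le_trans n12 (lerD n1 n2)).
rewrite [4 * _]mulrA mulrA ler_wpM2r ?mulr_ge0 ?wnorm_ge0//.
by rewrite le_max lexx orbT.
Qed.


(** * Fourier multipliers on Hartley densities *)

Local Notation C := R[i].
Implicit Types G H : E -> C.
Definition sqn (z : C) : R := complex.Re z ^+ 2 + complex.Im z ^+ 2.

Lemma sqn_ge0 z : 0 <= sqn z. Proof. by rewrite addr_ge0 ?sqr_ge0. Qed.
Lemma sqnM z z' : sqn (z * z') = sqn z * sqn z'.
Proof. case: z z' => [a b] [a' b']; rewrite /sqn /=; ring. Qed.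

Lemma sqn_eq0 z : sqn z = 0 -> z = 0.
Proof.
case: z => a b; rewrite /sqn /= => /eqP; rewrite paddr_eq0 ?sqr_ge0// !sqrf_eq0.
by move=> /andP[/eqP -> /eqP ->].
Qed.

Lemma sqnV z : sqn z^-1 = (sqn z)^-1.
Proof.
have [->|z0] := eqVneq z 0; first by rewrite invr0 /sqn /= !expr0n /= addr0 invr0.
have s0 : sqn z != 0 by apply: contra_neq z0 => /sqn_eq0.
by apply: (mulfI s0); rewrite -sqnM !divff// /sqn /= expr1n expr0n addr0.
Qed.

Lemma sqn_real (a : R) : sqn a%:C%C = a ^+ 2.
Proof. by rewrite /sqn /= expr0n addr0. Qed.

Definition measC G := measurable_fun setT (fun x => complex.Re (G x)) /\
  measurable_fun setT (fun x => complex.Im (G x)).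

Definition herm G := forall x, G (- x) = (G x)^*%C.

Lemma measC_real (a : E -> R) : measurable_fun setT a -> measC (fun x => (a x)%:C%C).
Proof. by move=> ma; split => //; exact: measurable_cst. Qed.
Lemma measC_cst (z : C) : measC (fun=> z).
Proof. by split; exact: measurable_cst. Qed.

Lemma measCD G H : measC G -> measC H -> measC (fun x => G x + H x).
Proof.
move=> [g1 g2] [h1 h2]; split.
  rewrite (_ : (fun x => _) = fun x => complex.Re (G x) + complex.Re (H x)); first exact: measurable_funD.
  by apply/funext => x; case: (G x) (H x) => ? ? [].
rewrite (_ : (fun x => _) = fun x => complex.Im (G x) + complex.Im (H x)); first exact: measurable_funD.
by apply/funext => x; case: (G x) (H x) => ? ? [].
Qed.

Lemma measCM G H : measC G -> measC H -> measC (fun x => G x * H x).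
Proof.
move=> [g1 g2] [h1 h2]; split.
  rewrite (_ : (fun x => _) = fun x => complex.Re (G x) * complex.Re (H x) - complex.Im (G x) * complex.Im (H x)).
    by apply: measurable_funB; exact: measurable_funM.
  by apply/funext => x; case: (G x) (H x) => ? ? [].
rewrite (_ : (fun x => _) = fun x => complex.Re (G x) * complex.Im (H x) + complex.Im (G x) * complex.Re (H x)).
  by apply: measurable_funD; exact: measurable_funM.
by apply/funext => x; case: (G x) (H x) => ? ? [].
Qed.

Lemma measCN G : measC G -> measC (fun x => - G x).
Proof.
move=> mG; have := measCM (measC_cst (-1)) mG; congr measC.
by apply/funext => x; rewrite mulN1r.
Qed.

Lemma measCV G : measC G -> measC (fun x => (G x)^-1).
Proof.
move=> [g1 g2].
have ms : measurable_fun setT (fun x => (sqn (G x))^-1).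
  apply: (measurableT_comp (@measurable_invr R)).
  by apply: measurable_funD; exact: measurable_funX.
split.
  rewrite (_ : (fun x => _) = fun x => complex.Re (G x) * (sqn (G x))^-1); first exact: measurable_funM.
  by apply/funext => x; case: (G x).
rewrite (_ : (fun x => _) = fun x => (- complex.Im (G x)) * (sqn (G x))^-1).
  by apply: measurable_funM => //; apply: measurableT_comp.
by apply/funext => x; case: (G x) => a b; rewrite /sqn /= mulNr.
Qed.

Lemma measC_sum (I : Type) (s : seq I) (F : I -> E -> C) : (forall i, measC (F i)) ->
  measC (fun x => \sum_(i <- s) F i x).
Proof.
move=> mF; elim: s => [|i s IH].
  by have := measC_cst 0; congr measC; apply/funext => x; rewrite big_nil.
have := measCD (mF i) IH; congr measC.
by apply/funext => x; rewrite big_cons.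
Qed.

Lemma hermD G H : herm G -> herm H -> herm (fun x => G x + H x).
Proof. by move=> hG hH x; rewrite hG hH rmorphD. Qed.
Lemma hermM G H : herm G -> herm H -> herm (fun x => G x * H x).
Proof. by move=> hG hH x; rewrite hG hH rmorphM. Qed.
Lemma hermN G : herm G -> herm (fun x => - G x).
Proof. by move=> hG x; rewrite hG rmorphN. Qed.
Lemma hermV G : herm G -> herm (fun x => (G x)^-1).
Proof. by move=> hG x; rewrite hG fmorphV. Qed.
Lemma herm_real (a : E -> R) : (forall x, a (- x) = a x) -> herm (fun x => (a x)%:C%C).
Proof. by move=> ae x; rewrite ae; apply/eqP; rewrite eq_complex /= oppr0 !eqxx. Qed.
Lemma herm_imag (a : E -> R) : (forall x, a (- x) = - a x) -> herm (fun x => 'i%C * (a x)%:C%C).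
Proof. by move=> ao x; rewrite ao; apply/eqP; rewrite eq_complex /= ?(mul0r, mulr0, mul1r, sub0r, addr0, oppr0, add0r) !eqxx. Qed.

(** Multipliers act by multiplication on the complex Fourier form, not on Hartley densities, hence
    the passage back and forth; the Hermitian functions are exactly the range of [hat]. *)
Definition hat h (x : E) : C := fourier_of_hartley h x.
Definition unhat G (x : E) : R := complex.Re (G x) - complex.Im (G x).

Lemma herm_hat h : herm (hat h).
Proof. by move=> x; apply/eqP; rewrite eq_complex /= evenpN oddpN !eqxx. Qed.
Lemma hatK h : unhat (hat h) = h.
Proof. by apply/funext => x; rewrite /unhat /= opprK evenpDoddp. Qed.

Lemma unhatK G : herm G -> hat (unhat G) = G.
Proof.
move=> hG; apply/funext => x; apply/eqP; rewrite eq_complex /= /evenp /oddp /unhat hG.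
case: (G x) => a b /=; apply/andP; split; apply/eqP; by field.
Qed.

Lemma hatD h k x : hat (fun y => h y + k y) x = hat h x + hat k x.
Proof.
apply/eqP; rewrite eq_complex /= /evenp /oddp; apply/andP; split; apply/eqP; ring.
Qed.

Lemma hatZ (c : R) h x : hat (fun y => c * h y) x = c%:C%C * hat h x.
Proof.
apply/eqP; rewrite eq_complex /= /evenp /oddp; apply/andP; split; apply/eqP; ring.
Qed.

Lemma sqn_hat h x : sqn (hat h x) = 2^-1 * (h x ^+ 2 + h (- x) ^+ 2).
Proof. by rewrite /sqn /= /evenp /oddp; field. Qed.

Definition fmul G h : E -> R := unhat (fun x => G x * hat h x).

Lemma hat_fmul G h : herm G -> hat (fmul G h) = fun x => G x * hat h x.
Proof. by move=> hG; rewrite /fmul unhatK//; exact: hermM hG (@herm_hat h). Qed.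

Lemma measurable_hat h : measurable_fun setT h -> measC (hat h).
Proof.
move=> mh; have mo : measurable_fun setT (fun x : E => h (- x)).
  by apply: measurableT_comp => //; exact: measurable_opp_rV.
split=> /=; rewrite /evenp /oddp.
  by apply: measurable_funM => //; exact: measurable_funD.
by apply: measurableT_comp => //; apply: measurable_funM => //; exact: measurable_funB.
Qed.

Lemma measurable_fmul G h : measC G -> measurable_fun setT h -> measurable_fun setT (fmul G h).
Proof.
by move=> mG mh; have [m1 m2] := measCM mG (measurable_hat mh); exact: measurable_funB.
Qed.

Lemma fmul_L2 (w w' : weight R d) G h (c : R) : measC G -> 0 <= c ->
  (forall x, sqn (G x) * w' x <= c ^+ 2 * w x) -> L2 w h ->
  L2 w' (fmul G h) /\ wnorm w' (fmul G h) <= 2 * c * wnorm w h.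
Proof.
move=> mG c0 Gw hL; have ih := L2_wsq hL; have iho := L1_opp ih.
have mf := measurable_fmul mG hL.1.
have le x : w' x * fmul G h x ^+ 2 <= c ^+ 2 * (w x * h x ^+ 2 + w (- x) * h (- x) ^+ 2).
  have w'0 := wt_gt0 w' x.
  have s1 : fmul G h x ^+ 2 <= 2 * (sqn (G x) * sqn (hat h x)).
    rewrite -sqnM /fmul /unhat; case: (G x * hat h x) => a b; rewrite /sqn /=.
    by have := sqr_ge0 (a + b); lra.
  apply: (le_trans (ler_wpM2l (ltW w'0) s1)); rewrite sqn_hat wt_even -mulrDr.
  have s2 : 0 <= h x ^+ 2 + h (- x) ^+ 2 by rewrite addr_ge0 ?sqr_ge0.
  have := ler_wpM2r s2 (Gw x); lra.
have iR : L1 (fun x => c ^+ 2 * (w x * h x ^+ 2 + w (- x) * h (- x) ^+ 2)) by exact/L1Z/L1D.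
have fL : L2 w' (fmul G h).
  apply: L2P => //; apply: (L1_le _ _ iR); first by apply/measurable_EFinP; exact: measurable_wsq.
  by move=> x; rewrite ger0_norm ?le// mulr_ge0 ?sqr_ge0// ltW// wt_gt0.
split=> //; rewrite -(@ler_pXn2r _ 2) ?nnegrE ?wnorm_ge0 ?mulr_ge0 ?wnorm_ge0//.
rewrite wnorm_sqr; apply: (le_trans (le_Rint (L2_wsq fL) iR le)).
rewrite RintZ; last exact: L1D.
rewrite RintD// (Rintegral_opp ih) -wnorm_sqr.
by have := mulr_ge0 (sqr_ge0 c) (sqr_ge0 (wnorm w h)); lra.
Qed.

(** [hat h x] also reads h at -x, so the exceptional set is united with its reflection, which is
    null too. *)
Lemma hat_ae h k : {ae mu, forall x, h x = k x} -> {ae mu, forall x, hat h x = hat k x}.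
Proof.
move=> [N [mN N0 HN]].
have mNo : measurable ((fun x : E => - x) @^-1` N).
  by rewrite -[X in measurable X]setTI; exact: measurable_opp_rV.
exists (N `|` (fun x : E => - x) @^-1` N); split.
- exact: measurableU.
- apply/eqP; rewrite eq_le measure_ge0 andbT; apply: (le_trans (measureU2 mu mN mNo)).
  have e : mu ((fun x : E => - x) @^-1` N) = mu N.
    have := @ge0_integral_oppr R d (fun x => (\1_N x)%:E).
    have mi : measurable_fun setT (fun x : E => (\1_N x : R)%:E) by apply/measurable_EFinP; exact: measurable_indic.
    have i0 (x : E) : (0 <= (\1_N x : R)%:E)%E by rewrite lee_fin.
    have e1 : (\int[mu]_x (\1_N x)%:E = mu N)%E by rewrite integral_indic// setIT.
    have e2 : (\int[mu]_x (\1_((fun x : E => (- x)%R) @^-1` N) x)%:E = mu ((fun x : E => (- x)%R) @^-1` N))%E.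
      by rewrite integral_indic// setIT.
    by move=> /(_ mi i0) H; rewrite -e1 -e2 -H.
  by rewrite [X in (_ + X)%E]e [X in (X + _)%E]N0 [X in (_ + X)%E]N0 adde0.
move=> x /= H; apply: contrapT => /not_orP[n1 n2]; apply: H.
have e1 : h x = k x by apply: contrapT => /HN.
have e2 : h (- x) = k (- x) by apply: contrapT => /HN.
by rewrite /hat /fourier_of_hartley /evenp /oddp e1 e2.
Qed.

Lemma unhat_ae h k : {ae mu, forall x, hat h x = hat k x} -> {ae mu, forall x, h x = k x}.
Proof.
by apply: filterS => x e; rewrite -[h]hatK -[k]hatK /unhat e.
Qed.

Definition zeta (j : 'I_d) (x : E) : R := 2 * pi * x ord0 j.

Definition dmul (j : 'I_d) (x : E) : C := 'i%C * (zeta j x)%:C%C.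

Lemma zetaN j x : zeta j (- x) = - zeta j x.
Proof. by rewrite /zeta mxE mulrN. Qed.
Lemma measurable_zeta j : measurable_fun setT (zeta j).
Proof. by apply: measurable_funM => //; exact: measurable_coord. Qed.
Lemma herm_dmul j : herm (dmul j).
Proof. by apply: herm_imag => x; exact: zetaN. Qed.
Lemma measC_dmul j : measC (dmul j).
Proof. by apply: measCM; [exact: measC_cst|apply: measC_real; exact: measurable_zeta]. Qed.
Lemma fmul_dmul j h x : fmul (dmul j) h x = - (2 * pi) * (x ord0 j * h (- x)).
Proof. by rewrite /fmul /unhat /dmul /zeta /= /evenp /oddp; field. Qed.

(** The comparison of the weights makes x_j h square integrable for [w'], hence integrable, which is
    what differentiating under the integral requires. *)
Lemma ihart_pderiv (w w' : weight R d) h j (c : R) : 0 <= c ->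
  (forall x, zeta j x ^+ 2 * w' x <= c ^+ 2 * w x) -> L2 w h ->
  [/\ forall x, derivable (ihart h) x (delta_mx ord0 j),
      pderiv j (ihart h) = ihart (fmul (dmul j) h), L2 w' (fmul (dmul j) h) &
      wnorm w' (fmul (dmul j) h) <= 2 * c * wnorm w h].
Proof.
move=> c0 cw hL; have ih := L2_L1 hL.
have sd x : sqn (dmul j x) = zeta j x ^+ 2.
  by rewrite /dmul sqnM sqn_real /sqn /= expr0n expr1n add0r mul1r.
have [fL fn] : L2 w' (fmul (dmul j) h) /\ wnorm w' (fmul (dmul j) h) <= 2 * c * wnorm w h.
  by apply: fmul_L2 => //; [exact: measC_dmul|move=> x; rewrite sd].
have pi0 : 2 * pi != 0 :> R by rewrite mulf_neq0// gt_eqF// pi_gt0.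
have ixh : L1 (fun y => y ord0 j * h y).
  have := L1Z (2 * pi)^-1 (L1_opp (L2_L1 fL)); congr L1; apply/funext => y.
  rewrite fmul_dmul mxE opprK; move: pi0; move: (2 * pi) => p p0; by field.
have [dh eh] := hart_pderiv ih ixh.
have e : fmul (dmul j) h = fun y => - (2 * pi) * (y ord0 j * h (- y)) by apply/funext => y; exact: fmul_dmul.
split=> //.
  by move=> x; apply: derivableM; [exact: derivable_cst|exact: dh].
apply/funext => x; rewrite /ihart pderivM; [|exact: derivable_cst|exact: dh].
by rewrite [X in _ + _ * X]derive_cst mulr0 addr0 eh e.
Qed.


(** * The isotropic, anisotropic and divergence weights *)

Lemma japaneseX (x : E) r : japanese x ^+ r.*2 = (1 + dotp x x) ^+ r.
Proof. by rewrite -mul2n exprM japanese_sqr. Qed.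
Lemma oneDdotp_gt0 (x : E) : 0 < 1 + dotp x x.
Proof. by rewrite ltr_pwDl// dotp_ge0. Qed.

Definition jfun (r : nat) (x : E) : R := (1 + dotp x x) ^+ r.

(** The weight of the anisotropic norm of order r, with the value 1 put at the origin, where the
    formula with 0^-1 = 0 would destroy positivity. *)
Definition afun (r : nat) (x : E) : R :=
  if dotp x x == 0 then 1 else
  if eucl x < 1 then eucl x ^- 2 * (dotp x e1 ^+ 2 + eucl x ^+ 4) else jfun r x.

(** The weight of divergences of fields of order r: one derivative is lost, and the factor |x|^-2
    encodes vanishing at low frequency. The value at the origin is again a convention. *)
Definition gfun (r : nat) (x : E) : R :=
  if dotp x x == 0 then 1 else jfun r x / dotp x x.

Lemma jfun_gt0 r x : 0 < jfun r x. Proof. by rewrite exprn_gt0// oneDdotp_gt0. Qed.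
Lemma jfun_ge1 r x : 1 <= jfun r x.
Proof. by rewrite exprn_ege1// lerDl dotp_ge0. Qed.
Lemma jfun_le r r' x : (r <= r')%N -> jfun r x <= jfun r' x.
Proof. by move=> rr; rewrite ler_weXn2l// lerDl dotp_ge0. Qed.
Lemma measurable_jfun r : measurable_fun setT (@jfun r).
Proof. by apply: measurable_funX; apply: measurable_funD => //; exact: measurable_dotp_diag. Qed.
Lemma dotp_neq0 (x : E) : dotp x x != 0 -> 0 < dotp x x.
Proof. by move=> x0; rewrite lt_def x0 dotp_ge0. Qed.

Lemma afunE r x : dotp x x != 0 -> eucl x < 1 ->
  afun r x = (dotp x e1 ^+ 2 + dotp x x ^+ 2) / dotp x x.
Proof.
move=> x0 x1; rewrite /afun (negbTE x0) x1 eucl_sqr -[eucl x ^+ 4]/(eucl x ^+ (2 * 2)) exprM eucl_sqr.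
by rewrite mulrC.
Qed.

Lemma afun_gt0 r x : 0 < afun r x.
Proof.
have [x0|x0] := eqVneq (dotp x x) 0; first by rewrite /afun x0 eqxx.
have [x1|x1] := ltP (eucl x) 1.
  rewrite afunE// divr_gt0 ?dotp_neq0// ltr_wpDl ?sqr_ge0// exprn_gt0//.
  exact: dotp_neq0.
by rewrite /afun (negbTE x0) ifF ?jfun_gt0//; apply/negbTE; rewrite -leNgt.
Qed.

Lemma gfun_gt0 r x : 0 < gfun r x.
Proof.
rewrite /gfun; case: eqVneq => // x0; rewrite divr_gt0 ?jfun_gt0//.
exact: dotp_neq0.
Qed.

Let measurable_dotp0 : measurable_fun setT (fun x : E => dotp x x == 0).
Proof.
apply: (measurable_fun_bool true) => /=.
rewrite setTI (_ : _ @^-1` _ = setT `&` (fun x : E => dotp x x) @^-1` [set 0]).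
  by apply: measurable_dotp_diag => //; exact: measurable_set1.
by apply/seteqP; split=> x /=; [move=> /eqP ->|move=> [_ ->]; rewrite eqxx].
Qed.

Lemma measurable_eucl_lt1 : measurable_fun setT (fun x : E => eucl x < 1).
Proof. by apply: measurable_fun_ltr => //; exact: measurable_eucl. Qed.

Lemma measurable_aniso_low : measurable_fun setT (fun x : E => eucl x ^- 2 * (dotp x e1 ^+ 2 + eucl x ^+ 4)).
Proof.
apply: measurable_funM; last exact: measurable_aniso.
by apply: (measurableT_comp (@measurable_invr R)); apply: measurable_funX; exact: measurable_eucl.
Qed.

Lemma measurable_afun r : measurable_fun setT (@afun r).
Proof.
apply: measurable_fun_ifT; [exact: measurable_dotp0|exact: measurable_cst|].
apply: measurable_fun_ifT; [exact: measurable_eucl_lt1|exact: measurable_aniso_low|].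
exact: measurable_jfun.
Qed.

Lemma measurable_gfun r : measurable_fun setT (@gfun r).
Proof.
apply: measurable_fun_ifT => //; apply: measurable_funM; first exact: measurable_jfun.
by apply: (measurableT_comp (@measurable_invr R)); exact: measurable_dotp_diag.
Qed.

Lemma jfunN r x : jfun r (- x) = jfun r x. Proof. by rewrite /jfun dotpNN. Qed.
Lemma afunN r x : afun r (- x) = afun r x.
Proof. by rewrite /afun jfunN euclN dotpNN dotpNl sqrrN. Qed.
Lemma gfunN r x : gfun r (- x) = gfun r x.
Proof. by rewrite /gfun jfunN dotpNN. Qed.

Lemma jfun_inv r : (d < r.*2)%N -> (\int[mu]_x ((jfun r x)^-1)%:E < +oo)%E.
Proof.
move=> dr; apply: le_lt_trans (@integral_japanese_lty R d r.*2 dr).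
apply/le_of_eq/eq_integral => x _.
by rewrite japaneseX.
Qed.

Lemma gfun_inv r : (d < r.-1.*2)%N -> (\int[mu]_x ((gfun r x)^-1)%:E < +oo)%E.
Proof.
move=> dr; apply: le_lt_trans (jfun_inv dr); apply: ge0_le_integral => //.
- by move=> x _; rewrite lee_fin invr_ge0 ltW// gfun_gt0.
- by apply/measurable_EFinP; apply: (measurableT_comp (@measurable_invr R)); exact: measurable_gfun.
- by apply/measurable_EFinP; apply: (measurableT_comp (@measurable_invr R)); exact: measurable_jfun.
move=> x _; rewrite lee_fin lef_pV2 ?posrE ?gfun_gt0 ?jfun_gt0// /gfun.
case: eqVneq => [x0|x0]; first by rewrite /jfun x0 addr0 expr1n.
have q0 := dotp_neq0 x0; rewrite ler_pdivlMr//.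
have -> : r = r.-1.+1 by case: r dr => // dr; move: dr; rewrite ltn0.
rewrite /jfun exprSr /= ler_wpM2l ?exprn_ge0 ?(ltW (oneDdotp_gt0 x))//.
by rewrite lerDr.
Qed.

End space.

Section aniso_inverse.
Context {R : realType} {d : nat}.

Lemma afun_inv r : (0 < d)%N -> (d < r.*2)%N ->
  (\int[@lebesgue_rV R d]_x ((afun r x)^-1)%:E < +oo)%E.
Proof.
case: d => // n _ dr; set mu := lebesgue_rV _.
have mset := @measurable_ball_lt R n.+1 1.
pose L (x : 'rV[R]_n.+1) : \bar R := (((fun x => (eucl x ^+ 2 * (dotp x e1 ^+ 2 + eucl x ^+ 4)^-1)%R%:E) \_ [set x | (eucl x < 1)%R]) x)%E.
have mL : measurable_fun setT L.
  apply: (measurable_restrictT _ mset).1; apply: measurable_funTS.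
  apply/measurable_EFinP; apply: measurable_funM; first by apply: measurable_funX; exact: measurable_eucl.
  exact: (measurableT_comp (@measurable_invr R) (@measurable_aniso R _)).
have L0 x : (0 <= L x)%E.
  rewrite /L /patch; case: ifP => // _; rewrite lee_fin mulr_ge0 ?sqr_ge0// invr_ge0 addr_ge0 ?sqr_ge0//.
  by rewrite exprn_ge0// eucl_ge0.
have mJ : measurable_fun setT (fun x : 'rV[R]_n.+1 => ((jfun r x)^-1)%:E).
  by apply/measurable_EFinP; apply: (measurableT_comp (@measurable_invr R)); exact: measurable_jfun.
have J0 (x : 'rV[R]_n.+1) : (0 <= ((jfun r x)^-1)%:E)%E by rewrite lee_fin invr_ge0 ltW// jfun_gt0.
apply: (@le_lt_trans _ _ (\int[mu]_x (L x + ((jfun r x)^-1)%:E))%E).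
  apply: ge0_le_integral => //.
  - by move=> x _; rewrite lee_fin invr_ge0 ltW// afun_gt0.
  - by apply/measurable_EFinP; apply: (measurableT_comp (@measurable_invr R)); exact: measurable_afun.
  - exact: emeasurable_funD.
  move=> x _; have [x0|x0] := eqVneq (dotp x x) 0.
    by rewrite /afun x0 eqxx invr1 /jfun x0 addr0 expr1n invr1 -[leLHS]add0e leeD2r.
  have [x1|x1] := ltP (eucl x) 1.
    rewrite -[leLHS]adde0; apply: leeD => //.
    rewrite /L /patch mem_set//= lee_fin afunE// eucl_sqr.
    by rewrite -[eucl x ^+ 4]/(eucl x ^+ (2 * 2)) exprM eucl_sqr invf_div.
  by rewrite -[leLHS]add0e; apply: leeD => //; rewrite /afun (negbTE x0) ifF//; apply/negbTE; rewrite -leNgt.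
rewrite ge0_integralD//; apply: lte_add_pinfty; last exact: jfun_inv.
by rewrite -integral_mkcond; exact: integral_aniso_lty.
Qed.

Lemma ae_neq0 : (0 < d)%N -> {ae (@lebesgue_rV R d), forall x, dotp x x != 0}.
Proof.
move=> d0; set mu := lebesgue_rV _.
have m0 : measurable [set x : 'rV[R]_d | dotp x x = 0].
  rewrite (_ : [set x | _] = setT `&` (fun x : 'rV[R]_d => dotp x x) @^-1` [set 0]).
    by apply: measurable_dotp_diag => //; exact: measurable_set1.
  by rewrite setTI.
exists [set x : 'rV[R]_d | dotp x x = 0]; split => //; last first.
  by move=> x /= /negP; rewrite negbK => /eqP.
apply/eqP; rewrite eq_le measure_ge0 andbT; apply/lee_addgt0Pr => e e0; rewrite add0e.
(* A cube of side t <= 1 has volume t^d <= t <= e in positive dimension. *)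
pose t : R := Num.min 1 e; have t0 : 0 < t by rewrite lt_min ltr01.
pose a : 'rV[R]_d := const_mx (- (t / 2)); pose b : 'rV[R]_d := const_mx (t / 2).
have ab i : a ord0 i < b ord0 i by rewrite !mxE; lra.
have mB := measurable_open_box a b.
apply: (@le_trans _ _ (mu [set x : 'rV[R]_d | forall i, a ord0 i < x ord0 i < b ord0 i])).
  apply: le_measure; rewrite ?inE// => x /= x0 i.
  have e0' : eucl x = 0 by rewrite /eucl x0 sqrtr0.
  have := coord_le_eucl x i; rewrite e0' normr_le0 => /eqP ->.
  by rewrite !mxE; apply/andP; split; lra.
have := measure_open_box ab; rewrite integral_indic// setIT => ->.
rewrite lee_fin (eq_bigr (fun=> t)); last by move=> i _; rewrite !mxE; field.
rewrite prodr_const card_ord; case: (d) d0 => // n _.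
rewrite exprS (le_trans (ler_piMr (ltW t0) _))//.
  by rewrite exprn_ile1 ?(ltW t0)// ge_min lexx.
by rewrite ge_min lexx orbT.
Qed.

End aniso_inverse.

Section concrete_weights.
Context (R : realType) (d : nat).
Local Notation E := 'rV[R]_d.

Definition jw r (dr : (d < r.*2)%N) : weight R d :=
  Weight (@jfun_gt0 R d r) (@measurable_jfun R d r) (@jfunN R d r) (jfun_inv dr).

Definition aw r (d0 : (0 < d)%N) (dr : (d < r.*2)%N) : weight R d :=
  Weight (@afun_gt0 R d r) (@measurable_afun R d r) (@afunN R d r) (afun_inv d0 dr).

Definition gw r (dr : (d < r.-1.*2)%N) : weight R d :=
  Weight (@gfun_gt0 R d r) (@measurable_gfun R d r) (@gfunN R d r) (gfun_inv dr).

Lemma jfunD r (x y : E) : jfun r (x + y) <= 4 ^+ r * (jfun r x + jfun r y).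
Proof.
have qx := dotp_ge0 x; have qy := dotp_ge0 y; have qxy := dotp_ge0 (x + y).
have h : 1 + dotp (x + y) (x + y) <= 2 * (1 + dotp x x) + 2 * (1 + dotp y y).
  have := dotp_ge0 (x - y); rewrite !dotpDl !dotpDr !(dotpNl, dotpNr) (dotpC y x); lra.
wlog xy : x y qx qy qxy h / dotp x x <= dotp y y.
  move=> H; case: (leP (dotp x x) (dotp y y)) => [|/ltW] le; first exact: H.
  rewrite addrC [jfun r x + _]addrC; apply: H => //; [by rewrite addrC|].
  by rewrite [y + x]addrC [2 * (1 + dotp y y) + _]addrC.
apply: (@le_trans _ _ (4 ^+ r * jfun r y)).
  rewrite /jfun -exprMn; apply: lerXn2r; rewrite ?nnegrE; lra.
by rewrite ler_wpM2l ?exprn_ge0// lerDr ltW// jfun_gt0.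
Qed.

(** The anisotropic weight has no positive lower bound near the origin, but there jfun r x <= 2^r
    and the weight of the other factor, at least 1, takes over. Thus multiplication by the height
    preserves Sobolev spaces. *)
Lemma jfun_afunD r r' (x y : E) : (r <= r')%N ->
  jfun r (x + y) <= (4 ^+ r * 2 ^+ r.+1) * (afun r' x + jfun r y).
Proof.
move=> rr; apply: (le_trans (jfunD r x y)); rewrite -mulrA ler_wpM2l ?exprn_ge0//.
have y1 := jfun_ge1 r y; have a0 := afun_gt0 r' x.
have p1 : 1 <= 2 ^+ r :> R by rewrite exprn_ege1// ler1n.
have [x1|x1] := leP 1 (dotp x x).
  have x0 : dotp x x != 0 by rewrite gt_eqF// (lt_le_trans ltr01).
  have e : eucl x < 1 = false.
    by apply/negbTE; rewrite -leNgt -(@ler_pXn2r _ 2) ?nnegrE ?eucl_ge0// eucl_sqr expr1n.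
  rewrite /afun (negbTE x0) e; have := jfun_le x rr; have := jfun_gt0 r' x; rewrite exprS; nra.
have : jfun r x <= 2 ^+ r by apply: lerXn2r; rewrite ?nnegrE; have := dotp_ge0 x; lra.
by rewrite exprS; nra.
Qed.

End concrete_weights.

(** * Multiplier operators, derivatives and products between the spaces *)

Record blin (R : realType) (V V' : lmodType R) (n : V -> R) (n' : V' -> R) (f : V -> V') : Prop := Blin {
  blin_lin : forall a u v, f (a *: u + v) = a *: f u + f v ;
  blin_bound : exists2 C, 1 <= C & forall u, n' (f u) <= C * n u }.

Section operators.
Context {R : realType} {d : nat}.
Local Notation E := 'rV[R]_d.
Local Notation mu := (@lebesgue_rV R d).
Local Notation C := R[i].
Implicit Types (w : weight R d) (G : E -> C).

Lemma hatD_ae w (u v : sp w) :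
  {ae mu, forall x, hat (coef (u + v)) x = hat (coef u) x + hat (coef v) x}.
Proof.
have [uL uE] := sp_coef u; have [vL vE] := sp_coef v.
have e : ((u + v : sp w) : E -> R) = ihart (fun x => coef u x + coef v x).
  rewrite ihartD; [|exact: L2_L1 uL|exact: L2_L1 vL].
  by rewrite -uE -vE.
rewrite e; have := hat_ae (coef_ae (L2D uL vL).1).
by apply: filterS => x ->; rewrite hatD.
Qed.

Lemma hatZ_ae w (a : R) (u : sp w) :
  {ae mu, forall x, hat (coef (a *: u)) x = a%:C%C * hat (coef u) x}.
Proof.
have [uL uE] := sp_coef u.
have e : ((a *: u : sp w) : E -> R) = ihart (fun x => a * coef u x).
  rewrite ihartZ; last exact: L2_L1 uL.
  by rewrite -uE.
rewrite e; have := hat_ae (coef_ae (L2Z a uL)).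
by apply: filterS => x ->; rewrite hatZ.
Qed.

Lemma hat_inj w w' (u : sp w) (v : sp w') :
  {ae mu, forall x, hat (coef u) x = hat (coef v) x} -> (u : E -> R) = v.
Proof.
have [uL uE] := sp_coef u; have [vL vE] := sp_coef v.
move=> /unhat_ae e; rewrite uE vE; apply: hart_ae e; [exact: uL.1|exact: vL.1].
Qed.

Lemma ae_and (P Q : E -> Prop) : {ae mu, forall x, P x} -> {ae mu, forall x, Q x} ->
  {ae mu, forall x, P x /\ Q x}.
Proof. by move=> HP HQ; exact: filterI. Qed.

Lemma ae_imp (P Q : E -> Prop) : {ae mu, forall x, P x} -> (forall x, P x -> Q x) ->
  {ae mu, forall x, Q x}.
Proof. by move=> HP PQ; apply: filterS HP. Qed.

Record symbol w w' G : Prop := Symbol {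
  symbol_meas : measC G ;
  symbol_herm : herm G ;
  symbol_dom : exists2 c, 0 <= c & forall x, sqn (G x) * w' x <= c * w x }.

Definition fop w w' G (u : sp w) : sp w' := to_sp w' (ihart (fmul G (coef u))).

Section fop.
Context w w' G (sG : symbol w w' G).

Let fop_L2 : exists2 c, 0 <= c & forall u : sp w, L2 w' (fmul G (coef u)) /\ wnorm w' (fmul G (coef u)) <= c * spn u.
Proof.
have [mG hG [c c0 cG]] := sG; exists (2 * Num.sqrt c); first by rewrite mulr_ge0.
move=> u; have [uL _] := sp_coef u; apply: fmul_L2 => // x.
by rewrite sqr_sqrtr.
Qed.

Lemma fopE (u : sp w) : (fop w' G u : E -> R) = ihart (fmul G (coef u)).
Proof. by rewrite to_spE//; apply: in_spaceI; have [c _ /(_ u)[]] := fop_L2. Qed.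

Lemma hat_fop (u : sp w) : {ae mu, forall x, hat (coef (fop w' G u)) x = G x * hat (coef u) x}.
Proof.
rewrite fopE; have [c _ /(_ u)[fL _]] := fop_L2; have := hat_ae (coef_ae fL).
by apply: filterS => x ->; rewrite (hat_fmul _ (symbol_herm sG)).
Qed.

Lemma fop_blin : blin (@spn _ _ w) (@spn _ _ w') (fop w' G).
Proof.
split.
  move=> a u v; apply/sp_inj/hat_inj.
  apply: (ae_imp (ae_and (ae_and (hat_fop (a *: u + v)) (ae_and (hat_fop u) (hat_fop v)))
    (ae_and (ae_and (hatD_ae (a *: u) v) (hatZ_ae a u))
            (ae_and (hatD_ae (a *: fop w' G u) (fop w' G v)) (hatZ_ae a (fop w' G u)))))).
  have alg (g b zu zv zuv zau fuv fu fv fs fau : C) : fuv = g * zuv -> fu = g * zu -> fv = g * zv ->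
      zuv = zau + zv -> zau = b * zu -> fs = fau + fv -> fau = b * fu -> fuv = fs.
    by move=> -> -> -> -> -> -> ->; rewrite mulrDr mulrCA.
  by move=> x [[e0 [eu ev]] [[e1 e2] [e3 e4]]]; exact: alg e0 eu ev e1 e2 e3 e4.
have [c c0 H] := fop_L2; exists (1 + c); first by rewrite lerDl.
move=> u; have [uL uc] := H u; rewrite /spn fopE spnorm_ihart//.
by apply: (le_trans uc); rewrite ler_wpM2r ?lerDr//; exact: wnorm_ge0.
Qed.

End fop.

Lemma symbol_real w w' (a : E -> R) : measurable_fun setT a -> (forall x, a (- x) = a x) ->
  (exists2 c, 0 <= c & forall x, a x ^+ 2 * w' x <= c * w x) -> symbol w w' (fun x => (a x)%:C%C).
Proof.
move=> ma ea [c c0 cw]; split; [exact: measC_real|exact: herm_real|].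
by exists c => // x; rewrite sqn_real.
Qed.

Definition incl w w' : sp w -> sp w' := fop w' (fun=> 1).

Lemma symbol1 w w' : (exists2 c, 0 <= c & forall x, w' x <= c * w x) -> symbol w w' (fun=> 1).
Proof.
move=> [c c0 cw]; have := @symbol_real w w' (fun=> 1); apply => //.
by exists c => // x; rewrite expr1n mul1r.
Qed.

Lemma inclE w w' (u : sp w) : symbol w w' (fun=> 1) -> (incl w' u : E -> R) = u.
Proof.
move=> sG; rewrite fopE//; have [_ {2}->] := sp_coef u; congr (ihart _).
by rewrite -[RHS]hatK; congr unhat; apply/funext => x; rewrite mul1r.
Qed.

Definition dop w w' j : sp w -> sp w' := fop w' (dmul j).

Lemma sqn_dmul j (x : E) : sqn (dmul j x) = zeta j x ^+ 2.
Proof. by rewrite /dmul sqnM sqn_real /sqn /= expr0n expr1n add0r mul1r. Qed.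

Lemma symbol_dmul w w' j : (exists2 c, 0 <= c & forall x, zeta j x ^+ 2 * w' x <= c * w x) ->
  symbol w w' (dmul j).
Proof.
move=> [c c0 cw]; split; [exact: measC_dmul|exact: herm_dmul|].
by exists c => // x; rewrite sqn_dmul.
Qed.

Lemma dopE w w' j (u : sp w) : symbol w w' (dmul j) ->
  (dop w' j u : E -> R) = pderiv j u /\ forall x, derivable (u : E -> R) x (delta_mx ord0 j).
Proof.
move=> sG; have [uL uE] := sp_coef u; have [_ _ [c c0 cw]] := sG.
have [|dh eh _ _] := @ihart_pderiv _ _ w w' (coef u) j (Num.sqrt c) (sqrtr_ge0 _) _ uL.
  by move=> x; rewrite sqr_sqrtr// -sqn_dmul.
rewrite -uE in eh dh.
by split=> //; rewrite /dop fopE// -eh.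
Qed.

End operators.

Section product.
Context {R : realType} {d : nat}.

Definition mulable (wa wb wc : weight R d) : Prop :=
  exists2 c, 0 < c & forall x y, wc (x + y) <= c * (wa x + wb y).

Definition spM (wa wb wc : weight R d) (u : sp wa) (v : sp wb) : sp wc := to_sp wc (fun x => u x * v x).

Context (wa wb wc : weight R d) (abc : mulable wa wb wc).

Lemma spME (u : sp wa) (v : sp wb) x : spM wc u v x = u x * v x.
Proof.
have [c c0 cw] := abc; have [K _ H] := in_spaceM cw c0.
by rewrite /spM to_spE//; have [] := H _ _ (sp_in u) (sp_in v).
Qed.

Lemma spM_bound : exists2 K, 1 <= K & forall (u : sp wa) (v : sp wb),
  spn (spM wc u v) <= K * (spn u * spn v).
Proof.
have [c c0 cw] := abc; have [K K1 H] := in_spaceM cw c0; exists K => // u v.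
have [i n] := H _ _ (sp_in u) (sp_in v).
by rewrite /spn; rewrite [sp_fun (spM _ _ _)]to_spE.
Qed.

End product.

(** * Elementary bounds for symbols and weights *)

Section real_bounds.
Context {R : realType}.
Implicit Types K q Z B m b X a : R.

Lemma equiv_onep K a q : 1 <= K -> 0 < a -> a <= K -> a^-1 <= K -> 0 <= q ->
  1 + q <= K * (1 + a * q) /\ 1 + a * q <= K * (1 + q).
Proof.
move=> K1 a0 aK iK q0; split.
  have e : q = a^-1 * (a * q) by rewrite mulKf// gt_eqF.
  rewrite mulrDr mulr1 lerD// {1}e ler_wpM2r// mulr_ge0// ltW//.
by rewrite mulrDr mulr1 lerD// ler_wpM2r.
Qed.

(** The right-hand side has the shape of the squared modulus of [symP], with real part Z B - b. If b
    <= Z B / 2, this part is at least Z B / 2; otherwise b exceeds Z B / 2 and b m^2 controls (Z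
    B)^2. [K] gathers the comparison constants. *)
Lemma wave_symbol_bound K q Z B m b X : 1 <= K -> 0 <= q -> 0 <= Z -> 0 <= B -> 0 <= m -> 0 <= b ->
  q <= K * Z -> Z <= K * q -> 1 + q <= K * B -> B <= K * (1 + q) -> 1 + q <= K * m -> X <= K * b ->
  (X + q ^+ 2) * (1 + q) ^+ 2 <= 5 * K ^+ 8 * ((Z * B - b) ^+ 2 + b * m ^+ 2).
Proof.
move=> K1 q0 Z0 B0 m0 b0 qZ Zq tB Bt tm Xb.
set t := 1 + q in tB Bt tm *; set a := Z * B; set p := _ + b * m ^+ 2.
have t0 : 0 <= t by rewrite addr_ge0.
have K0 : 0 <= K by exact: le_trans ler01 K1.
have a0 : 0 <= a by rewrite mulr_ge0.
have bm0 : 0 <= b * m ^+ 2 by rewrite mulr_ge0 ?sqr_ge0.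
have p0 : 0 <= p by rewrite addr_ge0 ?sqr_ge0.
have at2 : a <= K ^+ 2 * t ^+ 2.
  have : a <= (K * q) * (K * t) by apply: ler_pM.
  move=> /le_trans; apply; have -> : K ^+ 2 * t ^+ 2 = (K * t) * (K * t) by ring.
  by rewrite ler_wpM2r ?mulr_ge0// ler_wpM2l// lerDr.
have qta : q * t <= K ^+ 2 * a.
  have -> : K ^+ 2 * a = (K * Z) * (K * B) by rewrite /a; ring.
  by apply: ler_pM.
have tm2 : t ^+ 2 <= K ^+ 2 * m ^+ 2 by rewrite -exprMn lerXn2r// nnegrE mulr_ge0.
have a2p : a ^+ 2 <= 4 * K ^+ 4 * p.
  have K41 : 1 <= K ^+ 4 by rewrite exprn_ege1.
  have [ba|ba] := leP b (a / 2).
    have h : a ^+ 2 <= 4 * (a - b) ^+ 2.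
      have -> : 4 * (a - b) ^+ 2 = (2 * (a - b)) ^+ 2 by ring.
      by rewrite lerXn2r// ?nnegrE; lra.
    apply: (le_trans h); apply: (@le_trans _ _ (4 * p)).
      by rewrite ler_wpM2l// /p lerDl.
    by rewrite ler_wpM2r// ler_peMr.
  have h1 : a <= K ^+ 4 * m ^+ 2.
    apply: (le_trans at2); have -> : K ^+ 4 * m ^+ 2 = K ^+ 2 * (K ^+ 2 * m ^+ 2) by ring.
    by rewrite ler_wpM2l ?exprn_ge0.
  have h2 : a * a <= (2 * b) * (K ^+ 4 * m ^+ 2) by apply: ler_pM => //; lra.
  have h3 : b * m ^+ 2 <= p by rewrite lerDr sqr_ge0.
  rewrite expr2; apply: (le_trans h2).
  have -> : 2 * b * (K ^+ 4 * m ^+ 2) = 2 * K ^+ 4 * (b * m ^+ 2) by ring.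
  by apply: ler_pM => //; rewrite ?mulr_ge0 ?exprn_ge0//; lra.
have h1 : q ^+ 2 * t ^+ 2 <= 4 * K ^+ 8 * p.
  rewrite -exprMn; apply: (@le_trans _ _ ((K ^+ 2 * a) ^+ 2)).
    by rewrite lerXn2r// nnegrE mulr_ge0// exprn_ge0.
  have -> : (K ^+ 2 * a) ^+ 2 = K ^+ 4 * a ^+ 2 by ring.
  have -> : 4 * K ^+ 8 * p = K ^+ 4 * (4 * K ^+ 4 * p) by ring.
  by rewrite ler_wpM2l// exprn_ge0.
have h2 : X * t ^+ 2 <= K ^+ 8 * p.
  apply: (@le_trans _ _ ((K * b) * (K ^+ 2 * m ^+ 2))).
    apply: (le_trans (ler_wpM2r (sqr_ge0 _) Xb)).
    by rewrite ler_wpM2l// mulr_ge0.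
  have -> : (K * b) * (K ^+ 2 * m ^+ 2) = K ^+ 3 * (b * m ^+ 2) by ring.
  apply: ler_pM => //; first exact: exprn_ge0.
    by apply: ler_weXn2l.
  by rewrite lerDr sqr_ge0.
by rewrite mulrDl; lra.
Qed.

End real_bounds.

Section weight_bounds.
Context {R : realType} {d : nat}.
Local Notation E := 'rV[R]_d.

Lemma coord_sqr (x : E) j : x ord0 j ^+ 2 <= dotp x x.
Proof.
rewrite /dotp (bigD1 j)//= -expr2 lerDl sumr_ge0// => i _.
by rewrite -expr2 sqr_ge0.
Qed.

Lemma dotp_e1_sqr (x : E) : dotp x e1 ^+ 2 <= dotp x x.
Proof.
have [d0|d0] := posnP d; last by rewrite (dotp_e1 d0) coord_sqr.
rewrite [dotp x e1]big1 ?expr0n ?dotp_ge0// => i _.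
by have := ltn_ord i; rewrite [X in (_ < X)%N]d0.
Qed.

Lemma eucl_ge1 (x : E) : eucl x < 1 = false -> 1 <= dotp x x.
Proof. by move=> /negbT; rewrite -leNgt -eucl_sqr => h; rewrite expr_ge1// eucl_ge0. Qed.
Lemma eucl_lt1 (x : E) : eucl x < 1 -> dotp x x <= 1.
Proof. by move=> h; rewrite -eucl_sqr exprn_ile1// ?eucl_ge0// ltW. Qed.

(** With [afun_ge] this compares [afun r.+1] times |x|^2 to (x_1^2 + |x|^4)(1 + |x|^2)^r, uniformly
    across the break of the weight at |x| = 1. *)
Lemma afun_le r (x : E) : dotp x x != 0 ->
  afun r.+1 x * dotp x x <= 2 * (dotp x e1 ^+ 2 + dotp x x ^+ 2) * jfun r x.
Proof.
move=> x0; have q0 := dotp_neq0 x0; have j1 := jfun_ge1 r x.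
have X0 := sqr_ge0 (dotp x e1); have Q0 := sqr_ge0 (dotp x x).
case: (boolP (eucl x < 1)) => [x1|/negbTE x1].
  rewrite afunE// divfK// [2 * _]mulrC -mulrA; apply: ler_peMr; first exact: addr_ge0.
  by rewrite mulr_ege1// ler1n.
have {}x1' := eucl_ge1 x1; rewrite /afun (negbTE x0) x1 /jfun exprS.
rewrite -mulrA [_ ^+ r * _]mulrC mulrA ler_wpM2r ?exprn_ge0 ?addr_ge0 ?dotp_ge0//.
nra.
Qed.

Lemma afun_ge r (x : E) : dotp x x != 0 ->
  (dotp x e1 ^+ 2 + dotp x x ^+ 2) * jfun r x <= 2 ^+ r * (afun r.+1 x * dotp x x).
Proof.
move=> x0; have q0 := dotp_neq0 x0; have X1 := dotp_e1_sqr x.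
have X0 := sqr_ge0 (dotp x e1); have Q0 := sqr_ge0 (dotp x x).
case: (boolP (eucl x < 1)) => [x1|/negbTE x1].
  have x1' := eucl_lt1 x1.
  rewrite afunE// divfK// mulrC ler_wpM2r ?addr_ge0// lerXn2r ?nnegrE//; lra.
have {}x1' := eucl_ge1 x1; rewrite /afun (negbTE x0) x1 /jfun (exprS (1 + dotp x x)).
have -> : (1 + dotp x x) * (1 + dotp x x) ^+ r * dotp x x = ((1 + dotp x x) * dotp x x) * (1 + dotp x x) ^+ r by ring.
rewrite mulrA ler_wpM2r ?exprn_ge0 ?addr_ge0 ?dotp_ge0//.
have : 1 <= 2 ^+ r :> R by rewrite exprn_ege1// ler1n.
move=> r1; apply: (@le_trans _ _ ((1 + dotp x x) * dotp x x)); first nra.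
by rewrite ler_peMl// mulr_ge0 ?addr_ge0 ?dotp_ge0.
Qed.

Lemma afun_ge_dotp r (x : E) : dotp x x * jfun r x <= 2 ^+ r * afun r.+1 x.
Proof.
have [x0|x0] := eqVneq (dotp x x) 0.
  by rewrite x0 mul0r mulr_ge0 ?exprn_ge0// ltW// afun_gt0.
have q0 := dotp_neq0 x0; rewrite -(ler_pM2r q0); have := afun_ge r x0.
have : 0 <= dotp x e1 ^+ 2 * jfun r x by rewrite mulr_ge0 ?sqr_ge0// ltW// jfun_gt0.
by rewrite -!mulrA; move: (jfun r x) => j; lra.
Qed.

Lemma zeta_sqr j (x : E) : zeta j x ^+ 2 <= (2 * pi) ^+ 2 * dotp x x.
Proof. by rewrite /zeta exprMn ler_wpM2l ?sqr_ge0// coord_sqr. Qed.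

Lemma zeta_e1 (d0 : (0 < d)%N) (x : E) : zeta (Ordinal d0) x ^+ 2 = (2 * pi) ^+ 2 * dotp x e1 ^+ 2.
Proof.
by rewrite /zeta exprMn (dotp_e1 d0).
Qed.

Let p2 : R := (2 * pi) ^+ 2.
Let p20 : 0 <= p2. Proof. exact: sqr_ge0. Qed.

Lemma symbol_dmul_jj r r' (dr : (d < r.*2)%N) (dr' : (d < r'.*2)%N) j : (r' < r)%N ->
  symbol (jw R dr) (jw R dr') (dmul j).
Proof.
move=> rr; apply: symbol_dmul; exists p2 => // x /=.
apply: (le_trans (ler_wpM2r (ltW (jfun_gt0 r' x)) (zeta_sqr j x))).
rewrite -mulrA ler_wpM2l//; apply: (le_trans _ (jfun_le x rr)).
by rewrite /jfun exprS ler_wpM2r ?exprn_ge0 ?(ltW (oneDdotp_gt0 x))// lerDr.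
Qed.

Lemma symbol_dmul_aj r r' (d0 : (0 < d)%N) (dr : (d < r.+1.*2)%N) (dr' : (d < r'.*2)%N) j : (r' <= r)%N ->
  symbol (aw R d0 dr) (jw R dr') (dmul j).
Proof.
move=> rr; apply: symbol_dmul; exists (p2 * 2 ^+ r); first exact: mulr_ge0 p20 (exprn_ge0 _ (ler0n _ 2)).
move=> x /=; apply: (le_trans (ler_wpM2r (ltW (jfun_gt0 r' x)) (zeta_sqr j x))).
rewrite -/p2; move: p2 p20 => p p0; rewrite -!mulrA ler_wpM2l//.
apply: (le_trans _ (afun_ge_dotp r x)).
by rewrite ler_wpM2l ?dotp_ge0// jfun_le.
Qed.

Lemma symbol_dmul_jg r (dr : (d < r.*2)%N) (dr' : (d < r.-1.*2)%N) j :
  symbol (jw R dr) (gw R dr') (dmul j).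
Proof.
apply: symbol_dmul; exists p2 => // x /=.
apply: (le_trans (ler_wpM2r (ltW (gfun_gt0 r x)) (zeta_sqr j x))).
rewrite -mulrA ler_wpM2l// /gfun; case: eqVneq => [->|x0]; first by rewrite mul0r ltW// jfun_gt0.
by rewrite mulrC divfK.
Qed.

(** On the anisotropic space only the derivative along e_1 is worth a divergence: after division by
    |x|^2 its symbol squared is of order x_1^2 / |x|^2, precisely what the low-frequency weight
    controls. The term gamma d_1 eta of the mass equation relies on this. *)
Lemma symbol_dmul_ag r (d0 : (0 < d)%N) (dr : (d < r.+1.*2)%N) (dr' : (d < r.-1.*2)%N) :
  symbol (aw R d0 dr) (gw R dr') (dmul (Ordinal d0)).
Proof.
apply: symbol_dmul; exists (p2 * 2 ^+ r); first exact: mulr_ge0 p20 (exprn_ge0 _ (ler0n _ 2)).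
have e (x : E) : zeta (Ordinal d0) x ^+ 2 = p2 * dotp x e1 ^+ 2 := zeta_e1 d0 x.
move=> x /=; rewrite e {e}; move: p2 p20 => p p0.
rewrite -(mulrA p (dotp x e1 ^+ 2)) -(mulrA p (2 ^+ r)) ler_wpM2l//.
rewrite /gfun; case: eqVneq => [x0|x0].
  have := dotp_e1_sqr x; rewrite x0 mulr1 => h; apply: (le_trans h).
  exact: mulr_ge0 (exprn_ge0 _ (ler0n _ 2)) (ltW (afun_gt0 _ _)).
rewrite [leLHS]mulrA ler_pdivrMr ?dotp_neq0// -[leRHS]mulrA; apply: (le_trans _ (afun_ge r x0)).
by rewrite ler_wpM2r ?(ltW (jfun_gt0 r x))// lerDl sqr_ge0.
Qed.

Lemma symbol1_jj r r' (dr : (d < r.*2)%N) (dr' : (d < r'.*2)%N) : (r' <= r)%N ->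
  symbol (jw R dr) (jw R dr') (fun=> 1).
Proof.
by move=> rr; apply: symbol1; exists 1 => // x /=; rewrite mul1r jfun_le.
Qed.

Lemma mulable_jj r r' (dr : (d < r.*2)%N) (dr' : (d < r'.*2)%N) : (r' <= r)%N ->
  mulable (jw R dr) (jw R dr') (jw R dr').
Proof.
move=> rr; exists (4 ^+ r'); first exact: exprn_gt0.
move=> x y /=; apply: (le_trans (jfunD r' x y)).
by rewrite ler_wpM2l ?exprn_ge0// lerD2r jfun_le.
Qed.

Lemma mulable_aj r r' (d0 : (0 < d)%N) (dr : (d < r.*2)%N) (dr' : (d < r'.*2)%N) : (r' <= r)%N ->
  mulable (aw R d0 dr) (jw R dr') (jw R dr').
Proof.
move=> rr; exists (4 ^+ r' * 2 ^+ r'.+1); first by rewrite mulr_gt0 ?exprn_gt0.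
by move=> x y /=; exact: jfun_afunD.
Qed.

End weight_bounds.

Lemma common_bound (R : realType) (l : seq R) : all (fun a => 0 < a) l ->
  exists2 K, 1 <= K & forall a, a \in l -> a <= K /\ a^-1 <= K.
Proof.
elim: l => [|a l IH] /=; first by exists 1.
move=> /andP[a0 /IH[K K1 HK]]; have i0 : 0 < a^-1 by rewrite invr_gt0.
exists (K + (a + a^-1)); first by lra.
by move=> b; rewrite inE => /orP[/eqP ->|/HK[h1 h2]]; lra.
Qed.

(** * Symbols of the linearised wave system and of its inverse *)

Section wave_symbols.
Context {R : realType} {d s : nat} (d0 : (0 < d)%N) (ds : (d < s.*2)%N).
Local Notation E := 'rV[R]_d.
Local Notation C := R[i].
Variables (g m t : R).
Hypotheses (g0 : 0 < g) (m0 : 0 < m) (t0 : 0 < t).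
Local Notation j0 := (Ordinal d0).

Lemma doubleS_gt k r : (k < r.*2)%N -> (k < r.+1.*2)%N.
Proof. by move=> h; rewrite doubleS; exact: ltn_trans h _. Qed.

Definition Jw0 : weight R d := jw R ds.
Definition Jw1 : weight R d := jw R (doubleS_gt ds).
Definition Jw2 : weight R d := jw R (doubleS_gt (doubleS_gt ds)).
Definition Aw3 : weight R d := aw R d0 (doubleS_gt (doubleS_gt (doubleS_gt ds))).
Definition Gw2 : weight R d := @gw R d s.+2 (doubleS_gt ds).

Definition symLap (x : E) : C := \sum_j dmul j x ^+ 2.
(** It multiplies div v in the divergence of the linearised momentum balance; the divergence of the
    stress is Laplacian v + 3 grad div v, hence 1 + 3 = 4. [symD] acts on v itself. *)
Definition symE (x : E) : C := 1 - g%:C%C * dmul j0 x - (4 * m)%:C%C * symLap x.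
Definition symD (x : E) : C := 1 - g%:C%C * dmul j0 x - m%:C%C * symLap x.
Definition symB (x : E) : C := 1 - t%:C%C * symLap x.
(** Substituting div v = y + g d_1 eta into the divergence of the momentum balance leaves P eta = E
    y - div f. *)
Definition symP (x : E) : C := - (symLap x * symB x) - g%:C%C * dmul j0 x * symE x.

(** These five multipliers are the entries of the inverse: the height from the sources y and F, then
    the velocity from F, the height and y. *)
Definition eta_y (x : E) : C := symE x / symP x.
Definition eta_F j (x : E) : C := - (dmul j x / symP x).
Definition vel_F (x : E) : C := (symD x)^-1.
Definition vel_eta i (x : E) : C := dmul i x * ((3 * m * g)%:C%C * dmul j0 x - symB x) / symD x.
Definition vel_y i (x : E) : C := (3 * m)%:C%C * dmul i x / symD x.

(** Sealed, so that the arithmetic tactics see (2 pi)^2 as an atom. *)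
Let p_def : {p : R | p = (2 * pi) ^+ 2}. Proof. by exists ((2 * pi) ^+ 2). Qed.
Let p : R := sval p_def.
Let pE : p = (2 * pi) ^+ 2. Proof. exact: svalP p_def. Qed.
Let p_gt0 : 0 < p. Proof. by rewrite pE exprn_gt0// mulr_gt0// pi_gt0. Qed.

Lemma symLapE (x : E) : symLap x = (- (p * dotp x x))%:C%C.
Proof.
rewrite /symLap /dotp mulr_sumr -sumrN rmorph_sum; apply: eq_bigr => j _.
rewrite pE /dmul /zeta exprMn; apply/eqP; rewrite eq_complex /=; apply/andP; split; apply/eqP; ring.
Qed.

Let measC_lap : measC symLap.
Proof. by apply: measC_sum => j; apply: measCM; exact: measC_dmul. Qed.
Let herm_lap : herm symLap.
Proof.
by move=> x; rewrite !symLapE dotpNN; apply/eqP; rewrite eq_complex /= oppr0 !eqxx.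
Qed.

Let measC_aff (a b : C) : measC (fun x => 1 - a * dmul j0 x - b * symLap x).
Proof.
apply: measCD; last by apply/measCN/measCM => //; exact: measC_cst.
apply: measCD; first exact: measC_cst.
by apply/measCN/measCM; [exact: measC_cst|exact: measC_dmul].
Qed.

Let herm_cst (a : R) : herm (fun _ : E => a%:C%C). Proof. exact: herm_real. Qed.

Let herm_aff (a b : R) : herm (fun x => 1 - a%:C%C * dmul j0 x - b%:C%C * symLap x).
Proof.
apply: hermD; last by apply/hermN/hermM.
apply: hermD; first exact: herm_cst 1.
by apply/hermN/hermM => //; exact: herm_dmul.
Qed.

Let measC_B : measC symB.
Proof.
apply: measCD; first exact: measC_cst.
by apply/measCN/measCM => //; exact: measC_cst.
Qed.
Let herm_B : herm symB.
Proof. by apply: hermD; [exact: herm_cst 1|exact/hermN/hermM]. Qed.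

Let measC_P : measC symP.
Proof.
apply: measCD; first by apply/measCN/measCM.
apply/measCN/measCM; last exact: measC_aff.
by apply: measCM; [exact: measC_cst|exact: measC_dmul].
Qed.
Let herm_P : herm symP.
Proof.
apply: hermD; first by apply/hermN/hermM.
apply/hermN/hermM; last exact: herm_aff.
by apply: hermM; [exact: herm_cst|exact: herm_dmul].
Qed.

Let q (x : E) := dotp x x.
Let X (x : E) := dotp x e1 ^+ 2.
Let b (x : E) := g ^+ 2 * (p * X x).

Let z1 (x : E) : zeta j0 x ^+ 2 = p * X x. Proof. by rewrite pE; exact: zeta_e1. Qed.

Let sqnE (x : E) : sqn (symE x) = (1 + 4 * m * p * q x) ^+ 2 + b x.
Proof.
rewrite /b -z1 /symE symLapE -/(q x) /dmul /sqn /=; move: (zeta j0 x) (q x) => a c; ring.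
Qed.

Let sqnD (x : E) : sqn (symD x) = (1 + m * p * q x) ^+ 2 + b x.
Proof.
rewrite /b -z1 /symD symLapE -/(q x) /dmul /sqn /=; move: (zeta j0 x) (q x) => a c; ring.
Qed.

Let sqnB (x : E) : sqn ((3 * m * g)%:C%C * dmul j0 x - symB x) =
  (1 + t * p * q x) ^+ 2 + 9 * m ^+ 2 * b x.
Proof.
rewrite /b -z1 /symB symLapE -/(q x) /dmul /sqn /=; move: (zeta j0 x) (q x) => a c; ring.
Qed.

Let sqnP (x : E) : sqn (symP x) =
  (p * q x * (1 + t * p * q x) - b x) ^+ 2 + b x * (1 + 4 * m * p * q x) ^+ 2.
Proof.
rewrite /b -z1 /symP /symB /symE symLapE -/(q x) /dmul /sqn /=; move: (zeta j0 x) (q x) => a c; ring.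
Qed.

Let q_ge0 (x : E) : 0 <= q x. Proof. exact: dotp_ge0. Qed.
Let X_ge0 (x : E) : 0 <= X x. Proof. exact: sqr_ge0. Qed.
Let X_le (x : E) : X x <= q x. Proof. exact: dotp_e1_sqr. Qed.
Let b_ge0 (x : E) : 0 <= b x. Proof. by rewrite /b mulr_ge0 ?sqr_ge0// mulr_ge0// ltW. Qed.

Let zeta0 j (x : E) : q x = 0 -> zeta j x ^+ 2 = 0.
Proof.
move=> q0; apply/eqP; rewrite eq_le sqr_ge0 andbT; apply: (le_trans (zeta_sqr j x)).
by rewrite -/(q x) q0 mulr0.
Qed.

Let zeta_le j (x : E) : zeta j x ^+ 2 <= p * q x. Proof. by rewrite pE; exact: zeta_sqr. Qed.

Record wave_bounds (K : R) : Prop := WaveBounds {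
  wb1 : 1 <= K ;
  wbE : forall x, sqn (symE x) <= 2 * K ^+ 2 * (1 + q x) ^+ 2 ;
  wbB : forall x, sqn ((3 * m * g)%:C%C * dmul j0 x - symB x) <= (1 + 9 * m ^+ 2) * K ^+ 2 * (1 + q x) ^+ 2 ;
  wbD : forall x, (1 + q x) ^+ 2 <= K ^+ 2 * sqn (symD x) ;
  wbP : forall x, (X x + q x ^+ 2) * (1 + q x) ^+ 2 <= 5 * K ^+ 8 * sqn (symP x) }.

Let wb0 K : wave_bounds K -> 0 <= K. Proof. by move=> /wb1; exact: le_trans. Qed.
Let qSS x : (1 + q x) ^+ s.+2 = (1 + q x) ^+ 2 * (1 + q x) ^+ s. Proof. by rewrite -exprD. Qed.

Let bounds : exists K, wave_bounds K.
Proof.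
pose L := [:: p; 4 * m * p; m * p; t * p; g ^+ 2 * p].
have [|K K1 HK] := @common_bound _ L.
  by rewrite /= andbT p_gt0 !mulr_gt0// exprn_gt0.
have [/HK[p1 p2] /HK[e1 e2] /HK[d1 d2] /HK[b1 b2] /HK[g1 g2]] :
  [/\ p \in L,
      4 * m * p \in L,
      m * p \in L,
      t * p \in L &
      g ^+ 2 * p \in L].
  by rewrite !inE !eqxx ?orbT.
have K0 : 0 <= K by exact: le_trans K1.
have mp0 : 0 < m * p by rewrite mulr_gt0.
have fmp0 : 0 < 4 * m * p by rewrite -mulrA mulr_gt0.
have tp0 : 0 < t * p by rewrite mulr_gt0.
have gp0 : 0 < g ^+ 2 * p by rewrite mulr_gt0// exprn_gt0.
have bK x : b x <= K * X x by rewrite /b mulrA ler_wpM2r.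
have XK x : X x <= K * b x.
  have {1}-> : X x = (g ^+ 2 * p)^-1 * b x by rewrite /b mulrA mulKf// gt_eqF.
  by rewrite ler_wpM2r.
have Xt x : X x <= (1 + q x) ^+ 2 by have := X_le x; have := q_ge0 x; nra.
have t20 x : 0 <= (1 + q x) ^+ 2 by exact: sqr_ge0.
have KK : K <= K ^+ 2 by rewrite expr2 ler_peMr.
have bK2 x : b x <= K ^+ 2 * (1 + q x) ^+ 2.
  by apply: (le_trans (bK x)); apply: ler_pM.
have sqb a x : 0 <= a -> a <= K * (1 + q x) -> a ^+ 2 <= K ^+ 2 * (1 + q x) ^+ 2.
  by move=> a0 aK; rewrite -exprMn lerXn2r// nnegrE mulr_ge0// addr_ge0.
have pos a x : 0 < a -> 0 <= 1 + a * q x by move=> a0; rewrite addr_ge0// mulr_ge0// ltW.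
exists K; split=> // x.
- rewrite sqnE; have [_ h] := equiv_onep K1 fmp0 e1 e2 (q_ge0 x).
  have := sqb _ _ (pos _ _ fmp0) h; have := bK2 x; lra.
- rewrite sqnB; have [_ h] := equiv_onep K1 tp0 b1 b2 (q_ge0 x).
  have := sqb _ _ (pos _ _ tp0) h; have := ler_wpM2l (mulr_ge0 (ler0n _ 9) (sqr_ge0 m)) (bK2 x); lra.
- rewrite sqnD; have [h _] := equiv_onep K1 mp0 d1 d2 (q_ge0 x).
  apply: (@le_trans _ _ (K ^+ 2 * (1 + m * p * q x) ^+ 2)).
    by rewrite -exprMn lerXn2r// nnegrE ?addr_ge0// mulr_ge0// pos.
  by rewrite ler_wpM2l ?sqr_ge0// lerDl.
rewrite sqnP; have [h1 h2] := equiv_onep K1 tp0 b1 b2 (q_ge0 x).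
have [h3 _] := equiv_onep K1 fmp0 e1 e2 (q_ge0 x).
apply: wave_symbol_bound => //; rewrite ?pos//.
- by rewrite mulr_ge0// ltW.
- have {1}-> : q x = p^-1 * (p * q x) by rewrite mulKf// gt_eqF.
  by rewrite ler_wpM2r// mulr_ge0// ltW.
- by rewrite ler_wpM2r.
Qed.

Lemma symD_neq0 x : symD x != 0.
Proof.
have [K bK] := bounds; apply/eqP => D0; have := wbD bK x.
rewrite D0 /sqn /= expr0n addr0 mulr0 => h.
by have := q_ge0 x; nra.
Qed.

Lemma symP_neq0 x : dotp x x != 0 -> symP x != 0.
Proof.
move=> x0; have [K bK] := bounds; apply/eqP => P0; have := wbP bK x.
rewrite P0 /sqn /= expr0n addr0 mulr0 => h.
have q1 : 0 < q x := dotp_neq0 x0.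
have : 0 < (X x + q x ^+ 2) * (1 + q x) ^+ 2.
  by rewrite mulr_gt0 ?exprn_gt0//; [rewrite ltr_wpDl// exprn_gt0|lra].
by rewrite ltNge h.
Qed.

Let sqn_gt0 (z : C) : z != 0 -> 0 < sqn z.
Proof. by move=> z0; rewrite lt_def sqn_ge0 andbT; apply: contra_neq z0 => /sqn_eq0. Qed.

(* At the zero frequency [symP] vanishes, and so do the symbols (x / 0 = 0). *)
Let symP0 x : q x = 0 -> symP x = 0.
Proof.
move=> q0; apply: sqn_eq0; rewrite sqnP /b.
have -> : X x = 0 by apply/eqP; rewrite eq_le X_ge0 andbT -q0.
by rewrite q0 !(mulr0, mul0r) subr0 expr0n addr0.
Qed.

(** The factor X + q^2 in the lower bound [wbP] is exactly the one that [afun_le] extracts from the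
    anisotropic weight. *)
Let eta_bound K x : wave_bounds K -> q x != 0 ->
  (sqn (symP x))^-1 * afun s.+3 x <= 10 * K ^+ 8 * (jfun s x / q x).
Proof.
move=> bK x0; have q1 : 0 < q x := dotp_neq0 x0.
have P0 := sqn_gt0 (symP_neq0 x0).
rewrite ler_pdivrMl//.
have -> : sqn (symP x) * (10 * K ^+ 8 * (jfun s x / q x)) = sqn (symP x) * (10 * K ^+ 8) * jfun s x / q x by ring.
rewrite ler_pdivlMr//.
apply: (le_trans (afun_le _ x0)).
have := wbP bK x; rewrite -/(X x) -/(q x) /jfun -/(q x) qSS.
have : 0 <= (1 + q x) ^+ s by rewrite exprn_ge0// addr_ge0.
move: ((1 + q x) ^+ s) => J J0 h.
have := ler_wpM2r J0 h; lra.
Qed.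

Lemma symbol_eta_y : symbol Gw2 Aw3 eta_y.
Proof.
have [K bK] := bounds; have K0 := wb0 bK.
split; [exact: measCM (measC_aff _ _) (measCV measC_P)|exact: hermM (herm_aff _ _) (hermV herm_P)|].
exists (2 * K ^+ 2 * (10 * K ^+ 8)); first by rewrite !mulr_ge0 ?exprn_ge0.
move=> x /=; rewrite /eta_y sqnM sqnV; have [x0|x0] := eqVneq (q x) 0.
  rewrite symP0// /sqn /= expr0n addr0 invr0 mulr0 mul0r.
  by rewrite !mulr_ge0 ?exprn_ge0// ltW// gfun_gt0.
rewrite -mulrA; apply: (le_trans (ler_pM _ _ (wbE bK x) (eta_bound bK x0))).
- exact: sqn_ge0.
- by rewrite mulr_ge0 ?invr_ge0 ?sqn_ge0// ltW// afun_gt0.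
rewrite /gfun -/(q x) (negbTE x0) /jfun -/(q x) qSS.
by apply: le_of_eq; ring.
Qed.

Lemma symbol_eta_F j : symbol Jw0 Aw3 (eta_F j).
Proof.
have [K bK] := bounds; have K0 := wb0 bK.
split; [exact/measCN/(measCM (measC_dmul j) (measCV measC_P))|exact/hermN/(hermM (@herm_dmul _ _ j) (hermV herm_P))|].
exists (p * (10 * K ^+ 8)); first by rewrite !mulr_ge0 ?exprn_ge0// ltW.
move=> x /=; rewrite /eta_F -mulN1r sqnM (sqnM (dmul j x)) sqnV sqn_dmul.
have -> : sqn (-1 : C) = 1 by rewrite /sqn /= sqrrN expr1n oppr0 expr0n addr0.
rewrite mul1r; have [x0|x0] := eqVneq (q x) 0.
  by rewrite (zeta0 _ x0) !mul0r !mulr_ge0 ?exprn_ge0 ?(ltW p_gt0)// ltW// oneDdotp_gt0.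
rewrite -mulrA; apply: (le_trans (ler_pM _ _ (zeta_le j x) (eta_bound bK x0))).
- exact: sqr_ge0.
- by rewrite mulr_ge0 ?invr_ge0 ?sqn_ge0// ltW// afun_gt0.
apply: le_of_eq.
by transitivity (p * (10 * K ^+ 8) * (jfun s x / q x * q x)); [ring|rewrite divfK].
Qed.

Let vel_bound K x : wave_bounds K -> (sqn (symD x))^-1 * jfun s.+2 x <= K ^+ 2 * jfun s x.
Proof.
move=> bK; have D0 := sqn_gt0 (symD_neq0 x).
rewrite ler_pdivrMl// /jfun -/(q x) -add2n exprD.
have -> : sqn (symD x) * (K ^+ 2 * (1 + q x) ^+ s) = K ^+ 2 * sqn (symD x) * (1 + q x) ^+ s by ring.
rewrite ler_wpM2r//.
  by rewrite exprn_ge0// addr_ge0.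
exact: wbD.
Qed.

Lemma symbol_vel_F : symbol Jw0 Jw2 vel_F.
Proof.
have [K bK] := bounds.
split; [exact: measCV (measC_aff _ _)|exact: hermV (herm_aff _ _)|].
exists (K ^+ 2); first exact: sqr_ge0.
by move=> x /=; rewrite sqnV; exact: vel_bound.
Qed.

Lemma symbol_vel_eta i : symbol Aw3 Jw2 (vel_eta i).
Proof.
have [K bK] := bounds; have K0 := wb0 bK.
have mB : measC (fun x => (3 * m * g)%:C%C * dmul j0 x - symB x).
  by apply: measCD; [apply: measCM; [exact: measC_cst|exact: measC_dmul]|exact: measCN].
have hB : herm (fun x => (3 * m * g)%:C%C * dmul j0 x - symB x).
  by apply: hermD; [apply: hermM; [exact: herm_cst|exact: herm_dmul]|exact: hermN].
split.
- by apply: measCM; [exact: measCM (measC_dmul i) mB|exact: measCV (measC_aff _ _)].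
- by apply: hermM; [exact: hermM (@herm_dmul _ _ i) hB|exact: hermV (herm_aff _ _)].
pose c := (1 + 9 * m ^+ 2) * K ^+ 2.
have c0 : 0 <= c by rewrite mulr_ge0 ?sqr_ge0// addr_ge0// mulr_ge0 ?sqr_ge0.
have pc : 0 <= p * c * K ^+ 2 := mulr_ge0 (mulr_ge0 (ltW p_gt0) c0) (sqr_ge0 K).
exists (p * c * K ^+ 2 * 2 ^+ s.+2); first exact: mulr_ge0 pc (exprn_ge0 _ (ler0n _ 2)).
move=> x /=; rewrite /vel_eta (sqnM (dmul i x * _)) (sqnM (dmul i x)) sqnV sqn_dmul -mulrA.
have h1 : zeta i x ^+ 2 * sqn ((3 * m * g)%:C%C * dmul j0 x - symB x) <= (p * q x) * (c * (1 + q x) ^+ 2).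
  by apply: ler_pM; [exact: sqr_ge0|exact: sqn_ge0|exact: zeta_le|exact: wbB].
apply: (le_trans (ler_pM _ _ h1 (vel_bound x bK))).
- by rewrite mulr_ge0 ?sqr_ge0 ?sqn_ge0.
- by rewrite mulr_ge0 ?invr_ge0 ?sqn_ge0// ltW// jfun_gt0.
have := ler_wpM2l pc (afun_ge_dotp s.+2 x).
rewrite /jfun -/(q x) qSS.
rewrite (mulrA (p * c * K ^+ 2) (2 ^+ s.+2) (afun s.+3 x)).
have -> : p * c * K ^+ 2 * (q x * ((1 + q x) ^+ 2 * (1 + q x) ^+ s)) =
  p * q x * (c * (1 + q x) ^+ 2) * (K ^+ 2 * (1 + q x) ^+ s) by ring.
by [].
Qed.

Lemma symbol_vel_y i : symbol Gw2 Jw2 (vel_y i).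
Proof.
have [K bK] := bounds; have K0 := wb0 bK.
split.
- by apply: measCM; [apply: measCM; [exact: measC_cst|exact: measC_dmul]|exact: measCV (measC_aff _ _)].
- by apply: hermM; [apply: hermM; [exact: herm_cst|exact: herm_dmul]|exact: hermV (herm_aff _ _)].
pose c := (3 * m) ^+ 2 * p * K ^+ 2.
have c0 : 0 <= c by rewrite !mulr_ge0 ?sqr_ge0// ltW.
exists c => // x /=; rewrite /vel_y (sqnM (_ * dmul i x)) (sqnM _ (dmul i x)) sqnV sqn_dmul sqn_real -mulrA.
have h1 : (3 * m) ^+ 2 * zeta i x ^+ 2 <= (3 * m) ^+ 2 * (p * q x).
  by rewrite ler_wpM2l ?sqr_ge0.
apply: (le_trans (ler_pM _ _ h1 (vel_bound x bK))).
- by rewrite mulr_ge0 ?sqr_ge0.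
- by rewrite mulr_ge0 ?invr_ge0 ?sqn_ge0// ltW// jfun_gt0.
have -> : (3 * m) ^+ 2 * (p * q x) * (K ^+ 2 * jfun s x) = c * (q x * jfun s x) by rewrite /c; ring.
rewrite ler_wpM2l// /gfun -/(q x); case: eqVneq => [->|x0]; first by rewrite mul0r.
rewrite ler_pdivlMr; last exact: dotp_neq0.
rewrite /jfun -/(q x) qSS.
rewrite mulrAC ler_wpM2r ?exprn_ge0 ?addr_ge0//.
have := q_ge0 x; nra.
Qed.

End wave_symbols.

(** * Solving the linear system at one frequency *)

Section symbol_algebra.
Context {F : fieldType} {d : nat}.
Variables (D : 'I_d -> F) (d1 g m t : F).
Let L := \sum_j D j ^+ 2.
Let sE := 1 - g * d1 - 4 * m * L.
Let sD := 1 - g * d1 - m * L.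
Let sB := 1 - t * L.
Let sP := - (L * sB) - g * d1 * sE.

Definition mass (v : 'I_d -> F) (h : F) := \sum_j D j * v j - g * (d1 * h).
Definition momentum (v : 'I_d -> F) (h : F) i :=
  v i - g * (d1 * v i) -
  m * \sum_j D j * (D j * v i + D i * v j + (2 * (i == j)%:R) * \sum_k D k * v k) +
  D i * h - t * \sum_j D j * (D j * (D i * h)).

(** The stress contributes L v_i + 3 D_i (D . v); its first part merges into [sD]. *)
Lemma momentumE v h i : momentum v h i =
  sD * v i + D i * (sB * h) - 3 * m * D i * \sum_j D j * v j.
Proof.
have e1 : \sum_j D j * (D j * v i + D i * v j + (2 * (i == j)%:R) * \sum_k D k * v k) =
    L * v i + 3 * D i * \sum_j D j * v j.
  set S := \sum_k D k * v k.
  rewrite (eq_bigr (fun j => D j ^+ 2 * v i + D i * (D j * v j) + (2 * S) * (D j * (i == j)%:R))); last first.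
    by move=> j _; ring.
  have eD : \sum_j D j * (i == j)%:R = D i.
    rewrite (bigD1 i)//= eqxx mulr1 big1 ?addr0// => j /negPf ji.
    by rewrite eq_sym ji mulr0.
  rewrite !big_split/= -mulr_suml -!mulr_sumr eD -/S -/L; ring.
have e2 : \sum_j D j * (D j * (D i * h)) = L * (D i * h).
  by rewrite mulr_suml; apply: eq_bigr => j _; ring.
by rewrite /momentum e1 e2 /sD /sB; ring.
Qed.

Section forward.
Variables (y : F) (f : 'I_d -> F).
Hypotheses (P0 : sP != 0) (D0 : sD != 0).
Let h := sE / sP * y + \sum_j - (D j / sP) * f j.
Let v i := sD^-1 * f i + D i * (3 * m * g * d1 - sB) / sD * h + 3 * m * D i / sD * y.

Let hE : h = (sE * y - \sum_j D j * f j) / sP.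
Proof.
rewrite /h (_ : \sum_j - (D j / sP) * f j = - (\sum_j D j * f j) / sP); first by ring.
by rewrite mulNr mulr_suml -sumrN; apply: eq_bigr => j _; ring.
Qed.

(** This is the linear mass equation; contracting v with D reproduces it because [sP] was built by
    the same elimination. *)
Let sum_v : \sum_j D j * v j = y + g * (d1 * h).
Proof.
rewrite (eq_bigr (fun j => sD^-1 * (D j * f j) + ((3 * m * g * d1 - sB) / sD * h + 3 * m / sD * y) * D j ^+ 2)); last first.
  by move=> j _; rewrite /v; ring.
rewrite big_split/= -!mulr_sumr -/L; move: P0 D0; rewrite hE /sP /sD /sB /sE; move: L => l P0' D0'.
by field; apply/andP; split.
Qed.

Lemma mass_solve : mass v h = y.
Proof. by rewrite /mass sum_v addrK. Qed.

Lemma momentum_solve i : momentum v h i = f i.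
Proof.
rewrite momentumE sum_v /v.
have -> : sD * (sD^-1 * f i + D i * (3 * m * g * d1 - sB) / sD * h + 3 * m * D i / sD * y) =
  f i + D i * (3 * m * g * d1 - sB) * h + 3 * m * D i * y by field.
by ring.
Qed.
End forward.

Section backward.
Variables (v : 'I_d -> F) (h : F).
Hypotheses (P0 : sP != 0) (D0 : sD != 0).

Lemma solve_height : sE / sP * mass v h + \sum_j - (D j / sP) * momentum v h j = h.
Proof.
rewrite (eq_bigr (fun j => - (sD / sP) * (D j * v j) +
   (3 * m * (\sum_j D j * v j) - sB * h) / sP * D j ^+ 2)); last first.
  by move=> j _; rewrite momentumE; ring.
rewrite big_split/= -!mulr_sumr -/L /mass; move: P0 D0; rewrite /sP /sD /sB /sE.
by move: L (\sum_j D j * v j) => l S P0' D0'; field.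
Qed.

Lemma solve_velocity i : sD^-1 * momentum v h i +
  D i * (3 * m * g * d1 - sB) / sD * h + 3 * m * D i / sD * mass v h = v i.
Proof.
by rewrite momentumE /mass; move: (\sum_j D j * v j) => S; field.
Qed.
End backward.

End symbol_algebra.

(** * From identities of symbols to identities of operators *)

Section hat_calculus.
Context {R : realType} {d : nat}.
Local Notation E := 'rV[R]_d.
Local Notation mu := (@lebesgue_rV R d).
Local Notation C := R[i].

(** Fourier forms are known up to null sets only; through this relation, equations between operators
    become field identities at almost every frequency. *)
Definition has_hat (w : weight R d) (u : sp w) (f : E -> C) : Prop :=
  {ae mu, forall x, hat (coef u) x = f x}.

Lemma has_hat_refl w (u : sp w) : has_hat u (hat (coef u)).
Proof. exact: aeW. Qed.

Lemma has_hatD w (u v : sp w) f h : has_hat u f -> has_hat v h -> has_hat (u + v) (fun x => f x + h x).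
Proof.
move=> uf vh; apply: (ae_imp (ae_and (hatD_ae u v) (ae_and uf vh))) => x [e [eu ev]].
by rewrite [LHS]e [X in X + _ = _]eu [X in _ + X = _]ev.
Qed.

Lemma has_hatZ w (a : R) (u : sp w) f : has_hat u f -> has_hat (a *: u) (fun x => a%:C%C * f x).
Proof.
move=> uf; apply: (ae_imp (ae_and (hatZ_ae a u) uf)) => x [e eu].
by rewrite [LHS]e [X in _ * X = _]eu.
Qed.

Lemma has_hatN w (u : sp w) f : has_hat u f -> has_hat (- u) (fun x => - f x).
Proof.
rewrite -scaleN1r => /(has_hatZ (-1)) H; apply: (ae_imp H) => x ->.
by rewrite rmorphN rmorph1 mulN1r.
Qed.

Lemma has_hat0 w : has_hat (0 : sp w) (fun=> 0).
Proof.
rewrite -(scale0r (0 : sp w)); have := has_hatZ 0 (has_hat_refl (0 : sp w)).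
by move=> H; apply: (ae_imp H) => x ->; rewrite mul0r.
Qed.

Lemma has_hat_sum w (I : finType) (u : I -> sp w) (f : I -> E -> C) :
  (forall i, has_hat (u i) (f i)) -> has_hat (\sum_i u i) (fun x => \sum_i f i x).
Proof.
move=> uf; elim: (index_enum I) => [|i l IH].
  by rewrite big_nil; apply: (ae_imp (@has_hat0 w)) => x ->; rewrite big_nil.
by rewrite big_cons; apply: (ae_imp (has_hatD (uf i) IH)) => x ->; rewrite big_cons.
Qed.

Lemma has_hat_fop w w' G (u : sp w) f : symbol w w' G -> has_hat u f ->
  has_hat (fop w' G u) (fun x => G x * f x).
Proof.
move=> sG uf; apply: (ae_imp (ae_and (hat_fop sG u) uf)) => x [e eu].
by rewrite [LHS]e [X in _ * X = _]eu.
Qed.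

(** The symbols are singular at the origin alone, a null set in positive dimension. *)
Lemma has_hat_inj w (u v : sp w) f h : (0 < d)%N -> has_hat u f -> has_hat v h ->
  (forall x, dotp x x != 0 -> f x = h x) -> u = v.
Proof.
move=> d0 uf vh fh; apply/sp_inj/hat_inj.
apply: (ae_imp (ae_and (@ae_neq0 R d d0) (ae_and uf vh))) => x [x0 [eu ev]].
by rewrite [LHS]eu [RHS]ev fh.
Qed.

End hat_calculus.

(** * The linearised mass and momentum operators and their inverse *)

Section wave_operator.
Context {R : realType} {d s : nat} (d0 : (0 < d)%N) (ds : (d < s.*2)%N).
Local Notation C := R[i].
Local Notation j0 := (Ordinal d0).
Local Notation J0 := (Jw0 (R := R) ds).
Local Notation J1 := (Jw1 (R := R) ds).
Local Notation J2 := (Jw2 (R := R) ds).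
Local Notation A3 := (Aw3 (R := R) d0 ds).
Local Notation G2 := (Gw2 (R := R) ds).

Lemma sym_J1J0 j : symbol J1 J0 (dmul j). Proof. exact: symbol_dmul_jj. Qed.
Lemma sym_J2J0 j : symbol J2 J0 (dmul j). Proof. exact: symbol_dmul_jj. Qed.
Lemma sym_J2J1 j : symbol J2 J1 (dmul j). Proof. exact: symbol_dmul_jj. Qed.
Lemma sym_A3J2 j : symbol A3 J2 (dmul j). Proof. exact: symbol_dmul_aj. Qed.
Lemma sym_A3J0 j : symbol A3 J0 (dmul j). Proof. by apply: symbol_dmul_aj; rewrite ltnW. Qed.
Lemma sym_J2G2 j : symbol J2 G2 (dmul j). Proof. exact: symbol_dmul_jg. Qed.
Lemma sym_A3G2 : symbol A3 G2 (dmul j0). Proof. exact: symbol_dmul_ag. Qed.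
Lemma sym_incl : symbol J2 J0 (fun=> 1). Proof. by apply: symbol1_jj; rewrite ltnW. Qed.

Definition strainop (v : 'I_d -> sp J2) i j : sp J1 :=
  dop J1 j (v i) + dop J1 i (v j) + (2 * (i == j)%:R) *: \sum_k dop J1 k (v k).

Definition divstress (v : 'I_d -> sp J2) i : sp J0 := \sum_j dop J0 j (strainop v i j).

Definition lapgrad (h : sp A3) i : sp J0 := \sum_j dop J0 j (dop J1 j (dop J2 i h)).

Variables (g m t : R).

Definition massop (v : 'I_d -> sp J2) (h : sp A3) : sp G2 :=
  \sum_j dop G2 j (v j) - g *: dop G2 j0 h.

Definition momop (v : 'I_d -> sp J2) (h : sp A3) i : sp J0 :=
  incl J0 (v i) - g *: dop J0 j0 (v i) - m *: divstress v i + dop J0 i h - t *: lapgrad h i.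

Definition height_sol (y : sp G2) (f : 'I_d -> sp J0) : sp A3 :=
  fop A3 (eta_y d0 g m t) y + \sum_j fop A3 (eta_F d0 g m t j) (f j).

Definition velocity_sol (y : sp G2) (f : 'I_d -> sp J0) i : sp J2 :=
  fop J2 (vel_F d0 g m) (f i) + fop J2 (vel_eta d0 g m t i) (height_sol y f)
  + fop J2 (vel_y d0 g m i) y.

Lemma has_hat_massop v h fv fh : (forall j, has_hat (v j) (fv j)) -> has_hat h fh ->
  has_hat (massop v h) (fun x => mass (dmul^~ x) (dmul j0 x) g%:C%C (fv^~ x) (fh x)).
Proof.
move=> hv hh; apply: has_hatD.
  by apply: has_hat_sum => j; apply: has_hat_fop; [exact: sym_J2G2|].
by apply/has_hatN/has_hatZ/has_hat_fop; [exact: sym_A3G2|].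
Qed.

Lemma has_hat_momop v h fv fh i : (forall j, has_hat (v j) (fv j)) -> has_hat h fh ->
  has_hat (momop v h i)
    (fun x => momentum (dmul^~ x) (dmul j0 x) g%:C%C m%:C%C t%:C%C (fv^~ x) (fh x) i).
Proof.
move=> hv hh.
have h1 j : has_hat (strainop v i j) (fun x => dmul j x * fv i x + dmul i x * fv j x +
    (2 * (i == j)%:R) * \sum_k dmul k x * fv k x).
  have : has_hat (strainop v i j) (fun x => dmul j x * fv i x + dmul i x * fv j x +
    (2 * (i == j)%:R)%:C%C * \sum_k dmul k x * fv k x).
    apply: has_hatD; first by apply: has_hatD; (apply: has_hat_fop; [exact: sym_J2J1|]).
    by apply/has_hatZ/has_hat_sum => k; apply: has_hat_fop; [exact: sym_J2J1|].
  by congr has_hat; apply/funext => x; rewrite rmorphM !rmorph_nat.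
have h2 : has_hat (incl J0 (v i)) (fv i).
  have := has_hat_fop sym_incl (hv i); congr has_hat; apply/funext => x; exact: mul1r.
rewrite /momentum; apply: has_hatD; last first.
  apply/has_hatN/has_hatZ/has_hat_sum => j; apply: has_hat_fop; first exact: sym_J1J0.
  by apply: has_hat_fop; [exact: sym_J2J1|apply: has_hat_fop => //; exact: sym_A3J2].
apply: has_hatD; last by apply: has_hat_fop; [exact: sym_A3J0|].
apply: has_hatD.
  by apply: has_hatD => //; apply/has_hatN/has_hatZ/has_hat_fop; [exact: sym_J2J0|].
by apply/has_hatN/has_hatZ/has_hat_sum => j; apply: has_hat_fop; [exact: sym_J1J0|].
Qed.

Hypotheses (g0 : 0 < g) (m0 : 0 < m) (t0 : 0 < t).

Lemma has_hat_height y f fy ff : has_hat y fy -> (forall j, has_hat (f j) (ff j)) ->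
  has_hat (height_sol y f) (fun x => eta_y d0 g m t x * fy x + \sum_j eta_F d0 g m t j x * ff j x).
Proof.
move=> hy hf; apply: has_hatD; first by apply: has_hat_fop; [exact: symbol_eta_y|].
by apply: has_hat_sum => j; apply: has_hat_fop; [exact: symbol_eta_F|].
Qed.

Lemma has_hat_velocity y f fy ff i : has_hat y fy -> (forall j, has_hat (f j) (ff j)) ->
  has_hat (velocity_sol y f i) (fun x => vel_F d0 g m x * ff i x +
    vel_eta d0 g m t i x * (eta_y d0 g m t x * fy x + \sum_j eta_F d0 g m t j x * ff j x) +
    vel_y d0 g m i x * fy x).
Proof.
move=> hy hf; apply: has_hatD; last by apply: has_hat_fop; [exact: symbol_vel_y|].
apply: has_hatD; first by apply: has_hat_fop; [exact: symbol_vel_F|].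
apply: has_hat_fop; [exact: symbol_vel_eta|exact: has_hat_height].
Qed.

Let r4 : (4 * m)%:C%C = 4 * m%:C%C :> C. Proof. by rewrite rmorphM rmorph_nat. Qed.
Let r3 : (3 * m)%:C%C = 3 * m%:C%C :> C. Proof. by rewrite rmorphM rmorph_nat. Qed.
Let r3g : (3 * m * g)%:C%C = 3 * m%:C%C * g%:C%C :> C. Proof. by rewrite !rmorphM rmorph_nat. Qed.

Lemma massop_sol y f : massop (velocity_sol y f) (height_sol y f) = y.
Proof.
have hy := has_hat_refl y; have hf j := has_hat_refl (f j).
apply: (has_hat_inj d0 (has_hat_massop (fun i => has_hat_velocity i hy hf) (has_hat_height hy hf)) hy).
move=> x x0; have P0 := symP_neq0 d0 g0 m0 t0 x0; have D0 := symD_neq0 d0 g0 m0 t0 x.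
move: P0 D0; rewrite /vel_F /vel_eta /vel_y /eta_y /eta_F /symP /symE /symD /symB /symLap r4 r3 r3g => P0 D0.
exact: mass_solve.
Qed.

Lemma momop_sol y f i : momop (velocity_sol y f) (height_sol y f) i = f i.
Proof.
have hy := has_hat_refl y; have hf j := has_hat_refl (f j).
apply: (has_hat_inj d0 (has_hat_momop i (fun i => has_hat_velocity i hy hf) (has_hat_height hy hf)) (hf i)).
move=> x x0; have P0 := symP_neq0 d0 g0 m0 t0 x0; have D0 := symD_neq0 d0 g0 m0 t0 x.
move: P0 D0; rewrite /vel_F /vel_eta /vel_y /eta_y /eta_F /symP /symE /symD /symB /symLap r4 r3 r3g => P0 D0.
exact: (@momentum_solve _ _ (dmul^~ x) _ _ _ _ (hat (coef y) x) (fun j => hat (coef (f j)) x)).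
Qed.

Lemma height_solK v h : height_sol (massop v h) (momop v h) = h.
Proof.
have hv j := has_hat_refl (v j); have hh := has_hat_refl h.
apply: (has_hat_inj d0 (has_hat_height (has_hat_massop hv hh) (fun i => has_hat_momop i hv hh)) hh).
move=> x x0; have P0 := symP_neq0 d0 g0 m0 t0 x0; have D0 := symD_neq0 d0 g0 m0 t0 x.
move: P0 D0; rewrite /vel_F /vel_eta /vel_y /eta_y /eta_F /symP /symE /symD /symB /symLap r4 => P0 D0.
exact: solve_height.
Qed.

Lemma velocity_solK v h i : velocity_sol (massop v h) (momop v h) i = v i.
Proof.
have hv j := has_hat_refl (v j); have hh := has_hat_refl h.
have hm := has_hat_massop hv hh; have hM j := has_hat_momop j hv hh.
have H : has_hat (velocity_sol (massop v h) (momop v h) i) (fun x => vel_F d0 g m x *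
    momentum (dmul^~ x) (dmul j0 x) g%:C%C m%:C%C t%:C%C (fun j => hat (coef (v j)) x) (hat (coef h) x) i +
    vel_eta d0 g m t i x * hat (coef h) x +
    vel_y d0 g m i x * mass (dmul^~ x) (dmul j0 x) g%:C%C (fun j => hat (coef (v j)) x) (hat (coef h) x)).
  rewrite /velocity_sol height_solK.
  apply: has_hatD; last by apply: has_hat_fop; [exact: symbol_vel_y|].
  apply: has_hatD; first by apply: has_hat_fop; [exact: symbol_vel_F|].
  by apply: has_hat_fop; [exact: symbol_vel_eta|].
apply: (has_hat_inj d0 H (hv i)) => x x0.
have D0 := symD_neq0 d0 g0 m0 t0 x.
move: D0; rewrite /vel_F /vel_eta /vel_y /symD /symB /symLap r3 r3g => D0.
exact: solve_velocity.
Qed.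

End wave_operator.

(** * Finite products of normed spaces *)

Section product_norms.
Context {R : realType}.

Definition norm_fun k (V : lmodType R) (n : V -> R) (f : 'I_k -> V) : R := \sum_i n (f i).

Lemma norm_funP k (V : lmodType R) (n : V -> R) : is_norm n -> is_norm (@norm_fun k V n).
Proof.
move=> nP; split.
- by move=> f; apply: sumr_ge0 => i _; exact: norm_ge0.
- by move=> f g; rewrite /norm_fun -big_split; apply: ler_sum => i _; exact: norm_add.
- by move=> a f; rewrite /norm_fun mulr_sumr; apply: eq_bigr => i _; exact: norm_scale.
move=> f /eqP; rewrite psumr_eq0 => [/allP H|i _]; last exact: norm_ge0.
by apply/funext => i; apply: (norm_eq0 nP); apply/eqP/H; rewrite mem_index_enum.
Qed.

Lemma norm_fun_ge k (V : lmodType R) (n : V -> R) (f : 'I_k -> V) i : is_norm n -> n (f i) <= norm_fun n f.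
Proof.
by move=> nP; rewrite /norm_fun (bigD1 i)//= lerDl sumr_ge0// => j _; exact: norm_ge0.
Qed.

(* Telescoping recovers the sharp constant from any geometric rate. *)
Lemma fast_complete_rate (V : lmodType R) (n : V -> R) : is_norm n ->
  (forall (u : nat -> V) (C : R), (forall k, n (u k.+1 - u k) <= C * 2^-1 ^+ k) ->
     exists v K, forall k, n (v - u k) <= K * 2^-1 ^+ k) -> fast_complete n.
Proof.
move=> nP cV u C uC; have [v [K vP]] := cV u C uC; exists v => j.
have half0 r : (0 : R) < 2^-1 ^+ r by rewrite exprn_gt0.
have tele r : n (u (j + r)%N - u j) <= 2 * C * 2^-1 ^+ j * (1 - 2^-1 ^+ r).
  elim: r => [|r IH].
    by rewrite addn0 subrr (norm0 nP) expr0 subrr mulr0.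
  apply: (le_trans (norm_sub_trans nP (u (j + r)%N) _ _)).
  rewrite addnS; have := uC (j + r)%N; rewrite exprD exprS; move: IH; lra.
apply/ler_addgt0Pr => e e0.
have C0 : 0 <= C by have := uC 0%N; rewrite expr0 mulr1; apply: le_trans; exact: norm_ge0.
have K1 : 0 < `|K| + 1 by rewrite ltr_wpDl.
have [r hr] : exists r, (`|K| + 1) * 2^-1 ^+ r < e.
  have /cvgrPdist_lt/(_ (e / (`|K| + 1))) : (fun r => (2^-1 : R) ^+ r) @ \oo --> (0 : R).
    by apply: cvg_expr; rewrite gtr0_norm// invf_lt1// ltr1n.
  rewrite divr_gt0// => /(_ isT) [r _ /(_ r (leqnn r))] /=.
  rewrite sub0r normrN gtr0_norm// => h; exists r.
  by rewrite mulrC -ltr_pdivlMr.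
apply: (le_trans (norm_sub_trans nP (u (j + r)%N) _ _)).
rewrite addrC; apply: lerD.
  have h : 0 <= 2 * C * 2^-1 ^+ j by rewrite !mulr_ge0// ltW.
  by have := mulr_ge0 h (ltW (half0 r)); have := tele r; lra.
apply: (le_trans (vP _)); apply: ltW; apply: le_lt_trans hr.
apply: (@le_trans _ _ ((`|K| + 1) * 2^-1 ^+ (j + r))).
  by rewrite ler_wpM2r ?(ltW (half0 _))//; have := ler_norm K; lra.
rewrite ler_wpM2l ?(ltW K1)// exprD ler_piMl ?(ltW (half0 r))//.
by rewrite exprn_ile1// invf_le1// ler1n.
Qed.

Lemma fast_complete_fun k (V : lmodType R) (n : V -> R) : is_norm n -> fast_complete n ->
  fast_complete (@norm_fun k V n).
Proof.
move=> nP cV; apply: (fast_complete_rate (norm_funP _ nP)) => u C uC.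
have le i j : n (u j.+1 i - u j i) <= C * 2^-1 ^+ j.
  by apply: le_trans (uC j); exact: (norm_fun_ge (u j.+1 - u j) i nP).
have [v vP] := choice (fun i => cV _ _ (le i)).
exists v, (\sum_(i < k) 2 * C) => j; rewrite mulr_suml.
by apply: ler_sum => i _; exact: vP.
Qed.

Lemma fast_complete_pair (V W : lmodType R) (nV : V -> R) (nW : W -> R) :
  is_norm nV -> is_norm nW -> fast_complete nV -> fast_complete nW ->
  fast_complete (norm_pair nV nW).
Proof.
move=> vP wP cV cW; apply: (fast_complete_rate (norm_pairP vP wP)) => u C uC.
have [|v vK] := cV (fun j => (u j).1) C.
  by move=> j; apply: le_trans (uC j); rewrite /norm_pair lerDl norm_ge0.
have [|w wK] := cW (fun j => (u j).2) C.
  by move=> j; apply: le_trans (uC j); rewrite /norm_pair lerDr norm_ge0.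
by exists (v, w), (2 * C + 2 * C) => j; rewrite /norm_pair mulrDl; apply: lerD; [exact: vK|exact: wK].
Qed.

Lemma norm_realP : is_norm (fun x : R => `|x|).
Proof.
split=> //; [exact: ler_normD|by move=> a v; rewrite -normrM|].
by move=> v /eqP; rewrite normr_eq0 => /eqP.
Qed.

(** Nested intervals: u_k - 2C/2^k increases and u_k + 2C/2^k decreases, so the supremum of the
    lower ends lies in all of them. *)
Lemma fast_complete_real : fast_complete (fun x : R => `|x|).
Proof.
apply: (fast_complete_rate norm_realP) => u C uC.
have step k : `|u k.+1 - u k| <= C * 2^-1 ^+ k by exact: uC.
pose a k := u k - 2 * C * 2^-1 ^+ k; pose b k := u k + 2 * C * 2^-1 ^+ k.
have aS k : a k <= a k.+1.
  by have := step k; rewrite ler_norml /a exprS => /andP[h _]; lra.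
have bS k : b k.+1 <= b k.
  by have := step k; rewrite ler_norml /b exprS => /andP[_ h]; lra.
have ab k : a k <= b k.
  have : 0 <= C * 2^-1 ^+ k by exact: le_trans (step k).
  by rewrite /a /b; lra.
have mono i j : (i <= j)%N -> a i <= a j /\ b j <= b i.
  move=> /subnKC <-; elim: (j - i)%N => [|m [h1 h2]]; first by rewrite addn0.
  by rewrite addnS (le_trans h1) ?(le_trans _ h2).
have ub k : ubound (range a) (b k).
  move=> _ [i _ <-]; have [_ h1] := mono _ _ (leq_maxl k i); have [h2 _] := mono _ _ (leq_maxr k i).
  exact: le_trans h2 (le_trans (ab _) h1).
exists (sup (range a)), (2 * C) => k; rewrite ler_norml; apply/andP; split.
  have : a k <= sup (range a) by apply: ub_le_sup; [exists (b 0%N); exact: ub|exists k].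
  by rewrite {1}/a; lra.
have : sup (range a) <= b k by apply: ge_sup; [exists (a 0%N), 0%N|exact: ub].
by rewrite /b; lra.
Qed.

End product_norms.

(** * Bounded linear and bilinear maps *)

Section bounded_maps.
Context {R : realType}.
Implicit Types U V W Z : lmodType R.

Lemma blinP U V (nU : U -> R) (nV : V -> R) (f : U -> V) : blin nU nV f ->
  [/\ forall u v, f (u + v) = f u + f v, forall a u, f (a *: u) = a *: f u,
      f 0 = 0 & forall u, f (- u) = - f u].
Proof.
move=> [fl _]; have fD u v : f (u + v) = f u + f v by rewrite -[u]scale1r fl !scale1r.
have f0 : f 0 = 0 by have := fD 0 0; rewrite addr0 -{1}[f 0]addr0 => /addrI.
have fZ a u : f (a *: u) = a *: f u by rewrite -[a *: u]addr0 fl f0 addr0.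
by split=> // u; rewrite -scaleN1r fZ scaleN1r.
Qed.

Lemma blin_id U (n : U -> R) : blin n n id.
Proof. by split=> //; exists 1 => // u; rewrite mul1r. Qed.

Lemma blin_comp U V W (nU : U -> R) (nV : V -> R) (nW : W -> R) (f : U -> V) (h : V -> W) :
  blin nU nV f -> blin nV nW h -> blin nU nW (fun u => h (f u)).
Proof.
move=> [fl [C C1 fC]] [hl [K K1 hK]]; split; first by move=> a u v; rewrite fl hl.
exists (K * C); first by rewrite mulr_ege1.
move=> u; apply: (le_trans (hK _)); rewrite -mulrA ler_wpM2l//.
exact: le_trans ler01 K1.
Qed.

Lemma blin_fst U V W (nU : U -> R) (nV : V -> R) (nW : W -> R) (f : U -> (V * W)%type) : is_norm nW ->
  blin nU (norm_pair nV nW) f -> blin nU nV (fun u => (f u).1).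
Proof.
move=> wP [fl [C C1 fC]]; split; first by move=> a u v; rewrite fl.
by exists C => // u; apply: le_trans (fC u); rewrite lerDl norm_ge0.
Qed.

Lemma blin_snd U V W (nU : U -> R) (nV : V -> R) (nW : W -> R) (f : U -> (V * W)%type) : is_norm nV ->
  blin nU (norm_pair nV nW) f -> blin nU nW (fun u => (f u).2).
Proof.
move=> vP [fl [C C1 fC]]; split; first by move=> a u v; rewrite fl.
by exists C => // u; apply: le_trans (fC u); rewrite lerDr norm_ge0.
Qed.

Lemma blin_nth U V k (nU : U -> R) (nV : V -> R) (f : U -> 'I_k -> V) i : is_norm nV ->
  blin nU (norm_fun nV) f -> blin nU nV (fun u => f u i).
Proof.
move=> vP [fl [C C1 fC]]; split; first by move=> a u v; rewrite fl.
by exists C => // u; apply: le_trans (fC u); exact: norm_fun_ge.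
Qed.

Record bbil U V W (nU : U -> R) (nV : V -> R) (nW : W -> R) (B : U -> V -> W) : Prop := Bbil {
  bbil_l : forall a u u' v, B (a *: u + u') v = a *: B u v + B u' v ;
  bbil_r : forall a u v v', B u (a *: v + v') = a *: B u v + B u v' ;
  bbil_bound : exists2 C, 1 <= C & forall u v, nW (B u v) <= C * (nU u * nV v) }.

Lemma bbilP U V W (nU : U -> R) (nV : V -> R) (nW : W -> R) (B : U -> V -> W) : bbil nU nV nW B ->
  (forall v, B 0 v = 0) /\ (forall u, B u 0 = 0).
Proof.
move=> [Bl Br _]; split=> u.
  by have := Bl 1 0 0 u; rewrite !scale1r addr0 -{1}[B 0 u]addr0 => /addrI.
by have := Br 1 u 0 0; rewrite !scale1r addr0 -{1}[B u 0]addr0 => /addrI.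
Qed.

Section closure.
Context {Z : lmodType R} {nZ : Z -> R} (zP : is_norm nZ).

Lemma bbil_comp U V W (nU : U -> R) (nV : V -> R) (nW : W -> R) (B : U -> V -> W) (f : Z -> U) (h : Z -> V) :
  is_norm nU -> is_norm nV ->
  bbil nU nV nW B -> blin nZ nU f -> blin nZ nV h -> bbil nZ nZ nW (fun z z' => B (f z) (h z')).
Proof.
move=> uP vP [Bl Br [C C1 BC]] [fl [Cf Cf1 fC]] [hl [Ch Ch1 hC]]; split.
- by move=> a u v w; rewrite fl Bl.
- by move=> a u v w; rewrite hl Br.
exists (C * (Cf * Ch)); first by rewrite !mulr_ege1.
move=> u v; apply: (le_trans (BC _ _)).
have -> : C * (Cf * Ch) * (nZ u * nZ v) = C * ((Cf * nZ u) * (Ch * nZ v)) by ring.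
rewrite ler_wpM2l//; first exact: le_trans ler01 C1.
by apply: ler_pM => //; exact: norm_ge0.
Qed.

Lemma bbil_post V W (nV : V -> R) (nW : W -> R) (h : V -> W) (B : Z -> Z -> V) :
  blin nV nW h -> bbil nZ nZ nV B -> bbil nZ nZ nW (fun z z' => h (B z z')).
Proof.
move=> [hl [K K1 hK]] [Bl Br [C C1 BC]]; split.
- by move=> a u v w; rewrite Bl hl.
- by move=> a u v w; rewrite Br hl.
exists (K * C); first by rewrite mulr_ege1.
move=> u v; apply: (le_trans (hK _)); rewrite -mulrA ler_wpM2l//.
exact: le_trans ler01 K1.
Qed.

Section one_target.
Context {V : lmodType R} {nV : V -> R} (vP : is_norm nV).

Lemma blin0 : blin nZ nV (fun=> 0).
Proof.
split; first by move=> a u v; rewrite scaler0 addr0.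
by exists 1 => // u; rewrite (norm0 vP) mul1r norm_ge0.
Qed.

Lemma blinD f h : blin nZ nV f -> blin nZ nV h -> blin nZ nV (fun z => f z + h z).
Proof.
move=> [fl [C C1 fC]] [hl [K K1 hK]]; split; first by move=> a u v; rewrite fl hl scalerDr addrACA.
exists (C + K); first by lra.
by move=> u; apply: (le_trans (norm_add vP _ _)); rewrite mulrDl lerD.
Qed.

Lemma blinN f : blin nZ nV f -> blin nZ nV (fun z => - f z).
Proof.
move=> [fl [C C1 fC]]; split; first by move=> a u v; rewrite fl opprD scalerN.
by exists C => // u; rewrite (normN vP).
Qed.

Lemma blinZ (c : R) f : blin nZ nV f -> blin nZ nV (fun z => c *: f z).
Proof.
move=> [fl [C C1 fC]]; split; first by move=> a u v; rewrite fl scalerDr !scalerA mulrC.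
exists ((1 + `|c|) * C); first by rewrite mulr_ege1// lerDl.
move=> u; rewrite (norm_scale vP) -mulrA; apply: ler_pM => //; first exact: norm_ge0.
by rewrite lerDr.
Qed.

Lemma blin_sum k (f : 'I_k -> Z -> V) : (forall i, blin nZ nV (f i)) -> blin nZ nV (fun z => \sum_i f i z).
Proof.
elim: k f => [|k IH] f fl.
  by rewrite (_ : (fun z => _) = fun=> 0); [exact: blin0|apply/funext => z; rewrite big_ord0].
rewrite (_ : (fun z => _) = fun z => f ord0 z + \sum_i f (lift ord0 i) z).
  by apply: blinD => //; exact: IH.
by apply/funext => z; rewrite big_ord_recl.
Qed.

Lemma bbil0 : bbil nZ nZ nV (fun _ _ => 0).
Proof.
split; [by move=> *; rewrite scaler0 addr0|by move=> *; rewrite scaler0 addr0|].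
by exists 1 => // u v; rewrite (norm0 vP) mul1r mulr_ge0// norm_ge0.
Qed.

Lemma bbilD f h : bbil nZ nZ nV f -> bbil nZ nZ nV h -> bbil nZ nZ nV (fun z z' => f z z' + h z z').
Proof.
move=> [fl fr [C C1 fC]] [hl hr [K K1 hK]]; split.
- by move=> a u v w; rewrite fl hl scalerDr addrACA.
- by move=> a u v w; rewrite fr hr scalerDr addrACA.
exists (C + K); first by lra.
by move=> u v; apply: (le_trans (norm_add vP _ _)); rewrite mulrDl lerD.
Qed.

Lemma bbilN f : bbil nZ nZ nV f -> bbil nZ nZ nV (fun z z' => - f z z').
Proof.
move=> [fl fr [C C1 fC]]; split.
- by move=> a u v w; rewrite fl opprD scalerN.
- by move=> a u v w; rewrite fr opprD scalerN.
by exists C => // u v; rewrite (normN vP).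
Qed.

Lemma bbil_sum k (f : 'I_k -> Z -> Z -> V) : (forall i, bbil nZ nZ nV (f i)) ->
  bbil nZ nZ nV (fun z z' => \sum_i f i z z').
Proof.
elim: k f => [|k IH] f fl.
  rewrite (_ : (fun z z' => _) = fun _ _ => 0); first exact: bbil0.
  by apply/funext => z; apply/funext => z'; rewrite big_ord0.
rewrite (_ : (fun z z' => _) = fun z z' => f ord0 z z' + \sum_i f (lift ord0 i) z z').
  by apply: bbilD => //; exact: IH.
by apply/funext => z; apply/funext => z'; rewrite big_ord_recl.
Qed.

Lemma blin_fun k (f : Z -> 'I_k -> V) : (forall i, blin nZ nV (f^~ i)) -> blin nZ (norm_fun nV) f.
Proof.
move=> fl; split; first by move=> a u v; apply/funext => i; rewrite (blin_lin (fl i)).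
have ex i : exists C : R, 1 <= C /\ forall z, nV (f z i) <= C * nZ z.
  by have [C C1 fC] := blin_bound (fl i); exists C.
have [C CP] := choice ex.
exists (1 + \sum_i C i); first by rewrite lerDl sumr_ge0// => i _; exact: le_trans (CP i).1.
move=> u; rewrite mulrDl mul1r; apply: (@le_trans _ _ ((\sum_i C i) * nZ u)).
  by rewrite mulr_suml; apply: ler_sum => i _; exact: (CP i).2.
by rewrite lerDr norm_ge0.
Qed.

Lemma bbil_fun k (f : Z -> Z -> 'I_k -> V) : (forall i, bbil nZ nZ nV (fun z z' => f z z' i)) ->
  bbil nZ nZ (norm_fun nV) f.
Proof.
move=> fl; split.
- by move=> a u v w; apply/funext => i; rewrite (bbil_l (fl i)).
- by move=> a u v w; apply/funext => i; rewrite (bbil_r (fl i)).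
have ex i : exists C : R, 1 <= C /\ forall z z', nV (f z z' i) <= C * (nZ z * nZ z').
  by have [C C1 fC] := bbil_bound (fl i); exists C.
have [C CP] := choice ex.
exists (1 + \sum_i C i); first by rewrite lerDl sumr_ge0// => i _; exact: le_trans (CP i).1.
move=> u v; rewrite mulrDl mul1r; apply: (@le_trans _ _ ((\sum_i C i) * (nZ u * nZ v))).
  by rewrite mulr_suml; apply: ler_sum => i _; exact: (CP i).2.
by rewrite lerDr mulr_ge0 ?norm_ge0.
Qed.

End one_target.

Lemma blin_pair V W (nV : V -> R) (nW : W -> R) f h : blin nZ nV f -> blin nZ nW h ->
  blin nZ (norm_pair nV nW) (fun z => (f z, h z)).
Proof.
move=> [fl [C C1 fC]] [hl [K K1 hK]]; split; first by move=> a u v; rewrite fl hl.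
exists (C + K); first by lra.
by move=> u; rewrite /norm_pair mulrDl; exact: lerD (fC u) (hK u).
Qed.

Lemma bbil_pair V W (nV : V -> R) (nW : W -> R) f h : bbil nZ nZ nV f -> bbil nZ nZ nW h ->
  bbil nZ nZ (norm_pair nV nW) (fun z z' => (f z z', h z z')).
Proof.
move=> [fl fr [C C1 fC]] [hl hr [K K1 hK]]; split.
- by move=> a u v w; rewrite fl hl.
- by move=> a u v w; rewrite fr hr.
exists (C + K); first by lra.
by move=> u v; rewrite /norm_pair mulrDl; exact: lerD (fC u v) (hK u v).
Qed.

End closure.

Lemma bbil_scale V (nV : V -> R) : is_norm nV -> bbil (fun a : R => `|a|) nV nV (fun a u => a *: u).
Proof.
move=> vP; split.
- by move=> a u u' v; rewrite scalerDl scalerA.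
- by move=> a u v v'; rewrite scalerDr !scalerA mulrC.
by exists 1 => // a u; rewrite mul1r (norm_scale vP).
Qed.

Lemma bounded_quadraticI (X W Y : lmodType R) (nX : X -> R) (nW : W -> R) (nY : Y -> R) L Q :
  is_norm nX -> is_norm nW ->
  blin (norm_pair nX nW) nY L -> bbil (norm_pair nX nW) (norm_pair nX nW) nY Q ->
  exists C, bounded_quadratic nX nW nY L Q C.
Proof.
move=> xP wP [Ll [C C1 LC]] [Ql Qr [K K1 QK]]; have zP := norm_pairP xP wP.
exists (C + K); split=> //; first by lra.
- move=> z; apply: (le_trans (LC z)); rewrite ler_wpM2r ?norm_ge0//; lra.
move=> z w; apply: (le_trans (QK z w)); rewrite ler_wpM2r ?mulr_ge0 ?norm_ge0//; lra.
Qed.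

End bounded_maps.

Ltac is_norm_tac := repeat first
  [exact: norm_realP|exact: spn_is_norm|apply: norm_funP|apply: norm_pairP].

Ltac complete_tac := repeat first
  [exact: fast_complete_real|exact: sp_complete|apply: fast_complete_fun|
   apply: fast_complete_pair|is_norm_tac].

Lemma spM_bbil (R : realType) d (wa wb wc : weight R d) : mulable wa wb wc ->
  bbil (@spn _ _ wa) (@spn _ _ wb) (@spn _ _ wc) (spM wc).
Proof.
move=> abc; split; last exact: spM_bound.
- move=> a u u' v; apply/sp_inj/funext => x.
  by rewrite spD spZ !spME// spD spZ mulrDl mulrA.
- move=> a u v v'; apply/sp_inj/funext => x.
  by rewrite spD spZ !spME// spD spZ mulrDr mulrCA.
Qed.

Lemma norm_pair_fst (R : realType) (V W : lmodType R) (nV : V -> R) (nW : W -> R) (v : (V * W)%type) :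
  is_norm nW -> nV v.1 <= norm_pair nV nW v.
Proof. by move=> nP; rewrite lerDl norm_ge0. Qed.

Lemma norm_pair_snd (R : realType) (V W : lmodType R) (nV : V -> R) (nW : W -> R) (v : (V * W)%type) :
  is_norm nV -> nW v.2 <= norm_pair nV nW v.
Proof. by move=> nP; rewrite lerDr norm_ge0. Qed.

(** * A calculus of quantities tending to zero *)

Section small.
Context {R : realType} {Z : Type} (S : R -> Z -> Prop).
Hypothesis S_mono : forall r r' z, r <= r' -> S r z -> S r' z.
Implicit Types U V W : lmodType R.

Let S_min r r' z : S (Num.min r r') z -> S r z /\ S r' z.
Proof. by move=> Sz; split; apply: S_mono Sz; rewrite ge_min lexx ?orbT. Qed.

(** An o(1) notion as z approaches a base point, where approach means membership in an abstract
    family [S r] that shrinks with r. *)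
Definition small V (n : V -> R) (f : Z -> V) : Prop :=
  forall e, 0 < e -> exists2 r, 0 < r & forall z, S r z -> n (f z) <= e.

Definition bdd V (n : V -> R) (f : Z -> V) : Prop :=
  exists2 r, 0 < r & exists C, forall z, S r z -> n (f z) <= C.

Lemma small_bdd V (n : V -> R) f : small n f -> bdd n f.
Proof. by move=> /(_ 1 ltr01)[r r0 H]; exists r => //; exists 1. Qed.
Lemma small_eq V (n : V -> R) f h : (forall r z, S r z -> f z = h z) -> small n h -> small n f.
Proof. by move=> fh H e /H[r r0 Hr]; exists r => // z Sz; rewrite (fh r)// Hr. Qed.
Lemma bdd_eq V (n : V -> R) f h : (forall r z, S r z -> f z = h z) -> bdd n h -> bdd n f.
Proof. by move=> fh [r r0 [C H]]; exists r => //; exists C => z Sz; rewrite (fh r)// H. Qed.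

Lemma smallD V (n : V -> R) f h : is_norm n -> small n f -> small n h -> small n (fun z => f z + h z).
Proof.
move=> nP Hf Hh e e0; have e2 : 0 < e / 2 by rewrite divr_gt0.
have [r r0 fr] := Hf _ e2; have [r' r'0 hr] := Hh _ e2.
exists (Num.min r r'); first by rewrite lt_min r0.
move=> z /S_min[S1 S2]; apply: (le_trans (norm_add nP _ _)); rewrite (splitr e); apply: lerD.
  exact: fr.
exact: hr.
Qed.

Lemma smallN V (n : V -> R) f : is_norm n -> small n f -> small n (fun z => - f z).
Proof. by move=> nP H e /H[r r0 Hr]; exists r => // z Sz; rewrite (normN nP) Hr. Qed.

Lemma bddD V (n : V -> R) f h : is_norm n -> bdd n f -> bdd n h -> bdd n (fun z => f z + h z).
Proof.
move=> nP [r r0 [C fr]] [r' r'0 [K hr]]; exists (Num.min r r'); first by rewrite lt_min r0.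
exists (C + K) => z /S_min[S1 S2]; apply: (le_trans (norm_add nP _ _)); apply: lerD.
  exact: fr.
exact: hr.
Qed.

Lemma bdd_cst V (n : V -> R) c : bdd n (fun=> c).
Proof. by exists 1 => //; exists (n c). Qed.
Lemma small0 V (n : V -> R) : is_norm n -> small n (fun=> 0).
Proof. by move=> nP e e0; exists 1 => // z _; rewrite (norm0 nP) ltW. Qed.

Lemma small_sum V (n : V -> R) k (f : 'I_k -> Z -> V) : is_norm n -> (forall i, small n (f i)) ->
  small n (fun z => \sum_i f i z).
Proof.
move=> nP; elim: k f => [|k IH] f Hf.
  by apply: (small_eq _ (small0 nP)) => r z _; rewrite big_ord0.
apply: (@small_eq _ _ _ (fun z => f ord0 z + \sum_i f (lift ord0 i) z)).
  by move=> r z _; rewrite big_ord_recl.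
by apply: smallD => //; exact: IH.
Qed.

Lemma small_blin V W (n : V -> R) (n' : W -> R) (h : V -> W) f : is_norm n -> blin n n' h ->
  small n f -> small n' (fun z => h (f z)).
Proof.
move=> nP [_ [C C1 hC]] H e e0; have C0 : 0 < C by exact: lt_le_trans C1.
have [|r r0 Hr] := H (e / C); first by rewrite divr_gt0.
exists r => // z Sz; apply: (le_trans (hC _)); rewrite mulrC -ler_pdivlMr//.
exact: Hr.
Qed.

Lemma small_bbil_l U V W (nU : U -> R) (nV : V -> R) (nW : W -> R) (B : U -> V -> W) f h :
  is_norm nU -> is_norm nV -> bbil nU nV nW B -> small nU f -> bdd nV h -> small nW (fun z => B (f z) (h z)).
Proof.
move=> uP vP [_ _ [C C1 BC]] Hf [r r0 [K hK]] e e0; have C0 : 0 < C by exact: lt_le_trans C1.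
have K1 : 0 < `|K| + 1 by rewrite ltr_wpDl.
have [|r' r'0 fr] := Hf (e / (C * (`|K| + 1))); first by rewrite divr_gt0// mulr_gt0.
exists (Num.min r r'); first by rewrite lt_min r0.
move=> z /S_min[S1 S2]; have h1 : nV (h z) <= `|K| + 1.
  by apply: le_trans (hK _ S1) _; have := ler_norm K; lra.
have := fr _ S2; rewrite ler_pdivlMr ?mulr_gt0// => h2; apply: (le_trans (BC _ _)); apply: le_trans h2.
rewrite mulrCA; apply: ler_wpM2l; first exact: norm_ge0.
by rewrite ler_wpM2l// ltW.
Qed.

Lemma small_bbil_r U V W (nU : U -> R) (nV : V -> R) (nW : W -> R) (B : U -> V -> W) f h :
  is_norm nU -> is_norm nV -> bbil nU nV nW B -> bdd nU f -> small nV h -> small nW (fun z => B (f z) (h z)).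
Proof.
move=> uP vP [Bl Br [C C1 BC]] Hf Hh.
apply: (@small_bbil_l _ _ _ nV nU nW (fun v u => B u v)) => //; split => //.
by exists C => // v u; rewrite [nV v * _]mulrC.
Qed.

Lemma small_pair V W (nV : V -> R) (nW : W -> R) f h : small nV f -> small nW h ->
  small (norm_pair nV nW) (fun z => (f z, h z)).
Proof.
move=> Hf Hh e e0; have e2 : 0 < e / 2 by rewrite divr_gt0.
have [r r0 fr] := Hf _ e2; have [r' r'0 hr] := Hh _ e2.
exists (Num.min r r'); first by rewrite lt_min r0.
move=> z /S_min[S1 S2]; rewrite /norm_pair (splitr e); apply: lerD.
  exact: fr.
exact: hr.
Qed.

Lemma small_fun V k (n : V -> R) (f : Z -> 'I_k -> V) : is_norm n -> (forall i, small n (f^~ i)) ->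
  small (norm_fun n) f.
Proof.
move=> nP Hf e e0.
suff : small (fun x : R => `|x|) (fun z => \sum_i n (f z i)).
  move=> /(_ e e0)[r r0 H]; exists r => // z /H; apply: le_trans; exact: ler_norm.
apply: (small_sum norm_realP) => i e' /(Hf i)[r r0 H]; exists r => // z /H.
by rewrite ger0_norm// norm_ge0.
Qed.

Lemma small_le V W (n : V -> R) (n' : W -> R) f h : (forall z, n' (h z) <= n (f z)) -> small n f -> small n' h.
Proof. by move=> fh H e /H[r r0 Hr]; exists r => // z /Hr; apply: le_trans. Qed.

End small.

(** * Classical regularity of elements of the spaces *)

Section classical.
Context {R : realType} {d : nat}.
Local Notation E := 'rV[R]_d.

Lemma sp_sumE (w : weight R d) (I : finType) (u : I -> sp w) x : (\sum_i u i) x = \sum_i u i x.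
Proof. by elim/big_rec2: _ => // i y1 y2 _ <-. Qed.

Lemma pderiv_cstD (c : R) (f : E -> R) j x : derivable f x (delta_mx ord0 j) ->
  derivable (fun y => c + f y) x (delta_mx ord0 j) /\ pderiv j (fun y => c + f y) x = pderiv j f x.
Proof.
move=> df; have dc : derivable (cst c : E -> R) x (delta_mx ord0 j) by exact: derivable_cst.
split; first exact: (derivableD dc df).
by have := deriveD dc df; rewrite derive_cst add0r.
Qed.

Lemma Ck0 (f : E -> R) : continuous f -> Ck 0 f.
Proof. by move=> cf; split=> l; [rewrite leqn0 size_eq0 => /eqP ->|]. Qed.

Lemma CkS k (f : E -> R) : continuous f -> (forall j x, derivable f x (delta_mx ord0 j)) ->
  (forall j, Ck k (pderiv j f)) -> Ck k.+1 f.
Proof.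
move=> cf df Cf; split=> l; elim/last_ind: l => [|l j _] //; rewrite size_rcons ltnS => lk.
  by rewrite /pderivs foldr_rcons; exact: (Cf j).1.
by move=> i x; rewrite /pderivs foldr_rcons; exact: (Cf j).2.
Qed.

Lemma Ck_sp k (w w' : weight R d) (u : sp w) : (forall j, symbol w w' (dmul j)) ->
  (forall v : sp w', Ck k v) -> Ck k.+1 u.
Proof.
move=> sw Hw; apply: CkS; first exact: sp_continuous.
  by move=> j x; exact: (dopE u (sw j)).2.
by move=> j; rewrite -(dopE u (sw j)).1.
Qed.

End classical.

(* [J] identifies the normed space [(X, n)] with [set a | N a < +oo]. *)
Record realizes (R : realType) (A X : lmodType R) (N : A -> \bar R) (n : X -> R)
    (J : X -> A) (K : A -> X) : Prop := Realizes {
  rz_lin : forall a u v, J (a *: u + v) = a *: J u + J v ;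
  rz_norm : forall u, N (J u) = (n u)%:E ;
  rz_K : forall u, K (J u) = u ;
  rz_J : forall f, (N f < +oo)%E -> J (K f) = f ;
  rz_ge0 : forall f, (0 <= N f)%E }.

(** * Transport between Banach spaces and spaces of functionals *)

Section realizes_theory.
Context {R : realType} {A X : lmodType R} {N : A -> \bar R} {n : X -> R} {J : X -> A} {K : A -> X}.
Hypotheses (H : realizes N n J K) (nP : is_norm n).

Lemma rz_D u v : J (u + v) = J u + J v.
Proof. by rewrite -[u]scale1r (rz_lin H) !scale1r. Qed.
Lemma rz_0 : J 0 = 0.
Proof. by have := rz_D 0 0; rewrite addr0 -{1}[J 0]addr0 => /addrI. Qed.
Lemma rz_Z a u : J (a *: u) = a *: J u.
Proof. by rewrite -[a *: u]addr0 (rz_lin H) rz_0 addr0. Qed.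
Lemma rz_N u : J (- u) = - J u.
Proof. by rewrite -scaleN1r rz_Z scaleN1r. Qed.
Lemma rz_B u v : J (u - v) = J u - J v.
Proof. by rewrite rz_D rz_N. Qed.
Lemma rz_nK f : (N f < +oo)%E -> N f = (n (K f))%:E.
Proof. by move=> /(rz_J H) {1}<-; rewrite (rz_norm H). Qed.
Lemma rz_fin u : (N (J u) < +oo)%E.
Proof. by rewrite (rz_norm H) ltry. Qed.
Lemma rz_Klin a f g : (N f < +oo)%E -> (N g < +oo)%E -> K (a *: f + g) = a *: K f + K g.
Proof. by move=> /(rz_J H) ef /(rz_J H) eg; rewrite -{1}ef -{1}eg -(rz_lin H) (rz_K H). Qed.
Lemma rz_finD f g : (N f < +oo)%E -> (N g < +oo)%E -> (N (f + g) < +oo)%E.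
Proof. by move=> /(rz_J H) <- /(rz_J H) <-; rewrite -rz_D rz_fin. Qed.
Lemma rz_KD f g : (N f < +oo)%E -> (N g < +oo)%E -> K (f + g) = K f + K g.
Proof. by move=> ff fg; rewrite -[f]scale1r rz_Klin// !scale1r. Qed.
Lemma rz_KB f g : (N f < +oo)%E -> (N g < +oo)%E -> K (f - g) = K f - K g.
Proof. by move=> /(rz_J H) ef /(rz_J H) eg; rewrite -{1}ef -{1}eg -rz_B (rz_K H). Qed.

Lemma rz_open (U : set X) :
  (forall x, U x -> exists2 e, 0 < e & forall y, n (y - x) < e -> U y) ->
  open_in N [set f | (N f < +oo)%E /\ U (K f)].
Proof.
move=> Uo f [ff Uf]; split=> //; have [e e0 He] := Uo _ Uf; exists e => // g gf.
have fgf : (N (g - f)%R < +oo)%E by exact: lt_trans gf (ltry _).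
have gE : g = (g - f) + f by rewrite subrK.
have fg : (N g < +oo)%E by rewrite gE; exact: rz_finD.
by split=> //; apply: He; rewrite -rz_KB// -lte_fin -rz_nK.
Qed.

Lemma rz_prod (us : seq A) : all (fun v => (N v < +oo)%E) us ->
  (\big[mule/1]_(v <- us) N v = (prodn n (map K us))%:E)%E.
Proof.
elim: us => [|u us IH] /=; first by rewrite big_nil /prodn big_nil.
by move=> /andP[fu /IH e]; rewrite big_cons e rz_nK// /prodn big_cons EFinM.
Qed.

End realizes_theory.

(** Linearity and equality of norms carry the derivatives over; [pr] is the projection that drops
    the auxiliary unknowns from the solution map. *)
Lemma realizes_smooth (R : realType) (A X B Y W : lmodType R) (N : A -> \bar R) (n : X -> R) J K
    (N' : B -> \bar R) (n' : Y -> R) J' K' (nW : W -> R) (pr : W -> Y) (U : set X) (Psi : X -> W)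
    (D : X -> seq X -> W) :
  realizes N n J K -> realizes N' n' J' K' ->
  (forall a u v, pr (a *: u + v) = a *: pr u + pr v) -> (forall w, n' (pr w) <= nW w) ->
  (forall x, U x -> [/\ D x [::] = Psi x,
    forall u u' b y y', D x (u ++ (b *: y + y') :: u') = b *: D x (u ++ y :: u') + D x (u ++ y' :: u'),
    forall k, exists C, forall u, size u = k -> nW (D x u) <= C * prodn n u &
    forall k e, 0 < e -> exists2 r, 0 < r & forall h, n h < r -> U (x + h) ->
      forall u, size u = k -> nW (D (x + h) u - D x u - D x (h :: u)) <= e * n h * prodn n u]) ->
  smooth_on N N' [set f | (N f < +oo)%E /\ U (K f)] (fun f => J' (pr (Psi (K f)))).
Proof.
move=> H H' prl prn DP; exists (fun f us => J' (pr (D (K f) (map K us)))) => f [ff Uf].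
have prB u v : pr (u - v) = pr u - pr v.
  by have := prl (-1) v u; rewrite !scaleN1r ![- _ + _]addrC.
have [D0 Dl Db Dd] := DP _ Uf; split=> /=.
- by rewrite D0.
- move=> u u' a y z; rewrite all_cat /= => /and4P[_ fy fz _].
  by rewrite !map_cat /= (rz_Klin H)// Dl prl (rz_lin H').
- move=> k; have [C HC] := Db k; exists C => u uk fu.
  rewrite (rz_norm H') (rz_prod H fu) -EFinM lee_fin; apply: (le_trans (prn _)).
  by apply: HC; rewrite size_map.
move=> k e e0; have [r r0 Hr] := Dd k e e0; exists r => // h hr [fh Uh] u uk fu.
have hf : (N h < +oo)%E by exact: lt_trans hr (ltry _).
rewrite (rz_KD H)// in Uh *.
rewrite -!(rz_B H') -!prB (rz_norm H') (rz_prod H fu) (rz_nK H hf) -!EFinM lee_fin.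
apply: (le_trans (prn _)); apply: Hr => //; last by rewrite size_map.
by rewrite -lte_fin -(rz_nK H hf).
Qed.

Section realizes_closure.
Context {R : realType}.

Lemma realizes_real : realizes (fun x : R => `|x|%:E) (fun x : R => `|x|) id id.
Proof. by split=> // f; rewrite lee_fin. Qed.

Lemma sum_fin k (F : 'I_k -> \bar R) i : (forall i, 0 <= F i)%E -> (\sum_i F i < +oo)%E -> (F i < +oo)%E.
Proof.
move=> F0; apply: le_lt_trans; rewrite (bigD1 i)//= leeDl//.
by apply: sume_ge0 => j _.
Qed.

Lemma realizes_fun k (A X : lmodType R) (N : A -> \bar R) (n : X -> R) J K : realizes N n J K ->
  realizes (fun f : 'I_k -> A => \sum_i N (f i))%E (norm_fun n) (fun u i => J (u i)) (fun f i => K (f i)).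
Proof.
move=> H; split.
- by move=> a u v; apply/funext => i; exact: rz_lin H _ _ _.
- by move=> u; rewrite /norm_fun -sumEFin; apply: eq_bigr => i _; exact: rz_norm H _.
- by move=> u; apply/funext => i; exact: rz_K H _.
- by move=> f ff; apply/funext => i; apply: (rz_J H); apply: sum_fin ff => j; exact: rz_ge0 H _.
by move=> f; apply: sume_ge0 => i _; exact: rz_ge0 H _.
Qed.

Lemma realizes_pair (A X B Y : lmodType R) (N : A -> \bar R) (n : X -> R) J K
    (N' : B -> \bar R) (n' : Y -> R) J' K' :
  realizes N n J K -> realizes N' n' J' K' ->
  realizes (fun f : (A * B)%type => N f.1 + N' f.2)%E (norm_pair n n')
    (fun u => (J u.1, J' u.2)) (fun f => (K f.1, K' f.2)).
Proof.
move=> H H'; split.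
- by move=> a u v; congr pair; [exact: rz_lin H _ _ _|exact: rz_lin H' _ _ _].
- by move=> u; rewrite (rz_norm H) (rz_norm H') -EFinD.
- by move=> [u v]; rewrite /= (rz_K H) (rz_K H').
- move=> [f g] /= fg; congr pair.
    apply: (rz_J H); apply: le_lt_trans fg; rewrite leeDl//; exact: rz_ge0 H' _.
  apply: (rz_J H'); apply: le_lt_trans fg; rewrite leeDr//; exact: rz_ge0 H _.
by move=> f; apply: adde_ge0; [exact: rz_ge0 H _|exact: rz_ge0 H' _].
Qed.

Lemma realizes_eq (A X : lmodType R) (N N' : A -> \bar R) (n : X -> R) J K :
  N = N' -> realizes N n J K -> realizes N' n J K.
Proof. by move=> ->. Qed.

End realizes_closure.

(** * Sobolev and anisotropic norms as weighted norms *)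

Section sobolev_spaces.
Context {R : realType} {d : nat}.
Local Notation E := 'rV[R]_d.
Local Notation mu := (@lebesgue_rV R d).

Lemma L1_sp_schwartz (w : weight R d) (u : sp w) (p : schwartz R d) : L1 (fun x => u x * p x).
Proof.
have [uL uE] := sp_coef u; have iu := L2_L1 uL.
have ip := rapid_L1 (schwartz_rapid p).
have -> : (fun x => u x * p x) = fun x => p x * u x by apply/funext => x; rewrite mulrC.
apply: (@L1_Mb _ _ (`|(@hcst R d)^-1| * (2 * \int[mu]_y `|coef u y|)) _ _ ip).
  by rewrite uE; apply: measurable_funM => //; exact: hart_measurable.
move=> x; have -> : u x = (@hcst R d)^-1 * hart (coef u) x by rewrite {1}uE.
by rewrite normrM ler_wpM2l//; exact: hart_bound.
Qed.

Lemma functional_lin (w : weight R d) (a : R) (u v : sp w) :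
  functional (a *: u + v : sp w) = a *: functional u + functional v.
Proof.
apply/funext => p; have iu := L1_sp_schwartz u p; have iv := L1_sp_schwartz v p.
have -> : (a *: functional u + functional v) p = a * (\int[mu]_x (u x * p x)) + \int[mu]_x (v x * p x) by [].
rewrite /functional -(RintZ _ iu) -RintD//; last exact: L1Z.
by congr Rintegral; apply/funext => x; rewrite spD spZ mulrDl mulrA.
Qed.

Lemma functional_sp_inj (w w' : weight R d) (u : sp w) (v : sp w') : functional u = functional v -> (u : E -> R) = v.
Proof.
move=> e; apply: functional_inj; [exact: sp_continuous|exact: sp_continuous|] => p _.
by rewrite -[LHS]/(functional u p) e.
Qed.

Lemma weighted_norm_ge0 (w : E -> R) f : (0 <= weighted_norm w f)%E.
Proof. by apply: le_ereal_inf_tmp => _ [g _ <-]; exact: poweR_ge0. Qed.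

Definition unfunctional (w : weight R d) (f : schwartz R d -> R) : sp w :=
  xget 0 [set u : sp w | functional u = f].

Lemma realizes_weighted (w : weight R d) :
  realizes (weighted_norm w) (@spn R d w) (fun u : sp w => functional u) (@unfunctional w).
Proof.
split.
- exact: functional_lin.
- by move=> u; have [uL uE] := sp_coef u; rewrite {1}uE weighted_norm_ihart.
- move=> u; rewrite /unfunctional; case: xgetP => [v _ e|/(_ u)]; last by case.
  exact/sp_inj/functional_sp_inj.
- move=> f /weighted_norm_lty[h hL ->]; rewrite /unfunctional.
  by case: xgetP => [v _ ->//|/(_ (Sp (in_spaceI hL)))]; case.
exact: weighted_norm_ge0.
Qed.

Lemma sobolev_normE r (dr : (d < r.*2)%N) : sobolev_norm r%:R = weighted_norm (jw R dr).
Proof.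
congr weighted_norm; apply/funext => x; rewrite -natrM mul2n powR_mulrn ?japaneseX//.
exact: sqrtr_ge0.
Qed.

Lemma aniso_normE r (d0 : (0 < d)%N) (dr : (d < r.*2)%N) : aniso_norm r%:R = weighted_norm (aw R d0 dr).
Proof.
apply/funext => f.
have -> : @aniso_norm R d r%:R = weighted_norm (fun x =>
    if eucl x < 1 then eucl x ^- 2 * (dotp x e1 ^+ 2 + eucl x ^+ 4) else jfun r x).
  congr weighted_norm; apply/funext => x; case: ifP => // _.
  rewrite -natrM mul2n powR_mulrn ?japaneseX//; exact: sqrtr_ge0.
apply: eq_weighted_norm.
- apply: measurable_fun_ifT; [exact: measurable_eucl_lt1|exact: measurable_aniso_low|exact: measurable_jfun].
- exact: measurable_afun.
by apply: ae_imp (@ae_neq0 R d d0) _ => x /negbTE x0 /=; rewrite /afun x0.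
Qed.

End sobolev_spaces.

(** * The wave system as a quadratic equation *)

Section wave_system.
Context {R : realType} {d s : nat} (l : nat) (d0 : (0 < d)%N) (ds : (d < s.*2)%N).
Local Notation E := 'rV[R]_d.
Local Notation j0 := (Ordinal d0).
Local Notation J0 := (Jw0 (R := R) ds).
Local Notation J1 := (Jw1 (R := R) ds).
Local Notation J2 := (Jw2 (R := R) ds).
Local Notation A3 := (Aw3 (R := R) d0 ds).
Local Notation G2 := (Gw2 (R := R) ds).
Local Notation N0 := (@spn R d J0).
Local Notation N1 := (@spn R d J1).
Local Notation N2 := (@spn R d J2).
Local Notation NA := (@spn R d A3).
Local Notation NG := (@spn R d G2).
Definition fieldT : lmodType R := 'I_d -> sp J0.
Definition forceT : lmodType R := 'I_l.+1 -> fieldT.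
Definition tensorT : lmodType R := 'I_l.+1 -> 'I_d -> fieldT.
Definition parT : lmodType R := (R * R * R)%type.
Definition dataT : lmodType R := (parT * tensorT * forceT)%type.
Definition velT : lmodType R := 'I_d -> sp J2.
Definition stateT : lmodType R := (velT * sp A3)%type.
(** In order: the squares of viscosity and surface tension parameters, the Horner sums, then the
    fields [fg] and [fc]. The residue repeats this block, with one equation for each auxiliary
    unknown. *)
Definition auxT : lmodType R := ((R * R) * forceT * (fieldT * fieldT))%type.
Definition unknownT : lmodType R := (stateT * auxT)%type.
Definition residueT : lmodType R := (sp G2 * fieldT * auxT)%type.
Definition fullT : lmodType R := (dataT * unknownT)%type.

Definition n_real : R -> R := fun x => `|x|.
Definition n_field : fieldT -> R := norm_fun N0.
Definition n_force : forceT -> R := norm_fun n_field.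
Definition n_tensor : tensorT -> R := norm_fun (norm_fun n_field).
Definition n_par : parT -> R := norm_pair (norm_pair n_real n_real) n_real.
Definition n_data : dataT -> R := norm_pair (norm_pair n_par n_tensor) n_force.
Definition n_vel : velT -> R := norm_fun N2.
Definition n_state : stateT -> R := norm_pair n_vel NA.
Definition n_aux : auxT -> R := norm_pair (norm_pair (norm_pair n_real n_real) n_force) (norm_pair n_field n_field).
Definition n_unknown : unknownT -> R := norm_pair n_state n_aux.
Definition n_residue : residueT -> R := norm_pair (norm_pair NG n_field) n_aux.
Definition n_full : fullT -> R := norm_pair n_data n_unknown.

Lemma n_fieldP : is_norm n_field. Proof. by is_norm_tac. Qed.
Lemma n_forceP : is_norm n_force. Proof. by is_norm_tac. Qed.
Lemma n_tensorP : is_norm n_tensor. Proof. by is_norm_tac. Qed.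
Lemma n_parP : is_norm n_par. Proof. by is_norm_tac. Qed.
Lemma n_dataP : is_norm n_data. Proof. by is_norm_tac. Qed.
Lemma n_velP : is_norm n_vel. Proof. by is_norm_tac. Qed.
Lemma n_stateP : is_norm n_state. Proof. by is_norm_tac. Qed.
Lemma n_auxP : is_norm n_aux. Proof. by is_norm_tac. Qed.
Lemma n_unknownP : is_norm n_unknown. Proof. by is_norm_tac. Qed.
Lemma n_residueP : is_norm n_residue. Proof. by is_norm_tac. Qed.
Lemma n_fullP : is_norm n_full. Proof. by is_norm_tac. Qed.
Lemma unknown_complete : fast_complete n_unknown. Proof. by complete_tac. Qed.

(** The Horner sum of index k+1, taken to be 0 beyond l; [inord] is reached only for k < l, where it
    is exact. *)
Definition b_next (b : forceT) (k : 'I_l.+1) : fieldT :=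
  if (k < l)%N then b (inord k.+1) else 0.

Definition mulJ0 := @spM R d J0 J0 J0.
Definition mulA0 := @spM R d A3 J0 J0.
Definition mulA2 := @spM R d A3 J2 J2.
Definition mulJ10 := @spM R d J1 J0 J0.
Definition mulJ20 := @spM R d J2 J0 J0.

Lemma mul_J0 : bbil N0 N0 N0 mulJ0.
Proof. by apply: spM_bbil; exact: mulable_jj. Qed.
Lemma mul_A0 : bbil NA N0 N0 mulA0.
Proof. by apply: spM_bbil; apply: mulable_aj; rewrite ltnW// ltnW. Qed.
Lemma mul_A2 : bbil NA N2 N2 mulA2.
Proof. by apply: spM_bbil; exact: mulable_aj. Qed.
Lemma mul_J10 : bbil N1 N0 N0 mulJ10.
Proof. by apply: spM_bbil; exact: mulable_jj. Qed.
Lemma mul_J20 : bbil N2 N0 N0 mulJ20.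
Proof. by apply: spM_bbil; apply: mulable_jj; rewrite ltnW. Qed.

Definition gam (z : fullT) : R := z.1.1.1.1.1.
Definition vis (z : fullT) : R := z.1.1.1.1.2.
Definition sur (z : fullT) : R := z.1.1.1.2.
Definition tau (z : fullT) : tensorT := z.1.1.2.
Definition phi (z : fullT) : forceT := z.1.2.
Definition vel (z : fullT) : velT := z.2.1.1.
Definition hgt (z : fullT) : sp A3 := z.2.1.2.
Definition vis2 (z : fullT) : R := z.2.2.1.1.1.
Definition sur2 (z : fullT) : R := z.2.2.1.1.2.
Definition fb (z : fullT) : forceT := z.2.2.1.2.
Definition fg (z : fullT) : fieldT := z.2.2.2.1.
Definition fc (z : fullT) : fieldT := z.2.2.2.2.

Definition lin_part (z : fullT) : residueT :=
  ((\sum_j dop G2 j (vel z j), fun i => fc z i + incl J0 (vel z i) + fb z ord0 i),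
   ((vis2 z, sur2 z, fb z - phi z), (fg z, fun i => fc z i - dop J0 i (hgt z)))).

(** The mass flux enters as the divergence of the product of height and velocity: only in this form
    is its vanishing at zero frequency visible, as the target [G2] demands. *)
Definition quad_part (z z' : fullT) : residueT :=
  ((\sum_j dop G2 j (mulA2 (hgt z) (vel z' j)) - gam z *: dop G2 j0 (hgt z'),
    fun i => mulA0 (hgt z) (fc z' i) - vis2 z *: fg z' i),
   ((- (vis z * vis z'), - (sur z * sur z'),
     fun k i => - \sum_j mulJ0 (tau z k i j) (dop J0 j (hgt z')) - mulA0 (hgt z) (b_next (fb z') k i)),
    (fun i => - \sum_j mulJ10 (strainop (vel z) i j) (dop J0 j (hgt z')),
     fun i => - \sum_j mulJ20 (vel z j) (dop J0 j (vel z' i)) + gam z *: dop J0 j0 (vel z' i)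
       + vis2 z *: divstress (vel z') i + sur2 z *: lapgrad (hgt z') i))).

Section derived_fields.
Context {Z : lmodType R} {nZ : Z -> R} (zP : is_norm nZ).

Lemma blin_strain (v : Z -> velT) : (forall i, blin nZ N2 (v^~ i)) ->
  forall i j, blin nZ N1 (fun z => strainop (v z) i j).
Proof.
move=> bv i j; have nP := spn_is_norm J1.
have b_dv k i' : blin nZ N1 (fun z => dop J1 k (v z i')).
  by apply: (blin_comp (bv i')); apply: fop_blin; exact: sym_J2J1.
apply: (blinD nP); first exact: (blinD nP).
by apply/(blinZ nP)/(blin_sum zP nP) => k.
Qed.

Lemma blin_divs (v : Z -> velT) : (forall i, blin nZ N2 (v^~ i)) ->
  forall i, blin nZ N0 (fun z => divstress (v z) i).
Proof.
move=> bv i; apply: (blin_sum zP (spn_is_norm _)) => j; apply: (blin_comp (blin_strain bv i j)).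
by apply: fop_blin; exact: sym_J1J0.
Qed.

Lemma blin_lapg (h : Z -> sp A3) : blin nZ NA h ->
  forall i, blin nZ N0 (fun z => lapgrad (h z) i).
Proof.
move=> bh i; apply: (blin_sum zP (spn_is_norm _)) => j.
apply: (@blin_comp _ _ (sp J1)); last by apply: fop_blin; exact: sym_J1J0.
apply: (@blin_comp _ _ (sp J2)); last by apply: fop_blin; exact: sym_J2J1.
by apply: (blin_comp bh); apply: fop_blin; exact: sym_A3J2.
Qed.

End derived_fields.

Section boundedness.
Local Notation blinz := (blin n_full).
Let b_id : blinz n_full id. Proof. exact: blin_id. Qed.
Let b_1 : blinz n_data (fun z => z.1). Proof. exact: blin_fst n_unknownP b_id. Qed.
Let b_2 : blinz n_unknown (fun z => z.2). Proof. exact: blin_snd n_dataP b_id. Qed.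
Let b_pt : blinz (norm_pair n_par n_tensor) (fun z => z.1.1). Proof. exact: blin_fst n_forceP b_1. Qed.
Let b_par : blinz n_par (fun z => z.1.1.1). Proof. exact: blin_fst n_tensorP b_pt. Qed.
Let b_tau : blinz n_tensor tau. Proof. exact: blin_snd n_parP b_pt. Qed.
Let b_phi : blinz n_force phi. Proof. by apply: blin_snd b_1; is_norm_tac. Qed.
Let b_gv : blinz (norm_pair n_real n_real) (fun z => z.1.1.1.1). Proof. exact: blin_fst norm_realP b_par. Qed.
Let b_gam : blinz n_real gam. Proof. exact: blin_fst norm_realP b_gv. Qed.
Let b_vis : blinz n_real vis. Proof. exact: blin_snd norm_realP b_gv. Qed.
Let b_sur : blinz n_real sur. Proof. by apply: blin_snd b_par; is_norm_tac. Qed.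
Let b_state : blinz n_state (fun z => z.2.1). Proof. exact: blin_fst n_auxP b_2. Qed.
Let b_aux : blinz n_aux (fun z => z.2.2). Proof. exact: blin_snd n_stateP b_2. Qed.
Let b_vel : blinz n_vel vel. Proof. exact: blin_fst (spn_is_norm _) b_state. Qed.
Let b_hgt : blinz NA hgt. Proof. exact: blin_snd n_velP b_state. Qed.
Let b_a1 : blinz (norm_pair (norm_pair n_real n_real) n_force) (fun z => z.2.2.1).
Proof. by apply: blin_fst b_aux; is_norm_tac. Qed.
Let b_a2 : blinz (norm_pair n_field n_field) (fun z => z.2.2.2).
Proof. by apply: blin_snd b_aux; is_norm_tac. Qed.
Let b_mt : blinz (norm_pair n_real n_real) (fun z => z.2.2.1.1). Proof. exact: blin_fst n_forceP b_a1. Qed.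
Let b_vis2 : blinz n_real vis2. Proof. exact: blin_fst norm_realP b_mt. Qed.
Let b_sur2 : blinz n_real sur2. Proof. exact: blin_snd norm_realP b_mt. Qed.
Let b_fb : blinz n_force fb. Proof. by apply: blin_snd b_a1; is_norm_tac. Qed.
Let b_fg : blinz n_field fg. Proof. exact: blin_fst n_fieldP b_a2. Qed.
Let b_fc : blinz n_field fc. Proof. exact: blin_snd n_fieldP b_a2. Qed.
Let b_veli i : blinz N2 (fun z => vel z i). Proof. exact: blin_nth (spn_is_norm _) b_vel. Qed.
Let b_fci i : blinz N0 (fun z => fc z i). Proof. exact: blin_nth (spn_is_norm _) b_fc. Qed.
Let b_fgi i : blinz N0 (fun z => fg z i). Proof. exact: blin_nth (spn_is_norm _) b_fg. Qed.
Let b_fbi k i : blinz N0 (fun z => fb z k i).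
Proof. exact: (blin_nth i (spn_is_norm _) (blin_nth k n_fieldP b_fb)). Qed.
Let b_taui k i j : blinz N0 (fun z => tau z k i j).
Proof.
have h := blin_nth k (norm_funP _ n_fieldP) b_tau.
exact: (blin_nth j (spn_is_norm _) (blin_nth i n_fieldP h)).
Qed.
Let b_dhgt j : blinz N0 (fun z => dop J0 j (hgt z)).
Proof. by apply: (blin_comp b_hgt); apply: fop_blin; exact: sym_A3J0. Qed.
Let b_dvel j i : blinz N0 (fun z => dop J0 j (vel z i)).
Proof. by apply: (blin_comp (b_veli i)); apply: fop_blin; exact: sym_J2J0. Qed.
Let b_dvel1 j i : blinz N1 (fun z => dop J1 j (vel z i)).
Proof. by apply: (blin_comp (b_veli i)); apply: fop_blin; exact: sym_J2J1. Qed.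
Let b_divs := blin_divs n_fullP b_veli.
Let b_lapg := blin_lapg n_fullP b_hgt.
Let b_bnext k i : blinz N0 (fun z => b_next (fb z) k i).
Proof.
rewrite /b_next; case: (k < l)%N; first exact: b_fbi.
have := blin0 n_fullP (spn_is_norm J0); exact.
Qed.

Lemma lin_part_blin : blinz n_residue lin_part.
Proof.
have nP := spn_is_norm J0.
apply: blin_pair; first apply: blin_pair.
- apply: (blin_sum n_fullP (spn_is_norm _)) => j; apply: (blin_comp (b_veli j)).
  by apply: fop_blin; exact: sym_J2G2.
- apply: (blin_fun n_fullP) => i; apply: (blinD nP) => //; apply: (blinD nP) => //.
  by apply: (blin_comp (b_veli i)); apply: fop_blin; exact: sym_incl.
- apply: blin_pair; first apply: blin_pair.
  + exact: blin_pair.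
  + by apply: (blinD n_forceP) => //; exact: (blinN n_forceP).
  apply: blin_pair => //; apply: (blin_fun n_fullP) => i.
  by apply: (blinD nP) => //; exact: (blinN nP).
Qed.

Lemma quad_part_bbil : bbil n_full n_full n_residue quad_part.
Proof.
have nP := spn_is_norm J0; have nG := spn_is_norm G2; have zP := n_fullP.
have rP : is_norm n_real := norm_realP.
have n2 := spn_is_norm J2; have nA := spn_is_norm A3; have n1 := spn_is_norm J1.
have sc f h : blinz n_real f -> blinz N0 h -> bbil n_full n_full N0 (fun z z' => f z *: h z').
  by move=> bf bh; exact: (bbil_comp rP nP (bbil_scale nP) bf bh).
apply: bbil_pair; first apply: bbil_pair.
- apply: (bbilD nG).
    apply: (bbil_sum zP nG) => j; apply: (bbil_post (nV := @spn R d J2)).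
      by apply: fop_blin; exact: sym_J2G2.
    exact: (bbil_comp nA n2 mul_A2 b_hgt (b_veli j)).
  apply: (bbilN nG); apply: (bbil_comp rP nG (bbil_scale nG) b_gam).
  by apply: (blin_comp b_hgt); apply: fop_blin; exact: sym_A3G2.
- apply: (bbil_fun zP) => i; apply: (bbilD nP).
    exact: (bbil_comp nA nP mul_A0 b_hgt (b_fci i)).
  by apply: (bbilN nP); apply: sc.
apply: bbil_pair; first apply: bbil_pair.
- apply: bbil_pair; apply: (bbilN rP).
    exact: (bbil_comp rP rP (bbil_scale rP) b_vis b_vis).
  exact: (bbil_comp rP rP (bbil_scale rP) b_sur b_sur).
- apply: (bbil_fun zP) => k; apply: (bbil_fun zP) => i; apply: (bbilD nP).
    apply: (bbilN nP); apply: (bbil_sum zP nP) => j.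
    exact: (bbil_comp nP nP mul_J0 (b_taui k i j) (b_dhgt j)).
  by apply: (bbilN nP); exact: (bbil_comp nA nP mul_A0 b_hgt (b_bnext k i)).
apply: bbil_pair; apply: (bbil_fun zP) => i.
  apply: (bbilN nP); apply: (bbil_sum zP nP) => j.
  exact: (bbil_comp n1 nP mul_J10 (blin_strain n_fullP b_veli i j) (b_dhgt j)).
apply: (bbilD nP); last exact: sc.
apply: (bbilD nP); last exact: sc.
apply: (bbilD nP); last exact: sc.
apply: (bbilN nP); apply: (bbil_sum zP nP) => j.
exact: (bbil_comp n2 nP mul_J20 (b_veli j) (b_dvel j i)).
Qed.

Lemma wave_quadratic : exists C, bounded_quadratic n_data n_unknown n_residue lin_part quad_part C.
Proof. exact: bounded_quadraticI n_dataP n_unknownP lin_part_blin quad_part_bbil. Qed.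

End boundedness.

Record wave_eqs (z : fullT) : Prop := WaveEqs {
  eq_mass : \sum_j dop G2 j (vel z j) - gam z *: dop G2 j0 (hgt z)
    + \sum_j dop G2 j (mulA2 (hgt z) (vel z j)) = 0 ;
  eq_mom : forall i, fc z i + incl J0 (vel z i) + fb z ord0 i + mulA0 (hgt z) (fc z i) - vis2 z *: fg z i = 0 ;
  eq_vis : vis2 z = vis z * vis z ;
  eq_sur : sur2 z = sur z * sur z ;
  eq_b : forall k i, fb z k i = phi z k i + \sum_j mulJ0 (tau z k i j) (dop J0 j (hgt z))
    + mulA0 (hgt z) (b_next (fb z) k i) ;
  eq_g : forall i, fg z i = \sum_j mulJ10 (strainop (vel z) i j) (dop J0 j (hgt z)) ;
  eq_c : forall i, fc z i = dop J0 i (hgt z) + \sum_j mulJ20 (vel z j) (dop J0 j (vel z i))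
    - gam z *: dop J0 j0 (vel z i) - vis2 z *: divstress (vel z) i - sur2 z *: lapgrad (hgt z) i }.

Lemma wave_eqsP z : quad 0 lin_part quad_part z = 0 <-> wave_eqs z.
Proof.
have E1 : (quad 0 lin_part quad_part z).1.1 = \sum_j dop G2 j (vel z j) - gam z *: dop G2 j0 (hgt z)
    + \sum_j dop G2 j (mulA2 (hgt z) (vel z j)).
  by rewrite /quad /lin_part /quad_part /=; abel.
have E2 i : (quad 0 lin_part quad_part z).1.2 i =
    fc z i + incl J0 (vel z i) + fb z ord0 i + mulA0 (hgt z) (fc z i) - vis2 z *: fg z i.
  have -> : (quad 0 lin_part quad_part z).1.2 i =
    0 + (fc z i + incl J0 (vel z i) + fb z ord0 i) + (mulA0 (hgt z) (fc z i) - vis2 z *: fg z i) by [].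
  abel.
have E3 : (quad 0 lin_part quad_part z).2.1.1.1 = vis2 z - vis z * vis z.
  by rewrite /quad /lin_part /quad_part /= add0r.
have E4 : (quad 0 lin_part quad_part z).2.1.1.2 = sur2 z - sur z * sur z.
  by rewrite /quad /lin_part /quad_part /= add0r.
have E5 k i : (quad 0 lin_part quad_part z).2.1.2 k i = fb z k i -
    (phi z k i + \sum_j mulJ0 (tau z k i j) (dop J0 j (hgt z)) + mulA0 (hgt z) (b_next (fb z) k i)).
  have -> : (quad 0 lin_part quad_part z).2.1.2 k i = 0 + (fb z k i - phi z k i) +
    (- \sum_j mulJ0 (tau z k i j) (dop J0 j (hgt z)) - mulA0 (hgt z) (b_next (fb z) k i)) by [].
  abel.
have E6 i : (quad 0 lin_part quad_part z).2.2.1 i = fg z i -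
    \sum_j mulJ10 (strainop (vel z) i j) (dop J0 j (hgt z)).
  have -> : (quad 0 lin_part quad_part z).2.2.1 i = 0 + fg z i +
    (- \sum_j mulJ10 (strainop (vel z) i j) (dop J0 j (hgt z))) by [].
  abel.
have E7 i : (quad 0 lin_part quad_part z).2.2.2 i = fc z i - (dop J0 i (hgt z) + \sum_j mulJ20 (vel z j) (dop J0 j (vel z i))
    - gam z *: dop J0 j0 (vel z i) - vis2 z *: divstress (vel z) i - sur2 z *: lapgrad (hgt z) i).
  have -> : (quad 0 lin_part quad_part z).2.2.2 i = 0 + (fc z i - dop J0 i (hgt z)) +
    (- \sum_j mulJ20 (vel z j) (dop J0 j (vel z i)) + gam z *: dop J0 j0 (vel z i)
       + vis2 z *: divstress (vel z) i + sur2 z *: lapgrad (hgt z) i) by [].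
  abel.
split=> [q0|[h1 h2 h3 h4 h5 h6 h7]].
  rewrite q0 in E1 E3 E4; split=> //.
  - by move=> i; rewrite -E2 q0.
  - by apply/eqP; rewrite -subr_eq0 -E3.
  - by apply/eqP; rewrite -subr_eq0 -E4.
  - by move=> k i; apply/eqP; rewrite -subr_eq0 -E5 q0.
  - by move=> i; apply/eqP; rewrite -subr_eq0 -E6 q0.
  - by move=> i; apply/eqP; rewrite -subr_eq0 -E7 q0.
have e1 : (quad 0 lin_part quad_part z).1.1 = 0 by rewrite E1.
have e2 : (quad 0 lin_part quad_part z).1.2 = 0 by apply/funext => i; rewrite E2 h2.
have e3 : (quad 0 lin_part quad_part z).2.1.1.1 = 0 by rewrite E3 h3 subrr.
have e4 : (quad 0 lin_part quad_part z).2.1.1.2 = 0 by rewrite E4 h4 subrr.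
have e5 : (quad 0 lin_part quad_part z).2.1.2 = 0.
  by apply/funext => k; apply/funext => i; rewrite E5 {1}h5 subrr.
have e6 : (quad 0 lin_part quad_part z).2.2.1 = 0 by apply/funext => i; rewrite E6 {1}h6 subrr.
have e7 : (quad 0 lin_part quad_part z).2.2.2 = 0 by apply/funext => i; rewrite E7 {1}h7 subrr.
case: (quad _ _ _ _) e1 e2 e3 e4 e5 e6 e7 => [[? ?] [[[? ?] ?] [? ?]]] /=.
by do 7!move=> ->.
Qed.

(** * Linearisation at a trivial solution *)

Section base_point.
Variables (p : R * R * R).

Definition base_data : dataT := (p, 0, 0).
Definition base_unknown : unknownT := (0, ((p.1.2 * p.1.2, p.2 * p.2), 0, (0, 0))).

Let g := p.1.1.
Let m := p.1.2 * p.1.2.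
Let t := p.2 * p.2.
Local Notation z0 := (base_data, base_unknown).

Section linearisation.

Let dop0 w w' j : symbol w w' (dmul j) -> dop (R := R) (d := d) (w := w) w' j 0 = 0.
Proof. by move=> /fop_blin/blinP[]. Qed.

Let strain0 i j : strainop (ds := ds) (0 : 'I_d -> sp J2) i j = 0.
Proof.
rewrite /strainop big1 => [|k _]; last exact: dop0 (sym_J2J1 _ _).
by rewrite scaler0 addr0 !(dop0 (sym_J2J1 _ _)) addr0.
Qed.
Let divs0 i : divstress (ds := ds) (0 : 'I_d -> sp J2) i = 0.
Proof. by rewrite /divstress big1// => j _; rewrite strain0; exact: dop0 (sym_J1J0 _ _). Qed.
Let lapg0 i : lapgrad (0 : sp A3) i = 0.
Proof.
rewrite /lapgrad big1// => j _.
by rewrite (dop0 (sym_A3J2 _ _ _)) (dop0 (sym_J2J1 _ _)) (dop0 (sym_J1J0 _ _)).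
Qed.
Let bnext0 k i : b_next (0 : forceT) k i = 0.
Proof. by rewrite /b_next; case: (k < l)%N. Qed.
Let A0l (u : sp J0) : mulA0 0 u = 0. Proof. exact: (bbilP (mul_A0)).1. Qed.
Let A2l (u : sp J2) : mulA2 0 u = 0. Proof. exact: (bbilP (mul_A2)).1. Qed.
Let A0r (u : sp A3) : mulA0 u 0 = 0. Proof. exact: (bbilP (mul_A0)).2. Qed.
Let A2r (u : sp A3) : mulA2 u 0 = 0. Proof. exact: (bbilP (mul_A2)).2. Qed.
Let J0l (u : sp J0) : mulJ0 0 u = 0. Proof. exact: (bbilP (mul_J0)).1. Qed.
Let J1l (u : sp J0) : mulJ10 0 u = 0. Proof. exact: (bbilP (mul_J10)).1. Qed.
Let J1r (u : sp J1) : mulJ10 u 0 = 0. Proof. exact: (bbilP (mul_J10)).2. Qed.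
Let J2l (u : sp J0) : mulJ20 0 u = 0. Proof. exact: (bbilP (mul_J20)).1. Qed.
Let J2r (u : sp J2) : mulJ20 u 0 = 0. Proof. exact: (bbilP (mul_J20)).2. Qed.
Let dG0 j : dop G2 j (0 : sp J2) = 0. Proof. exact: dop0 (sym_J2G2 _ _). Qed.
Let dA0 : dop G2 j0 (0 : sp A3) = 0. Proof. exact: dop0 (sym_A3G2 _ _). Qed.
Let dJ0 j : dop J0 j (0 : sp J2) = 0. Proof. exact: dop0 (sym_J2J0 _ _). Qed.
Let dAJ j : dop J0 j (0 : sp A3) = 0. Proof. exact: dop0 (sym_A3J0 _ _ _). Qed.
Let inc0 : incl J0 (0 : sp J2) = 0.
Proof. by have [] := blinP (fop_blin (sym_incl (R := R) ds)). Qed.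
Let S0 : \sum_j dop G2 j (0 : sp J2) = 0. Proof. by apply: big1 => j _. Qed.
Let S1 (v : velT) : \sum_j dop G2 j (mulA2 0 (v j)) = 0.
Proof. by apply: big1 => j _; rewrite A2l. Qed.
Let S2 (h : sp A3) : \sum_j dop G2 j (mulA2 h 0) = 0.
Proof. by apply: big1 => j _; rewrite A2r. Qed.
Let S3 (h : sp A3) : \sum_j mulJ0 0 (dop J0 j h) = 0.
Proof. by apply: big1 => j _; exact: J0l. Qed.
Let S4 (h : sp A3) i : \sum_j mulJ10 (strainop (0 : velT) i j) (dop J0 j h) = 0.
Proof. by apply: big1 => j _; rewrite strain0; exact: J1l. Qed.
Let S5 (v : velT) i : \sum_j mulJ10 (strainop v i j) (dop J0 j (0 : sp A3)) = 0.
Proof. by apply: big1 => j _; rewrite dAJ; exact: J1r. Qed.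
Let S6 (v : velT) i : \sum_j mulJ20 0 (dop J0 j (v i)) = 0.
Proof. by apply: big1 => j _; exact: J2l. Qed.
Let S7 (v : velT) : \sum_j mulJ20 (v j) (dop J0 j (0 : sp J2)) = 0.
Proof. by apply: big1 => j _; rewrite dJ0; exact: J2r. Qed.

Let V0 : velT := 0.

Lemma base_solution : quad 0 lin_part quad_part z0 = 0.
Proof.
apply/wave_eqsP; split.
- have : \sum_j dop G2 j (0 : sp J2) - g *: dop G2 j0 (0 : sp A3) + \sum_j dop G2 j (mulA2 0 (V0 j)) = 0.
    by rewrite S0 (S1 V0) dA0 scaler0 subr0 addr0.
  by [].
- move=> i; have : (0 : sp J0) + incl J0 (0 : sp J2) + 0 + mulA0 0 0 - m *: 0 = 0.
    by rewrite inc0 A0l scaler0 !addr0 subr0.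
  by [].
- by [].
- by [].
- move=> k i; have : (0 : sp J0) = 0 + \sum_j mulJ0 0 (dop J0 j (0 : sp A3)) + mulA0 0 (b_next (0 : forceT) k i).
    by rewrite S3 A0l !addr0.
  by [].
- by move=> i; exact: esym (S4 0 i).
- move=> i; have : (0 : sp J0) = dop J0 i (0 : sp A3) + \sum_j mulJ20 0 (dop J0 j (V0 i))
    - g *: dop J0 j0 (0 : sp J2) - m *: divstress V0 i - t *: lapgrad (0 : sp A3) i.
    by rewrite S6 dAJ dJ0 divs0 lapg0 !scaler0 !subr0 addr0.
  by [].
Qed.

Definition base_lin (w : unknownT) : residueT :=
  ((massop g w.1.1 w.1.2, fun i => w.2.2.2 i + incl J0 (w.1.1 i) + w.2.1.2 ord0 i - m *: w.2.2.1 i),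
   (w.2.1, (w.2.2.1, fun i => w.2.2.2 i - dop J0 i w.1.2 + g *: dop J0 j0 (w.1.1 i)
      + m *: divstress w.1.1 i + t *: lapgrad w.1.2 i))).

Lemma dquad_base w : dquad lin_part quad_part z0 w = base_lin w.
Proof.
case: w => [[v h] [[[m2 t2] b] [gg cc]]]; set w := (_, _); set r := dquad _ _ _ _.
have e1 : r.1.1 = massop g v h.
  have -> : r.1.1 = \sum_j dop G2 j (v j) + ((\sum_j dop G2 j (mulA2 0 (v j)) - g *: dop G2 j0 h) +
    (\sum_j dop G2 j (mulA2 h 0) - 0 *: dop G2 j0 (0 : sp A3))) by [].
  (* Stated over an abstract group, so that the cancellation is independent of the concrete spaces;
     the same device recurs below. *)
  have alg (V : zmodType) (a b1 c1 x y : V) : b1 = 0 -> c1 = 0 -> x = 0 ->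
      a + ((b1 - y) + (c1 - x)) = a - y by move=> -> -> ->; abel.
  exact: alg (S1 v) (S2 h) (scale0r _).
have e2 : r.1.2 = fun i => cc i + incl J0 (v i) + b ord0 i - m *: gg i.
  apply/funext => i; have -> : r.1.2 i = cc i + incl J0 (v i) + b ord0 i +
    ((mulA0 0 (cc i) - m *: gg i) + (mulA0 h 0 - m2 *: (0 : sp J0))) by [].
  by rewrite A0l A0r scaler0 subr0 addr0 add0r.
have e3 : r.2.1.1 = (m2, t2).
  have -> : r.2.1.1 = (m2 + (- (p.1.2 * 0) + - (0 * p.1.2)), t2 + (- (p.2 * 0) + - (0 * p.2))) by [].
  by rewrite !mulr0 !mul0r !oppr0 !addr0.
have e4 : r.2.1.2 = b.
  apply/funext => k; apply/funext => i; have -> : r.2.1.2 k i = (b k i - 0) +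
    ((- (\sum_j mulJ0 0 (dop J0 j h)) - mulA0 0 (b_next b k i)) +
     (- (\sum_j mulJ0 0 (dop J0 j (0 : sp A3))) - mulA0 h (b_next (0 : forceT) k i))) by [].
  have alg (V : zmodType) (a b1 c1 x y : V) : b1 = 0 -> c1 = 0 -> x = 0 -> y = 0 ->
      (a - 0) + ((- b1 - c1) + (- x - y)) = a by move=> -> -> -> ->; abel.
  apply: alg (S3 h) (A0l (b_next b k i)) (S3 0) _.
  by apply: etrans (A0r h); congr (mulA0 h _); exact: bnext0.
have e5 : r.2.2.1 = gg.
  apply/funext => i; have -> : r.2.2.1 i = gg i + (- (\sum_j mulJ10 (strainop V0 i j) (dop J0 j h)) +
    - (\sum_j mulJ10 (strainop v i j) (dop J0 j (0 : sp A3)))) by [].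
  have alg (V : zmodType) (a b1 c1 : V) : b1 = 0 -> c1 = 0 -> a + (- b1 + - c1) = a.
    by move=> -> ->; abel.
  exact: alg (S4 h i) (S5 v i).
have e6 : r.2.2.2 = fun i => cc i - dop J0 i h + g *: dop J0 j0 (v i) + m *: divstress v i + t *: lapgrad h i.
  apply/funext => i; have -> : r.2.2.2 i = (cc i - dop J0 i h) +
    ((- (\sum_j mulJ20 0 (dop J0 j (v i))) + g *: dop J0 j0 (v i) + m *: divstress v i + t *: lapgrad h i) +
     (- (\sum_j mulJ20 (v j) (dop J0 j (0 : sp J2))) + 0 *: dop J0 j0 (0 : sp J2) + m2 *: divstress V0 i + t2 *: lapgrad (0 : sp A3) i)) by [].
  have alg (V : lmodType R) (c x y z x' y' z' u u' : V) (a1 a2 : R) : u = 0 -> u' = 0 -> y' = 0 -> z' = 0 ->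
      c + ((- u + x + y + z) + (- u' + 0 *: x' + a1 *: y' + a2 *: z')) = c + x + y + z.
    by move=> -> -> -> ->; rewrite scale0r !scaler0; abel.
  exact: alg (S6 v i) (S7 v) (divs0 i) (lapg0 i).
rewrite /base_lin /= -e1 -e2 -e3 -e4 -e5 -e6.
by case: (r) => [[? ?] [[? ?] [? ?]]].
Qed.

End linearisation.

Section base_inverse.

(** What is left of the momentum source once c, g and the first Horner sum have been eliminated by
    their own linearised equations. *)
Definition reduced_force (y : residueT) i : sp J0 :=
  y.1.2 i - y.2.2.2 i + m *: y.2.2.1 i - y.2.1.2 ord0 i.

Definition base_height (y : residueT) : sp A3 := height_sol d0 g m t y.1.1 (reduced_force y).
Definition base_velocity (y : residueT) i : sp J2 := velocity_sol d0 g m t y.1.1 (reduced_force y) i.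

Definition base_inv (y : residueT) : unknownT :=
  ((base_velocity y, base_height y), (y.2.1, (y.2.2.1, fun i => y.2.2.2 i + dop J0 i (base_height y)
     - g *: dop J0 j0 (base_velocity y i) - m *: divstress (base_velocity y) i - t *: lapgrad (base_height y) i))).

Hypothesis p_gt0 : positive_triple p.
Let g0 : 0 < g. Proof. by case: p_gt0. Qed.
Let m0 : 0 < m. Proof. by case: p_gt0 => _ h _; exact: mulr_gt0. Qed.
Let t0 : 0 < t. Proof. by case: p_gt0 => _ _ h; exact: mulr_gt0. Qed.

Lemma base_invK y : base_lin (base_inv y) = y.
Proof.
have hm : massop g (base_velocity y) (base_height y) = y.1.1 by exact: massop_sol.
have hM i : momop g m t (base_velocity y) (base_height y) i = reduced_force y i by exact: momop_sol.
have e1 : (base_lin (base_inv y)).1.2 = y.1.2.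
  apply/funext => i; have := hM i; rewrite /momop /reduced_force => h.
  have alg (V : zmodType) (c iv a1 a2 a3 a4 b1 mg f : V) :
      iv - a1 - a2 + a3 - a4 = f - c + mg - b1 -> c + a3 - a1 - a2 - a4 + iv + b1 - mg = f.
    move=> e; have -> : c + a3 - a1 - a2 - a4 + iv + b1 - mg =
      c + (iv - a1 - a2 + a3 - a4) + b1 - mg by abel.
    by rewrite e; abel.
  exact: alg h.
have e2 : (base_lin (base_inv y)).2.2.2 = y.2.2.2.
  apply/funext => i; have alg (V : zmodType) (c a1 a2 a3 a4 : V) : c + a3 - a1 - a2 - a4 - a3 + a1 + a2 + a4 = c by abel.
  exact: alg.
have eqr (r r' : residueT) : r.1.1 = r'.1.1 -> r.1.2 = r'.1.2 -> r.2.1 = r'.2.1 ->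
    r.2.2.1 = r'.2.2.1 -> r.2.2.2 = r'.2.2.2 -> r = r'.
  by case: r r' => [[? ?] [? [? ?]]] [[? ?] [? [? ?]]] /= -> -> -> -> ->.
exact (eqr (base_lin (base_inv y)) y hm e1 erefl erefl e2).
Qed.

Lemma base_linK w : base_inv (base_lin w) = w.
Proof.
have hF : reduced_force (base_lin w) = momop g m t w.1.1 w.1.2.
  apply/funext => i; rewrite /momop.
  have alg (V : zmodType) (c iv a1 a2 a3 a4 b1 mg : V) :
    (c + iv + b1 - mg) - (c - a3 + a1 + a2 + a4) + mg - b1 = iv - a1 - a2 + a3 - a4 by abel.
  exact: alg.
have hh : base_height (base_lin w) = w.1.2 by rewrite /base_height hF; exact: height_solK.
have hv : base_velocity (base_lin w) = w.1.1.
  by apply/funext => i; rewrite /base_velocity hF; exact: velocity_solK.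
rewrite /base_inv hh hv; case: w hF hh hv => [[v h] [mb [gg cc]]] _ _ _.
congr (_, (_, (_, _))); apply/funext => i.
have alg (V : zmodType) (c a1 a2 a3 a4 : V) : c - a3 + a1 + a2 + a4 + a3 - a1 - a2 - a4 = c by abel.
exact: alg.
Qed.

Local Notation blin_r := (blin n_residue).
Let nR := n_residueP.
Let n0P := spn_is_norm J0.

Lemma base_inv_blin : blin n_residue n_unknown base_inv.
Proof.
have b_id : blin_r n_residue id by exact: blin_id.
have b_1 : blin_r (norm_pair NG n_field) (fun y => y.1) := blin_fst n_auxP b_id.
have b_2 : blin_r n_aux (fun y => y.2).
  by apply: blin_snd b_id; is_norm_tac.
have b_y : blin_r NG (fun y => y.1.1) := blin_fst n_fieldP b_1.
have b_f i : blin_r N0 (fun y => y.1.2 i).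
  by apply: blin_nth (blin_snd _ b_1) => //; exact: spn_is_norm.
have b_21 : blin_r (norm_pair (norm_pair n_real n_real) n_force) (fun y => y.2.1).
  by apply: blin_fst b_2; is_norm_tac.
have b_22 : blin_r (norm_pair n_field n_field) (fun y => y.2.2).
  by apply: blin_snd b_2; is_norm_tac.
have b_b k i : blin_r N0 (fun y => y.2.1.2 k i).
  have b_bf : blin_r n_force (fun y => y.2.1.2) by apply: blin_snd b_21; is_norm_tac.
  exact: blin_nth i n0P (blin_nth k n_fieldP b_bf).
have b_g : blin_r n_field (fun y => y.2.2.1) := blin_fst n_fieldP b_22.
have b_c : blin_r n_field (fun y => y.2.2.2) := blin_snd n_fieldP b_22.
have b_gi i : blin_r N0 (fun y => y.2.2.1 i) := blin_nth i n0P b_g.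
have b_ci i : blin_r N0 (fun y => y.2.2.2 i) := blin_nth i n0P b_c.
have b_F i : blin_r N0 (fun y => reduced_force y i).
  apply: (blinD n0P); last exact: (blinN n0P).
  apply: (blinD n0P); last exact: (blinZ n0P).
  by apply: (blinD n0P) => //; exact: (blinN n0P).
have nA := spn_is_norm A3; have n2 := spn_is_norm J2; have n1 := spn_is_norm J1.
have b_h : blin_r NA base_height.
  apply: (blinD nA); first by apply: (blin_comp b_y); apply: fop_blin; exact: symbol_eta_y.
  apply: (blin_sum nR nA) => j; apply: (blin_comp (b_F j)).
  by apply: fop_blin; exact: symbol_eta_F.
have b_v i : blin_r N2 (fun y => base_velocity y i).
  apply: (blinD n2); last by apply: (blin_comp b_y); apply: fop_blin; exact: symbol_vel_y.
  apply: (blinD n2); first by apply: (blin_comp (b_F i)); apply: fop_blin; exact: symbol_vel_F.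
  by apply: (blin_comp b_h); apply: fop_blin; exact: symbol_vel_eta.
apply: blin_pair; first apply: blin_pair => //; first exact: (blin_fun nR).
apply: blin_pair => //; apply: blin_pair => //; apply: (blin_fun nR) => i.
apply: (blinD n0P); last by apply/(blinN n0P)/(blinZ n0P)/blin_lapg.
apply: (blinD n0P); last by apply/(blinN n0P)/(blinZ n0P)/blin_divs.
apply: (blinD n0P); last apply/(blinN n0P)/(blinZ n0P).
  apply: (blinD n0P) => //; apply: (blin_comp b_h); apply: fop_blin; exact: sym_A3J0.
by apply: (blin_comp (b_v i)); apply: fop_blin; exact: sym_J2J0.
Qed.

End base_inverse.

(** * Auxiliary unknowns are controlled by the data and (v, eta) *)

Section near_base.

(** Closeness is imposed on the data and on (v, eta) only; nothing is assumed about the auxiliary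
    unknowns beyond the equations. *)
Let S r (z : fullT) := [/\ quad 0 lin_part quad_part z = 0, n_data (z.1 - base_data) <= r & n_state z.2.1 <= r].
Let S_mono r r' z : r <= r' -> S r z -> S r' z.
Proof. by move=> rr [q h1 h2]; split=> //; exact: le_trans rr. Qed.
Local Notation small := (small S).
Local Notation bdd := (bdd S).
Let nr : is_norm n_real := norm_realP.
Let n0 := spn_is_norm J0.
Let n1 := spn_is_norm J1.
Let n2 := spn_is_norm J2.
Let nA := spn_is_norm A3.

Let s_data : small n_data (fun z => z.1 - base_data).
Proof. by move=> e e0; exists e => // z []. Qed.
Let s_state : small n_state (fun z => z.2.1).
Proof. by move=> e e0; exists e => // z []. Qed.

Let s_vel i : small N2 (fun z => vel z i).
Proof.
apply: small_le s_state => z; apply: le_trans (norm_pair_fst _ _ nA).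
exact: (norm_fun_ge (n := @spn R d J2) (vel z) i n2).
Qed.
Let s_hgt : small NA hgt.
Proof. by apply: small_le s_state => z; exact: (norm_pair_snd _ _ n_velP). Qed.
Let s_pt : small (norm_pair n_par n_tensor) (fun z => z.1.1 - (p, 0)).
Proof. by apply: small_le s_data => z; exact: (norm_pair_fst _ _ n_forceP). Qed.
Let s_phi : small n_force phi.
Proof.
apply: small_le s_data => z; have -> : phi z = (z.1 - base_data).2.
  by rewrite /= subr0.
by apply: norm_pair_snd; is_norm_tac.
Qed.
Let s_tau : small n_tensor tau.
Proof.
apply: small_le s_pt => z; have -> : tau z = (z.1.1 - (p, 0)).2 by rewrite /= subr0.
by apply: norm_pair_snd; is_norm_tac.
Qed.
Let s_par : small n_par (fun z => z.1.1.1 - p).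
Proof. by apply: small_le s_pt => z; exact: (norm_pair_fst _ _ n_tensorP). Qed.
Let s_gv : small (norm_pair n_real n_real) (fun z => z.1.1.1.1 - p.1).
Proof. by apply: small_le s_par => z; exact: (norm_pair_fst _ _ nr). Qed.
Let s_gam : small n_real (fun z => gam z - p.1.1).
Proof. by apply: small_le s_gv => z; exact: (norm_pair_fst _ _ nr). Qed.
Let s_vis : small n_real (fun z => vis z - p.1.2).
Proof. by apply: small_le s_gv => z; exact: (norm_pair_snd _ _ nr). Qed.
Let s_sur : small n_real (fun z => sur z - p.2).
Proof. by apply: small_le s_par => z; apply: norm_pair_snd; is_norm_tac. Qed.

Let b_shift (f : fullT -> R) c : small n_real (fun z => f z - c) -> bdd n_real f.
Proof.
move=> H; apply: (bdd_eq (h := fun z => (f z - c) + c)) => [r z _|]; first by rewrite subrK.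
by apply: (bddD S_mono nr); [exact: small_bdd|exact: bdd_cst].
Qed.

Let s_sq (f h : fullT -> R) c : small n_real (fun z => f z - c) -> (forall r z, S r z -> h z = f z * f z) ->
  small n_real (fun z => h z - c * c).
Proof.
move=> H hf; apply: (small_eq (h := fun z => (f z - c) *: (f z + c : R))).
  by move=> r z Sz; rewrite (hf r z Sz) /GRing.scale /=; ring.
apply: (small_bbil_l S_mono nr nr (bbil_scale nr) H).
by apply: (bddD S_mono nr); [exact: b_shift H|exact: bdd_cst].
Qed.

Let eqs r z : S r z -> wave_eqs z. Proof. by case=> /wave_eqsP. Qed.
Let s_vis2 : small n_real (fun z => vis2 z - p.1.2 * p.1.2).
Proof. by apply: (s_sq s_vis) => r z /eqs/eq_vis. Qed.
Let s_sur2 : small n_real (fun z => sur2 z - p.2 * p.2).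
Proof. by apply: (s_sq s_sur) => r z /eqs/eq_sur. Qed.
Let s_dh j : small N0 (fun z => dop J0 j (hgt z)).
Proof. by apply: (small_blin nA) s_hgt; apply: fop_blin; exact: sym_A3J0. Qed.
Let s_dv i j : small N0 (fun z => dop J0 j (vel z i)).
Proof. by apply: (small_blin n2) (s_vel i); apply: fop_blin; exact: sym_J2J0. Qed.
Let s_dv1 i j : small N1 (fun z => dop J1 j (vel z i)).
Proof. by apply: (small_blin n2) (s_vel i); apply: fop_blin; exact: sym_J2J1. Qed.
Let s_strain i j : small N1 (fun z => strainop (vel z) i j).
Proof.
apply: (smallD S_mono n1); first exact: (smallD S_mono n1).
apply: (small_blin n1 (n' := @spn R d J1) (h := fun u => (2 * (i == j)%:R) *: u)).
  by apply: (blinZ n1); exact: blin_id.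
by apply: (small_sum S_mono n1) => k.
Qed.
Let s_divs i : small N0 (fun z => divstress (vel z) i).
Proof.
apply: (small_sum S_mono n0) => j; apply: (small_blin n1) (s_strain i j).
by apply: fop_blin; exact: sym_J1J0.
Qed.
Let s_lapg i : small N0 (fun z => lapgrad (hgt z) i).
Proof.
apply: (small_sum S_mono n0) => j.
apply: (small_blin n1); first by apply: fop_blin; exact: sym_J1J0.
apply: (small_blin n2); first by apply: fop_blin; exact: sym_J2J1.
by apply: (small_blin nA) s_hgt; apply: fop_blin; exact: sym_A3J2.
Qed.

Let s_g : small n_field fg.
Proof.
apply: (small_fun S_mono n0) => i.
apply: (small_eq (h := fun z => \sum_j mulJ10 (strainop (vel z) i j) (dop J0 j (hgt z)))).
  by move=> r z /eqs/eq_g.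
apply: (small_sum S_mono n0) => j.
exact: (small_bbil_l S_mono n1 n0 mul_J10 (s_strain i j) (small_bdd (s_dh j))).
Qed.

Let s_scale (f : fullT -> R) (h : fullT -> sp J0) c : small n_real (fun z => f z - c) -> small N0 h ->
  small N0 (fun z => f z *: h z).
Proof. by move=> Hf Hh; exact: (small_bbil_r S_mono nr n0 (bbil_scale n0) (b_shift Hf) Hh). Qed.

Let s_c : small n_field fc.
Proof.
apply: (small_fun S_mono n0) => i; apply: (small_eq (fun r z Sz => eq_c (eqs Sz) i)).
have N := smallN n0.
apply: (smallD S_mono n0); last by apply/N/s_scale; [exact: s_sur2|].
apply: (smallD S_mono n0); last by apply/N/s_scale; [exact: s_vis2|].
apply: (smallD S_mono n0); last by apply/N/s_scale; [exact: s_gam|].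
apply: (smallD S_mono n0) => //; apply: (small_sum S_mono n0) => j.
exact: (small_bbil_l S_mono n2 n0 mul_J20 (s_vel j) (small_bdd (s_dv i j))).
Qed.

(** Downward induction along the recursion: b_k is its source plus eta b_(k+1), and b_(l+1) = 0. The
    source is small as phi, tau and grad eta are. *)
Let s_b : small n_force fb.
Proof.
have step (k : 'I_l.+1) : small n_field (fun z => b_next (fb z) k) -> small n_field (fun z => fb z k).
  move=> Hn; apply: (small_fun S_mono n0) => i; apply: (small_eq (fun r z Sz => eq_b (eqs Sz) k i)).
  apply: (smallD S_mono n0); first apply: (smallD S_mono n0).
  - apply: small_le s_phi => z; apply: le_trans (norm_fun_ge (phi z) k n_fieldP).
    exact: (norm_fun_ge (n := @spn R d J0) (phi z k) i n0).
  - apply: (small_sum S_mono n0) => j.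
    apply: (small_bbil_r S_mono n0 n0 mul_J0 (small_bdd _) (s_dh j)).
    apply: small_le s_tau => z; apply: le_trans (norm_fun_ge (tau z) k (norm_funP _ n_fieldP)).
    apply: le_trans (norm_fun_ge (tau z k) i n_fieldP).
    exact: (norm_fun_ge (n := @spn R d J0) (tau z k i) j n0).
  - apply: (small_bbil_l S_mono nA n0 mul_A0 s_hgt); apply: small_bdd.
    apply: small_le Hn => z; exact: (norm_fun_ge (n := @spn R d J0) (b_next (fb z) k) i n0).
have down r (k : 'I_l.+1) : (l - k <= r)%N -> small n_field (fun z => fb z k).
  elim: r k => [|r IH] k lk; apply: step.
    apply: (small_eq (h := fun=> 0)); last exact: small0 n_fieldP.
    by move=> r z _; rewrite /b_next ltnNge -subn_eq0 -leqn0 lk.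
  rewrite /b_next; case kl: (k < l)%N; last exact: small0 n_fieldP.
  apply: IH; rewrite inordK ?ltnS//.
  by rewrite leq_subLR addSn -addnS -leq_subLR.
by apply: (small_fun S_mono n_fieldP) => k; exact: down (leqnn _).
Qed.

(** This brings any solution with nearby data and small (v, eta) into the ball, in all unknowns,
    where the contraction gives uniqueness. *)
Lemma near_base e : 0 < e -> exists2 r, 0 < r & forall z, quad 0 lin_part quad_part z = 0 ->
  n_data (z.1 - base_data) <= r -> n_state z.2.1 <= r -> n_unknown (z.2 - base_unknown) <= e.
Proof.
have H : small n_unknown (fun z => (z.2.1, ((vis2 z - p.1.2 * p.1.2, sur2 z - p.2 * p.2, fb z), (fg z, fc z)))).
  apply: (small_pair S_mono) => //; apply: (small_pair S_mono); last by apply: (small_pair S_mono).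
  apply: (small_pair S_mono); last exact: s_b.
  by apply: (small_pair S_mono); [exact: s_vis2|exact: s_sur2].
move=> /H[r r0 Hr]; exists r => // z q h1 h2.
suff -> : z.2 - base_unknown =
   (z.2.1, ((vis2 z - p.1.2 * p.1.2, sur2 z - p.2 * p.2, fb z), (fg z, fc z))) by exact: Hr.
case: z {q h1 h2} => x [[v h] [[[m' t'] b] [g' c]]].
have -> : ((v, h), ((m', t', b), (g', c))) - base_unknown =
  ((v - 0, h - 0), ((m' - p.1.2 * p.1.2, t' - p.2 * p.2, b - 0), (g' - 0, c - 0))) by [].
by rewrite !subr0.
Qed.

End near_base.

End base_point.

(** * Gluing the local solutions *)

Section local_package.

Local Notation base := base_data.
Local Notation F := (quad 0 lin_part quad_part).
Let nX : is_norm n_data := n_dataP.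
Let nW : is_norm n_unknown := n_unknownP.
Let nY : is_norm n_residue := n_residueP.
Let cW : fast_complete n_unknown := unknown_complete.

Lemma n_par_le (x y : dataT) : n_par (x.1.1 - y.1.1) <= n_data (x - y).
Proof.
have e1 := @norm_pair_fst _ _ _ n_par n_tensor (x - y).1 n_tensorP.
apply: (le_trans e1).
exact: (@norm_pair_fst _ _ _ (norm_pair n_par n_tensor) n_force (x - y) n_forceP).
Qed.

(** [rho] bounds the data and [a] the pair (v, eta). Existence is granted within rho, but the other
    properties within 2 a: two base points p and q with a common datum are then comparable, because
    rho p + rho q is at most twice the larger of a p and a q. *)
Record local_radii (p : R * R * R) (a rho : R) : Prop := LocalRadii {
  lr_a : 0 < a ;
  lr_rho : 0 < rho ;
  lr_le : rho <= a ;
  lr_pos : forall x, n_data (x - base p) < rho -> positive_triple x.1.1 ;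
  lr_exists : forall x, n_data (x - base p) < rho -> exists2 w, F (x, w) = 0 & n_state w.1 < a ;
  lr_unique : forall x w w', n_data (x - base p) <= 2 * a -> n_state w.1 < a -> n_state w'.1 < a ->
    F (x, w) = 0 -> F (x, w') = 0 -> w = w' ;
  lr_inv : forall x w, n_data (x - base p) <= 2 * a -> n_state w.1 < a -> F (x, w) = 0 ->
    exists Ri : residueT -> unknownT, [/\ forall b u v, Ri (b *: u + v) = b *: Ri u + Ri v,
      exists2 C, 1 <= C & forall y, n_unknown (Ri y) <= C * n_residue y,
      forall y, dquad lin_part quad_part (x, w) (Ri y) = y &
      forall v, Ri (dquad lin_part quad_part (x, w) v) = v] ;
  lr_lip : exists2 C, 1 <= C & forall x x' w w', n_data (x - base p) <= 2 * a ->
    n_data (x' - base p) <= 2 * a -> n_state w.1 < a -> n_state w'.1 < a ->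
    F (x, w) = 0 -> F (x', w') = 0 -> n_unknown (w - w') <= C * n_data (x - x') }.

Lemma local_radii_exist p : positive_triple p -> exists a rho, local_radii p a rho.
Proof.
move=> p0; have [CF LQ] := wave_quadratic.
have [Rl [c c1 Rb]] := base_inv_blin p0.
have RK w : base_inv p (dquad lin_part quad_part (base p, base_unknown p) w) = w.
  by rewrite dquad_base base_linK.
have KR y : dquad lin_part quad_part (base p, base_unknown p) (base_inv p y) = y.
  by rewrite dquad_base base_invK.
have z0E := base_solution p.
pose delta := ift_radius CF c; have de0 : 0 < delta := ift_radius_gt0 LQ c1.
have [r r0 near] := near_base p de0.
have [C C1 lip] := ift_lipschitz nX nW nY 0 LQ Rl c1 Rb RK.
have C0 : 0 < C by exact: lt_le_trans C1.
(* Halved, because the data are allowed up to the distance 2 a. *)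
pose a := Num.min r delta / 2.
have a0 : 0 < a by rewrite divr_gt0// lt_min r0.
have ar : 2 * a <= r by rewrite /a mulrC divfK// ge_min lexx.
have ad : 2 * a <= delta by rewrite /a mulrC divfK// ge_min lexx orbT.
have wnear x w : n_data (x - base p) <= 2 * a -> n_state w.1 < a -> F (x, w) = 0 ->
    n_unknown (w - base_unknown p) <= delta.
  move=> h1 h2 h3; apply: (near (x, w)) => //; first exact: le_trans ar.
  by rewrite (le_trans (ltW h2))//; move: a0 ar; lra.
pose rx := ift_radius_x n_data n_unknown CF (base p) (base_unknown p) c.
have rx0 : 0 < rx := ift_radius_x_gt0 nX nW LQ _ _ c1.
have [p1 p2 p3] := p0.
pose q := Num.min p.1.1 (Num.min p.1.2 p.2).
have q0 : 0 < q by rewrite !lt_min p1 p2.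
(* a / C lets the Lipschitz bound place the solution in the ball of radius a; [rx] gives existence;
   [q] keeps the three parameters positive. *)
pose rho := Num.min (a / C) (Num.min rx q).
have rho0 : 0 < rho by rewrite /rho lt_min (divr_gt0 a0 C0) lt_min rx0 q0.
have rhoC : rho <= a / C by rewrite ge_min lexx.
have rhoa : rho <= a by rewrite (le_trans rhoC)// ler_piMr ?(ltW a0)// invf_le1.
have [rhorx rhoq] : rho <= rx /\ rho <= q.
  have : rho <= Num.min rx q by rewrite ge_min lexx orbT.
  by rewrite le_min => /andP[].
exists a, rho; split => //.
- move=> x h; have hp : n_par (x.1.1 - p) < q.
    apply: le_lt_trans (lt_le_trans h rhoq).
    exact: n_par_le x (base p).
  case: x h hp => [[[[g m] t] ta] ph] /= _.
  rewrite /n_par /norm_pair /n_real /= => hp.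
  have [q1 [q2 q3]] : q <= p.1.1 /\ q <= p.1.2 /\ q <= p.2.
    by rewrite !ge_min !lexx !orbT.
  have := normr_ge0 (g - p.1.1); have := normr_ge0 (m - p.1.2); have := normr_ge0 (t - p.2).
  have := ler_norm (- (g - p.1.1)); have := ler_norm (- (m - p.1.2)); have := ler_norm (- (t - p.2)).
  by rewrite !normrN => *; split=> /=; lra.
- move=> x h; have [w [w1 w2]] := ift_exists nX nW nY cW LQ z0E Rl c1 Rb RK KR (le_trans (ltW h) rhorx).
  exists w => //.
  have xd : n_data (x - base p) <= delta by rewrite (le_trans (ltW h))// (le_trans rhoa)//; move: a0 ad; lra.
  have := lip x (base p) w (base_unknown p) xd.
  rewrite subrr (norm0 nX) subrr (norm0 nW) => /(_ (ltW de0)) H.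
  have : n_unknown (w - base_unknown p) <= C * n_data (x - base p).
    have d4 : n_unknown (w - base_unknown p) <= delta.
      by apply: (le_trans w1); rewrite ler_piMr ?(ltW de0)// invf_le1// ler1n.
    exact: H d4 (ltW de0) w2 z0E.
  move=> hl; apply: le_lt_trans (_ : C * n_data (x - base p) < a).
    apply: le_trans hl; have -> : w.1 = (w - base_unknown p).1 by rewrite /= subr0.
    exact: (@norm_pair_fst _ _ _ n_state n_aux (w - base_unknown p) n_auxP).
  by rewrite mulrC -ltr_pdivlMr//; exact: lt_le_trans h rhoC.
- move=> x w w' xa wa wa' e e'.
  exact: (ift_unique nX nW nY LQ Rl c1 Rb RK (le_trans xa ad) (wnear _ _ xa wa e) (wnear _ _ xa wa' e') e e').
- move=> x w xa wa e.
  have [Ri [i1 i2 i3 i4]] := dquad_inverse nX nW nY cW LQ Rl c1 Rb RK KR (le_trans xa ad) (wnear _ _ xa wa e).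
  by exists Ri; split => //; exists (4 * c) => //; move: c1; lra.
- exists C => // x x' w w' xa xa' wa wa' e e'.
  exact: lip (le_trans xa ad) (le_trans xa' ad) (wnear _ _ xa wa e) (wnear _ _ xa' wa' e') e e'.
Qed.

Theorem wave_package : exists (U : set dataT) (V : R * R * R -> set stateT) (Psi : dataT -> unknownT)
    (D : dataT -> seq dataT -> unknownT),
  [/\ [/\ forall x, U x -> exists2 e, 0 < e & forall y, n_data (y - x) < e -> U y,
         forall p, positive_triple p -> U (base p) &
         forall x, U x -> positive_triple x.1.1],
      forall p, positive_triple p -> V p 0,
      forall p w, V p w -> exists2 e, 0 < e & forall w', n_state (w' - w) < e -> V p w',
      forall x, U x -> [/\ D x [::] = Psi x,
        forall u u' b y y', D x (u ++ (b *: y + y') :: u') = b *: D x (u ++ y :: u') + D x (u ++ y' :: u'),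
        forall k, exists C, forall u, size u = k -> n_unknown (D x u) <= C * prodn n_data u &
        forall k e, 0 < e -> exists2 r, 0 < r & forall h, n_data h < r -> U (x + h) ->
          forall u, size u = k -> n_unknown (D (x + h) u - D x u - D x (h :: u)) <= e * n_data h * prodn n_data u] &
      forall x, U x -> [/\ V x.1.1 (Psi x).1, F (x, Psi x) = 0 &
        forall w, F (x, w) = 0 -> V x.1.1 w.1 -> w = Psi x]].
Proof.
have radii p : exists ar : R * R, positive_triple p -> local_radii p ar.1 ar.2.
  have [/local_radii_exist[a [rho H]]|np] := pselect (positive_triple p); first by exists (a, rho).
  by exists (0, 0).
have {radii}[ar radii] := choice radii.
pose a p := (ar p).1; pose rho p := (ar p).2.
have LR p : positive_triple p -> local_radii p (a p) (rho p) := radii p.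
pose near p x := positive_triple p /\ n_data (x - base p) < rho p.
pose U : set dataT := [set x | exists p, near p x].
(* All base points whose data ball contains p contribute, so that V depends on p alone and is open
   as a union of balls. *)
pose V p : set stateT := [set w | exists q, [/\ positive_triple q, n_par (p - q) < rho q & n_state w < a q]].
have le2 p x : near p x -> n_data (x - base p) <= 2 * a p.
  move=> [/LR L h]; have := lr_le L; have := lr_a L; move: h; lra.
have exW x : exists w, U x -> F (x, w) = 0 /\ exists2 p, near p x & n_state w.1 < a p.
  have [[p [p0 h]]|nU] := pselect (U x); last by exists 0.
  by have [w e wa] := lr_exists (LR p p0) h; exists w => _; split=> //; exists p.
have [Psi PsiP] := choice exW.
(* Local uniqueness is invoked at the base point with the larger [a], from which x is at most rho p
   + rho q away. *)
have uniq x p q w w' : near p x -> positive_triple q -> n_par (x.1.1 - q) < rho q ->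
    n_state w.1 < a p -> n_state w'.1 < a q -> F (x, w) = 0 -> F (x, w') = 0 -> w = w'.
  move=> np q0 hq wa wa' e e'; have [p0 hp] := np; have Lp := LR p p0; have Lq := LR q q0.
  have [aa|aa] := leP (a p) (a q).
    apply: (lr_unique Lq) e e' => //; last exact: lt_le_trans wa aa.
    (* Moving the base point changes only the parameter part of the distance, since tau and phi
       vanish at both. *)
    have -> : n_data (x - base q) = n_par (x.1.1 - q) + (n_data (x - base p) - n_par (x.1.1 - p)).
      rewrite /n_data /norm_pair /= !subr0; lra.
    have := norm_ge0 n_parP (x.1.1 - p); have := lr_le Lp; have := lr_le Lq; move: hq hp aa; lra.
  by apply: (lr_unique Lp) e e' => //; [exact: le2|exact: lt_trans aa].
(* [exW] used some base point q near x; uniqueness shows that the chosen solution obeys the bound of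
   every other base point near x. *)
have PsiN x p : near p x -> n_state (Psi x).1 < a p.
  move=> np; have [e [q [q0 hq] wq]] := PsiP x (ex_intro _ p np); have [p0 hp] := np.
  have [w e' wa] := lr_exists (LR p p0) hp.
  suff <- : w = Psi x by [].
  exact: (uniq x p q w (Psi x) np q0 (le_lt_trans (n_par_le x (base q)) hq) wa wq e' e).
have near_open p x : near p x -> exists2 e, 0 < e & forall y, n_data (y - x) < e -> near p y.
  move=> [p0 hp]; exists (rho p - n_data (x - base p)); first by rewrite subr_gt0.
  move=> y hy; split; first exact: p0.
  by apply: (le_lt_trans (norm_sub_trans nX x y (base p))); rewrite -ltrBrDr.
have exR x : exists Ri : residueT -> unknownT, U x -> [/\ forall b u v, Ri (b *: u + v) = b *: Ri u + Ri v,
      exists2 C, 1 <= C & forall y, n_unknown (Ri y) <= C * n_residue y,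
      forall y, dquad lin_part quad_part (x, Psi x) (Ri y) = y &
      forall v, Ri (dquad lin_part quad_part (x, Psi x) v) = v].
  have [[p np]|nU] := pselect (U x); last by exists (fun=> 0).
  have [Ri H] := lr_inv (LR p np.1) (le2 p x np) (PsiN x p np) (PsiP x (ex_intro _ p np)).1.
  by exists Ri.
have [Rinv RinvP] := choice exR.
have [CF LQ] := wave_quadratic.
have ID : implicit_data n_data n_unknown n_residue 0 lin_part quad_part U Psi Rinv.
  split.
  - by move=> x /PsiP[].
  - by move=> x b u v /RinvP[H _ _ _]; exact: H.
  - by move=> x /RinvP[].
  - by move=> x y /RinvP[_ _ H _]; exact: H.
  - by move=> x w /RinvP[_ _ _ H]; exact: H.
  move=> x [p np]; have [C C1 lip] := lr_lip (LR p np.1); have [e e0 He] := near_open p x np.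
  (* The summand e^-1 keeps x + h near the same base point p, where the Lipschitz bound holds. *)
  exists (C + e^-1); first by rewrite (le_trans C1)// lerDl invr_ge0 ltW.
  move=> h hh Uh; have i0 : 0 < e^-1 by rewrite invr_gt0.
  have hx : x + h - x = h by rewrite addrC addKr.
  have np' : near p (x + h).
    apply: He; rewrite hx; apply: (lt_le_trans hh).
    by rewrite -[leRHS]invrK lef_pV2 ?posrE//; move: C1 i0; lra.
  apply: (@le_trans _ _ (C * n_data h)).
    rewrite -{2}hx; apply: lip.
    + exact: le2.
    + exact: le2.
    + exact: PsiN.
    + exact: PsiN.
    + by have [] := PsiP _ Uh.
    + by have [] := PsiP x (ex_intro _ p np).
  by rewrite ler_wpM2r ?norm_ge0// lerDl ltW.
have [D DP] := implicit_smooth nX nW nY LQ ID.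
exists U, V, Psi, D; split => //.
- split.
  + move=> x [p /near_open[e e0 H]]; exists e => // y /H ny; exact: (ex_intro _ p ny).
  + move=> p p0; exists p; split=> //; rewrite subrr (norm0 nX).
    exact: lr_rho (LR p p0).
  + by move=> x [p [p0 hp]]; exact: lr_pos (LR p p0) _ hp.
- move=> p p0; exists p; rewrite subrr (norm0 n_parP) (norm0 n_stateP).
  by split=> //; [exact: lr_rho (LR p p0)|exact: lr_a (LR p p0)].
- move=> p w [q [q0 hq wq]]; exists (a q - n_state w); first by rewrite subr_gt0.
  move=> w' hw; exists q; split; [exact: q0|exact: hq|].
  by apply: (le_lt_trans (norm_le_sub n_stateP w' w)); rewrite -ltrBrDr.
move=> x Ux; have [e [p np wa]] := PsiP x Ux; have [p0 hp] := np; split=> //.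
  by exists p; split=> //; exact: le_lt_trans (n_par_le x (base p)) hp.
move=> w ew [q [q0 hq wq]]; apply/esym; exact: (uniq x p q (Psi x) w np q0 hq wa wq e ew).
Qed.

End local_package.

(** * Back from the quadratic equation to the differential equations *)

Lemma Ck_J2 (u : sp J2) : Ck 2 u.
Proof.
apply: (@Ck_sp _ _ 1 J2 J1 u (sym_J2J1 ds)) => u1; apply: (@Ck_sp _ _ 0 J1 J0 u1 (sym_J1J0 ds)) => u0.
by apply: Ck0; exact: sp_continuous.
Qed.

Lemma Ck_A3 (u : sp A3) : Ck 3 u.
Proof. by apply: (@Ck_sp _ _ 2 A3 J2 u (sym_A3J2 d0 ds)); exact: Ck_J2. Qed.
Lemma mulJ0E u v x : mulJ0 u v x = u x * v x. Proof. by apply: spME; exact: mulable_jj. Qed.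
Lemma mulA0E u v x : mulA0 u v x = u x * v x.
Proof. by apply: spME; apply: mulable_aj; rewrite ltnW// ltnW. Qed.
Lemma mulA2E u v x : mulA2 u v x = u x * v x. Proof. by apply: spME; exact: mulable_aj. Qed.
Lemma mulJ10E u v x : mulJ10 u v x = u x * v x. Proof. by apply: spME; exact: mulable_jj. Qed.
Lemma mulJ20E u v x : mulJ20 u v x = u x * v x.
Proof. by apply: spME; apply: mulable_jj; rewrite ltnW. Qed.

Local Notation fn v := (fun i => (v i : E -> R)).

Lemma strainopE (v : 'I_d -> sp J2) i j : (strainop v i j : E -> R) = stress (fn v) i j.
Proof.
apply/funext => x; rewrite /strainop !spD spZ sp_sumE /stress /divergence.
rewrite (dopE (v i) (sym_J2J1 ds j)).1 (dopE (v j) (sym_J2J1 ds i)).1.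
rewrite (eq_bigr (fun k => pderiv k (v k) x)); last by move=> k _; rewrite (dopE (v k) (sym_J2J1 ds k)).1.
by ring.
Qed.

Lemma divstressE (v : 'I_d -> sp J2) i x : divstress v i x = \sum_j pderiv j (stress (fn v) i j) x.
Proof.
rewrite /divstress sp_sumE; apply: eq_bigr => j _.
by rewrite (dopE _ (sym_J1J0 ds j)).1 strainopE.
Qed.

Lemma lapgradE (h : sp A3) i x : lapgrad h i x = laplacian (pderiv i h) x.
Proof.
rewrite /lapgrad sp_sumE; apply: eq_bigr => j _.
by rewrite (dopE _ (sym_J1J0 ds j)).1 (dopE _ (sym_J2J1 ds j)).1 (dopE _ (sym_A3J2 d0 ds i)).1.
Qed.

Lemma e1_sum (f : 'I_d -> R) : \sum_j e1 ord0 j * f j = f j0.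
Proof.
rewrite (bigD1 j0)//= mxE eqxx mul1r big1 ?addr0// => j /negPf jj.
by rewrite mxE (_ : (j == 0%N :> nat) = false) ?mul0r//; exact: jj.
Qed.

Section solution_fields.
Variables (v : 'I_d -> sp J2) (h : sp A3).

Let dv i j x : derivable (v i : E -> R) x (delta_mx ord0 j).
Proof. exact: (dopE (v i) (sym_J2J0 ds j)).2. Qed.
Let dh j x : derivable (h : E -> R) x (delta_mx ord0 j).
Proof. exact: (dopE h (sym_A3J0 d0 ds j)).2. Qed.

Lemma divergence_flux (g : R) x :
  divergence (fun j y => (1 + h y) * (v j y - g * e1 ord0 j)) x =
  (\sum_j dop G2 j (v j) - g *: dop G2 j0 h + \sum_j dop G2 j (mulA2 h (v j))) x.
Proof.
rewrite !spD spN spZ !sp_sumE (dopE _ (sym_A3G2 d0 ds)).1.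
transitivity (\sum_j (pderiv j (v j) x + pderiv j (mulA2 h (v j)) x - g * (e1 ord0 j * pderiv j h x))).
  apply: eq_bigr => j _.
  have [d1 e1'] := @pderiv_cstD R d 1 (h : E -> R) j x (@dh j x); have [d2 e2] := @pderiv_cstD R d (- (g * e1 ord0 j)) (v j : E -> R) j x (@dv j j x).
  have -> : (fun y => (1 + h y) * (v j y - g * e1 ord0 j)) = fun y => (1 + h y) * (- (g * e1 ord0 j) + v j y).
    by apply/funext => y; rewrite [_ + v j y]addrC.
  have -> : (mulA2 h (v j) : E -> R) = fun y => h y * v j y by apply/funext => y; exact: mulA2E.
  rewrite [LHS](pderivM d1 d2) [X in _ + X - _](pderivM (@dh j x) (@dv j j x)) e1' e2; ring.
rewrite big_split/= big_split/= sumrN -mulr_sumr e1_sum.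
rewrite (eq_bigr (fun j => dop G2 j (v j) x)); last by move=> j _; rewrite (dopE _ (sym_J2G2 ds j)).1.
rewrite [X in _ + X - _](eq_bigr (fun j => dop G2 j (mulA2 h (v j)) x)); last by move=> j _; rewrite (dopE _ (sym_J2G2 ds j)).1.
by ring.
Qed.

Lemma divergence_stress i x :
  divergence (fun j y => (1 + h y) * stress (fn v) i j y) x =
  (\sum_j mulJ10 (strainop v i j) (dop J0 j h)) x + (1 + h x) * divstress v i x.
Proof.
rewrite sp_sumE divstressE mulr_sumr -big_split/=; apply: eq_bigr => j _.
rewrite mulJ10E (dopE _ (sym_A3J0 d0 ds j)).1 -strainopE.
have ds1 : derivable (strainop v i j : E -> R) x (delta_mx ord0 j) := (dopE _ (sym_J1J0 ds j)).2 x.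
have [d1 e1'] := @pderiv_cstD R d 1 (h : E -> R) j x (@dh j x).
by rewrite [LHS](pderivM d1 ds1) e1'; ring.
Qed.

Variables (g m t : R) (ta : tensorT) (ph : forceT).

Definition source k i : sp J0 := ph k i + \sum_j mulJ0 (ta k i j) (dop J0 j h).

Lemma sourceE k i x : source k i x = \sum_j ta k i j x * pderiv j h x + ph k i x.
Proof.
rewrite /source spD sp_sumE addrC; congr (_ + _); apply: eq_bigr => j _.
by rewrite mulJ0E (dopE _ (sym_A3J0 d0 ds j)).1.
Qed.

(** Downward induction unrolls the recursion into the sum over r >= k of eta^(r-k) times the r-th
    source; k = 0 is the forcing. *)
Lemma horner_force (b : forceT) :
  (forall k i, b k i = source k i + mulA0 h (b_next b k i)) ->
  forall i x, b ord0 i x = forcing (fun k i j => (ta k i j : E -> R)) (fun k i => (ph k i : E -> R)) h i x.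
Proof.
move=> bE i x.
have H n (k : 'I_l.+1) : (l - k = n)%N ->
    b k i x = \sum_(r < l.+1 | (k <= r)%N) h x ^+ (r - k) * source r i x.
  elim: n k => [|n IH] k lk.
    have kl : k = ord_max.
      by apply/val_inj/eqP; rewrite eqn_leq -ltnS ltn_ord /= -subn_eq0 lk.
    rewrite bE spD mulA0E /b_next kl ltnn mulr0 addr0 (big_pred1 ord_max) ?subnn ?mul1r// => r.
    have := ltn_ord r; rewrite ltnS => rl.
    by rewrite /= -val_eqE /= [RHS]eqn_leq rl.
  have kl : (k < l)%N by rewrite -subn_gt0 lk.
  rewrite bE spD mulA0E /b_next kl (IH (inord k.+1)) ?inordK ?ltnS//; last by rewrite subnS lk.
  rewrite [RHS](bigD1 k)//= subnn mul1r; congr (_ + _); rewrite mulr_sumr.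
  apply: eq_big => [r|r kr]; first by rewrite ltn_neqAle andbC eq_sym.
  by rewrite mulrA -exprS -subSn// subSS.
rewrite (H l ord0) ?subn0// /forcing; apply: eq_big => // k _.
by rewrite subn0 sourceE.
Qed.

(** Expanding the divergence of (1 + eta) S v separates the products of S v with grad eta, collected
    in [gg], from the terms multiplied by 1 + eta, collected in [cc]; the balance becomes c + v +
    b_0 + eta c - m^2 g = 0. *)
Lemma wave_systemE (b : forceT) (gg cc : fieldT) :
  (forall k i, b k i = source k i + mulA0 h (b_next b k i)) ->
  (forall i, gg i = \sum_j mulJ10 (strainop v i j) (dop J0 j h)) ->
  (forall i, cc i = dop J0 i h + \sum_j mulJ20 (v j) (dop J0 j (v i))
    - g *: dop J0 j0 (v i) - (m * m) *: divstress v i - (t * t) *: lapgrad h i) ->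
  wave_system g m t (fn v) h (forcing (fun k i j => (ta k i j : E -> R)) (fun k i => (ph k i : E -> R)) h) <->
  \sum_j dop G2 j (v j) - g *: dop G2 j0 h + \sum_j dop G2 j (mulA2 h (v j)) = 0 /\
  forall i, cc i + incl J0 (v i) + b ord0 i + mulA0 h (cc i) - (m * m) *: gg i = 0.
Proof.
move=> bE gE cE.
have mom i x : (1 + h x) * \sum_j (v j x - g * e1 ord0 j) * pderiv j (v i) x + v i x
    - m ^+ 2 * divergence (fun j y => (1 + h y) * stress (fn v) i j y) x
    + (1 + h x) * (pderiv i h x - t ^+ 2 * laplacian (pderiv i h) x)
    + forcing (fun k i j => (ta k i j : E -> R)) (fun k i => (ph k i : E -> R)) h i x =
   (cc i + incl J0 (v i) + b ord0 i + mulA0 h (cc i) - (m * m) *: gg i) x.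
  rewrite divergence_stress -gE -(horner_force bE) -lapgradE.
  have adv : \sum_j (v j x - g * e1 ord0 j) * pderiv j (v i) x =
     (\sum_j mulJ20 (v j) (dop J0 j (v i))) x - g * dop J0 j0 (v i) x.
    rewrite sp_sumE (dopE _ (sym_J2J0 ds j0)).1 -(e1_sum (fun j => pderiv j (v i) x)) mulr_sumr -sumrB.
    by apply: eq_bigr => j _; rewrite mulJ20E (dopE _ (sym_J2J0 ds j)).1; ring.
  have cx : cc i x = pderiv i h x + (\sum_j mulJ20 (v j) (dop J0 j (v i))) x - g * dop J0 j0 (v i) x
     - (m * m) * divstress v i x - (t * t) * lapgrad h i x.
    by rewrite cE !spD !spN !spZ (dopE _ (sym_A3J0 d0 ds i)).1.
  rewrite !spD spN spZ mulA0E (inclE _ (sym_incl ds)) adv cx; ring.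
split=> [W|[W1 W2] x].
  split; first by apply/sp_inj/funext => x; rewrite -divergence_flux; exact: (W x).1.
  by move=> i; apply/sp_inj/funext => x; rewrite -mom; exact: (W x).2.
split; first by rewrite divergence_flux W1.
by move=> i; rewrite mom W2.
Qed.

Lemma aux_exist : exists (b : forceT) (gg cc : fieldT), [/\
  forall k i, b k i = source k i + mulA0 h (b_next b k i),
  forall i, gg i = \sum_j mulJ10 (strainop v i j) (dop J0 j h) &
  forall i, cc i = dop J0 i h + \sum_j mulJ20 (v j) (dop J0 j (v i))
    - g *: dop J0 j0 (v i) - (m * m) *: divstress v i - (t * t) *: lapgrad h i].
Proof.
(* The recursion runs on n = l - k, as the Horner sums are determined downwards from k = l. *)
pose bg := fix bg n : fieldT := if n is n'.+1 then fun i => source (inord (l - n)) i + mulA0 h (bg n' i)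
  else source ord_max.
exists (fun k => bg (l - k)%N), (fun i => \sum_j mulJ10 (strainop v i j) (dop J0 j h)).
exists (fun i => dop J0 i h + \sum_j mulJ20 (v j) (dop J0 j (v i))
    - g *: dop J0 j0 (v i) - (m * m) *: divstress v i - (t * t) *: lapgrad h i); split=> // k i.
have m0 : mulA0 h 0 = 0 by exact: (bbilP mul_A0).2.
rewrite /b_next; case kl: (k < l)%N; last first.
  have -> : k = ord_max by apply/val_inj/eqP; rewrite eqn_leq -ltnS ltn_ord /= leqNgt kl.
  by rewrite /= subnn m0 addr0.
rewrite inordK ?ltnS//; have -> : (l - k = (l - k.+1).+1)%N by rewrite subnSK.
congr (source _ i + _); apply/val_inj; rewrite /= inordK ?ltnS ?leq_subr// subnSK// subKn//.
exact: ltnW.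
Qed.

End solution_fields.

Local Notation F := (quad 0 lin_part quad_part).

(** * Passage to distributions and conclusion *)

Definition data_of (x : dataT) : data R d l :=
  ((x.1.1.1.1, x.1.1.1.2, x.1.1.2), fun k i j => functional (x.1.2 k i j), fun k i => functional (x.2 k i)).
Definition of_data (q : data R d l) : dataT :=
  ((q.1.1.1.1, q.1.1.1.2, q.1.1.2), fun k i j => unfunctional J0 (q.1.2 k i j), fun k i => unfunctional J0 (q.2 k i)).
Definition solution_of (y : stateT) : solution R d := (fun i => functional (y.1 i), functional y.2).
Definition of_solution (w : solution R d) : stateT := (fun i => unfunctional J2 (w.1 i), unfunctional A3 w.2).

Lemma realizes_data : realizes (data_norm s%:R) n_data data_of of_data.
Proof.
have H0 := realizes_weighted J0; have Hr := @realizes_real R.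
have Hf := realizes_fun d H0.
have := realizes_pair (realizes_pair (realizes_pair (realizes_pair Hr Hr) Hr)
  (realizes_fun l.+1 (realizes_fun d Hf))) (realizes_fun l.+1 Hf).
apply: realizes_eq; apply/funext => -[[[[g m] t] ta] ph].
by rewrite /data_norm (@sobolev_normE R d s ds).
Qed.

Lemma realizes_solution : realizes (solution_norm s%:R) n_state solution_of of_solution.
Proof.
have := realizes_pair (realizes_fun d (realizes_weighted J2)) (realizes_weighted A3).
apply: realizes_eq; apply/funext => w; rewrite /solution_norm -[2 + s%:R]natrD -[3 + s%:R]natrD.
by rewrite (@aniso_normE R d s.+3 d0 (doubleS_gt (doubleS_gt (doubleS_gt ds)))) (@sobolev_normE R d s.+2 (doubleS_gt (doubleS_gt ds))).
Qed.

Lemma represented_functional (w : weight R d) (u : sp w) (v : E -> R) :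
  represented_by (functional u) v <-> v = u.
Proof.
split=> [[cv e]|->]; last by split=> //; exact: sp_continuous.
apply: functional_inj => //; first exact: sp_continuous.
by move=> p kp; rewrite -e.
Qed.

Lemma classical_solutionP (x : dataT) (y : stateT) : classical_solution (data_of x) (solution_of y) <->
  wave_system x.1.1.1.1 x.1.1.1.2 x.1.1.2 (fun i => (y.1 i : E -> R)) y.2
    (forcing (fun k i j => (x.1.2 k i j : E -> R)) (fun k i => (x.2 k i : E -> R)) y.2).
Proof.
split=> [[v [h [t [f [hv [/represented_functional -> _] ht hf W]]]]]|W].
  have <- : v = (fun i => (y.1 i : E -> R)).
    by apply/funext => i; have [/represented_functional] := hv i.
  have <- : t = (fun k i j => (x.1.2 k i j : E -> R)).
    by apply/funext => k; apply/funext => i; apply/funext => j; exact/represented_functional.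
  have <- : f = (fun k i => (x.2 k i : E -> R)).
    by apply/funext => k; apply/funext => i; exact/represented_functional.
  exact: W.
exists (fun i => (y.1 i : E -> R)), (y.2 : E -> R), (fun k i j => (x.1.2 k i j : E -> R)), (fun k i => (x.2 k i : E -> R)).
split.
- by move=> i; split; [exact/represented_functional|exact: Ck_J2].
- by split; [exact/represented_functional|exact: Ck_A3].
- by move=> k i j; exact/represented_functional.
- by move=> k i; exact/represented_functional.
- exact: W.
Qed.

(** The auxiliary unknowns are explicit functions of the data and of (v, eta), so quantifying over
    them existentially loses nothing. *)
Lemma wave_system_quad (x : dataT) (y : stateT) :
  wave_system x.1.1.1.1 x.1.1.1.2 x.1.1.2 (fun i => (y.1 i : E -> R)) y.2
    (forcing (fun k i j => (x.1.2 k i j : E -> R)) (fun k i => (x.2 k i : E -> R)) y.2) <->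
  exists a, F (x, (y, a)) = 0.
Proof.
split=> [W|[a /wave_eqsP[h1 h2 h3 h4 h5 h6 h7]]].
  have [b [gg [cc [bE gE cE]]]] :=
    aux_exist y.1 y.2 x.1.1.1.1 x.1.1.1.2 x.1.1.2 x.1.2 x.2.
  have [W1 W2] := (wave_systemE bE gE cE).1 W.
  exists ((x.1.1.1.2 * x.1.1.1.2, x.1.1.2 * x.1.1.2), b, (gg, cc)).
  by apply/wave_eqsP; split.
have cE i := h7 i; rewrite h3 h4 in cE.
apply: (wave_systemE (b := a.1.2) (gg := a.2.1) (cc := a.2.2) h5 h6 cE).2.
by split=> // i; rewrite -[RHS](h2 i) h3.
Qed.

End wave_system.

Theorem theorem1 (R : realType) (d l s : nat)
    (d_gt0 : (0 < d)%N) (s_gt : d%:R / 2 < s%:R :> R) :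
  exists (U : set (data R d l)) (V : R * R * R -> set (solution R d))
         (Phi : data R d l -> solution R d),
  [/\ open_in (data_norm s%:R) U
      /\ [set q : data R d l |
            [/\ positive_triple q.1.1, q.1.2 = 0 & q.2 = 0]] `<=` U
      /\ U `<=` [set q : data R d l | positive_triple q.1.1],
      forall p, positive_triple p ->
        open_in (solution_norm s%:R) (V p) /\ V p 0,
      smooth_on (data_norm s%:R) (solution_norm s%:R) U Phi,
      Phi @` U `<=` \bigcup_(p in [set p | positive_triple p]) V p
    & forall q, U q ->
        [/\ V q.1.1 (Phi q), classical_solution q (Phi q)
          & forall w, V q.1.1 w -> classical_solution q w -> w = Phi q]].
Proof.
(* The condition s > d / 2 in natural numbers, the form in which it makes 1 / (1 + |x|^2)^s
   integrable. *)
have ds : (d < s.*2)%N.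
  by move: s_gt; rewrite ltr_pdivrMr// -natrM ltr_nat muln2.
have HX := realizes_data (R := R) l ds; have HS := realizes_solution (R := R) d_gt0 ds.
have [U0 [V0 [Psi [D [[Uo Ubase Upos] V00 Vo smooth PsiP]]]]] := wave_package (R := R) l d_gt0 ds.
pose K := of_data (R := R) (d := d) (l := l) ds.
have K11 q : (K q).1.1 = q.1.1 by case: q => [[[[g m] t] ta] ph].
pose U := [set q | (data_norm s%:R q < +oo)%E /\ U0 (K q)].
pose V p := [set w | (solution_norm s%:R w < +oo)%E /\ V0 p (of_solution d_gt0 ds w)].
pose Phi q := solution_of (Psi (K q)).1.
have VPhi q : U q -> V q.1.1 (Phi q).
  move=> [_ /PsiP[Vq _ _]]; split; first exact: (rz_fin HS (Psi (K q)).1).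
  by rewrite /= /Phi (rz_K HS) -K11.
exists U, V, Phi; split.
- split; first exact: rz_open HX _ Uo.
  split=> [q [q0 q1 q2]|q [_ /Upos]]; last by rewrite K11.
  have f0 : functional (0 : sp (Jw0 (R := R) ds)) = 0 := rz_0 (realizes_weighted _).
  have -> : q = data_of (base_data l ds q.1.1).
    case: q q0 q1 q2 => [[[[g m] t] ta] ph] /= _ -> ->; congr (_, _, _).
      by apply/funext => k; apply/funext => i; apply/funext => j.
    by apply/funext => k; apply/funext => i.
  split; first exact: rz_fin HX _.
  by rewrite /K (rz_K HX); exact: Ubase.
- move=> p p0; split; first exact: rz_open HS _ (Vo p).
  have e0 : (0 : solution R d) = solution_of (0 : stateT (R := R) d_gt0 ds) by rewrite (rz_0 HS).
  split; first by rewrite e0; exact: rz_fin HS _.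
  by rewrite e0 (rz_K HS); exact: V00.
- apply: (realizes_smooth HX HS (nW := @n_unknown R d s l d_gt0 ds) (pr := fst)) smooth => // w.
  by rewrite lerDl norm_ge0//; exact: n_auxP.
- move=> _ [q Uq <-]; exists q.1.1; last exact: VPhi.
  by have [_ /Upos] := Uq; rewrite K11.
move=> q Uq; have [fq Uq0] := Uq; have [Vq Fq uq] := PsiP _ Uq0.
have qE : q = data_of (K q) by rewrite (rz_J HX).
split; first exact: VPhi.
  rewrite [X in classical_solution X]qE; apply/classical_solutionP/wave_system_quad.
  by exists (Psi (K q)).2; rewrite -surjective_pairing.
(* Membership in V includes finiteness of the norm, so w comes from the Banach space, where
   uniqueness for the quadratic equation decides. *)
move=> w [fw Vw]; have wE : w = solution_of (of_solution d_gt0 ds w) by rewrite (rz_J HS).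
rewrite {1}qE {1}wE => /classical_solutionP/wave_system_quad[a Fa].
by rewrite /Phi -(uq _ Fa) ?K11.
Qed.
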